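(* The following problem is 2ExpTime-complete: given $\mathcal{ALC}$ KBs $\mathcal{K}_1,\mathcal{K}_2$ and a signature $\Sigma$, decide whether $\mathcal{K}_1$ $\Sigma$-UCQ entails $\mathcal{K}_2$.
   Context: A KB is $\mathcal{K}=(\mathcal{T},\mathcal{A})$ with $\mathcal{T}$ an $\mathcal{ALC}$ TBox (finite set of inclusions between $\mathcal{ALC}$ concepts) and $\mathcal{A}$ an ABox of assertions $A(a)$, $R(a,b)$; $\mathsf{ind}(\mathcal{K})$ its individuals; interpretations satisfy $a^{\mathcal{I}}=a$. A UCQ is a disjunction of CQs $\exists\vec y\,\varphi(\vec x,\vec y)$ (conjunctions of atoms $A(z)$, $R(z,z')$) with the same answer variables; $\mathcal{K}\models q(\vec a)$ means all models satisfy $q(\vec a)$. For consistent KBs, $\mathcal{K}_1$ $\Sigma$-UCQ entails $\mathcal{K}_2$ if for every UCQ $q(\vec x)$ over names in $\Sigma$ and tuple $\vec a$ from $\mathsf{ind}(\mathcal{K}_2)$, $\mathcal{K}_2\models q(\vec a)$ implies $\vec a\subseteq\mathsf{ind}(\mathcal{K}_1)$ and $\mathcal{K}_1\models q(\vec a)$. *)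

(* Defs.v *)
(* Built on MathComp. *)
From Stdlib Require List.
From mathcomp Require Import all_boot.

Set Implicit Arguments.
Unset Strict Implicit.
Unset Printing Implicit Defensive.

(** * ALC knowledge bases *)

(* Concept, role and individual names are binary words.  The three sorts of
   names are kept apart by the syntactic positions in which they occur. *)
Definition name := seq bool.

Inductive concept :=
| Top
| Bot
| Atom of name
| Not of concept
| And of concept & concept
| Or of concept & concept
| Ex of name & concept
| All of name & concept.

Inductive assertion :=
| ConceptAssertion of name & name          (* A(a): A, a *)
| RoleAssertion of name & name & name.     (* R(a, b): R, a, b *)

(* The pair (C, D) of the TBox stands for the inclusion of C in D. *)
Record kb := KB { tbox : seq (concept * concept); abox : seq assertion }.

Definition individuals_of (x : assertion) : seq name :=
  match x with
  | ConceptAssertion _ a => [:: a]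
  | RoleAssertion _ a b => [:: a; b]
  end.

Definition ind (K : kb) : seq name := flatten (map individuals_of (abox K)).

(* Standard name assumption: the domain of an interpretation consists of the
   individual names, each denoting itself, and of an arbitrary type of further
   elements. *)
Record interp := Interp {
  anon : Type;
  cint : name -> (name + anon) -> Prop;
  rint : name -> (name + anon) -> (name + anon) -> Prop }.

Definition elt (I : interp) : Type := (name + anon I)%type.

Definition named (I : interp) (a : name) : elt I := inl a.

Fixpoint ext (I : interp) (C : concept) (d : elt I) : Prop :=
  match C with
  | Top => True
  | Bot => False
  | Atom A => cint A d
  | Not C => ~ ext C d
  | And C D => ext C d /\ ext D d
  | Or C D => ext C d \/ ext D d
  | Ex R C => exists e, rint R d e /\ ext C e
  | All R C => forall e, rint R d e -> ext C e
  end.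

Definition sat_assertion (I : interp) (x : assertion) : Prop :=
  match x with
  | ConceptAssertion A a => cint A (named I a)
  | RoleAssertion R a b => rint R (named I a) (named I b)
  end.

Definition model (I : interp) (K : kb) : Prop :=
  (forall C D, List.In (C, D) (tbox K) -> forall d : elt I, ext C d -> ext D d)
  /\ (forall x, List.In x (abox K) -> sat_assertion I x).

Definition consistent (K : kb) : Prop := exists I, model I K.

(** * Unions of conjunctive queries *)

Definition var := nat.

Inductive atom :=
| ConceptAtom of name & var            (* A(z): A, z *)
| RoleAtom of name & var & var.        (* R(z, z'): R, z, z' *)

(* All variables of a disjunct that are not answer variables are existentially
   quantified in that disjunct. *)
Record ucq := UCQ { answer_vars : seq var; disjuncts : seq (seq atom) }.

Definition sat_atom (I : interp) (v : var -> elt I) (x : atom) : Prop :=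
  match x with
  | ConceptAtom A z => cint A (v z)
  | RoleAtom R z z' => rint R (v z) (v z')
  end.

Definition sat_ucq (I : interp) (q : ucq) (a : seq name) : Prop :=
  exists phi, List.In phi (disjuncts q) /\
  exists v : var -> elt I,
    map v (answer_vars q) = map (named I) a /\
    forall x, List.In x phi -> sat_atom v x.

Definition certain (K : kb) (q : ucq) (a : seq name) : Prop :=
  forall I, model I K -> sat_ucq I q a.

Record signature := Signature { sig_concepts : seq name; sig_roles : seq name }.

Definition atom_over (S : signature) (x : atom) : Prop :=
  match x with
  | ConceptAtom A _ => A \in sig_concepts S
  | RoleAtom R _ _ => R \in sig_roles S
  end.

Definition ucq_over (S : signature) (q : ucq) : Prop :=
  forall phi, List.In phi (disjuncts q) ->
  forall x, List.In x phi -> atom_over S x.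

Definition ucq_entails (S : signature) (K1 K2 : kb) : Prop :=
  forall (q : ucq) (a : seq name),
    ucq_over S q -> size a = size (answer_vars q) -> {subset a <= ind K2} ->
    certain K2 q a -> {subset a <= ind K1} /\ certain K1 q a.

(** * Binary encoding of problem instances *)

(* Every [enc_*] below is a prefix code, whence [enc_instance_inj].  A
   sequence has each of its items preceded by [true] and is closed by
   [false]. *)
Definition enc_seq (T : Type) (enc : T -> seq bool) (s : seq T) : seq bool :=
  foldr (fun x w => true :: enc x ++ w) [:: false] s.

Definition enc_name (a : name) : seq bool := enc_seq (fun b => [:: b]) a.

Fixpoint enc_concept (C : concept) : seq bool :=
  match C with
  | Top => [:: false; false; false]
  | Bot => [:: false; false; true]
  | Atom A => [:: false; true; false] ++ enc_name A
  | Not C => [:: false; true; true] ++ enc_concept C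
  | And C D => [:: true; false; false] ++ enc_concept C ++ enc_concept D
  | Or C D => [:: true; false; true] ++ enc_concept C ++ enc_concept D
  | Ex R C => [:: true; true; false] ++ enc_name R ++ enc_concept C
  | All R C => [:: true; true; true] ++ enc_name R ++ enc_concept C
  end.

Definition enc_inclusion (x : concept * concept) : seq bool :=
  enc_concept x.1 ++ enc_concept x.2.

Definition enc_assertion (x : assertion) : seq bool :=
  match x with
  | ConceptAssertion A a => false :: enc_name A ++ enc_name a
  | RoleAssertion R a b => true :: enc_name R ++ enc_name a ++ enc_name b
  end.

Definition enc_kb (K : kb) : seq bool :=
  enc_seq enc_inclusion (tbox K) ++ enc_seq enc_assertion (abox K).

Definition enc_signature (S : signature) : seq bool :=
  enc_seq enc_name (sig_concepts S) ++ enc_seq enc_name (sig_roles S).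

Definition enc_instance (x : kb * kb * signature) : seq bool :=
  enc_kb x.1.1 ++ enc_kb x.1.2 ++ enc_signature x.2.

Definition prefix_code (T : Type) (enc : T -> seq bool) : Prop :=
  forall x y u v, enc x ++ u = enc y ++ v -> x = y /\ u = v.

Lemma enc_seq_prefix (T : Type) (enc : T -> seq bool) :
  prefix_code enc -> prefix_code (enc_seq enc).
Proof.
move=> enc_p; elim=> [|x s IHs] [|y t] u v //=; first by case.
by case; rewrite -!catA => /enc_p[-> /IHs[-> ->]].
Qed.

Lemma enc_name_prefix : prefix_code enc_name.
Proof. by apply: enc_seq_prefix => x y u v [-> ->]. Qed.

Lemma enc_concept_prefix : prefix_code enc_concept.
Proof.
elim=> [||A|C IHC|C IHC D IHD|C IHC D IHD|R C IHC|R C IHC];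
  case=> [||A'|C'|C' D'|C' D'|R' C'|R' C'] u v //=; case; rewrite -?catA.
- by move->.
- by move->.
- by case/enc_name_prefix=> -> ->.
- by case/IHC=> -> ->.
- by case/IHC=> -> /IHD[-> ->].
- by case/IHC=> -> /IHD[-> ->].
- by case/enc_name_prefix=> -> /IHC[-> ->].
- by case/enc_name_prefix=> -> /IHC[-> ->].
Qed.

Lemma enc_inclusion_prefix : prefix_code enc_inclusion.
Proof.
move=> [C D] [C' D'] u v; rewrite /enc_inclusion /= -!catA.
by case/enc_concept_prefix=> -> /enc_concept_prefix[-> ->].
Qed.

Lemma enc_assertion_prefix : prefix_code enc_assertion.
Proof.
move=> [A a|R a b] [A' a'|R' a' b'] u v //=; case; rewrite -!catA.
  by case/enc_name_prefix=> -> /enc_name_prefix[-> ->].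
by case/enc_name_prefix=> -> /enc_name_prefix[-> /enc_name_prefix[-> ->]].
Qed.

Lemma enc_kb_prefix : prefix_code enc_kb.
Proof.
move=> [T A] [T' A'] u v; rewrite /enc_kb /= -!catA.
case/(enc_seq_prefix enc_inclusion_prefix)=> ->.
by case/(enc_seq_prefix enc_assertion_prefix)=> -> ->.
Qed.

Lemma enc_signature_prefix : prefix_code enc_signature.
Proof.
move=> [C R] [C' R'] u v; rewrite /enc_signature /= -!catA.
case/(enc_seq_prefix enc_name_prefix)=> ->.
by case/(enc_seq_prefix enc_name_prefix)=> -> ->.
Qed.

Lemma enc_instance_inj : injective enc_instance.
Proof.
move=> [[K1 K2] S] [[K1' K2'] S']; rewrite /enc_instance /=.
case/enc_kb_prefix=> -> /enc_kb_prefix[->].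
by rewrite -[enc_signature S]cats0 -[enc_signature S']cats0
  => /enc_signature_prefix[->].
Qed.

(** * Turing machines and complexity classes *)

Definition language := seq bool -> Prop.

Inductive move := MoveLeft | Stay | MoveRight.

(* Deterministic machines with one two-way infinite tape.  A cell holds [None]
   (blank), an input bit [Some (inl b)] or an auxiliary symbol
   [Some (inr x)].  The machine halts where [trans] is [None]. *)
Record tm := TM {
  state : finType;
  aux : finType;
  start : state;
  accepting : pred state;
  trans : state -> option (bool + aux) ->
          option (state * option (bool + aux) * move) }.

Definition cell (M : tm) : Type := option (bool + aux M).

(* [tape_left] lists the cells to the left of the head, nearest first;
   [tape_right] lists the cells from the scanned one rightwards.  Both are
   implicitly continued by blanks. *)
Record config (M : tm) := Config {
  cstate : state M;
  tape_left : seq (cell M);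
  tape_right : seq (cell M) }.

Definition input_cells (M : tm) (w : seq bool) : seq (cell M) :=
  [seq Some (inl b) | b <- w].

Definition init (M : tm) (w : seq bool) : config M :=
  Config (start M) [::] (input_cells M w).

Definition step (M : tm) (c : config M) : option (config M) :=
  let l := tape_left c in
  let r := tape_right c in
  if trans (cstate c) (head None r) is Some (q, x, m) then
    Some (match m with
          | MoveLeft => Config q (behead l) (head None l :: x :: behead r)
          | Stay => Config q l (x :: behead r)
          | MoveRight => Config q (x :: l) (behead r)
          end)
  else None.

Definition halts_within (M : tm) (w : seq bool) (t : nat) (c : config M) :
    Prop :=
  exists n, [/\ n <= t, iter n (obind (@step M)) (Some (init M w)) = Some c
              & step c = None].

Definition decides (M : tm) (L : language) (t : nat -> nat) : Prop :=
  forall w, exists c : config M,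
    halts_within w (t (size w)) c /\ (accepting (cstate c) <-> L w).

(* The output starts at the head and extends to the first blank. *)
Definition has_output (M : tm) (c : config M) (w : seq bool) : Prop :=
  exists s, tape_right c = input_cells M w ++ s /\ head None s = None.

Definition computes (M : tm) (f : seq bool -> seq bool) (t : nat -> nat) :
    Prop :=
  forall w, exists c : config M,
    halts_within w (t (size w)) c /\ has_output c (f w).

Definition poly_bounded (p : nat -> nat) : Prop :=
  exists c k, forall n, p n <= c * n ^ k + c.

Definition in_two_exptime (L : language) : Prop :=
  exists (M : tm) (p : nat -> nat),
    poly_bounded p /\ decides M L (fun n => 2 ^ (2 ^ p n)).

Definition poly_reducible (L1 L2 : language) : Prop :=
  exists f : seq bool -> seq bool,
    (exists (M : tm) (p : nat -> nat), poly_bounded p /\ computes M f p) /\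
    (forall w, L1 w <-> L2 (f w)).

Definition two_exptime_complete (L : language) : Prop :=
  in_two_exptime L /\
  (forall L', in_two_exptime L' -> poly_reducible L' L).

(** * The decision problem *)

(* Entailment is only defined between consistent KBs: an instance with an
   inconsistent KB, like a word that encodes no instance, is a no-instance. *)
Definition ucq_entailment_problem : language := fun w =>
  exists (K1 K2 : kb) (S : signature),
    [/\ w = enc_instance (K1, K2, S), consistent K1, consistent K2
      & ucq_entails S K1 K2].

(* Main.v *)
(** Upper bound. Non-entailment is witnessed by a model of the first knowledge
    base and a depth [n] such that no choice of types of the second one for its
    individuals can be unravelled homomorphically to depth [n]; unfolding the
    types to that depth gives the separating query.  Assigning to every element
    and type the depth at which the type fails there, passing to the quotient
    under bounded bisimilarity and repeating profiles by the pigeonhole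
    principle turns such a model into a labelling by doubly exponentially many
    labels with locally checkable ranks, which an elimination procedure over
    the enumerated labels finds.  A knowledge base is consistent iff it does not
    entail an inconsistent one.  Complexity is handled by an algebra of functions
    on binary trees, which compiles to stack programs and these to one-tape
    machines.

    Lower bound. A machine running in time [2 ^ 2 ^ p n] rejects iff some cell of
    its cyclic space-time diagram shows a rejecting halting state.  Models of
    the first knowledge base are trees of claims "row [t] has symbol [s] at
    [x]", each justified by claims on three cells of row [t - 1]; a claim is
    a chain of [2 ^ P] elements that carry the bits of [t] and [x] together with
    copies of the parent's bits.  The second knowledge base forces an infinite
    path or two elements at distance [2 ^ P] with a wrongly copied bit, so it
    maps into every model of the first one unless there is a finite correct
    tree of claims. *)

From HB Require Import structures.
From mathcomp Require Import all_boot zify.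
From Stdlib Require Import Classical ClassicalEpsilon FunctionalExtensionality.
Require Import Defs.

Set Implicit Arguments.
Unset Strict Implicit.
Unset Printing Implicit Defensive.


(** * Stack programs on a one-tape machine *)

(** Two obstacles shape the upper bound. A query is finite but of unknown size, so the bisimulation
    quotient may have a tower of exponentially many classes. It serves only as a finite graph; the
    certificate keeps of each class a profile: its type, the pairs it hosts to every depth, and
    those it hosts to one current depth. Secondly, roles outside the signature leave no trace in a
    query, so a successor along them may be mapped to any element. Failure is then no local matter,
    and its depth behaves like an ordinal below [omega * (L + 1)], where [L] is the number of types
    of the second knowledge base: the admissible targets of such jumps shrink in at most [L] rounds,
    each with its own finite depths. Numbers below [(L + 1) * Wd] imitate these ordinals, one block
    of width [Wd] per round. In the lower bound the first TBox cannot compare bits at distance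
    [2 ^ P], so it guesses the copies; the second one counts [2 ^ P] steps with [P] concept names
    and exposes a wrong guess. Its infinite path is no UCQ, but may be cut off beyond the height of
    a claim tree. *)

Inductive cmd :=
| Nop
| Push of nat & bool
| Seq of cmd & cmd
| Case of nat & cmd & cmd
| Loop of nat & cmd & cmd.

Definition store := nat -> seq bool.

Definition upd (s : store) r v : store := fun i => if i == r then v else s i.

(* [Case] and [Loop] pop a bit and branch on it; on an empty stack [Case] does
   nothing and [Loop] stops. *)
Inductive exec : cmd -> store -> store -> nat -> Prop :=
| ENop s : exec Nop s s 1
| EPush r b s : exec (Push r b) s (upd s r (b :: s r)) 1
| ESeq c d s s1 s2 n m :
    exec c s s1 n -> exec d s1 s2 m -> exec (Seq c d) s s2 (n + m)
| ECase0 r c0 c1 s : s r = [::] -> exec (Case r c0 c1) s s 1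
| ECase r c0 c1 s b w s' n :
    s r = b :: w -> exec (if b then c1 else c0) (upd s r w) s' n ->
    exec (Case r c0 c1) s s' n.+1
| ELoop0 r c0 c1 s : s r = [::] -> exec (Loop r c0 c1) s s 1
| ELoop r c0 c1 s b w s1 s2 n m :
    s r = b :: w -> exec (if b then c1 else c0) (upd s r w) s1 n ->
    exec (Loop r c0 c1) s1 s2 m -> exec (Loop r c0 c1) s s2 (n + m).+1.

Fixpoint regs_le K c :=
  match c with
  | Nop => true
  | Push r _ => r <= K
  | Seq c d => regs_le K c && regs_le K d
  | Case r c d | Loop r c d => [&& r <= K, regs_le K c & regs_le K d]
  end.

Fixpoint max_reg c :=
  match c with
  | Nop => 0
  | Push r _ => r
  | Seq c d => maxn (max_reg c) (max_reg d)
  | Case r c d | Loop r c d => maxn r (maxn (max_reg c) (max_reg d))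
  end.

Lemma regs_le_max K c : max_reg c <= K -> regs_le K c.
Proof.
elim: c => //= [c IHc d IHd|r c IHc d IHd|r c IHc d IHd]; rewrite !geq_max.
- by case/andP=> /IHc -> /IHd ->.
- by case/and3P=> -> /IHc -> /IHd ->.
- by case/and3P=> -> /IHc -> /IHd ->.
Qed.

Section Machine.
Variable K : nat.

Let col : finType := {ffun 'I_K.+1 -> option bool}.
Let tcell : Type := option (bool + option col).
Let tape : Type := (seq tcell * seq tcell)%type.

Definition marker : tcell := Some (inr None).

Definition get r (x : tcell) : option bool :=
  if x is Some (inr (Some f)) then f (inord r) else None.

Definition set r v (x : tcell) : tcell :=
  Some (inr (Some [ffun j : 'I_K.+1 =>
    if j == inord r then v else
    if x is Some (inr (Some f)) then f j else None])).

Lemma get_set r r' v x : r <= K -> r' <= K ->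
  get r (set r' v x) = if r == r' then v else get r x.
Proof.
move=> rK r'K; rewrite /get /set ffunE -val_eqE /= !inordK ?ltnS //.
Qed.

Definition mv (t : tape) (x : tcell) (m : Defs.move) : tape :=
  match m with
  | MoveLeft => (behead t.1, head None t.1 :: x :: behead t.2)
  | Stay => (t.1, x :: behead t.2)
  | MoveRight => (x :: t.1, behead t.2)
  end.

(** Pieces of machines with several exits, the values of [X]. Composition turns exits into states of
    the larger fragment, so programs are assembled before any final state exists. *)
Record frag (X : Type) := Frag {
  fstate : finType;
  f0 : fstate;
  fdelta : fstate -> tcell -> (fstate + X) * tcell * Defs.move }.

Inductive reach X (f : frag X) :
    fstate f + X -> tape -> fstate f + X -> tape -> nat -> Prop :=
| Reach0 u t : reach u t u t 0
| ReachS q t u x m v t' n :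
    fdelta q (head None t.2) = (u, x, m) -> reach u (mv t x m) v t' n ->
    reach (inl q) t v t' n.+1.

Lemma reach_trans X (f : frag X) u t u' t' u'' t'' n m :
  @reach X f u t u' t' n -> reach u' t' u'' t'' m -> reach u t u'' t'' (n + m).
Proof.
elim=> [//|q t1 v x mm v' t1' k e _ IH /IH H].
by rewrite addSn; apply: ReachS e H.
Qed.

Lemma reach1 X (f : frag X) q t u x m :
  @fdelta X f q (head None t.2) = (u, x, m) -> reach (inl q) t u (mv t x m) 1.
Proof. by move=> e; apply: (ReachS e); apply: Reach0. Qed.

Definition lift_exit X Y S T (i : S -> T) (e : X -> T + Y) (u : S + X) :=
  match u with inl q => inl (i q) | inr x => e x end.

(** Runs of a part are runs of the whole. For the composite fragments below the hypothesis on
    [fdelta] holds by computation, whence the [erefl] arguments. *)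
Lemma reach_embed X Y (f : frag X) (g : frag Y) (i : fstate f -> fstate g)
    (e : X -> fstate g + Y) :
  (forall q x, fdelta (i q) x =
     let: (u, y, m) := fdelta q x in (lift_exit i e u, y, m)) ->
  forall u t v t' n, @reach X f u t v t' n ->
  reach (lift_exit i e u) t (lift_exit i e v) t' n.
Proof.
move=> emb u t v t' n; elim=> [*|q t1 w x m v1 t1' k d _ IH]; first exact: Reach0.
by apply: ReachS IH; rewrite emb d.
Qed.

(* Register [r] is the stack on track [r], bottom at the cell right of the
   marker. *)
Definition home (s : store) (t : tape) :=
  [/\ t.1 = [:: marker], all (predC1 marker) t.2 &
      forall r, r <= K -> forall i, get r (nth None t.2 i) = onth (rev (s r)) i].

Definition nop_frag : frag unit :=
  @Frag unit unit tt (fun _ x => (inr tt, x, Stay)).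

(** State [false] climbs to the first cell whose track [r] is empty and writes there; state [true]
    walks back to the marker. *)
Definition push_frag r b : frag unit :=
  @Frag unit bool false (fun q x =>
    if q then if x == marker then (inr tt, x, MoveRight)
              else (inl true, x, MoveLeft)
    else if get r x is Some _ then (inl false, x, MoveRight)
         else (inl true, set r (Some b) x, MoveLeft)).

(** The climb overshoots the top by one cell and steps back. If that cell is the marker, the stack
    was empty; otherwise the erased bit is kept in the state during the return. *)
Definition pop_frag r : frag (option bool) :=
  @Frag (option bool) (bool + option bool)%type (inl false) (fun q x =>
    match q with
    | inl false => if get r x is Some _ then (inl (inl false), x, MoveRight)
                   else (inl (inl true), x, MoveLeft)
    | inl true => if x == marker then (inr None, x, MoveRight)
                  else (inl (inr (get r x)), set r None x, MoveLeft)
    | inr v => if x == marker then (inr v, x, MoveRight)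
               else (inl (inr v), x, MoveLeft)
    end).

Definition seq_frag X (f : frag unit) (g : frag X) : frag X :=
  @Frag X (fstate f + fstate g)%type (inl (f0 f)) (fun q x =>
    match q with
    | inl q => let: (u, y, m) := fdelta q x in
               (lift_exit inl (fun _ => inl (inr (f0 g))) u, y, m)
    | inr q => let: (u, y, m) := fdelta q x in (lift_exit inr inr u, y, m)
    end).

Definition branch_frag (loop : bool) r (f g : frag unit) : frag unit :=
  let P := pop_frag r in
  let again : (fstate P + (fstate f + fstate g))%type + unit :=
    if loop then inl (inl (f0 P)) else inr tt in
  @Frag unit (fstate P + (fstate f + fstate g))%type (inl (f0 P)) (fun q x =>
    match q with
    | inl q => let: (u, y, m) := fdelta q x in
        (lift_exit inl (fun v => match v with
           | None => inr tt
           | Some b => inl (inr (if b then inr (f0 g) else inl (f0 f))) end) u,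
         y, m)
    | inr (inl q) => let: (u, y, m) := fdelta q x in
        (lift_exit (fun q => inr (inl q)) (fun _ => again) u, y, m)
    | inr (inr q) => let: (u, y, m) := fdelta q x in
        (lift_exit (fun q => inr (inr q)) (fun _ => again) u, y, m)
    end).

Fixpoint frag_of (c : cmd) : frag unit :=
  match c with
  | Nop => nop_frag
  | Push r b => push_frag r b
  | Seq c d => seq_frag (frag_of c) (frag_of d)
  | Case r c d => branch_frag false r (frag_of c) (frag_of d)
  | Loop r c d => branch_frag true r (frag_of c) (frag_of d)
  end.

Lemma walk_right X (f : frag X) q r :
  (forall x, get r x -> fdelta q x = (inl q, x, MoveRight)) ->
  forall xs l y, all (fun x => get r x : bool) xs ->
  @reach X f (inl q) (l, xs ++ y) (inl q) (rev xs ++ l, y) (size xs).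
Proof.
move=> H; elim=> [|x xs IH] l y /=; first by move=> _; apply: Reach0.
case/andP=> gx /IH {}IH; apply: ReachS; first by apply: H.
by rewrite /mv /= rev_cons cat_rcons.
Qed.

Lemma walk_left X (f : frag X) q v :
  (forall x, fdelta q x = if x == marker then (v, x, MoveRight)
                          else (inl q, x, MoveLeft)) ->
  forall ys r, all (predC1 marker) ys ->
  @reach X f (inl q) (behead (ys ++ [:: marker]),
                      head None (ys ++ [:: marker]) :: r)
         v ([:: marker], rev ys ++ r) (size ys).+1.
Proof.
move=> H; elim=> [|y ys IH] r /=.
  by move=> _; apply: (ReachS (x := marker)); [apply: H|apply: Reach0].
case/andP=> /= ny /IH {}IH; apply: ReachS; first by rewrite H /= (negPf ny).
by rewrite /mv /= rev_cons cat_rcons.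
Qed.

Lemma nth_some (T : Type) (s : seq T) i :
  i < size s -> exists x, onth s i = Some x.
Proof. by rewrite -onthTE; case: onth => // x; exists x. Qed.

Lemma home_split s t r : home s t -> r <= K ->
  exists xs y, [/\ t.2 = xs ++ y, size xs = size (s r),
    all (fun x => get r x : bool) xs, get r (head None y) = None
    & all (predC1 marker) xs /\ all (predC1 marker) y].
Proof.
case: t => l t [/= _ ok H] rK; set n := size (s r).
have len : n <= size t.
  case En: n => [//|k]; rewrite ltnNge; apply/negP=> le.
  have := H r rK k; rewrite (nth_default None le) /=.
  by have [|x ->] := @nth_some _ (rev (s r)) k; rewrite // size_rev -/n En.
have szn : size (take n t) = n by rewrite size_takel.
exists (take n t), (drop n t); split; rewrite ?cat_take_drop //.
- apply/(all_nthP None) => i; rewrite szn => lt; rewrite nth_take // H //.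
  by have [|x ->] := @nth_some _ (rev (s r)) i; rewrite // size_rev.
- by rewrite -nth0 nth_drop addn0 H // onth_default ?size_rev.
- by split; apply/allP=> x; [move/mem_take|move/mem_drop]; apply: (allP ok).
Qed.

Lemma nth_upd (xs : seq tcell) z y i :
  nth None (xs ++ z :: behead y) i =
  if i == size xs then z else nth None (xs ++ y) i.
Proof.
rewrite !nth_cat; case: ltngtP => // [lt|->]; last by rewrite subnn.
by case: (i - size xs) (subn_gt0 (size xs) i) => [|k]; [rewrite lt|rewrite /= nth_behead].
Qed.

Lemma all_behead (T : Type) (p : pred T) s : all p s -> all p (behead s).
Proof. by case: s => //= x s /andP[]. Qed.

Lemma push_reach r b s t : r <= K -> home s t ->
  exists t' n, [/\ @reach unit (push_frag r b) (inl false) t (inr tt) t' n,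
    home (upd s r (b :: s r)) t' & n <= 2 * size (s r) + 2].
Proof.
move=> rK h; have [xs [y [e sz gx gy [mx my]]]] := home_split h rK.
case: t h e => l t [/= el _ H] /= et; rewrite {}et {}el in H *.
pose z := set r (Some b) (head None y).
exists ([:: marker], xs ++ z :: behead y), (size xs + (1 + (size (rev xs)).+1)).
split; last by rewrite size_rev; lia.
  apply: (reach_trans (walk_right (f := push_frag r b) (q := false) _ _ _ gx)).
    by move=> x /=; case: (get r x).
  apply: reach_trans.
    by apply: (reach1 (f := push_frag r b) (q := false)); rewrite /= gy.
  rewrite /mv /= -/z -{3}(revK xs).
  by apply: (walk_left (f := push_frag r b)); rewrite // all_rev.
split=> //=; first by rewrite all_cat mx /= all_behead.
move=> r' r'K i; rewrite nth_upd; case: eqP => [->|ne].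
  rewrite get_set //; case: eqP => [->|ne]; rewrite /upd ?eqxx.
    by rewrite rev_cons -cats1 onth_cat size_rev sz ltnn subnn.
  case: eqP => // _; rewrite -H // nth_cat ltnn subnn.
  by rewrite nth0.
rewrite H // /upd; case: eqP => // ->; rewrite rev_cons -cats1 onth_cat.
rewrite size_rev; case: ltnP => // le.
by rewrite !onth_default //= ?size_rev //; lia.
Qed.

Lemma pop_reach r s t : r <= K -> home s t ->
  exists t' n, [/\ reach (f := pop_frag r) (inl (inl false)) t (inr (ohead (s r))) t' n,
    home (upd s r (behead (s r))) t' & n <= 2 * size (s r) + 3].
Proof.
move=> rK h; have [xs [y [e sz gx gy [mx my]]]] := home_split h rK.
case: t h e => l t [/= el _ H] /= et; rewrite {}et {}el in H *.
have go : reach (f := pop_frag r) (inl (inl false)) ([:: marker], xs ++ y)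
    (inl (inl false)) (rev xs ++ [:: marker], y) (size xs).
  by apply: walk_right gx => x /=; case: (get r x).
have go1 : reach (f := pop_frag r) (inl (inl false)) (rev xs ++ [:: marker], y)
    (inl (inl true)) (mv (rev xs ++ [:: marker], y) (head None y) MoveLeft) 1.
  by apply: reach1; rewrite /= gy.
have {go1}go := reach_trans go go1.
have Hr := H r rK.
case/lastP: xs => [|xs z] in sz gx mx H Hr go *.
  have s0 : s r = [::] by apply: size0nil.
  exists ([:: marker], head None y :: behead y), (0 + 1 + 1); split; last by lia.
  - apply: (reach_trans go); rewrite /mv /= s0 /=.
    apply: (ReachS (f := pop_frag r) (x := marker) (m := MoveRight)).
      by [].
    by apply: Reach0.
  - split=> //=; first by case: (y) my => [|u v] //=.
  have -> : upd s r (behead (s r)) = s.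
    by apply: functional_extensionality => j; rewrite /upd; case: eqP => // ->; rewrite s0.
  move=> r' r'K i; rewrite -(H r' r'K i) /=; by case: (y) i => [|u v] [|i] //=; rewrite nth_nil.
case es: (s r) sz => [|b w]; first by rewrite size_rcons.
rewrite size_rcons /= => -[sz].
have zb : get r z = Some b.
  have := Hr (size xs); rewrite cat_rcons nth_cat ltnn subnn /= => ->.
  by rewrite es rev_cons -cats1 onth_cat size_rev sz ltnn subnn.
move: mx; rewrite all_rcons => /andP[/= mz mx].
exists ([:: marker], xs ++ set r None z :: head None y :: behead y),
   ((size (rcons xs z) + 1) + (1 + (size (rev xs)).+1)); split.
- apply: (reach_trans go); rewrite rev_rcons /mv /=.
  apply: reach_trans.
    apply: (reach1 (f := pop_frag r) (q := inl true)).
    by rewrite /= (negPf mz) zb.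
  rewrite /mv /= -{3}(revK xs).
  by apply: (walk_left (f := pop_frag r) (q := inr (Some b))); rewrite // all_rev.
- split=> //=; first by rewrite all_cat mx /=; case: (y) my => [|u v].
  move=> r' r'K i.
  have -> : get r' (nth None (xs ++ [:: set r None z, head None y & behead y]) i) =
     if (i == size xs) && (r' == r) then None else get r' (nth None (rcons xs z ++ y) i).
    have := nth_upd xs (set r None z) (z :: y) i; rewrite /= -cat_rcons => e1.
    have -> : nth None (xs ++ [:: set r None z, head None y & behead y]) i =
      nth None (xs ++ set r None z :: y) i.
      rewrite !nth_cat; case: ltnP => // _; case: (i - _) => //= j.
      by case: (y) j => [|u v] [|j] //=; rewrite nth_nil.
    rewrite -[in LHS]cat_rcons e1 cat_rcons.
    case: (i =P size xs) => [->|//]; rewrite get_set //=; case: eqP => // _.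
    by rewrite nth_cat ltnn subnn.
  rewrite H // /upd; case: (i =P size xs) => [->|ne] /=; case: (r' =P r) => [er|_] //.
  + by rewrite onth_default // size_rev sz.
  + rewrite er es rev_cons -cats1 onth_cat size_rev.
    case: ltnP => // le; rewrite !onth_default //= ?size_rev //; lia.
- by rewrite size_rcons size_rev sz; lia.
Qed.

Lemma home_stay s l t : home s (l, t) -> home s (l, head None t :: behead t).
Proof.
case=> /= el ok H; split=> //=; first by case: (t) ok.
by move=> r rK i; rewrite -H //; case: (t) i => [|u v] [|i] //=; rewrite nth_nil.
Qed.

(** A command costs at most one walk to the top of a stack and back, and a run of cost [n] cannot
    raise a stack of height at most [m] above [m + n]; hence a quadratic slowdown. *)
Lemma cmd_reach c s s' n : exec c s s' n -> regs_le K c ->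
  forall m t, (forall r, r <= K -> size (s r) <= m) -> home s t ->
  exists t' k, [/\ reach (f := frag_of c) (inl (f0 (frag_of c))) t (inr tt) t' k,
    home s' t', k <= n * (2 * (m + n) + 8) &
    forall r, r <= K -> size (s' r) <= m + n].
Proof.
elim=> {c s s' n}.
- move=> s _ m [l t] sz h; exists (l, head None t :: behead t), 1; split.
  + by apply: (ReachS (f := nop_frag)) => //; apply: Reach0.
  + exact: home_stay.
  + by lia.
  + by move=> r /sz; lia.
- move=> r b s /= rK m t sz h.
  have [t' [n [R h' le]]] := push_reach b rK h; exists t', n; split=> //.
    by have := sz r rK; lia.
  by move=> r' r'K; rewrite /upd; case: eqP => [_|_] /=; [have := sz r rK|have := sz r' r'K]; lia.
- move=> c d s s1 s2 n m _ IHc _ IHd /= /andP[cK dK] M t sz h.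
  have [t1 [k1 [R1 h1 le1 sz1]]] := IHc cK M t sz h.
  have [t2 [k2 [R2 h2 le2 sz2]]] := IHd dK (M + n) t1 sz1 h1.
  exists t2, (k1 + k2); split=> //; last by move=> r /sz2; lia.
    have E1 := reach_embed (g := seq_frag (frag_of c) (frag_of d)) (i := inl)
      (e := fun _ => inl (inr (f0 (frag_of d)))) (fun _ _ => erefl) R1.
    have E2 := reach_embed (g := seq_frag (frag_of c) (frag_of d)) (i := inr)
      (e := inr) (fun _ _ => erefl) R2.
    exact: reach_trans E1 E2.
  by nia.
- move=> r c d s s0 /= /and3P[rK _ _] m t sz h.
  have [t' [n [R h' le]]] := pop_reach rK h; exists t', n; split.
  + have := reach_embed (g := branch_frag false r (frag_of c) (frag_of d)) (i := inl)
      (e := fun v => match v with None => inr tt | Some b => inl (inr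
         (if b then inr (f0 (frag_of d)) else inl (f0 (frag_of c)))) end) _ R.
    by rewrite s0; apply.
  + rewrite s0 in h'; rewrite (_ : s = upd s r (behead [::])) //.
    by apply: functional_extensionality => j; rewrite /upd; case: eqP => // ->.
  + by move: le; rewrite s0 /=; lia.
  + by move=> r' /sz; lia.
- move=> r c d s b w s' n es _ IH /= /and3P[rK cK dK] m t sz h.
  have [t1 [n1 [R1 h1 le1]]] := pop_reach rK h; rewrite es /= in R1 h1 le1.
  have bK : regs_le K (if b then d else c) by case: (b).
  have sr := sz r rK; rewrite es /= in sr.
  have [r' r'K|t2 [n2 [R2 h2 le2 sz2]]] := IH bK m t1 _ h1.
    by rewrite /upd; case: eqP => _; [lia|apply: sz].
  exists t2, (n1 + n2); split=> //; last by move=> r' /sz2; lia.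
    have E1 := reach_embed (g := branch_frag false r (frag_of c) (frag_of d)) (i := inl)
      (e := fun v => match v with None => inr tt | Some b => inl (inr
         (if b then inr (f0 (frag_of d)) else inl (f0 (frag_of c)))) end)
      (fun _ _ => erefl) R1.
    apply: reach_trans E1 _; case: (b) R2 => R2.
      exact: (reach_embed (g := branch_frag false r (frag_of c) (frag_of d))
        (i := fun q => inr (inr q)) (e := fun _ => inr tt) (fun _ _ => erefl) R2).
    exact: (reach_embed (g := branch_frag false r (frag_of c) (frag_of d))
        (i := fun q => inr (inl q)) (e := fun _ => inr tt) (fun _ _ => erefl) R2).
  by nia.
- move=> r c d s s0 /= /and3P[rK _ _] m t sz h.
  have [t' [n [R h' le]]] := pop_reach rK h; exists t', n; split.
  + have := reach_embed (g := branch_frag true r (frag_of c) (frag_of d)) (i := inl)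
      (e := fun v => match v with None => inr tt | Some b => inl (inr
         (if b then inr (f0 (frag_of d)) else inl (f0 (frag_of c)))) end) _ R.
    by rewrite s0; apply.
  + rewrite s0 in h'; rewrite (_ : s = upd s r (behead [::])) //.
    by apply: functional_extensionality => j; rewrite /upd; case: eqP => // ->.
  + by move: le; rewrite s0 /=; lia.
  + by move=> r' /sz; lia.
- move=> r c d s b w s1 s2 n n' es _ IH _ IHl /= rcd m t sz h.
  have /and3P[rK cK dK] := rcd.
  have [t1 [n1 [R1 h1 le1]]] := pop_reach rK h; rewrite es /= in R1 h1 le1.
  have bK : regs_le K (if b then d else c) by case: (b).
  have sr := sz r rK; rewrite es /= in sr.
  have [r' r'K|t2 [n2 [R2 h2 le2 sz2]]] := IH bK m t1 _ h1.
    by rewrite /upd; case: eqP => _; [lia|apply: sz].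
  have [t3 [n3 [R3 h3 le3 sz3]]] := IHl rcd (m + n) t2 sz2 h2.
  exists t3, (n1 + n2 + n3); split=> //; last by move=> r' /sz3; lia.
    have E1 := reach_embed (g := branch_frag true r (frag_of c) (frag_of d)) (i := inl)
      (e := fun v => match v with None => inr tt | Some b => inl (inr
         (if b then inr (f0 (frag_of d)) else inl (f0 (frag_of c)))) end)
      (fun _ _ => erefl) R1.
    apply: reach_trans R3; apply: reach_trans E1 _; case: (b) R2 => R2.
      exact: (reach_embed (g := branch_frag true r (frag_of c) (frag_of d))
        (i := fun q => inr (inr q)) (e := fun _ => inl (inl (inl false)))
        (fun _ _ => erefl) R2).
    exact: (reach_embed (g := branch_frag true r (frag_of c) (frag_of d))
        (i := fun q => inr (inl q)) (e := fun _ => inl (inl (inl false)))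
        (fun _ _ => erefl) R2).
  by nia.
Qed.

(* States: before the marker is written (twice), conversion of the input,
   return to the marker. *)
Definition init_frag : frag unit :=
  @Frag unit (bool + bool)%type (inl false) (fun q x =>
    match q with
    | inl false => (inl (inl true), x, MoveLeft)
    | inl true => (inl (inr false), marker, MoveRight)
    | inr false => if x is Some (inl b)
                   then (inl (inr false), set 2 (Some b) None, MoveRight)
                   else (inl (inr true), x, MoveLeft)
    | inr true => if x == marker then (inr tt, x, MoveRight)
                  else (inl (inr true), x, MoveLeft)
    end).

Definition final_frag : frag bool :=
  @Frag bool (bool + bool)%type (inl false) (fun q x =>
    match q with
    | inl false => if get 2 x is Some b then (inl (inl false), Some (inl b), MoveRight)
                   else (inl (inl true), None, MoveLeft)
    | inl true => if x == marker then (inl (inr false), x, MoveRight)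
                  else (inl (inl true), x, MoveLeft)
    | inr _ => (inr (if x is Some (inl b) then b else false), x, Stay)
    end).

(** The marker is written to the left of the input, and the first input bit stays next to it. It
    thereby becomes the bottom of stack 2, which explains [rev w]. *)
Lemma init_reach w : 2 <= K ->
  exists t n, [/\ reach (f := init_frag) (inl (inl false))
      ([::], [seq Some (inl b) | b <- w]) (inr tt) t n,
    home (upd (fun=> [::]) 2 (rev w)) t & n <= 2 * size w + 4].
Proof.
move=> K2; set t0 : seq tcell := [seq _ | b <- w].
pose c b : tcell := set 2 (Some b) None.
have conv v l y : reach (f := init_frag) (inl (inr false))
    (l, [seq Some (inl b) | b <- v] ++ y) (inl (inr false))
    (rev (map c v) ++ l, y) (size v).
  elim: v l => [|b v IH] l /=; first exact: Reach0.
  apply: (ReachS (f := init_frag)) => //; rewrite /mv /= rev_cons cat_rcons.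
  exact: IH.
have [y [ey hy yy]] : exists y, [/\ head None t0 :: behead t0 = t0 ++ y,
    head None y = None & behead y = [::]].
  by rewrite /t0; case: (w) => [|b v]; [exists [:: None]|exists [::]; rewrite ?cats0].
exists ([:: marker], map c w ++ [:: None]), (2 + (size w + (1 + (size w).+1))).
split; last by lia.
  apply: (reach_trans (f := init_frag) (u' := inl (inr false)) (t' := ([:: marker], head None t0 :: behead t0))).
    apply: (ReachS (f := init_frag)); first by [].
    by apply: (ReachS (f := init_frag)); first by []; apply: Reach0.
  rewrite ey; apply: (reach_trans (conv _ _ _)).
  apply: reach_trans.
    by apply: (reach1 (f := init_frag) (q := inr false)); rewrite /= hy.
  have := @walk_left _ init_frag (inr true) (inr tt) (fun _ => erefl)
    (rev (map c w)) [:: None].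
  rewrite revK size_rev size_map /mv /= yy; apply.
  by rewrite all_rev all_map; apply/allP.
split=> //=; first by rewrite all_cat all_map /= andbT; apply/allP.
move=> r rK i; rewrite nth_cat size_map; case: ltnP => [lt|le].
  rewrite (nth_map false) // get_set // /upd; case: eqP => _; last by case: (i).
  rewrite revK onthE; rewrite (nth_map false) //.
rewrite /upd; case: eqP => _; rewrite ?revK ?onth_default //.
all: by case: (i - size w) => [|[]].
Qed.

(** After the conversion the head ends on the first output cell, whose bit is the exit; an empty
    output leaves a blank there and counts as [false]. *)
Lemma final_reach s t w : 2 <= K -> home s t -> s 2 = rev w ->
  exists t' n, [/\ reach (f := final_frag) (inl (inl false)) t
      (inr (head false w)) t' n,
    exists r, t'.2 = [seq Some (inl b) | b <- w] ++ None :: r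
    & n <= 2 * size w + 4].
Proof.
move=> K2 h e2; have [xs [y [e sz gx gy [mx my]]]] := home_split h K2.
have exs : map (get 2) xs = map Some w.
  apply: (@eq_from_nth _ None); rewrite !size_map sz e2 size_rev // => i lt.
  have lt' : i < size xs by rewrite sz e2 size_rev.
  case: h => _ _ /(_ 2 K2 i); rewrite e nth_cat lt' e2 revK onthE => <-.
  by rewrite (nth_map None).
case: t h e => l t [/= el _ _] /= et; rewrite {}et {}el.
have conv v zs l0 : map (get 2) zs = map Some v ->
    reach (f := final_frag) (inl (inl false)) (l0, zs ++ y) (inl (inl false))
    (rev [seq Some (inl b) | b <- v] ++ l0, y) (size v).
  elim: v zs l0 => [|b v IH] [|z zs] l0 //=; first by move=> _; exact: Reach0.
  case=> gz /IH {}IH; apply: (ReachS (f := final_frag)); first by rewrite /= gz.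
  rewrite /mv /= rev_cons cat_rcons; exact: IH.
set o : seq tcell := [seq _ | b <- w].
exists ([:: marker], o ++ None :: behead y),
   (size w + (1 + ((size (rev o)).+1 + 1))); split.
- apply: (reach_trans (conv _ _ _ exs)).
  apply: reach_trans.
    by apply: (reach1 (f := final_frag) (q := inl false)); rewrite /= gy.
  rewrite /mv /= -/o; apply: (reach_trans (f := final_frag) (u' := inl (inr false))
    (t' := ([:: marker], o ++ None :: behead y))).
    have := @walk_left _ final_frag (inl true) (inl (inr false)) (fun _ => erefl)
      (rev o) (None :: behead y).
    by rewrite revK; apply; rewrite all_rev all_map; apply/allP.
  have -> : head false w = if head None o is Some (inl b) then b else false.
    by rewrite /o; case: (w).
  apply: (ReachS (f := final_frag)); first by [].
  rewrite /mv /= /o; case: (w) => [|b v] /=; exact: Reach0.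
- by exists (behead y).
- by rewrite size_rev size_map; lia.
Qed.

End Machine.

Definition tm_of K (F : frag K bool) : tm :=
  @TM (fstate F + bool)%type (option {ffun 'I_K.+1 -> option bool})
    (inl (f0 F)) (fun q => if q is inr b then b else false)
    (fun q x => if q is inl q then Some (fdelta q x) else None).

Lemma tm_of_reach K (F : frag K bool) u t v t' n : reach (f := F) u t v t' n ->
  iter n (obind (@step (tm_of F))) (Some (Config (u : state (tm_of F)) t.1 t.2)) =
  Some (Config (v : state (tm_of F)) t'.1 t'.2).
Proof.
elim=> [//|q s w x m v1 s' k d _ IH]; rewrite iterSr /=.
rewrite /step /= d -{}IH; congr (iter _ _ (Some _)).
by case: (m).
Qed.

Section TuringMachine.
Variable c : cmd.
Let K := maxn 2 (max_reg c).
Let F : frag K bool := seq_frag (init_frag K) (seq_frag (frag_of K c) (final_frag K)).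

Lemma tm_of_correct w w' s n :
  exec c (upd (fun=> [::]) 2 (rev w)) s n -> s 2 = rev w' ->
  exists d : config (tm_of F),
    [/\ halts_within w (4 * (size w + n + 2) ^ 2 * 4) d, has_output d w' &
        accepting (cstate d) = head false w'].
Proof.
move=> ex e2; have K2 : 2 <= K by rewrite leq_maxl.
have cK : regs_le K c by apply: regs_le_max; rewrite leq_maxr.
have [t [k [R h le]]] := init_reach w K2.
have [r rK|t1 [k1 [R1 h1 le1 sz1]]] := cmd_reach ex cK (m := size w) _ h.
  by rewrite /upd; case: eqP => //; rewrite size_rev.
have [t2 [k2 [R2 [r er] le2]]] := final_reach K2 h1 e2.
have szw' : size w' <= size w + n by rewrite -size_rev -e2; apply: sz1.
exists (Config (inr (head false w') : state (tm_of F)) t2.1 t2.2); split=> //.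
  exists (k + (k1 + k2)); split=> //; first by nia.
  have := @tm_of_reach K F (inl (f0 F)) ([::], input_cells (tm_of F) w) (inr (head false w')) t2
    (k + (k1 + k2)); apply.
  apply: reach_trans.
    exact: (reach_embed (g := F) (i := inl) (e := fun _ => inl (inr (inl (f0 (frag_of K c)))))
      (fun _ _ => erefl) R).
  apply: reach_trans.
    have R1' := reach_embed (g := seq_frag (frag_of K c) (final_frag K)) (i := inl)
      (e := fun _ => inl (inr (f0 (final_frag K)))) (fun _ _ => erefl) R1.
    exact: (reach_embed (g := F) (i := inr) (e := inr) (fun _ _ => erefl) R1').
  have R2' := reach_embed (g := seq_frag (frag_of K c) (final_frag K)) (i := inr)
      (e := inr) (fun _ _ => erefl) R2.
  exact: (reach_embed (g := F) (i := inr) (e := inr) (fun _ _ => erefl) R2').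
by exists (None :: r).
Qed.

End TuringMachine.


(** * Functions on binary trees *)

Inductive tree := L | N of tree & tree.

Fixpoint tsize t := if t is N a b then (tsize a + tsize b).+1 else 1.

Fixpoint code t := if t is N a b then true :: code a ++ code b else [:: false].

Lemma size_code t : size (code t) = tsize t.
Proof. by elim: t => //= a IHa b IHb; rewrite size_cat IHa IHb. Qed.

(** This lets a program cut one tree off a stack without an end mark. *)
Lemma code_prefix : prefix_code code.
Proof.
elim=> [|a IHa b IHb] [|a' b'] u v //=; first by case.
by case; rewrite -!catA => /IHa[-> /IHb[-> ->]].
Qed.

Fixpoint treeb x y :=
  match x, y with
  | L, L => true
  | N a b, N c d => treeb a c && treeb b d
  | _, _ => false
  end.

Lemma treebP : Equality.axiom treeb.
Proof.
move=> x y; apply: (iffP idP) => [|<-]; last by elim: x => //= a -> b ->.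
by elim: x y => [|a IHa b IHb] [|c d] //= /andP[/IHa-> /IHb->].
Qed.

HB.instance Definition _ := hasDecEq.Build tree treebP.

(* Lists are right combs [N x1 (N x2 ...)]; [L] is false and every [N] is
   true. *)
Inductive fn :=
| Id
| Lf
| Pair of fn & fn
| Hd
| Tl
| Comp of fn & fn
| Cond of fn & fn & fn
| Fold of fn
| Eq.

Definition hd t := if t is N a _ then a else L.
Definition tl t := if t is N _ b then b else L.

Section Fold.
Variables (g : tree -> tree) (cg : tree -> nat).
Fixpoint tfold a l := if l is N h t then tfold (g (N a h)) t else a.
Fixpoint tfold_cost a l :=
  if l is N h t then tsize a + tsize h + cg (N a h) + tfold_cost (g (N a h)) t
  else tsize a.
End Fold.

Fixpoint eval F x :=
  match F with
  | Id => x
  | Lf => L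
  | Pair f g => N (eval f x) (eval g x)
  | Hd => hd x
  | Tl => tl x
  | Comp g f => eval g (eval f x)
  | Cond c f g => if eval c x is N _ _ then eval f x else eval g x
  | Fold g => if x is N a l then tfold (eval g) a l else L
  | Eq => if x is N a b then if a == b then N L L else L else L
  end.

(** Besides the evaluation itself, this charges for the copies and moves of inputs and intermediate
    values that the compiled program makes; the factor 60 in [comp_ex] absorbs the constants. *)
Fixpoint cost F x :=
  match F with
  | Id | Lf | Hd | Tl | Eq => tsize x + 3
  | Pair f g => tsize x + cost f x + cost g x + tsize (eval f x) + tsize (eval g x) + 1
  | Comp g f => cost f x + cost g (eval f x)
  | Cond c f g => tsize x + cost c x + tsize (eval c x) +
      (if eval c x is N _ _ then cost f x else cost g x)
  | Fold g => tsize x +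
      (if x is N a l then tfold_cost (eval g) (cost g) a l +
         tsize (tfold (eval g) a l) else 0)
  end.

Lemma tsize_gt0 x : 0 < tsize x. Proof. by case: x. Qed.

Lemma eval_cost F x : tsize (eval F x) <= cost F x.
Proof.
elim: F x => //=.
- by move=> x; lia.
- by move=> x; lia.
- by move=> f IHf g IHg x; have := IHf x; have := IHg x; have := tsize_gt0 x; lia.
- by case=> //= *; lia.
- by case=> //= *; lia.
- by move=> g IHg f IHf x; have := IHg (eval f x); lia.
- move=> c _ f IHf g IHg x; case: (eval c x) => *; by [have := IHg x; lia|have := IHf x; lia].
- move=> g IH [|a l] /=; first by [].
  by lia.
- by case=> [|a b] //=; case: ifP => //=; lia.
Qed.

Definition ex c s s' B := exists2 n, n <= B & exec c s s' n.

Lemma ex_le c s s' B B' : ex c s s' B -> B <= B' -> ex c s s' B'.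
Proof. by case=> n le e le'; exists n => //; apply: leq_trans le le'. Qed.

Lemma ex_seq c d s s1 s2 B B' : ex c s s1 B -> ex d s1 s2 B' ->
  ex (Seq c d) s s2 (B + B').
Proof. by case=> n le e [m le' e']; exists (n + m); [lia|apply: ESeq e e']. Qed.

Lemma ex_push r b s : ex (Push r b) s (upd s r (b :: s r)) 1.
Proof. by exists 1; last exact: EPush. Qed.

Lemma ex_case c0 c1 r s b w s' B : s r = b :: w ->
  ex (if b then c1 else c0) (upd s r w) s' B -> ex (Case r c0 c1) s s' B.+1.
Proof. by move=> e [n le H]; exists n.+1 => //; apply: ECase e H. Qed.

Lemma ex_loop c0 c1 r s b w s1 s2 B B' : s r = b :: w ->
  ex (if b then c1 else c0) (upd s r w) s1 B -> ex (Loop r c0 c1) s1 s2 B' ->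
  ex (Loop r c0 c1) s s2 (B + B').+1.
Proof.
by move=> e [n le H] [m le' H']; exists (n + m).+1; [lia|apply: ELoop e H H'].
Qed.

Lemma ex_loop0 c0 c1 r s : s r = [::] -> ex (Loop r c0 c1) s s 1.
Proof. by exists 1; last exact: ELoop0. Qed.

Lemma ex_nop s : ex Nop s s 1.
Proof. by exists 1; last exact: ENop. Qed.

Lemma ex_eq c s s' s'' B : ex c s s' B -> (forall i, s' i = s'' i) -> ex c s s'' B.
Proof. by move=> + /functional_extensionality <-. Qed.

Lemma updE s r v i : upd s r v i = if i == r then v else s i.
Proof. by []. Qed.

Lemma upd_same s r v : upd s r v r = v.
Proof. by rewrite updE eqxx. Qed.

Lemma upd_other s r v i : i <> r -> upd s r v i = s i.
Proof. by rewrite updE => /eqP/negPf->. Qed.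

Ltac upd_simpl := repeat first [rewrite upd_same | rewrite upd_other; [|lia]].

Ltac upd_solve :=
  let i := fresh "i" in move=> i; upd_simpl; rewrite ?updE;
  repeat (case: eqP => ?; subst; rewrite ?updE);
  try lia; try congruence; try done.

Definition move_reg a b := Loop a (Push b false) (Push b true).
Definition clear a := Loop a Nop Nop.

Lemma ex_move a b s : a <> b ->
  ex (move_reg a b) s (upd (upd s b (catrev (s a) (s b))) a [::])
     (2 * size (s a) + 1).
Proof.
move=> ab; move E: (s a) => w; elim: w s E => [|x w IH] s E.
  apply: ex_eq; first exact: ex_loop0.
  by upd_solve.
apply: (@ex_le _ _ _ (1 + (2 * size w + 1)).+1); last by rewrite /=; lia.
apply: (ex_loop E (s1 := upd (upd s a w) b (x :: s b))).
  by case: (x); apply: ex_eq; [exact: ex_push| |exact: ex_push|]; upd_solve.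
apply: ex_eq; first by apply: IH; upd_simpl.
by upd_solve.
Qed.

Lemma ex_clear a s : ex (clear a) s (upd s a [::]) (2 * size (s a) + 1).
Proof.
move E: (s a) => w; elim: w s E => [|x w IH] s E.
  by apply: ex_eq; [exact: ex_loop0|upd_solve].
apply: (@ex_le _ _ _ (1 + (2 * size w + 1)).+1); last by rewrite /=; lia.
apply: (ex_loop E (s1 := upd s a w)); first by case: (x); apply: ex_nop.
by apply: ex_eq; [apply: IH; rewrite updE eqxx|upd_solve].
Qed.

(* Both use register 0, assumed empty, to restore the order. *)
Definition mov a b := Seq (move_reg a 0) (move_reg 0 b).
Definition copy a b := Seq (move_reg a 0)
  (Loop 0 (Seq (Push a false) (Push b false)) (Seq (Push a true) (Push b true))).

Lemma ex_mov a b s : a <> b -> a <> 0 -> b <> 0 -> s 0 = [::] ->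
  ex (mov a b) s (upd (upd s a [::]) b (s a ++ s b)) (4 * size (s a) + 2).
Proof.
move=> ab a0 b0 s0; apply: ex_le.
  apply: ex_eq; first by apply: ex_seq; apply: ex_move; lia.
  by upd_simpl; rewrite s0 !catrevE cats0 revK; upd_solve.
by upd_simpl; rewrite s0 catrevE cats0 size_rev; lia.
Qed.

Lemma ex_copy a b s : a <> b -> a <> 0 -> b <> 0 -> s 0 = [::] ->
  ex (copy a b) s (upd s b (s a ++ s b)) (5 * size (s a) + 2).
Proof.
move=> ab a0 b0 s0.
have H w s' : s' 0 = w -> ex (Loop 0 (Seq (Push a false) (Push b false))
    (Seq (Push a true) (Push b true))) s'
    (upd (upd (upd s' 0 [::]) a (catrev w (s' a))) b (catrev w (s' b)))
    (3 * size w + 1).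
  elim: w s' => [|x w IH] s' E.
    by apply: ex_eq; [exact: ex_loop0|upd_solve].
  apply: (@ex_le _ _ _ (1 + 1 + (3 * size w + 1)).+1); last by rewrite /=; lia.
  apply: (ex_loop E (s1 := upd (upd (upd s' 0 w) a (x :: s' a)) b (x :: s' b))).
    by case: (x); (apply: ex_eq; [by apply: ex_seq; apply: ex_push|]);
      upd_simpl; upd_solve.
  apply: ex_eq; first by apply: IH; upd_simpl.
  by upd_simpl; upd_solve.
apply: ex_le.
  apply: ex_eq; first by apply: ex_seq; [apply: ex_move; lia|apply: H; upd_simpl].
  by upd_simpl; rewrite s0 !catrevE cats0 revK cats0; upd_solve.
by upd_simpl; rewrite s0 catrevE cats0 size_rev; lia.
Qed.

(* Moves the tree on top of stack [r] to stack 0, reversed; stack 1 counts the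
   subtrees that remain to be read. *)
Definition split_loop r := Loop 1 Nop
  (Case r (Push 0 false) (Seq (Push 0 true) (Seq (Push 1 true) (Push 1 true)))).
Definition split_tree r := Seq (Push 1 true) (split_loop r).

(** The rest of the run is a premise: both subtrees of a node are consumed by one and the same loop,
    so the induction has to continue a run rather than finish it. *)
Lemma ex_split_loop r x w k s s2 B : 1 < r -> s r = code x ++ w ->
  s 1 = true :: k ->
  ex (split_loop r) (upd (upd (upd s 1 k) r w) 0 (catrev (code x) (s 0))) s2 B ->
  ex (split_loop r) s s2 (7 * tsize x + B).
Proof.
move=> r1; elim: x w k s B => [|a IHa b IHb] w k s B er e1 H /=.
  apply: (@ex_le _ _ _ ((1).+1 + B).+1); last by lia.
  apply: (ex_loop e1 _ H) => /=; apply: ex_case; first by upd_simpl; exact: er.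
  by apply: ex_eq; [apply: ex_push|upd_simpl; upd_solve].
apply: (@ex_le _ _ _ ((1 + (1 + 1)).+1 + (7 * tsize a + (7 * tsize b + B))).+1); last by lia.
apply: (ex_loop e1 (s1 := upd (upd (upd s 1 (true :: true :: k)) r
   (code a ++ code b ++ w)) 0 (true :: s 0))) => /=.
  apply: ex_case; first by upd_simpl; rewrite er /= -catA.
  apply: ex_eq; first by apply: ex_seq; [|apply: ex_seq]; apply: ex_push.
  by upd_simpl; upd_solve.
apply: (IHa (code b ++ w)); [by upd_simpl|by upd_simpl|].
apply: (IHb w k); [by upd_simpl|by upd_simpl|].
set s' := upd _ 0 _; suff -> : s' =
  upd (upd (upd s 1 k) r w) 0 (catrev (code (N a b)) (s 0)) by [].
apply: functional_extensionality; rewrite /s' {s'}; upd_simpl.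
by rewrite /= catrev_catl; upd_solve.
Qed.

Lemma ex_split r x w s : 1 < r -> s r = code x ++ w -> s 0 = [::] -> s 1 = [::] ->
  ex (split_tree r) s (upd (upd s r w) 0 (rev (code x))) (7 * tsize x + 2).
Proof.
move=> r1 er s0 s1.
apply: (@ex_le _ _ _ (1 + (7 * tsize x + 1))); last by lia.
apply: ex_seq; first exact: ex_push.
apply: (@ex_split_loop r x w [::]); upd_simpl; rewrite ?s1 ?s0 //.
apply: ex_eq; first by apply: ex_loop0; upd_simpl.
by upd_simpl; upd_solve.
Qed.

Fixpoint hamming (u v : seq bool) : nat :=
  match u, v with
  | x :: u, y :: v => (x != y) + hamming u v
  | _, _ => 0
  end.

(** Only the common length is compared. Without a mismatch one code is a prefix of the other, and
    then the prefix property makes the trees equal. *)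
Lemma hamming_code a b : (hamming (code a) (code b) == 0) = (a == b).
Proof.
apply/idP/eqP => [/eqP m0|<-]; last by elim: (code a) => //= x u IH; rewrite eqxx.
have [w [e|e]] : exists w, code a = code b ++ w \/ code b = code a ++ w.
  elim: (code a) (code b) m0 => [|x u IH] [|y v] /=.
  - by exists [::]; left.
  - by exists (y :: v); right.
  - by exists (x :: u); left.
  - move=> /eqP; rewrite addn_eq0 eqb0 negbK => /andP[/eqP<- /eqP/IH[w [->|->]]];
    by exists w; first [by left|by right].
- by move: e; rewrite -[code a]cats0 => /code_prefix[].
- by move: e; rewrite -[code b]cats0 => /code_prefix[].
Qed.

(** Both stacks are popped in step, and every mismatch is recorded in unary on [r.+2]. *)
Definition cmp_loop r := Loop r.+1 (Case r Nop (Push r.+2 true))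
  (Case r (Push r.+2 true) Nop).

Fixpoint comp (F : fn) (r : nat) : cmd :=
  match F with
  | Id => Nop
  | Lf => Seq (clear r) (Push r false)
  | Pair f g =>
      Seq (copy r r.+1) (Seq (comp g r.+1) (Seq (mov r r.+2) (Seq (comp f r.+2)
      (Seq (mov r.+1 r) (Seq (mov r.+2 r) (Push r true))))))
  | Hd => Case r (Push r false) (Seq (split_tree r) (Seq (clear r) (move_reg 0 r)))
  | Tl => Case r (Push r false) (Seq (split_tree r) (clear 0))
  | Comp g f => Seq (comp f r) (comp g r)
  | Cond c f g => Seq (copy r r.+1) (Seq (comp c r.+1)
      (Case r.+1 (comp g r) (Seq (clear r.+1) (comp f r))))
  | Fold g => Case r (Push r false) (Seq (split_tree r) (Seq (move_reg 0 r.+1)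
      (Seq (Loop r Nop
        (Seq (split_tree r) (Seq (move_reg 0 r.+2) (Seq (mov r.+1 r.+3)
        (Seq (mov r.+2 r.+1) (Seq (mov r.+3 r.+1) (Seq (Push r.+1 true)
          (comp g r.+1))))))))
      (mov r.+1 r))))
  | Eq => Case r (Push r false) (Seq (split_tree r) (Seq (move_reg 0 r.+1)
      (Seq (cmp_loop r) (Seq (clear r) (Seq (Push r false) (Seq (Push r false)
      (Seq (Push r true) (Case r.+2 Nop
        (Seq (clear r.+2) (Seq (clear r) (Push r false)))))))))))
  end.

(** Stacks 0 and 1 are scratch space for moving and splitting, and everything above [r] is free. The
    stacks from 2 to [r - 1] are not constrained, since they hold data of enclosing calls. *)
Definition clean r (s : store) :=
  forall i, (i <> r -> (i < 2) || (r < i) -> s i = [::]).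

Lemma ex_cmp r u s : 1 < r -> s r.+1 = u ->
  ex (cmp_loop r) s (upd (upd (upd s r (drop (size u) (s r))) r.+1 [::])
    r.+2 (nseq (hamming u (s r)) true ++ s r.+2)) (3 * size u + 1).
Proof.
move=> r1; elim: u s => [|x u IH] s e1.
  by apply: ex_eq; [exact: ex_loop0|rewrite drop0; upd_solve].
apply: (@ex_le _ _ _ (2 + (3 * size u + 1)).+1); last by rewrite /=; lia.
case er: (s r) => [|y v].
  apply: (ex_loop e1 (s1 := upd s r.+1 u)).
    by case: (x); exists 1 => //; apply: ECase0; upd_simpl.
  apply: ex_eq; first by apply: IH; upd_simpl.
  upd_simpl; rewrite er (_ : hamming u [::] = 0); last by case: (u).
  by rewrite !drop_oversize //; upd_solve.
apply: (ex_loop e1 (s1 := upd (upd (upd s r.+1 u) r v) r.+2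
    (nseq (x != y) true ++ s r.+2))).
  by case: (x); (apply: ex_case; [by upd_simpl; exact: er|]); case: (y);
    (apply: ex_eq; [first [exact: ex_push|exact: ex_nop]|]); upd_simpl; upd_solve.
apply: ex_eq; first by apply: IH; upd_simpl.
upd_simpl; rewrite /= catA cat_nseq -nseqD addnC; upd_solve.
Qed.

Lemma comp_ex F r x s : 1 < r -> clean r s -> s r = code x ->
  ex (comp F r) s (upd s r (code (eval F x))) (60 * cost F x).
Proof.
elim: F r x s => [||f IHf g IHg|||g IHg f IHf|c IHc f IHf g IHg|g IHg|] r x s r1 cl er.
all: have s0 : s 0 = [::] by apply: cl; lia.
all: have s1 : s 1 = [::] by apply: cl; lia.
all: have sx : size (s r) = tsize x by rewrite er size_code.
all: have x0 := tsize_gt0 x.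
- by apply: ex_le; [apply: ex_eq; [exact: ex_nop|upd_solve]|rewrite /=; lia].
- apply: ex_le; [apply: ex_eq; first by apply: ex_seq; [apply: ex_clear|apply: ex_push]|].
    by upd_simpl; upd_solve.
  by rewrite /= sx; lia.
- have e1 : s r.+1 = [::] by apply: cl; lia.
  have e2 : s r.+2 = [::] by apply: cl; lia.
  apply: ex_le; [apply: ex_eq|].
  + apply: ex_seq; first by apply: ex_copy => //; lia.
    apply: ex_seq.
      apply: (IHg _ x); first by lia.
        by move=> i ni di; upd_simpl; apply: cl; lia.
      by upd_simpl; rewrite e1 cats0.
    apply: ex_seq; first by apply: ex_mov; upd_simpl => //; lia.
    apply: ex_seq.
      apply: (IHf _ x); first by lia.
        move=> i ni di; rewrite updE; case: eqP => // _.
        rewrite updE; case: eqP => // i2; upd_simpl; apply: cl; lia.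
      by upd_simpl; rewrite e2 cats0.
    apply: ex_seq; first by apply: ex_mov; upd_simpl => //; lia.
    apply: ex_seq; first by apply: ex_mov; upd_simpl => //; lia.
    exact: ex_push.
  + upd_simpl; rewrite /= cats0; upd_solve.
  + by upd_simpl; rewrite /= !size_code sx; have := eval_cost f x; have := eval_cost g x; lia.
- case: x er sx x0 => [|a b] er sx x0.
    apply: ex_le; first apply: ex_case; first exact: er.
      by apply: ex_eq; [exact: ex_push|upd_simpl; upd_solve].
    by rewrite /=; lia.
  apply: ex_le; first apply: ex_case; first exact: er.
    apply: ex_eq; first apply: ex_seq.
      apply: (@ex_split r a (code b)); upd_simpl; rewrite // ?s0 ?s1 //.
    apply: ex_seq; first exact: ex_clear.
      by apply: ex_move; lia.
    by upd_simpl; rewrite catrevE revK cats0; upd_solve.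
  by upd_simpl; rewrite size_rev !size_code /=; lia.
- case: x er sx x0 => [|a b] er sx x0.
    apply: ex_le; first apply: ex_case; first exact: er.
      by apply: ex_eq; [exact: ex_push|upd_simpl; upd_solve].
    by rewrite /=; lia.
  apply: ex_le; first apply: ex_case; first exact: er.
    apply: ex_eq; first apply: ex_seq.
      apply: (@ex_split r a (code b)); upd_simpl; rewrite // ?s0 ?s1 //.
    exact: ex_clear.
    by upd_simpl; upd_solve.
  by upd_simpl; rewrite size_rev !size_code /=; lia.
- apply: ex_le; [apply: ex_eq|].
  + apply: ex_seq; first exact: IHf er.
    apply: (IHg _ (eval f x)) => //; last by upd_simpl.
    by move=> i ni di; upd_simpl; apply: cl.
  + by upd_simpl; upd_solve.
  + by rewrite /=; lia.
- have e1 : s r.+1 = [::] by apply: cl; lia.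
  have cl1 : clean r.+1 (upd s r.+1 (s r ++ s r.+1)).
    by move=> i ni di; upd_simpl; apply: cl; lia.
  have R B : ex (Case r.+1 (comp g r) (Seq (clear r.+1) (comp f r)))
      (upd s r.+1 (code (eval c x))) (upd s r (code (eval (Cond c f g) x))) B ->
      ex (comp (Cond c f g) r) s (upd s r (code (eval (Cond c f g) x)))
        (5 * tsize x + 2 + (60 * cost c x + B)).
    move=> H; apply: ex_seq; first by rewrite -sx; apply: ex_copy => //; lia.
    apply: ex_seq H; apply: ex_eq.
      apply: (IHc r.+1 x); [by lia|exact: cl1|].
      by upd_simpl; rewrite e1 cats0.
    by upd_simpl; upd_solve.
  have := eval_cost c x; case ec: (eval c x) R => [|p q] /= R le.
  + apply: ex_le; first apply: R.
      apply: ex_case; first by upd_simpl.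
      apply: ex_eq; first apply: (IHg r x) => //.
      * by move=> i ni di; rewrite !updE; case: eqP => // _; apply: cl.
      * by upd_simpl.
      * by rewrite ec; upd_simpl; upd_solve.
    by rewrite ec; lia.
  + apply: ex_le; first apply: R.
      apply: ex_case; first by upd_simpl.
      apply: ex_eq; first apply: ex_seq.
      * exact: ex_clear.
      * apply: (IHf r x) => //; last by upd_simpl.
        by move=> i ni di; rewrite !updE; case: eqP => // _; apply: cl.
      * by rewrite ec; upd_simpl; upd_solve.
    by upd_simpl; rewrite ec size_cat !size_code /=; lia.
- case: x er sx x0 => [|a l] er sx x0.
    apply: ex_le; first apply: ex_case; first exact: er.
      by apply: ex_eq; [exact: ex_push|upd_simpl; upd_solve].
    by rewrite /=; lia.
  have e1 : s r.+1 = [::] by apply: cl; lia.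
  have e2 : s r.+2 = [::] by apply: cl; lia.
  have e3 : s r.+3 = [::] by apply: cl; lia.
  (* The remaining list is on [r], the accumulator on [r.+1]. Popping the final [false] of the list
     empties [r], which stops the loop. *)
  have LP : forall a s, clean r.+1 s -> s r = code l -> s r.+1 = code a ->
    ex (Loop r Nop
        (Seq (split_tree r) (Seq (move_reg 0 r.+2) (Seq (mov r.+1 r.+3)
        (Seq (mov r.+2 r.+1) (Seq (mov r.+3 r.+1) (Seq (Push r.+1 true)
          (comp g r.+1)))))))) s
      (upd (upd s r [::]) r.+1 (code (tfold (eval g) a l)))
      (60 * tfold_cost (eval g) (cost g) a l).
    elim: l {a s s0 s1 sx er cl x0 e1 e2 e3} => [|h _ t IHt] a s cl er e1.
      apply: ex_le; first apply: ex_loop; first exact: er.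
      - exact: ex_nop.
      - by apply: ex_eq; [apply: ex_loop0; upd_simpl|rewrite /=; upd_solve].
      - by have := tsize_gt0 a; rewrite /=; lia.
    have s0 : s 0 = [::] by apply: cl; lia.
    have s1 : s 1 = [::] by apply: cl; lia.
    have e2 : s r.+2 = [::] by apply: cl; lia.
    have e3 : s r.+3 = [::] by apply: cl; lia.
    apply: ex_le; first apply: ex_loop; first exact: er.
    - apply: ex_seq.
        by apply: (@ex_split r h (code t)); upd_simpl.
      apply: ex_seq; first by apply: ex_move; lia.
      apply: ex_seq; first by apply: ex_mov; upd_simpl => //; lia.
      apply: ex_seq; first by apply: ex_mov; upd_simpl => //; lia.
      apply: ex_seq; first by apply: ex_mov; upd_simpl => //; lia.
      apply: ex_seq; first exact: ex_push.
      apply: (IHg r.+1 (N a h)); first by lia.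
        move=> i ni di; rewrite updE; case: eqP => [|_]; first by lia.
        rewrite !updE; do ![case: eqP => [//|_]]; try lia; apply: cl; lia.
      by upd_simpl; rewrite catrevE revK e1 e2 e3 /= !cats0.
    - apply: ex_eq; first apply: (IHt (eval g (N a h))).
      + move=> i ni di; rewrite updE; case: eqP => [|_]; first by lia.
        rewrite !updE; do ![case: eqP => [//|_]]; try lia; apply: cl; lia.
      + by upd_simpl.
      + by upd_simpl.
      + by upd_simpl; upd_solve.
    - upd_simpl; rewrite catrevE revK e1 e2 e3 ?cats0 !size_rev !size_code /=.
      by have := tsize_gt0 h; lia.
  apply: ex_le; first apply: ex_case; first exact: er.
    apply: ex_eq; first apply: ex_seq.
    - apply: (@ex_split r a (code l)); upd_simpl; rewrite // ?s0 ?s1 //.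
    - apply: ex_seq; first by apply: ex_move; lia.
      apply: ex_seq.
        apply: (LP a); upd_simpl => //; last by rewrite catrevE revK e1 cats0.
        move=> i ni di; rewrite !updE; do ![case: eqP => [//|_]]; try lia; apply: cl; lia.
      by apply: ex_mov; upd_simpl => //; lia.
    - by upd_simpl; rewrite cats0; upd_solve.
  upd_simpl; rewrite !size_rev !size_code /=.
  by lia.
- case: x er sx x0 => [|a b] er sx x0.
    apply: ex_le; first apply: ex_case; first exact: er.
      by apply: ex_eq; [exact: ex_push|upd_simpl; upd_solve].
    by rewrite /=; lia.
  have e1 : s r.+1 = [::] by apply: cl; lia.
  have e2 : s r.+2 = [::] by apply: cl; lia.
  have e3 : s r.+3 = [::] by apply: cl; lia.
  have mc := hamming_code a b.
  apply: ex_le; first apply: ex_case; first exact: er.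
    apply: ex_seq.
      apply: (@ex_split r a (code b)); upd_simpl; rewrite // ?s0 ?s1 //.
    apply: ex_seq; first by apply: ex_move; lia.
    apply: ex_seq.
      by apply: (@ex_cmp r (code a)) => //; upd_simpl; rewrite catrevE revK e1 cats0.
    apply: ex_seq; first exact: ex_clear.
    apply: ex_seq; first exact: ex_push.
    apply: ex_seq; first exact: ex_push.
    apply: ex_seq; first exact: ex_push.
    set S := upd _ r _; have Sr : S r = code (N L L).
      by rewrite /S; upd_simpl.
    have S2 : S r.+2 = nseq (hamming (code a) (code b)) true.
      by rewrite /S; upd_simpl; rewrite e2 cats0.
    have SE i : i <> r -> i <> r.+2 -> S i = s i.
      move=> n1 n2; rewrite /S; upd_simpl; rewrite !updE.
      by repeat (case: eqP => ?; [subst; congruence|]).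
    have fin : ex (Case r.+2 Nop (Seq (clear r.+2) (Seq (clear r) (Push r false)))) S
        (upd s r (code (eval Eq (N a b)))) (2 * tsize b + 20 + 2 * hamming (code a) (code b)).
      rewrite /= -mc; case em: (hamming _ _) S2 => [|k] /= S2.
        exists 1; first by lia.
        rewrite (_ : upd s r _ = S); first exact: ECase0.
        apply: functional_extensionality => i; rewrite updE.
        case: eqP => [->|ni]; first by rewrite Sr.
        by case: (i =P r.+2) => [->|n2]; [rewrite S2 e2|rewrite SE].
      apply: ex_le; first apply: ex_case; first exact: S2.
        apply: ex_eq; first apply: ex_seq; first exact: ex_clear.
          by apply: ex_seq; [exact: ex_clear|exact: ex_push].
        move=> i; upd_simpl; rewrite !updE; case: eqP => // ni.
        by case: (i =P r.+2) => [->|n2]; [rewrite e2|rewrite SE].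
      by upd_simpl; rewrite Sr size_nseq /=; lia.
    exact: fin.
  have mle : hamming (code a) (code b) <= tsize b.
    rewrite -size_code; elim: (code a) (code b) => [|y u IH] [|z v] //=.
    by have := IH v; case: (y != z); lia.
  upd_simpl; rewrite ?catrevE ?size_rev ?size_drop !size_code /=; lia.
Qed.


(** * Functions computable in time polynomial in a bound *)

Structure enc := Enc { esort :> Type; en : esort -> tree; en_inj : injective en }.

Definition sz (A : enc) (x : A) := tsize (en x).

(** The base is at least 2, so that sums, products and constants are absorbed by raising the
    exponent. The budget [b] admits time polynomial in something larger than the input, such as the
    length of an enumeration; budget 0 is polynomial time. *)
Definition fpb (A B : enc) (b : A -> nat) (f : A -> B) :=
  exists F k, forall x, eval F (en x) = en (f x) /\
    cost F (en x) <= (sz x + b x + 2) ^ k.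

Notation fp := (fpb (fun=> 0)).

Definition en_bool (b : bool) := if b then N L L else L.
Lemma en_bool_inj : injective en_bool. Proof. by do 2![case]. Qed.
Canonical enc_bool := Enc en_bool_inj.

Canonical enc_tree := Enc (@inj_id tree).

Definition en_unit (x : unit) := L.
Lemma en_unit_inj : injective en_unit. Proof. by do 2![case]. Qed.
Canonical enc_unit := Enc en_unit_inj.

Fixpoint en_nat n := if n is n.+1 then N L (en_nat n) else L.
Lemma en_nat_inj : injective en_nat.
Proof. by elim=> [|n IH] [|m] //= [/IH->]. Qed.
Canonical enc_nat := Enc en_nat_inj.

Section Encodings.
Context (A B : enc).

Definition en_pair (x : A * B) := N (en x.1) (en x.2).
Lemma en_pair_inj : injective en_pair.
Proof. by move=> [a b] [c d]; case=> /en_inj-> /en_inj->. Qed.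

Fixpoint en_seq (s : seq A) := if s is x :: s then N (en x) (en_seq s) else L.
Lemma en_seq_inj : injective en_seq.
Proof. by elim=> [|x s IH] [|y t] //= [/en_inj-> /IH->]. Qed.

Definition en_opt (x : option A) := if x is Some x then N (en x) L else L.
Lemma en_opt_inj : injective en_opt.
Proof. by move=> [x|] [y|] //= [/en_inj->]. Qed.
End Encodings.

Canonical enc_pair (A B : enc) := Enc (@en_pair_inj A B).
Canonical enc_seq (A : enc) := Enc (@en_seq_inj A).
Canonical enc_option (A : enc) := Enc (@en_opt_inj A).

Lemma sz_gt0 (A : enc) (x : A) : 0 < sz x. Proof. exact: tsize_gt0. Qed.

Lemma sz_pair (A B : enc) (x : A) (y : B) :
  sz (x, y) = (sz x + sz y).+1.
Proof. by []. Qed.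

Lemma sz_cons (A : enc) (x : A) s : sz (x :: s) = (sz x + sz s).+1.
Proof. by []. Qed.

Lemma sz_nil (A : enc) : sz ([::] : seq A) = 1. Proof. by []. Qed.

Lemma sz_bool (b : bool) : sz b <= 3. Proof. by case: b. Qed.

Lemma sz_nat n : sz n = (2 * n).+1.
Proof. by rewrite /sz /=; elim: n => //= n ->; lia. Qed.

Lemma sz_cat (A : enc) (s t : seq A) : (sz (s ++ t)).+1 = sz s + sz t.
Proof. by elim: s => //= x s IH; rewrite !sz_cons; lia. Qed.

Lemma sz_size (A : enc) (s : seq A) : 2 * size s < sz s.
Proof. elim: s => //= x s IH; rewrite sz_cons; have := sz_gt0 x; lia. Qed.

Lemma sz_seq_bound (A : enc) (s : seq A) M :
  (forall x, List.In x s -> sz x <= M) -> sz s <= (size s * M.+1).+1.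
Proof.
elim: s => //= x s IH H; rewrite sz_cons.
have := H x (or_introl erefl); have := IH (fun y i => H y (or_intror i)); lia.
Qed.

Lemma pow_ge1 n k : 0 < (n + 2) ^ k.
Proof. by rewrite expn_gt0; lia. Qed.

Lemma pow_add n a b : (n + 2) ^ a + (n + 2) ^ b <= (n + 2) ^ (a + b).+1.
Proof.
rewrite expnS expnD; have := pow_ge1 n a; have := pow_ge1 n b; nia.
Qed.

Lemma pow_mul n a b : (n + 2) ^ a * (n + 2) ^ b = (n + 2) ^ (a + b).
Proof. by rewrite expnD. Qed.

Lemma pow_leS n a b : a <= b -> (n + 2) ^ a <= (n + 2) ^ b.
Proof. by move=> le; apply: leq_pexp2l; lia. Qed.

Lemma pow_const n c : c <= (n + 2) ^ c.
Proof.
case: c => // c; apply: leq_trans (ltnW (ltn_expl c.+1 (ltnSn 1))) _.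
by rewrite leq_exp2r //; lia.
Qed.

Section Basic.
Context (A B C : enc).
Implicit Types b : A -> nat.

Lemma fpb_le b (f : A -> B) : fp f -> fpb b f.
Proof.
case=> F [k H]; exists F, k => x; have [e le] := H x; split=> //.
apply: leq_trans le _; case: k {H} => // k; rewrite leq_exp2r //; lia.
Qed.

Lemma fpb_ext b (f g : A -> B) : f =1 g -> fpb b f -> fpb b g.
Proof. by move=> e [F [k H]]; exists F, k => x; rewrite -e. Qed.

Lemma fpb_bound b b' k (f : A -> B) :
  (forall x, b' x <= (sz x + b x + 2) ^ k) -> fpb b' f -> fpb b f.
Proof.
move=> le [F [l H]]; exists F, (k.+2 * l) => x.
have [e c] := H x; split=> //; apply: leq_trans c _; rewrite expnM.
case: l {H} => // l; rewrite leq_exp2r // expnS expnS.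
have := le x; have := pow_ge1 (sz x + b x) k.
move: ((sz x + b x + 2) ^ k) (b' x) => P b1 P0 bP.
have : (sz x + b x + 2) * 1 <= (sz x + b x + 2) * P by rewrite leq_mul2l P0 orbT.
by nia.
Qed.

Lemma fpb_sz b (f : A -> B) : fpb b f ->
  exists k, forall x, sz (f x) <= (sz x + b x + 2) ^ k.
Proof.
case=> F [k H]; exists k => x; have [e c] := H x.
by apply: leq_trans c; rewrite /sz -e; apply: eval_cost.
Qed.

Lemma fpb_comp b (f : A -> B) (g : B -> C) : fpb b f -> fp g ->
  fpb b (fun x => g (f x)).
Proof.
move=> ff [G [l HG]]; have [k' Hk'] := fpb_sz ff.
case: ff => F [k HF]; exists (Comp G F), (k + k'.+1 * l).+1 => x /=.
have [e c] := HF x; have [e' c'] := HG (f x).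
rewrite e e'; split=> //.
have : (sz (f x) + 0 + 2) ^ l <= (sz x + b x + 2) ^ (k'.+1 * l).
  rewrite expnM; case: (l) => // n; rewrite leq_exp2r // expnS.
  have := Hk' x; have := pow_ge1 (sz x + b x) k'; have := sz_gt0 x; nia.
by have := pow_add (sz x + b x) k (k'.+1 * l); lia.
Qed.

Lemma fpb_pair b (f : A -> B) (g : A -> C) : fpb b f -> fpb b g ->
  fpb b (fun x => (f x, g x)).
Proof.
move=> [F [k HF]] [G [l HG]]; exists (Pair F G), (k + l).+3 => x /=.
have [e c] := HF x; have [e' c'] := HG x.
rewrite e e'; split=> //; rewrite -/(sz x).
have := eval_cost F (en x); have := eval_cost G (en x).
rewrite e e'; have := pow_add (sz x + b x) k l.
rewrite !expnS; have := pow_ge1 (sz x + b x) (k + l); nia.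
Qed.

Lemma fp_id : fp (fun x : A => x).
Proof. exists Id, 2 => x; split=> //=; rewrite -/(sz x); nia. Qed.

Fixpoint const_fn t := if t is N a b then Pair (const_fn a) (const_fn b) else Lf.

Lemma fp_const (c : B) : fp (fun _ : A => c).
Proof.
pose K := fix K t := if t is N a b then K a + K b + tsize a + tsize b + 1 else 3.
exists (const_fn (en c)), (K (en c)).+2 => x.
have e t y : eval (const_fn t) y = t by elim: t => //= a -> b0 ->.
split=> //; suff H t : cost (const_fn t) (en x) <= (sz x + 2) * (tsize t + K t).
  apply: leq_trans (H _) _; rewrite !expnS addn0.
  have : tsize (en c) <= K (en c) by elim: (en c) => //= a IHa b0 IHb; lia.
  by have := pow_const (sz x) (K (en c)); nia.
elim: t => [|a IHa b0 IHb] /=; first by rewrite -/(sz x); lia.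
rewrite !e -/(sz x); have := sz_gt0 x; nia.
Qed.
End Basic.

Section Pairs.
Context (A B C : enc).

Lemma fp_fst0 : fp (@fst A B).
Proof.
exists Hd, 2 => -[x y]; split=> //=; rewrite -/(sz x) -/(sz y) sz_pair; nia.
Qed.

Lemma fp_snd0 : fp (@snd A B).
Proof.
exists Tl, 2 => -[x y]; split=> //=; rewrite -/(sz x) -/(sz y) sz_pair; nia.
Qed.

Lemma fp_fst (f : C -> A * B) : fp f -> fp (fun x => (f x).1).
Proof. by move/fpb_comp; apply; apply: fp_fst0. Qed.

Lemma fp_snd (f : C -> A * B) : fp f -> fp (fun x => (f x).2).
Proof. by move/fpb_comp; apply; apply: fp_snd0. Qed.

Lemma fp_app2 (D : enc) (g : A -> B -> D) (f1 : C -> A) (f2 : C -> B) :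
  fp (fun p : A * B => g p.1 p.2) -> fp f1 -> fp f2 ->
  fp (fun x => g (f1 x) (f2 x)).
Proof. by move=> H h1 h2; apply: (fpb_comp (fpb_pair h1 h2) H). Qed.

Lemma fp_if (c : C -> bool) (f g : C -> A) : fp c -> fp f -> fp g ->
  fp (fun x => if c x then f x else g x).
Proof.
move=> [H [m HH]] [F [k HF]] [G [l HG]]; exists (Cond H F G), (m + k + l).+4 => x /=.
have [e c0] := HH x; have [e1 c1] := HF x; have [e2 c2] := HG x.
rewrite e addn0 in c0 c1 c2 *.
have b1 := pow_leS (sz x) (leq_addr (k + l) m).
have b2 := pow_leS (sz x) (leq_addr (m + l) k).
have b3 := pow_leS (sz x) (leq_addr (m + k) l).
rewrite (_ : (k + (m + l)) = m + k + l) in b2; last by lia.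
rewrite (_ : (l + (m + k)) = m + k + l) in b3; last by lia.
rewrite (_ : (m + (k + l)) = m + k + l) in b1; last by lia.
rewrite -/(sz x) !expnS; have := pow_ge1 (sz x) (m + k + l); have := sz_gt0 x.
by case: (c x) => /=; split=> //; nia.
Qed.

Lemma fp_eq0 (f g : C -> A) (r : A -> A -> bool) :
  (forall x y, reflect (x = y) (r x y)) -> fp f -> fp g ->
  fp (fun x => r (f x) (g x)).
Proof.
move=> rP hf hg; apply: (fpb_comp (g := fun p => r p.1 p.2) (fpb_pair hf hg)).
exists Eq, 2 => -[x y] /=; rewrite -/(sz x) -/(sz y) sz_pair; split; last by nia.
by case: rP => [->|ne]; rewrite ?eqxx //; case: eqP => // /en_inj.
Qed.

End Pairs.

Definition pbd (T : Type) (n u : T -> nat) := exists k, forall x, u x <= (n x + 2) ^ k.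

Section PolyBound.
Variables (T : Type) (n : T -> nat).
Implicit Types u v : T -> nat.

Lemma pbd_le u v : pbd n v -> (forall x, u x <= v x) -> pbd n u.
Proof. by case=> k H le; exists k => x; apply: leq_trans (le x) (H x). Qed.

Lemma pbd_id : pbd n n.
Proof. by exists 1 => x; lia. Qed.

Lemma pbd_const c : pbd n (fun=> c).
Proof. by exists c => x; apply: pow_const. Qed.

Lemma pbdD u v : pbd n u -> pbd n v -> pbd n (fun x => u x + v x).
Proof.
move=> [k H] [l H']; exists (k + l).+1 => x.
by apply: leq_trans (pow_add _ _ _); apply: leq_add.
Qed.

Lemma pbdM u v : pbd n u -> pbd n v -> pbd n (fun x => u x * v x).
Proof.
move=> [k H] [l H']; exists (k + l) => x.
by rewrite -pow_mul; apply: leq_mul.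
Qed.

Lemma pbdX u k : pbd n u -> pbd n (fun x => u x ^ k).
Proof.
move=> [l H]; exists (l * k) => x; rewrite expnM.
by case: k => // k; rewrite leq_exp2r.
Qed.
End PolyBound.

Ltac pbd := repeat first [ exact: pbd_id | exact: pbd_const | eassumption
  | apply: pbdD | apply: pbdM | apply: pbdX ].

Lemma fpbI (A B : enc) b (f : A -> B) F :
  (forall x, eval F (en x) = en (f x)) ->
  pbd (fun x => sz x + b x) (fun x => cost F (en x)) -> fpb b f.
Proof. by move=> e [k H]; exists F, k. Qed.

Lemma fpb_pbd (A B : enc) b (f : A -> B) : fpb b f ->
  pbd (fun x => sz x + b x) (fun x => sz (f x)).
Proof. by move/fpb_sz=> [k H]; exists k. Qed.

Lemma tfold_le g cg a l : (forall x, tsize (g x) <= cg x) ->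
  tsize (tfold g a l) <= tfold_cost g cg a l.
Proof.
by move=> H; elim: l a => //= h _ t IH a; have := IH (g (N a h)); lia.
Qed.

(** [Fold] takes a closed step function, so the parameter [a] travels along with the accumulator. *)
Lemma en_foldl (A S X : enc) (f : A -> S -> X -> S) G :
  (forall a s x, eval G (en (a, s, x)) = en (f a s x)) -> forall a s l,
  tfold (eval (Pair (Comp Hd Hd) G)) (en (a, s)) (en l) = en (a, foldl (f a) s l).
Proof.
move=> e a s l; elim: l s => //= x l IH s; rewrite -IH /=.
by congr (tfold _ (N _ _) _); apply: (e a s x).
Qed.

(** The bound on every intermediate accumulator is the crux: a polynomial step may square the size
    each time, and only an a priori bound keeps the iteration polynomial. *)
Lemma fpb_foldl (A S X : enc) b (f : A -> S -> X -> S) (s0 : A -> S)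
    (l : A -> seq X) :
  fp (fun p : A * S * X => f p.1.1 p.1.2 p.2) -> fpb b s0 -> fpb b l ->
  (exists2 u, pbd (fun x => sz x + b x) u &
     forall a i, sz (foldl (f a) (s0 a) (take i (l a))) <= u a) ->
  fpb b (fun a => foldl (f a) (s0 a) (l a)).
Proof.
move=> [G [g HG]] fs0 fl [u pu Hu]; have ps0 := fpb_pbd fs0; have pl := fpb_pbd fl.
have [P [k HP]] := fpb_pair (fpb_pair (fpb_le b (fp_id A)) fs0) fl.
have eG a s x : eval G (en (a, s, x)) = en (f a s x) by have [] := HG (a, s, x).
pose G' := Pair (Comp Hd Hd) G.
pose F := Comp Tl (Comp (Fold G') P).
have eP x : eval P (en x) = N (en (x, s0 x)) (en (l x)) by case: (HP x).
apply: (@fpbI _ _ _ _ F) => [x /=|]; first by rewrite eP /= (en_foldl eG).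
pose st a := (u a + sz (l a) + sz a + 5) ^ g.
have stepb (a : A) (s : S) (x : X) : sz s <= u a -> sz x <= sz (l a) ->
    cost G' (en (a, s, x)) <= 20 * (u a + sz (l a) + sz a + 2) + 2 * st a.
  move=> hs hx; have [_ c] := HG (a, s, x).
  have cg : cost G (en (a, s, x)) <= st a.
    apply: leq_trans c _; rewrite /st; case: (g) => // g'; rewrite leq_exp2r //.
    by rewrite !sz_pair; lia.
  have := cg; have := eval_cost G (en (a, s, x)).
  by rewrite /G' /= -/(sz a) -/(sz s) -/(sz x); lia.
pose M a := 20 * (u a + sz (l a) + sz a + 2) + 2 * st a + u a + sz (l a) + sz a + 2.
have cf a : tfold_cost (eval G') (cost G') (en (a, s0 a)) (en (l a)) <= (sz (l a) + 1) * M a.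
  (* Generalised to the suffix after [i] items, where the accumulator is the fold of the prefix and
     hence stays below [u a]. *)
  have : forall i (s : S), s = foldl (f a) (s0 a) (take i (l a)) ->
    tfold_cost (eval G') (cost G') (en (a, s)) (en (drop i (l a))) <=
    (size (drop i (l a)) + 1) * M a.
    move=> i; move E: (drop i (l a)) => d; elim: d i E => [|x d IH] i E s es.
      have := Hu a i; rewrite -es; rewrite /M /= -/(sz a) -/(sz s); lia.
    have xl : sz x <= sz (l a).
      have := sz_cat (take i (l a)) (drop i (l a)); rewrite cat_take_drop E sz_cons.
      by have := sz_gt0 d; have := sz_gt0 (take i (l a)); lia.
    have su : sz s <= u a by rewrite es; apply: Hu.
    have eG' : eval G' (en (a, s, x)) = en (a, f a s x) by rewrite /= (eG a s x).
    have Ed : drop i.+1 (l a) = d by rewrite -addn1 addnC -drop_drop E /= drop0.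
    have es' : f a s x = foldl (f a) (s0 a) (take i.+1 (l a)).
      rewrite (take_nth x); last by rewrite ltnNge; apply/negP=> /drop_oversize; rewrite E.
      rewrite foldl_rcons -es; congr (f _ _ _).
      by rewrite -[in RHS](addn0 i) -nth_drop E.
    have hr := IH i.+1 Ed _ es'; have hs := stepb a s x su xl.
    rewrite [size (x :: d)]/= addSn mulSn.
    have -> : tfold_cost (eval G') (cost G') (en (a, s)) (en (x :: d)) =
        sz (a, s) + sz x + cost G' (en (a, s, x)) +
        tfold_cost (eval G') (cost G') (eval G' (en (a, s, x))) (en d) by [].
    rewrite eG'; apply: leq_add hr; rewrite /M sz_pair; lia.
  move/(_ 0 (s0 a)); rewrite take0 drop0 => /(_ erefl) H; apply: leq_trans H _.
  by rewrite leq_mul2r; have := sz_size (l a); lia.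
apply: (@pbd_le _ _ _ (fun x => cost P (en x) + 3 + 2 * (sz x + sz (s0 x) + sz (l x) + 3) +
    4 * ((sz (l x) + 1) * M x) + 3)).
  have pP : pbd (fun x => sz x + b x) (fun x => cost P (en x)).
    by exists k => x; case: (HP x).
  have psz : pbd (fun x => sz x + b x) (fun x => sz x).
    by apply: pbd_le; [exact: pbd_id|move=> x; lia].
  by rewrite /M /st; pbd.
move=> x; have c1 := cf x.
have c2 : tsize (tfold (eval G') (en (x, s0 x)) (en (l x))) <=
    tfold_cost (eval G') (cost G') (en (x, s0 x)) (en (l x)).
  by apply: tfold_le => y; apply: eval_cost.
have -> : cost F (en x) = cost P (en x) + cost (Fold G') (eval P (en x)) +
  cost Tl (eval (Fold G') (eval P (en x))) by [].
set r := tfold _ _ _ in c2; set c := tfold_cost _ _ _ _ in c1 c2.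
rewrite eP; have -> : cost (Fold G') (N (en (x, s0 x)) (en (l x))) =
  (sz (x, s0 x) + sz (l x)).+1 + (c + tsize r) by [].
have -> : cost Tl (eval (Fold G') (N (en (x, s0 x)) (en (l x)))) = tsize r + 3 by [].
by rewrite sz_pair; move: c1 c2; move: ((sz (l x) + 1) * M x) => z; lia.
Qed.


(** Encodings are shared on purpose: a cons cell is a pair, a successor or a [Some] is a pair with
    the unit, a number is a list of units. Such constructors and conversions are the identity on
    trees. *)
Lemma fp_recode (A B : enc) (f : A -> B) : (forall x, en (f x) = en x) -> fp f.
Proof. by move=> e; exists Id, 2 => x; rewrite e; split=> //=; rewrite -/(sz x); nia. Qed.

Lemma in_listP (T : eqType) (x : T) s : reflect (List.In x s) (x \in s).
Proof.
elim: s => [|y s IH] /=; first by constructor.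
rewrite inE; apply: (iffP orP) => [[/eqP->|/IH]|[->|/IH]]; by [left|right|left; rewrite eqxx].
Qed.

Lemma sz_take (X : enc) (s : seq X) i : sz (take i s) <= sz s.
Proof.
have := sz_cat (take i s) (drop i s).
by rewrite cat_take_drop; have := sz_gt0 (drop i s); lia.
Qed.

Lemma fp_andb (A : enc) (f g : A -> bool) : fp f -> fp g -> fp (fun x => f x && g x).
Proof. by move=> hf hg; apply: (fp_if hf hg); apply: fp_const. Qed.

Lemma fp_orb (A : enc) (f g : A -> bool) : fp f -> fp g -> fp (fun x => f x || g x).
Proof. by move=> hf hg; apply: (fp_if hf _ hg); apply: fp_const. Qed.

Lemma fp_negb (A : enc) (f : A -> bool) : fp f -> fp (fun x => ~~ f x).
Proof. by move=> hf; apply: (fp_if hf); apply: fp_const. Qed.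

Lemma fp_implb (A : enc) (f g : A -> bool) : fp f -> fp g -> fp (fun x => f x ==> g x).
Proof. by move=> hf hg; apply: (fp_if hf hg); apply: fp_const. Qed.

Lemma fp_cons (A X : enc) (f : A -> X) (g : A -> seq X) : fp f -> fp g -> fp (fun x => f x :: g x).
Proof.
move=> hf hg; apply: (fpb_comp (g := fun p : X * seq X => p.1 :: p.2) (fpb_pair hf hg)).
by apply: fp_recode => -[].
Qed.

Lemma fp_succ (A : enc) (f : A -> nat) : fp f -> fp (fun x => (f x).+1).
Proof.
move=> hf; apply: (fpb_comp (g := fun p : unit * nat => p.2.+1) (fpb_pair (fp_const A tt) hf)).
by apply: fp_recode => -[[]].
Qed.

Lemma fp_Some (A X : enc) (f : A -> X) : fp f -> fp (fun x => Some (f x)).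
Proof.
move=> hf; apply: (fpb_comp (g := fun p : X * unit => Some p.1) (fpb_pair hf (fp_const A tt))).
by apply: fp_recode => -[x []].
Qed.

Lemma fp_nilp (A X : enc) (f : A -> seq X) : fp f -> fp (fun x => nilp (f x)).
Proof.
move/fpb_comp; apply; exists (Cond Id Lf (Pair Lf Lf)), 5 => s.
rewrite addn0 /= -/(sz s); have := sz_gt0 s.
by case: s => [|x s] //= _; split=> //; rewrite -/(sz x) -/(sz s) ?sz_cons; nia.
Qed.

Lemma fp_behead (A X : enc) (f : A -> seq X) : fp f -> fp (fun x => behead (f x)).
Proof.
move/fpb_comp; apply; exists Tl, 2 => -[|x s]; split=> //=.
by rewrite -/(sz x) -/(sz s) sz_cons; nia.
Qed.

Lemma fp_head (A X : enc) (d : X) (f : A -> seq X) : fp f -> fp (fun x => head d (f x)).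
Proof.
move/fpb_comp; apply.
have [D [l hD]] := fp_const (enc_seq X) d.
exists (Cond Id Hd D), l.+4 => s; have [e1 c1] := hD s.
rewrite /= e1 -/(sz s) addn0 in c1 *; have := pow_ge1 (sz s) l.
by case: s {e1 hD} c1 => [|x s] /= c1 P; split=> //; move: P c1;
  rewrite !expnS -?/(sz x) -?/(sz s) ?sz_cons ?sz_nil; nia.
Qed.

Lemma fp_unsome (A X : enc) (d : X) (f : A -> option X) : fp f -> fp (fun x => odflt d (f x)).
Proof.
move=> hf; apply: (fpb_ext (f := fun x => head d (if f x is Some y then [:: y] else [::]))).
  by move=> x; case: (f x).
apply: fp_head; apply: (fpb_comp (g := fun o : option X => if o is Some y then [:: y] else [::]) hf).
by apply: fp_recode; case.
Qed.

Lemma fp_isSome (A X : enc) (f : A -> option X) : fp f -> fp (fun x => isSome (f x)).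
Proof.
move=> hf; apply: (fpb_ext (f := fun x => ~~ nilp (if f x is Some y then [:: y] else [::]))).
  by move=> x; case: (f x).
apply: fp_negb; apply: fp_nilp; apply: (fpb_comp (g := fun o : option X => if o is Some y then [:: y] else [::]) hf).
by apply: fp_recode; case.
Qed.

Lemma fp_foldl_bool (A X : enc) (f : A -> bool -> X -> bool) (b : A -> bool) (l : A -> seq X) :
  fp (fun p : A * bool * X => f p.1.1 p.1.2 p.2) -> fp b -> fp l ->
  fp (fun a => foldl (f a) (b a) (l a)).
Proof.
move=> hf hb hl; apply: (fpb_foldl hf hb hl); exists (fun=> 3); first by pbd.
by move=> a i; apply: sz_bool.
Qed.

Lemma fp_has (A X : enc) (p : A -> X -> bool) (l : A -> seq X) :
  fp (fun q : A * X => p q.1 q.2) -> fp l -> fp (fun a => has (p a) (l a)).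
Proof.
move=> hp hl; apply: (fpb_ext (f := fun a => foldl (fun b x => b || p a x) false (l a))).
  move=> a; suff H s b : foldl (fun b x => b || p a x) b s = b || has (p a) s by rewrite H.
  by elim: s b => [|x s IH] b /=; rewrite ?orbF // IH orbA.
apply: fp_foldl_bool => //; last exact: fp_const.
apply: fp_orb; first by do ![apply: fp_snd0 || apply: fp_snd || apply: fp_fst || apply: fp_id].
apply: (@fp_app2 _ _ _ _ p) => //; first by do !apply: fp_fst; apply: fp_id.
by apply: fp_snd; apply: fp_id.
Qed.

Lemma fp_all (A X : enc) (p : A -> X -> bool) (l : A -> seq X) :
  fp (fun q : A * X => p q.1 q.2) -> fp l -> fp (fun a => all (p a) (l a)).
Proof.
move=> hp hl; apply: (fpb_ext (f := fun a => ~~ has (fun x => ~~ p a x) (l a))).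
  by move=> a; rewrite -all_predC; apply: eq_all => x /=; rewrite negbK.
by apply: fp_negb; apply: fp_has => //; apply: fp_negb.
Qed.

Lemma fp_catrev (A X : enc) (f g : A -> seq X) : fp f -> fp g -> fp (fun x => catrev (f x) (g x)).
Proof.
move=> hf hg; apply: (fpb_ext (f := fun a => foldl (fun s x => x :: s) (g a) (f a))).
  by move=> a; elim: (f a) (g a) => //= x s IH t; rewrite IH.
apply: fpb_foldl => //.
  apply: fp_cons; first by apply: fp_snd; apply: fp_id.
  by apply: fp_snd; apply: fp_fst; apply: fp_id.
exists (fun a => sz (f a) + sz (g a)).
  by apply: pbdD; apply: fpb_pbd.
move=> a i.
have -> : foldl (fun s x => x :: s) (g a) (take i (f a)) = catrev (take i (f a)) (g a).
  by elim: (take i (f a)) (g a) => //= x s IH t; rewrite IH.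
suff H (s t : seq X) : (sz (catrev s t)).+1 = sz s + sz t.
  have := H (take i (f a)) (g a); have := sz_cat (take i (f a)) (drop i (f a)).
  by rewrite cat_take_drop; have := sz_gt0 (drop i (f a)); lia.
by elim: s t => //= x s IH t; rewrite IH !sz_cons; lia.
Qed.

Lemma fp_rev (A X : enc) (f : A -> seq X) : fp f -> fp (fun x => rev (f x)).
Proof. by move=> hf; apply: fp_catrev => //; apply: fp_const. Qed.

Ltac proj := repeat first [exact: fp_id | apply: fp_fst | apply: fp_snd].

Lemma fp_cat (A X : enc) (f g : A -> seq X) : fp f -> fp g -> fp (fun x => f x ++ g x).
Proof.
move=> hf hg; apply: (fpb_ext (f := fun x => catrev (rev (f x)) (g x))).
  by move=> x; rewrite catrevE revK.
by apply: fp_catrev => //; apply: fp_rev.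
Qed.

Lemma fp_map (A X Y : enc) (f : A -> X -> Y) (l : A -> seq X) :
  fp (fun p : A * X => f p.1 p.2) -> fp l -> fp (fun a => map (f a) (l a)).
Proof.
move=> hf hl.
apply: (fpb_ext (f := fun a => rev (foldl (fun s x => f a x :: s) [::] (l a)))).
  move=> a; suff H s t : foldl (fun s x => f a x :: s) t s = catrev (map (f a) s) t.
    by rewrite H -/(rev _) revK.
  by elim: s t => //= x s IH t; rewrite IH.
apply: fp_rev; apply: fpb_foldl => //; last 1 first.
- have [k hk] := fpb_sz hf.
  exists (fun a => (sz (l a) * ((sz a + sz (l a) + 3) ^ k).+1).+1).
    have pl := fpb_pbd hl.
    have p1 : pbd (fun x => sz x + 0) (fun x : A => sz x).
      by apply: pbd_le; [exact: pbd_id|move=> x; lia].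
    apply: (@pbd_le _ _ _ (fun a => sz (l a) * ((sz a + sz (l a) + 3) ^ k + 1) + 1)).
      by pbd.
    by move=> a; lia.
  move=> a i; set t := foldl _ _ _.
  have tE : t = rev (map (f a) (take i (l a))).
    rewrite /t -[in LHS](cats0 (take i (l a))) cats0.
    suff H s u : foldl (fun s x => f a x :: s) u s = catrev (map (f a) s) u by rewrite H.
    by elim: s u => //= x s IH u; rewrite IH.
  apply: leq_trans (@sz_seq_bound _ t ((sz a + sz (l a) + 3) ^ k) _) _.
    move=> y; rewrite tE => iy.
    have {iy} [x ix ->] : exists2 x, List.In x (l a) & y = f a x.
      have : List.In y (map (f a) (take i (l a))).
        elim: (map _ _) iy => //= z s IH; rewrite rev_cons -cats1 => H.
        by case: (List.in_app_or _ _ _ H) => [/IH|[<-|[]]]; auto.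
      move=> H; have [x [<- ix]] := proj1 (List.in_map_iff _ _ _) H; exists x => //.
      by rewrite -(cat_take_drop i (l a)); apply: List.in_or_app; left.
    apply: leq_trans (hk (a, x)) _; case: (k) => // k'; rewrite leq_exp2r // sz_pair.
    suff : sz x < sz (l a) by lia.
    elim: (l a) ix => //= z s IH [->|/IH]; rewrite sz_cons; first by have := sz_gt0 s; lia.
    by lia.
  rewrite ltnS leq_mul2r; apply/orP; right; rewrite tE size_rev size_map size_take.
  by have := sz_size (l a); case: ifP; lia.
- apply: fp_cons; last by proj.
  by apply: (@fp_app2 _ _ _ _ f) => //; proj.
- exact: fp_const.
Qed.

Lemma fp_filter (A X : enc) (p : A -> X -> bool) (l : A -> seq X) :
  fp (fun q : A * X => p q.1 q.2) -> fp l -> fp (fun a => filter (p a) (l a)).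
Proof.
move=> hp hl.
pose st a := fun (s : seq X) x => if p a x then x :: s else s.
have H a s t : foldl (st a) t s = catrev (filter (p a) s) t.
  by elim: s t => //= x s IH t; rewrite IH /st; case: (p a x).
apply: (fpb_ext (f := fun a => rev (foldl (st a) [::] (l a)))).
  by move=> a; rewrite H -/(rev _) revK.
apply: fp_rev; apply: fpb_foldl => //; last 1 first.
- exists (fun a => sz (l a)); first exact: fpb_pbd.
  move=> a i; rewrite H -/(rev _).
  have srev (s : seq X) : sz (rev s) = sz s.
    elim: s => // x s IH; rewrite rev_cons -cats1; have := sz_cat (rev s) [:: x].
    by rewrite !sz_cons sz_nil; lia.
  rewrite srev; have : sz (filter (p a) (take i (l a))) <= sz (take i (l a)).
    elim: (take i (l a)) => //= x s IH; case: ifP; rewrite !sz_cons; lia.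
  have := sz_cat (take i (l a)) (drop i (l a)).
  by rewrite cat_take_drop; have := sz_gt0 (drop i (l a)); lia.
- apply: fp_if; last by proj.
    by apply: (@fp_app2 _ _ _ _ p) => //; proj.
  by apply: fp_cons; proj.
- exact: fp_const.
Qed.

Lemma fp_flatten (A X : enc) (l : A -> seq (seq X)) : fp l -> fp (fun a => flatten (l a)).
Proof.
move=> hl.
have H (s : seq (seq X)) t : foldl (fun u x => x ++ u) t s = flatten (rev s) ++ t.
  elim: s t => //= x s IH t; rewrite IH rev_cons -cats1 flatten_cat /= cats0.
  by rewrite catA.
apply: (fpb_ext (f := fun a => foldl (fun u x => x ++ u) [::] (rev (l a)))).
  by move=> a; rewrite H revK cats0.
apply: fpb_foldl; last 1 first.
- exists (fun a => sz (rev (l a))); first by apply: fpb_pbd; apply: fp_rev.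
  move=> a i; move: (rev (l a)) => s; rewrite H cats0.
  have F (u : seq (seq X)) : sz (flatten (rev u)) <= sz u.
    elim: u => // x u IH; rewrite rev_cons -cats1 flatten_cat /= cats0.
    by have := sz_cat (flatten (rev u)) x; rewrite sz_cons; lia.
  apply: leq_trans (F _) _.
  exact: sz_take.
- by apply: fp_cat; proj.
- exact: fp_const.
- exact: fp_rev.
Qed.

Lemma fp_nseq (A X : enc) (f : A -> nat) (g : A -> X) : fp f -> fp g ->
  fp (fun a => nseq (f a) (g a)).
Proof.
move=> hf hg.
pose u n : seq unit := nseq n tt.
apply: (fpb_ext (f := fun a => map (fun=> g a) (u (f a)))).
  by move=> a; rewrite /u map_nseq.
apply: fp_map; first by apply: (fpb_comp (fp_fst0 A enc_unit)).
by apply: (fpb_comp hf); apply: fp_recode; elim=> //= n ->.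
Qed.

Lemma fp_size (A X : enc) (f : A -> seq X) : fp f -> fp (fun a => size (f a)).
Proof.
move=> hf; pose g (s : seq unit) := size s.
apply: (fpb_ext (f := fun a => g (map (fun=> tt) (f a)))).
  by move=> a; rewrite /g size_map.
apply: (fpb_comp (g := g)); first by apply: fp_map => //; apply: fp_const.
by apply: fp_recode; elim=> //= -[] s <-.
Qed.

Lemma fp_drop (A X : enc) (n : A -> nat) (f : A -> seq X) : fp n -> fp f ->
  fp (fun a => drop (n a) (f a)).
Proof.
move=> hn hf.
have H (s : seq X) m : foldl (fun s (_ : unit) => behead s) s (nseq m tt) = drop m s.
  elim: m s => [|m IH] s /=; first by rewrite drop0.
  by rewrite IH; case: s.
apply: (fpb_ext (f := fun a => foldl (fun s (_ : unit) => behead s) (f a) (nseq (n a) tt))).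
  by move=> a; apply: H.
apply: (fpb_foldl (X := enc_unit)) => //; last 1 first.
- exists (fun a => sz (f a)); first exact: fpb_pbd.
  move=> a i; rewrite (_ : take i _ = nseq (minn i (n a)) tt).
    rewrite H; have := sz_cat (take (minn i (n a)) (f a)) (drop (minn i (n a)) (f a)).
    by rewrite cat_take_drop; have := sz_gt0 (take (minn i (n a)) (f a)); lia.
  by elim: (n a) i => [|m IH] [|i] //=; rewrite ?min0n ?minn0 // minnSS /= IH.
- by apply: fp_behead; proj.
- by apply: fp_nseq => //; apply: fp_const.
Qed.

Lemma fp_nth (A X : enc) (d : X) (f : A -> seq X) (n : A -> nat) : fp n -> fp f ->
  fp (fun a => nth d (f a) (n a)).
Proof.
move=> hn hf; apply: (fpb_ext (f := fun a => head d (drop (n a) (f a)))).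
  by move=> a; rewrite -nth0 nth_drop addn0.
by apply: fp_head; apply: fp_drop.
Qed.

Lemma fp_leq (A : enc) (f g : A -> nat) : fp f -> fp g -> fp (fun a => f a <= g a).
Proof.
move=> hf hg; apply: (fpb_ext (f := fun a => nilp (drop (g a) (nseq (f a) tt)))).
  by move=> a; rewrite /nilp size_drop size_nseq /leq.
by apply: fp_nilp; apply: fp_drop => //; apply: fp_nseq => //; apply: fp_const.
Qed.

Lemma fp_addn (A : enc) (f g : A -> nat) : fp f -> fp g -> fp (fun a => f a + g a).
Proof.
move=> hf hg; apply: (fpb_ext (f := fun a => size (nseq (f a) tt ++ nseq (g a) tt))).
  by move=> a; rewrite size_cat !size_nseq.
by apply: fp_size; apply: fp_cat; apply: fp_nseq => //; apply: fp_const.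
Qed.

Lemma fp_muln (A : enc) (f g : A -> nat) : fp f -> fp g -> fp (fun a => f a * g a).
Proof.
move=> hf hg.
apply: (fpb_ext (f := fun a => size (flatten (nseq (f a) (nseq (g a) tt))))).
  by move=> a; rewrite size_flatten /shape map_nseq size_nseq sumn_nseq mulnC.
by apply: fp_size; apply: fp_flatten; do ![apply: fp_nseq] => //; apply: fp_const.
Qed.

Lemma fp_expn (A : enc) (f : A -> nat) k : fp f -> fp (fun a => f a ^ k).
Proof.
move=> hf; elim: k => [|k IH].
  by apply: (fpb_ext (f := fun=> 1)) => //; apply: fp_const.
by apply: (fpb_ext (f := fun a => f a * f a ^ k)) => [a|]; [rewrite expnS|apply: fp_muln].
Qed.

Lemma fp_iota (A : enc) (f g : A -> nat) : fp f -> fp g -> fp (fun a => iota (f a) (g a)).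
Proof.
move=> hf hg.
have e n m : foldl (fun s (_ : unit) => m :: map succn s) [::] (nseq n tt) = iota m n.
  elim: n => // n; rewrite -addn1 nseqD foldl_cat => -> /=.
  by rewrite addn1 /= -[m.+1]add1n iotaDl.
apply: (fpb_ext (f := fun a => foldl (fun s (_ : unit) => f a :: map succn s) [::]
   (nseq (g a) tt))); first by move=> a.
apply: (fpb_foldl (X := enc_unit)).
- apply: fp_cons; first by apply: (fpb_comp (f := fun p : A * seq nat * unit => p.1.1)) hf; proj.
  by apply: fp_map; [apply: fp_succ|]; proj.
- exact: fp_const.
- by apply: fp_nseq => //; apply: fp_const.
exists (fun a => (g a * (2 * (f a + g a) + 1).+1).+1).
  have h (h : A -> nat) : fp h -> pbd (fun x : A => sz x + 0) h.
    move/fpb_pbd=> p; apply: pbd_le p _ => a; rewrite sz_nat; lia.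
  have pf := h _ hf; have pg := h _ hg.
  apply: (@pbd_le _ _ _ (fun a => g a * (2 * (f a + g a) + 2) + 1)); first by pbd.
  by move=> a; lia.
move=> a i; rewrite (_ : take i _ = nseq (minn i (g a)) tt).
  rewrite e; apply: leq_trans (@sz_seq_bound _ _ (2 * (f a + g a) + 1) _) _.
    by move=> x; rewrite sz_nat => /in_listP; rewrite mem_iota; lia.
  by rewrite size_iota ltnS leq_mul2r; lia.
by elim: (g a) i => [|m IH] [|i] //=; rewrite ?min0n ?minn0 // minnSS /= IH.
Qed.

Lemma fp_allpairs (A X Y : enc) (B : enc) (f : A -> X -> Y -> B) (s : A -> seq X) (t : A -> seq Y) :
  fp (fun p : A * X * Y => f p.1.1 p.1.2 p.2) -> fp s -> fp t ->
  fp (fun a => [seq f a x y | x <- s a, y <- t a]).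
Proof.
move=> hf hs ht; apply: fp_flatten.
apply: (fp_map (f := fun a x => [seq f a x y | y <- t a])) => //.
apply: (fp_map (f := fun (p : A * X) y => f p.1 p.2 y)) => //.
by apply: (fpb_comp _ ht); proj.
Qed.


(** * Passing from input words to trees and back *)

Definition read_loop := Loop 2 (Seq (Push 3 false) (Push 3 true))
  (Seq (Push 3 false) (Seq (Push 3 false) (Seq (Push 3 true) (Push 3 true)))).

Definition write_loop := Loop 3 Nop (Case 3 (Push 2 false)
  (Seq (Push 2 true) (Seq (Case 3 Nop Nop) (Case 3 Nop Nop)))).

(** The last input bit is on top of stack 2, so prepending the popped bits builds the list in the
    right order; each bit is pushed as its tree code written backwards. *)
Lemma ex_read u v s : s 2 = rev u -> s 3 = code (en v) ->
  ex read_loop s (upd (upd s 3 (code (en (u ++ v)))) 2 [::]) (6 * size u + 1).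
Proof.
elim/last_ind: u v s => [|u b IH] v s e2 e3.
  by apply: ex_eq; [exact: ex_loop0|upd_solve].
rewrite rev_rcons in e2.
apply: (@ex_le _ _ _ (4 + (6 * size u + 1)).+1); last by rewrite size_rcons; lia.
apply: (ex_loop e2 (s1 := upd (upd s 2 (rev u)) 3 (code (en (b :: v))))).
  case: b e2 => e2; apply: ex_le.
  - apply: ex_eq; first by do ![apply: ex_seq; first exact: ex_push]; apply: ex_push.
    by upd_simpl; rewrite e3; upd_solve.
  - by [].
  - by apply: ex_eq; [apply: ex_seq; apply: ex_push|upd_simpl; rewrite e3; upd_solve].
  - by [].
apply: ex_eq; first by apply: (IH (b :: v)); upd_simpl.
by rewrite cat_rcons; upd_simpl; upd_solve.
Qed.

Lemma ex_write u s : s 3 = code (en u) ->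
  ex write_loop s (upd (upd s 2 (catrev u (s 2))) 3 [::]) (10 * size u + 3).
Proof.
elim: u s => [|b u IH] s e3.
  apply: (@ex_le _ _ _ (1 + 1).+1) => //.
  apply: (ex_loop e3 (ex_nop _)); apply: ex_eq; first by apply: ex_loop0; upd_simpl.
  by upd_simpl; upd_solve.
apply: (@ex_le _ _ _ (8 + (10 * size u + 3)).+1); last by rewrite /=; lia.
apply: (ex_loop e3 (s1 := upd (upd s 2 (b :: s 2)) 3 (code (en u)))).
  case: b e3 => e3; apply: ex_le.
  - apply: ex_case; first by upd_simpl.
    apply: ex_eq; first apply: ex_seq; first exact: ex_push.
      apply: ex_seq; (apply: ex_case; [by upd_simpl|exact: ex_nop]).
    by upd_simpl; upd_solve.
  - by [].
  - apply: ex_case; first by upd_simpl.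
    by apply: ex_eq; [exact: ex_push|upd_simpl; upd_solve].
  - by [].
apply: ex_eq; first by apply: IH; upd_simpl.
by upd_simpl; upd_solve.
Qed.

Lemma sz_bits (w : seq bool) : sz w <= 4 * size w + 1.
Proof.
by elim: w => //= b w IH; rewrite sz_cons; have := sz_bool b; lia.
Qed.

Lemma fpb_machine (f : seq bool -> seq bool) b : fpb b f ->
  exists M k, forall w, exists c : config M,
    [/\ halts_within w ((size w + b w + 2) ^ k) c, has_output c (f w)
      & accepting (cstate c) = head false (f w)].
Proof.
move=> ff; have [l Hl] := fpb_sz ff; case: ff => F [k HF].
pose P := Seq (Push 3 false) (Seq read_loop (Seq (comp F 3) write_loop)).
have run (w : seq bool) : ex P (upd (fun=> [::]) 2 (rev w)) (upd (fun=> [::]) 2 (rev (f w)))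
    (1 + ((6 * size w + 1) + (60 * (sz w + b w + 2) ^ k +
       (10 * (sz w + b w + 2) ^ l + 3)))).
  have [e c] := HF w.
  apply: ex_seq; first exact: ex_push.
  apply: ex_seq; first by apply: (@ex_read w [::]); upd_simpl.
  apply: ex_seq.
    apply: ex_le; first apply: (@comp_ex F 3 (en w)) => //.
    - by move=> i n3 d; rewrite !updE; do ![case: eqP => // _].
    - by upd_simpl; rewrite cats0.
    - by rewrite leq_mul2l c.
  rewrite e; apply: ex_le.
    apply: ex_eq; first by apply: ex_write; upd_simpl.
    by upd_simpl; rewrite catrevE; upd_solve; rewrite cats0.
  by have := Hl w; have := sz_size (f w); lia.
pose T (w : seq bool) := 1 + ((6 * size w + 1) + (60 * (sz w + b w + 2) ^ k +
       (10 * (sz w + b w + 2) ^ l + 3))).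
have [K HK] : pbd (fun w : seq bool => size w + b w)
    (fun w => 4 * (size w + T w + 2) ^ 2 * 4).
  have p1 : pbd (fun w : seq bool => size w + b w) (fun w => size w).
    by apply: pbd_le; [exact: pbd_id|move=> w; lia].
  have p2 : pbd (fun w : seq bool => size w + b w) b.
    by apply: pbd_le; [exact: pbd_id|move=> w; lia].
  have p3 : pbd (fun w : seq bool => size w + b w) (fun w => sz w).
    apply: (@pbd_le _ _ _ (fun w : seq bool => 4 * size w + 1)); first by pbd.
    exact: sz_bits.
  by rewrite /T; pbd.
exists (tm_of (seq_frag (init_frag (maxn 2 (max_reg P)))
   (seq_frag (frag_of (maxn 2 (max_reg P)) P) (final_frag (maxn 2 (max_reg P)))))), K => w.
have [n len ex] := run w.
have e2 : upd (fun=> [::]) 2 (rev (f w)) 2 = rev (f w) by [].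
have [c [[m [lm it st]] out acc]] := tm_of_correct ex e2.
exists c; split=> //; exists m; split=> //; apply: leq_trans lm _.
apply: leq_trans (HK w); rewrite leq_mul2r leq_mul2l leq_exp2r //=.
by rewrite /T; lia.
Qed.

Lemma poly_pow k : poly_bounded (fun n => (n + 2) ^ k).
Proof.
exists (3 ^ k), k => -[|n].
  by rewrite add0n; case: k => // k; apply: leq_trans (leq_addl _ _); rewrite leq_exp2r.
rewrite -expnMn; apply: leq_trans (leq_addr _ _).
by case: k => // k; rewrite leq_exp2r //; lia.
Qed.

Lemma poly_le p q : poly_bounded q -> (forall n, p n <= q n) -> poly_bounded p.
Proof. by case=> c [k H] le; exists c, k => n; apply: leq_trans (le n) (H n). Qed.

Lemma poly_pbd p : poly_bounded p <-> pbd id p.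
Proof.
split=> [[c [k H]]|[k H]]; last exact: poly_le (poly_pow k) H.
have h : pbd id (fun n => c * n ^ k + c).
  by apply: pbdD; [apply: pbdM; [|apply: pbdX; exact: (@pbd_id _ id)]|]; apply: pbd_const.
exact: pbd_le h H.
Qed.

Lemma fp_computes f : fp f ->
  exists (M : tm) (p : nat -> nat), poly_bounded p /\ computes M f p.
Proof.
move/fpb_machine=> [M [k H]]; exists M, (fun n => (n + 2) ^ k); split.
  exact: poly_pow.
by move=> w; have [c [h o _]] := H w; exists c; rewrite addn0 in h.
Qed.

(** A fixed power of a double exponential is again one: [(2 ^ 2 ^ a) ^ k <= 2 ^ 2 ^ (a + k)] because
    [k <= 2 ^ k]. The summand 2 in the exponent pays for adding the input size to the budget. *)
Lemma fpb_two_exptime (L : language) b f q :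
  fpb b f -> poly_bounded q -> (forall w, b w <= 2 ^ (2 ^ q (size w))) ->
  (forall w, head false (f w) <-> L w) -> in_two_exptime L.
Proof.
move=> /fpb_machine[M [k H]] pq bq fL.
exists M, (fun n => q n + n + 2 + k); split.
  apply/poly_pbd; have pq' : pbd id q by apply/poly_pbd.
  by apply: pbdD; [apply: pbdD; [apply: pbdD => //; exact: (@pbd_id _ id)|]|];
    apply: pbd_const.
move=> w; have [c [[n [le it st]] _ acc]] := H w; exists c; split; last by rewrite acc.
exists n; split=> //; apply: leq_trans le _.
set m := size w; have bw := bq w; rewrite -/m in bw.
have h1 : m + 2 <= 2 ^ (2 ^ (q m + m + 1)).
  apply: (@leq_trans (2 ^ (m + 1))).
    by elim: (m) => // j IH; rewrite !addSn expnS; lia.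
  by rewrite leq_exp2l //; have := ltn_expl (q m + m + 1) (ltnSn 1); lia.
have h2 : b w <= 2 ^ (2 ^ (q m + m + 1)).
  by apply: leq_trans bw _; rewrite leq_exp2l // leq_exp2l // -addnA leq_addr.
have h3 : m + b w + 2 <= 2 ^ (2 ^ (q m + m + 2)).
  rewrite (_ : q m + m + 2 = (q m + m + 1).+1); last by lia.
  rewrite expnS mul2n -addnn expnD.
  have : 2 <= 2 ^ (2 ^ (q m + m + 1)).
    by rewrite -{1}(expn1 2) leq_exp2l // expn_gt0.
  by move: h1 h2; move: (2 ^ (2 ^ _)) => y h1 h2 h; nia.
apply: (@leq_trans ((2 ^ (2 ^ (q m + m + 2))) ^ k)).
  by case: (k) => // j; rewrite leq_exp2r.
rewrite -expnM leq_exp2l // [in X in _ <= X]expnD leq_mul2l.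
by apply/orP; right; apply: ltnW; apply: ltn_expl.
Qed.


(** * Types *)

Lemma prefix_inj (T : Type) (e : T -> seq bool) : prefix_code e -> injective e.
Proof. by move=> p x y exy; case: (p x y [::] [::]); rewrite ?exy. Qed.

HB.instance Definition _ := Equality.copy concept
  (inj_type (prefix_inj enc_concept_prefix)).
HB.instance Definition _ := Equality.copy assertion
  (inj_type (prefix_inj enc_assertion_prefix)).

Definition holds (P : Prop) : bool :=
  if excluded_middle_informative P then true else false.

Lemma holdsP P : reflect P (holds P).
Proof. by rewrite /holds; case: excluded_middle_informative => p; constructor. Qed.

Notation type := (seq concept).

Fixpoint subs (C : concept) : seq concept :=
  C :: match C with
       | Not D => subs D
       | And D E | Or D E => subs D ++ subs E
       | Ex _ D | All _ D => subs D
       | _ => [::]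
       end.

Definition sub_in (cl : seq concept) C : Prop :=
  match C with
  | Not D | Ex _ D | All _ D => D \in cl
  | And D E | Or D E => (D \in cl) /\ (E \in cl)
  | _ => True
  end.

Definition closed_cl (cl : seq concept) := forall C, C \in cl -> sub_in cl C.

Definition cl_of (K : kb) : seq concept :=
  flatten [seq subs p.1 ++ subs p.2 | p <- tbox K] ++
  [seq (if x is ConceptAssertion A _ then Atom A else Top) | x <- abox K].

Lemma subs_refl C : C \in subs C.
Proof. by case: C => *; rewrite /= mem_head. Qed.

Lemma sub_in_sub (s s' : seq concept) C : {subset s <= s'} -> sub_in s C -> sub_in s' C.
Proof.
by move=> ss; case: C => //= [C D|C D] [/ss ? /ss ?].
Qed.

Lemma closed_cat s t : closed_cl s -> closed_cl t -> closed_cl (s ++ t).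
Proof.
move=> cs ct C; rewrite mem_cat => /orP[/cs|/ct]; apply: sub_in_sub => x i;
  by rewrite mem_cat i ?orbT.
Qed.

Lemma closed_cons C s : sub_in s C -> closed_cl s -> closed_cl (C :: s).
Proof.
have ss : {subset s <= C :: s} by move=> x i; rewrite inE i orbT.
by move=> iC cs D; rewrite inE => /orP[/eqP->|/cs]; [move: iC|]; apply: sub_in_sub.
Qed.

Lemma subs_closed C : closed_cl (subs C).
Proof.
elim: C => [||A|C IH|C IHC D IHD|C IHC D IHD|R C IH|R C IH] /=; apply: closed_cons;
  rewrite //= ?mem_cat ?subs_refl ?orbT //; exact: closed_cat.
Qed.

Lemma cl_of_closed K : closed_cl (cl_of K).
Proof.
apply: closed_cat.
  elim: (tbox K) => //= p s IH; apply: closed_cat IH; apply: closed_cat; exact: subs_closed.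
by move=> C /mapP[[A a|R a b] _ ->].
Qed.

Lemma cl_of_tbox K C D : (C, D) \in tbox K -> (C \in cl_of K) /\ (D \in cl_of K).
Proof.
move=> i; rewrite /cl_of !mem_cat; split; apply/orP; left; apply/flattenP;
  exists (subs C ++ subs D); rewrite ?mem_cat ?subs_refl ?orbT //;
  by apply/mapP; exists (C, D).
Qed.

Lemma cl_of_abox K A a : ConceptAssertion A a \in abox K -> Atom A \in cl_of K.
Proof.
by move=> i; rewrite mem_cat; apply/orP; right; apply/mapP; exists (ConceptAssertion A a).
Qed.

Definition okc (t : type) C : bool :=
  match C with
  | Top => C \in t
  | Bot => C \notin t
  | Not D => (C \in t) == (D \notin t)
  | And D E => (C \in t) == (D \in t) && (E \in t)
  | Or D E => (C \in t) == (D \in t) || (E \in t)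
  | _ => true
  end.

Definition okt cl (T : seq (concept * concept)) (t : type) : bool :=
  all (okc t) cl && all (fun p => (p.1 \in t) ==> (p.2 \in t)) T.

(* A demand of [t] needs a successor: an existential in [t] or a universal
   missing from [t]. *)
Definition demand C (t : type) : bool :=
  match C with Ex _ _ => C \in t | All _ _ => C \notin t | _ => false end.

Definition role C : name := match C with Ex R _ | All R _ => R | _ => [::] end.

(** An absent existential is a universal for the negated filler, hence the two symmetric conditions
    on an edge. *)
Definition compat cl R (t t' : type) : bool :=
  all (fun C => match C with
    | All R' D => (R' == R) && (C \in t) ==> (D \in t')
    | Ex R' D => (R' == R) && (C \notin t) ==> (D \notin t')
    | _ => true end) cl.

Definition wit cl C (t t' : type) : bool :=
  compat cl (role C) t t' &&
  match C with Ex _ D => D \in t' | All _ D => D \notin t' | _ => false end.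

Fixpoint sublists (T : Type) (s : seq T) : seq (seq T) :=
  if s is x :: s then let r := sublists s in r ++ map (cons x) r else [:: [::]].

Lemma filter_sublists (T : eqType) (p : pred T) s : filter p s \in sublists s.
Proof.
elim: s => //= x s IH; rewrite mem_cat; case: (p x); rewrite ?IH //.
by apply/orP; right; apply/mapP; exists (filter p s).
Qed.

(** Types are kept as subsequences of the closure, in which form they can be enumerated and serve as
    keys of tables. *)
Definition types_of (K : kb) : seq type :=
  filter (okt (cl_of K) (tbox K)) (sublists (cl_of K)).

Definition typeof (I : interp) cl (d : elt I) : type :=
  filter (fun C => holds (ext C d)) cl.

Section TypeOf.
Variables (I : interp) (cl : seq concept).
Hypothesis cl_cl : closed_cl cl.

Lemma mem_typeof d C : C \in cl -> (C \in typeof cl d) = holds (@ext I C d).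
Proof. by rewrite mem_filter => ->; rewrite andbT. Qed.

Lemma typeof_okt T d : (forall C D, (C, D) \in T -> (C \in cl) /\ (D \in cl)) ->
  (forall C D, List.In (C, D) T -> ext C d -> ext D d) -> okt cl T (@typeof I cl d).
Proof.
move=> Tcl mod; apply/andP; split; apply/allP.
  move=> C iC; have := cl_cl iC; case: C iC => //=.
  - by move=> iC _; rewrite mem_typeof //; apply/holdsP.
  - by move=> iC _; rewrite mem_typeof //; apply/holdsP.
  - move=> C iC iD; rewrite !mem_typeof //; apply/eqP.
    by case: (holdsP (ext C d)) => h; apply/holdsP.
  - move=> C D iC [iD iE]; rewrite !mem_typeof //; apply/eqP.
    by apply/holdsP/andP => [[/holdsP-> /holdsP->]|[/holdsP ? /holdsP ?]].
  - move=> C D iC [iD iE]; rewrite !mem_typeof //; apply/eqP.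
    case: (holdsP (ext C d)); case: (holdsP (ext D d)) => h1 h2 /=; apply/holdsP => /=; tauto.
move=> [C D] iT /=; have [iC iD] := Tcl _ _ iT; rewrite !mem_typeof //.
by apply/implyP=> /holdsP h; apply/holdsP; apply: mod h; apply/in_listP.
Qed.

Lemma typeof_compat R d e : rint R d e -> compat cl R (@typeof I cl d) (typeof cl e).
Proof.
move=> Rde; apply/allP => C iC; have := cl_cl iC; case: C iC => // R' D iC iD.
  rewrite !mem_typeof //; apply/implyP => /andP[/eqP-> /holdsP n]; apply/holdsP => h.
  by apply: n; exists e.
by rewrite !mem_typeof //; apply/implyP => /andP[/eqP-> /holdsP h]; apply/holdsP; apply: h.
Qed.

Lemma typeof_wit C d : C \in cl -> demand C (@typeof I cl d) ->
  exists2 e, rint (role C) d e & wit cl C (typeof cl d) (typeof cl e).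
Proof.
move=> iC; have := cl_cl iC; case: C iC => // R D iC iD /=; rewrite mem_typeof //.
  move/holdsP=> [e [r h]]; exists e => //; rewrite /wit (typeof_compat r) /=.
  by rewrite mem_typeof //; apply/holdsP.
move/holdsP=> n.
have [e he] : exists e, ~ (rint R d e -> ext D e).
  exact: not_all_ex_not.
have [r h] := imply_to_and _ _ he.
exists e => //; rewrite /wit (typeof_compat r) /=.
by rewrite mem_typeof //; apply/holdsP.
Qed.

End TypeOf.

(** * Unravelling *)

Section Unravel.
Variables (K : kb) (Y : Type) (tau : Y -> type) (ch : Y -> concept -> Y)
  (y0 : name -> Y).
Let cl := cl_of K.
Hypothesis tau_ok : forall y, okt cl (tbox K) (tau y).
Hypothesis ch_ok : forall y C, C \in cl -> demand C (tau y) ->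
  wit cl C (tau y) (tau (ch y C)).
Hypothesis abox_role : forall R a b, RoleAssertion R a b \in abox K ->
  compat cl R (tau (y0 a)) (tau (y0 b)).
Hypothesis abox_atom : forall A a, ConceptAssertion A a \in abox K ->
  Atom A \in tau (y0 a).

(* [(a, C, p)] is the element reached from [a] through the demands [C :: p],
   latest first. *)
Definition unode := (name + name * concept * seq concept)%type.
Definition upath (x : unode) : name * seq concept :=
  match x with inl a => (a, [::]) | inr (a, C, p) => (a, C :: p) end.
Definition ulab x := let: (a, p) := upath x in foldr (fun C y => ch y C) (y0 a) p.
Definition uchild x C : unode := inr ((upath x).1, C, (upath x).2).

Definition unravel : interp := @Interp (name * concept * seq concept)
  (fun A x => Atom A \in tau (ulab x))
  (fun R x y =>
    (exists a b, [/\ x = inl a, y = inl b & RoleAssertion R a b \in abox K]) \/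
    (exists C, [/\ y = uchild x C, C \in cl, demand C (tau (ulab x)) & role C = R])).

Lemma ulab_child x C : ulab (uchild x C) = ch (ulab x) C.
Proof. by rewrite /ulab /uchild; case: x => [a|[[a D] p]]. Qed.

Lemma unravel_compat R x y : rint (i := unravel) R x y -> compat cl R (tau (ulab x)) (tau (ulab y)).
Proof.
case=> [[a [b [-> -> /abox_role //]]]|[C [-> iC d <-]]].
by rewrite ulab_child; have /andP[] := ch_ok iC d.
Qed.

(** Truth lemma. [compat] along all edges settles one direction for both quantifiers; the other is
    what [ch_ok] provides: a successor for each existential in the type and a counterexample for
    each universal missing from it. *)
Lemma unravel_truth C : C \in cl -> forall x, @ext unravel C x <-> C \in tau (ulab x).
Proof.
have cc := @cl_of_closed K; have ok x : okc (tau (ulab x)) C \/ True by auto.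
have okx D : D \in cl -> forall x, okc (tau (ulab x)) D.
  by move=> iD x; have /andP[/allP/(_ D iD)] := tau_ok (ulab x).
elim: C {ok} => [||A|C IH|C IHC D IHD|C IHC D IHD|R C IH|R C IH] iC x /=;
  have := cc _ iC => //= sub; have /= okC := okx _ iC x.
- by [].
- by rewrite (negPf okC).
- by rewrite (eqP okC) IH //; split=> /negP.
- by case: sub => s1 s2; rewrite (eqP okC) IHC // IHD //; split=> /andP.
- by case: sub => s1 s2; rewrite (eqP okC) IHC // IHD //; split=> /orP.
- split=> [[e [r /(IH sub) h]]|h].
    have /allP/(_ _ iC) /= := unravel_compat r; rewrite eqxx /=.
    by case: (Ex R C \in _) => // /implyP/(_ isT)/negP.
  exists (uchild x (Ex R C)); split; first by right; exists (Ex R C).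
  by apply/(IH sub); rewrite ulab_child; have /andP[] := @ch_ok (ulab x) _ iC h.
- split=> [h|h e r]; last first.
    have /allP/(_ _ iC) /= := unravel_compat r; rewrite eqxx h /= => ?.
    exact/(IH sub).
  apply/negP => /negP n; have d : demand (All R C) (tau (ulab x)) by [].
  have /(IH sub) := h (uchild x (All R C)) (or_intror (ex_intro _ _ (And4 erefl iC d erefl))).
  by rewrite ulab_child; have /andP[_ /negP] := @ch_ok (ulab x) _ iC d.
Qed.

Lemma unravel_model : model unravel K.
Proof.
split=> [C D /in_listP i x|x /in_listP i].
  have [iC iD] := cl_of_tbox i; move/(unravel_truth iC) => h; apply/(unravel_truth iD).
  by have /andP[_ /allP/(_ _ i)] := tau_ok (ulab x); rewrite /= h.
case: x i => [A a|R a b] i /=; first exact: abox_atom i.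
by left; exists a, b.
Qed.
End Unravel.


(** * Approximate homomorphisms *)

Section Approx.
Variables (S : signature) (K : kb) (D : Type) (at_ : name -> D -> Prop)
  (edge : name -> D -> D -> Prop).

Definition aok d (t : type) :=
  forall A, Atom A \in t -> A \in sig_concepts S -> at_ A d.

(* [approx jmp n d t]: the depth-[n] unravelling of an element of type [t] can
   be mapped to [d]; [jmp] tells where successors along roles outside the
   signature may be mapped. *)
Fixpoint approx (jmp : (D -> type -> Prop) -> type -> Prop) n d (t : type) : Prop :=
  aok d t /\
  if n is n.+1 then
    forall C, C \in cl_of K -> demand C t ->
    exists t', [/\ t' \in types_of K, wit (cl_of K) C t t' &
      if role C \in sig_roles S then exists2 e, edge (role C) d e & approx jmp n e t'
      else jmp (approx jmp n) t']
  else True.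

Definition anywhere (W : D -> type -> Prop) t := exists e, W e t.

Lemma approx_aok jmp n d t : approx jmp n d t -> aok d t.
Proof. by case: n => [|n] []. Qed.

End Approx.

(** Successors along roles outside the signature may go anywhere because a query keeps no edge to
    them. The last clause accounts for the nonempty domain: it still says something when the second
    ABox is empty. *)
Definition embeds S K2 I n :=
  exists s : name -> type,
    [/\ forall a, a \in ind K2 -> s a \in types_of K2 /\
          approx S K2 (@cint I) (@rint I) (@anywhere (elt I)) n (named I a) (s a),
        forall A a, ConceptAssertion A a \in abox K2 -> Atom A \in s a,
        forall R a b, RoleAssertion R a b \in abox K2 ->
          compat (cl_of K2) R (s a) (s b) /\
          (R \in sig_roles S -> rint R (named I a) (named I b)) &
        exists t d, t \in types_of K2 /\
          approx S K2 (@cint I) (@rint I) (@anywhere (elt I)) n d t].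

Definition refuted S K1 K2 := exists I n, model I K1 /\ ~ embeds S K2 I n.

(** ** Certificates of refutation *)

Section Certificate.
Variables (S : signature) (K1 K2 : kb) (N : nat).
Let cl1 := cl_of K1.
Let cl2 := cl_of K2.

Definition mism (t1 t : type) := exists A, [/\ Atom A \in t, A \in sig_concepts S & Atom A \notin t1].

(** [rho y t] is a depth at which type [t] of the second knowledge base fails at [y]; a value of [N]
    or more claims no failure. [why y t] is the demand that fails. Since the target of a jump is
    unknown, [g t] bounds the ranks of [t] at all nodes. Except for the last field, every condition
    concerns a single node, a single edge or the table [g], so it can be checked locally. *)
Record cert := Cert {
  Y : Type;
  tau : Y -> type;
  rho : Y -> type -> nat;
  why : Y -> type -> concept;
  ch : Y -> concept -> Y;
  y0 : name -> Y;
  g : type -> nat;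
  edge_ok := fun R y y' => R \in sig_roles S -> forall t, t \in types_of K2 ->
    rho y t < N -> ~ mism (tau y) t -> role (why y t) = R ->
    forall t', t' \in types_of K2 -> wit cl2 (why y t) t t' -> rho y' t' < rho y t;
  _ : forall y, okt cl1 (tbox K1) (tau y) && (tau y \in sublists cl1);
  _ : forall y C, C \in cl1 -> demand C (tau y) ->
    wit cl1 C (tau y) (tau (ch y C)) /\ edge_ok (role C) y (ch y C);
  _ : forall R a b, RoleAssertion R a b \in abox K1 ->
    compat cl1 R (tau (y0 a)) (tau (y0 b)) /\ edge_ok R (y0 a) (y0 b);
  _ : forall A a, ConceptAssertion A a \in abox K1 -> Atom A \in tau (y0 a);
  _ : forall y t, t \in types_of K2 -> rho y t < N -> mism (tau y) t \/
    [/\ why y t \in cl2, demand (why y t) t, 0 < rho y t &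
        role (why y t) \notin sig_roles S -> forall t', t' \in types_of K2 ->
        wit cl2 (why y t) t t' -> g t' < rho y t];
  _ : forall y t, t \in types_of K2 -> rho y t <= g t;
  _ : (forall t, t \in types_of K2 -> g t < N) \/
      forall s : name -> type,
      (forall a, a \in ind K2 -> s a \in types_of K2) ->
      (forall A a, ConceptAssertion A a \in abox K2 -> Atom A \in s a) ->
      (forall R a b, RoleAssertion R a b \in abox K2 ->
          compat cl2 R (s a) (s b)) ->
      (exists R a b, [/\ RoleAssertion R a b \in abox K2, R \in sig_roles S &
          RoleAssertion R a b \notin abox K1]) \/
      exists2 a, a \in ind K2 & rho (y0 a) (s a) < N }.

Lemma cert_refuted : cert -> refuted S K1 K2.
Proof.
case=> Y tau rho why ch y0 g edge_ok H1 H2 H3 H4 H5 H6 H7.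
pose I := unravel K1 tau ch y0.
exists I, N; split.
  by apply: unravel_model => // [y|y C iC d|R a b i]; [case/andP: (H1 y)|case: (H2 y C iC d)|case: (H3 _ _ _ i)].
pose lab : elt I -> Y := ulab ch y0.
have eok R x y : rint (i := I) R x y -> edge_ok R (lab x) (lab y).
  case=> [[a [b [-> -> /H3[] //]]]|[C [-> iC d <-]]].
  by rewrite /lab ulab_child; have [] := H2 _ _ iC d.
(* An embedding to depth [n] needs a rank above [n]: along an edge of the signature the rank falls
   by [edge_ok], and a jump leads to a rank of at most [g], which is smaller as well. *)
have claim n : forall x t, t \in types_of K2 -> rho (lab x) t < N ->
    approx S K2 (@cint I) (@rint I) (@anywhere (elt I)) n x t -> n < rho (lab x) t.
  elim: n => [|n IH] x t it lt W; have [[A [iA sA nA]]|[iw dw r0 jw]] := H5 _ _ it lt.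
  - by have := approx_aok W iA sA; rewrite /= -/lab; move/negP: nA.
  - by [].
  - by have := approx_aok W iA sA; rewrite /= -/lab; move/negP: nA.
  have nm : ~ mism (tau (lab x)) t.
    by case=> A [iA sA nA]; have := approx_aok W iA sA; rewrite /= -/lab; move/negP: nA.
  case: W => _ /(_ _ iw dw)[t' [it' w]]; case: ifP => sR.
    case=> e r W; have lt' := eok _ _ _ r sR _ it lt nm erefl _ it' w.
    by have := IH e t' it' (ltn_trans lt' lt) W; lia.
  case=> e W; have lt' := jw (negbT sR) _ it' w; have le := H6 (lab e) _ it'.
  by have := IH e t' it' _ W; lia.
have claimN x t : t \in types_of K2 -> rho (lab x) t < N ->
    ~ approx S K2 (@cint I) (@rint I) (@anywhere (elt I)) N x t.
  by move=> it lt W; have := claim _ _ _ it lt W; lia.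
case=> s [Hs Ha Hr [t [d [it W]]]]; case: H7 => [gN|/(_ s) H7].
  by apply: (claimN d t) => //; apply: leq_ltn_trans (H6 _ _ it) (gN _ it).
case: H7 => //.
- by move=> a /Hs[].
- by move=> R a b /Hr[].
- case=> R [a [b [i sR n]]]; have [_ /(_ sR)] := Hr _ _ _ i.
  case=> [[a' [b' [[<-] [<-] i']]]|[C []]] //.
  by rewrite i' in n.
- case=> a ia lt; have [ita Wa] := Hs a ia.
  exact: (claimN (named I a) (s a)).
Qed.
End Certificate.

(** ** Queries describing the approximations *)

Definition enc_atom (x : atom) :=
  match x with
  | ConceptAtom A z => (A, z, None)
  | RoleAtom R z z' => (R, z, Some z')
  end.

Lemma enc_atom_inj : injective enc_atom.
Proof. by case=> [A z|R z z'] [B y|Q y y'] //= [-> -> // ->]. Qed.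

HB.instance Definition _ := Equality.copy atom (inj_type enc_atom_inj).

Lemma choice_fun (A B : Type) (P : A -> B -> Prop) :
  (forall x, exists y, P x y) -> exists f, forall x, P x (f x).
Proof.
move=> H; exists (fun x => proj1_sig (constructive_indefinite_description _ (H x))) => x.
by case: constructive_indefinite_description.
Qed.

Fixpoint cart (T : Type) (s : seq (seq T)) : seq (seq T) :=
  if s is l :: s then [seq x :: u | x <- l, u <- cart s] else [:: [::]].

Lemma cartP (T : eqType) (s : seq (seq T)) u :
  u \in cart s <-> size u = size s /\
  forall i d, i < size s -> nth d u i \in nth [::] s i.
Proof.
elim: s u => [|l s IH] u /=.
  by rewrite inE; split=> [/eqP->|[/size0nil->]].
split=> [/allpairsP[[x v] /= [ix /IH[sz H] ->]]|].
  by rewrite /= sz; split=> // -[|i] d //=; apply: H.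
case: u => [|x v] [] //= [sz] H; apply/allpairsP; exists (x, v); split=> //=.
  exact: (H 0 x).
by apply/IH; split=> // i d lt; apply: (H i.+1).
Qed.

Lemma cart_map (T U : eqType) (F : T -> seq U) (h : T -> U) (s : seq T) :
  {in s, forall x, h x \in F x} -> map h s \in cart (map F s).
Proof.
elim: s => //= x s IH H; apply/allpairsP; exists (h x, map h s); split=> //=.
  by apply: H; rewrite mem_head.
by apply: IH => y iy; apply: H; rewrite inE iy orbT.
Qed.

Section Queries.
Variables (S : signature) (K : kb).
Let cl := cl_of K.

Definition demands (t : type) := [seq C <- cl | demand C t].

Definition type_atoms (t : type) z : seq atom :=
  pmap (fun C => if C is Atom A then
    if A \in sig_concepts S then Some (ConceptAtom A z) else None else None) t.

Definition edge_atoms R z z' : seq atom :=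
  if R \in sig_roles S then [:: RoleAtom R z z'] else [::].

(* Conjunctive queries for the depth-[n] unravellings of [t]; variables are
   named by paths, encoded by [f]. *)
Fixpoint unfoldings n (t : type) (f : seq nat -> var) : seq (seq atom) :=
  if n is n.+1 then
    [seq type_atoms t (f [::]) ++ flatten cs | cs <- cart
      [seq [seq edge_atoms (role (nth Top (demands t) i)) (f [::]) (f [:: i]) ++ phi
           | t' <- [seq t' <- types_of K | wit cl (nth Top (demands t) i) t t'],
             phi <- unfoldings n t' (fun p => f (i :: p))]
        | i <- iota 0 (size (demands t))]]
  else [:: type_atoms t (f [::])].

Definition sat_all (I : interp) (v : var -> elt I) (phi : seq atom) :=
  forall x, x \in phi -> sat_atom v x.

Lemma sat_all_cat I (v : var -> elt I) s t :
  sat_all v (s ++ t) <-> sat_all v s /\ sat_all v t.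
Proof.
split=> [H|[hs ht] x]; last by rewrite mem_cat => /orP[/hs|/ht].
by split=> x i; apply: H; rewrite mem_cat i ?orbT.
Qed.

Lemma sat_all_flatten I (v : var -> elt I) ss :
  sat_all v (flatten ss) <-> forall s, s \in ss -> sat_all v s.
Proof.
split=> [H s i x ix|H x /flattenP[s i ix]]; last exact: H i x ix.
by apply: H; apply/flattenP; exists s.
Qed.

Lemma type_atoms_sat (I : interp) (v : var -> elt I) t z :
  sat_all v (type_atoms t z) <-> aok S (@cint I) (v z) t.
Proof.
split=> H.
  move=> A iA sA; apply: (H (ConceptAtom A z)).
  by rewrite mem_pmap; apply/mapP; exists (Atom A); rewrite ?sA.
by move=> x; rewrite mem_pmap => /mapP[[] // A iA]; case: ifP => // sA [->]; apply: H.
Qed.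

Lemma edge_atoms_sat (I : interp) (v : var -> elt I) R z z' :
  sat_all v (edge_atoms R z z') <-> (R \in sig_roles S -> rint R (v z) (v z')).
Proof.
rewrite /edge_atoms; case: ifP => sR; split=> // H; last first.
  by move=> x; rewrite inE => /eqP->; apply: H.
by move=> _; apply: (H (RoleAtom R z z')); rewrite mem_head.
Qed.

Lemma edge_atoms_over R z z' x : x \in edge_atoms R z z' -> atom_over S x.
Proof. by rewrite /edge_atoms; case: ifP => // sR; rewrite inE => /eqP->. Qed.

Lemma unfoldings_over n t f phi : phi \in unfoldings n t f ->
  forall x, x \in phi -> atom_over S x.
Proof.
have ta u z x : x \in type_atoms u z -> atom_over S x.
  by rewrite mem_pmap => /mapP[[] // A iA]; case: ifP => // sA [->].
elim: n t f phi => [|n IH] t f phi /=.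
  by rewrite inE => /eqP-> x; apply: ta.
move=> /mapP[cs /cartP[sz ics] ->] x; rewrite mem_cat => /orP[|/flattenP[c /(nthP [::])[i lt <-]]].
  exact: ta.
rewrite size_map size_iota in sz ics; rewrite sz in lt; have := ics i [::] lt.
rewrite (nth_map 0) ?size_iota // nth_iota // => /allpairsPdep[t' [psi [_ ip ->]]].
by rewrite mem_cat => /orP[/edge_atoms_over|/(IH _ _ _ ip)].
Qed.

Lemma unfoldings_sound n (I : interp) (v : var -> elt I) t f phi :
  phi \in unfoldings n t f -> sat_all v phi ->
  approx S K (@cint I) (@rint I) (@anywhere (elt I)) n (v (f [::])) t.
Proof.
elim: n t f phi => [|n IH] t f phi /=.
  by rewrite inE => /eqP-> /type_atoms_sat.
move=> /mapP[cs /cartP[sz ics] ->] /sat_all_cat[/type_atoms_sat H0 /sat_all_flatten H].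
split=> // C iC dC; rewrite size_map size_iota in sz ics.
have iD : C \in demands t by rewrite mem_filter dC.
pose i := index C (demands t); have lt : i < size (demands t) by rewrite index_mem.
have := ics i [::] lt; rewrite (nth_map 0) ?size_iota // nth_iota // add0n nth_index //.
move=> /allpairsPdep[t' [psi []]]; rewrite mem_filter => /andP[w it'] ip e.
have : sat_all v (nth [::] cs i) by apply: H; apply: mem_nth; rewrite sz.
rewrite e => /sat_all_cat[/edge_atoms_sat he hp].
exists t'; split=> //; have := IH _ _ _ ip hp; case: ifP => sR h.
  by exists (v (f [:: i])) => //; apply: he.
by exists (v (f [:: i])).
Qed.

(** The disjunct is read off the model: each demand takes the type of an actual successor. The
    assignment [g] is indexed by paths, since [f] is arbitrary here; [pickle] keeps the variables
    apart later. *)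
Lemma unfoldings_complete n (I : interp) (d : elt I) f : model I K ->
  exists phi (g : seq nat -> elt I), [/\ phi \in unfoldings n (typeof cl d) f,
    g [::] = d & forall v, (forall p, v (f p) = g p) -> sat_all v phi].
Proof.
move=> mod; have aokd v z : v z = d -> sat_all v (type_atoms (typeof cl d) z).
  move=> e; apply/type_atoms_sat => A; rewrite e => iA sA.
  by move: iA; rewrite mem_filter => /andP[/holdsP].
elim: n d f aokd => [|n IH] d f aokd.
  exists (type_atoms (typeof cl d) (f [::])), (fun=> d); split=> //=.
    by rewrite mem_head.
  by move=> v e; apply: aokd.
have aok0 d0 (v : var -> elt I) z : v z = d0 -> sat_all v (type_atoms (typeof cl d0) z).
  move=> e; apply/type_atoms_sat => A; rewrite e => iA sA.
  by move: iA; rewrite mem_filter => /andP[/holdsP].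
set t := typeof cl d.
have H i : exists x : seq atom * (seq nat -> elt I), i < size (demands t) ->
    (x.1 \in [seq edge_atoms (role (nth Top (demands t) i)) (f [::]) (f [:: i]) ++ phi
           | t' <- [seq t' <- types_of K | wit cl (nth Top (demands t) i) t t'],
             phi <- unfoldings n t' (fun p => f (i :: p))]) /\
    forall v, v (f [::]) = d -> (forall p, v (f (i :: p)) = x.2 p) -> sat_all v x.1.
  case: (ltnP i (size (demands t))) => [lt|le]; last by exists ([::], fun=> d).
  have := mem_nth Top lt; set C := nth _ _ _; rewrite mem_filter => /andP[dC iC].
  have [e r w] := typeof_wit (@cl_of_closed K) iC dC.
  have [phi [h [ip h0 hv]]] := IH e (fun p => f (i :: p)) (aok0 e).
  exists (edge_atoms (role C) (f [::]) (f [:: i]) ++ phi, h) => _; split.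
    apply/allpairsPdep; exists (typeof cl e), phi; split=> //=.
    rewrite mem_filter w mem_filter filter_sublists andbT /=.
    by apply: typeof_okt => [|C1 D1|C1 D1 i1]; [exact: cl_of_closed|exact: cl_of_tbox|case: mod => m _; exact: m].
  move=> v vd vh; apply/sat_all_cat; split; last exact: hv.
  by apply/edge_atoms_sat => _; rewrite vd vh /= h0.
have [F HF] := choice_fun H.
exists (type_atoms t (f [::]) ++ flatten [seq (F i).1 | i <- iota 0 (size (demands t))]),
  (fun p => if p is i :: q then if i < size (demands t) then (F i).2 q else d else d).
split=> //=.
  apply/mapP; exists [seq (F i).1 | i <- iota 0 (size (demands t))] => //.
  by apply: cart_map => i; rewrite mem_iota add0n => /andP[_ lt]; case: (HF i lt).
move=> v hv; have v0 : v (f [::]) = d by apply: hv.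
apply/sat_all_cat; split; first exact: aok0.
apply/sat_all_flatten => s /mapP[i]; rewrite mem_iota add0n => /andP[_ lt] ->.
by have [_] := HF i lt; apply=> // p; rewrite hv lt.
Qed.
End Queries.

Section RefutedQuery.
Variables (S : signature) (K1 K2 : kb) (n : nat).
Let inds := ind K2.
Let m := size inds.
Let var_of (k : nat) (p : seq nat) : var := pickle (k, p).
Let ivar a := var_of (index a inds) [::].

Definition assigned (ts : seq type) a := nth [::] ts (index a inds).

Definition abox_ok ts := all (fun x => match x with
  | ConceptAssertion A a => Atom A \in assigned ts a
  | RoleAssertion R a b => compat (cl_of K2) R (assigned ts a) (assigned ts b)
  end) (abox K2).

Definition abox_atoms := flatten [seq if x is RoleAssertion R a b
  then edge_atoms S R (ivar a) (ivar b) else [::] | x <- abox K2].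

(* One unfolding for each individual and one for an arbitrary element. *)
Definition unfolding_ucq := UCQ (map ivar inds)
  [seq abox_atoms ++ flatten cs |
    ts <- [seq ts <- cart (nseq m.+1 (types_of K2)) | abox_ok ts],
    cs <- cart [seq unfoldings S K2 n (nth [::] ts k) (var_of k) | k <- iota 0 m.+1]].

Lemma ucq_satP (I : interp) q a : sat_ucq I q a <->
  exists2 phi, phi \in disjuncts q & exists2 v : var -> elt I,
    map v (answer_vars q) = map (named I) a & sat_all v phi.
Proof.
split=> [[phi [/in_listP i [v [e h]]]]|[phi /in_listP i [v e h]]].
  by exists phi => //; exists v => // x /in_listP; apply: h.
by exists phi; split=> //; exists v; split=> // x /in_listP; apply: h.
Qed.

Lemma unfolding_over : ucq_over S unfolding_ucq.
Proof.
move=> phi /in_listP /allpairsPdep[ts [cs [_ ics ->]]] x /in_listP.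
rewrite mem_cat => /orP[/flattenP[s /mapP[[A a|R a b] _ ->]]|/flattenP[s is_ ix]].
- by [].
- exact: edge_atoms_over.
move/cartP: ics => [sz H]; move/(nthP [::]): is_ => [i lt es].
rewrite sz size_map size_iota in lt; have := H i [::]; rewrite size_map size_iota => /(_ lt).
by rewrite (nth_map 0) ?size_iota // nth_iota // es => /unfoldings_over; apply.
Qed.

Lemma unfolding_certain : certain K2 unfolding_ucq inds.
Proof.
move=> I mod; apply/ucq_satP; have [mT mA] := mod.
(* Index [m], one past the individuals, stands for the additional element; any element will do. *)
pose d k : elt I := if k < m then named I (nth [::] inds k) else named I [::].
pose ty k := typeof (cl_of K2) (d k).
have H k : exists x : seq atom * (seq nat -> elt I),
   [/\ x.1 \in unfoldings S K2 n (ty k) (var_of k), x.2 [::] = d k &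
     forall v, (forall p, v (var_of k p) = x.2 p) -> sat_all v x.1].
  by have [phi [h H]] := unfoldings_complete S n (d k) (var_of k) mod; exists (phi, h).
have [F HF] := choice_fun H.
pose ts := map ty (iota 0 m.+1).
have tsE k : k < m.+1 -> nth [::] ts k = ty k.
  by move=> lt; rewrite (nth_map 0) ?size_iota // nth_iota.
have dE a : a \in inds -> d (index a inds) = named I a.
  by move=> ia; rewrite /d index_mem ia nth_index.
have asE a : a \in inds -> assigned ts a = typeof (cl_of K2) (named I a).
  move=> ia; rewrite /assigned tsE; first by rewrite /ty dE.
  by rewrite ltnS ltnW // index_mem.
have inA A a : ConceptAssertion A a \in abox K2 -> a \in inds.
  by move=> i; apply/flattenP; exists [:: a]; rewrite ?mem_head //; apply/mapP; exists (ConceptAssertion A a).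
have inR R a b : RoleAssertion R a b \in abox K2 -> (a \in inds) /\ (b \in inds).
  by move=> i; split; apply/flattenP; exists [:: a; b]; rewrite ?inE ?eqxx ?orbT //;
    apply/mapP; exists (RoleAssertion R a b).
pose v z : elt I := if unpickle z is Some (k, p) then (F k).2 p else named I [::].
have vE k p : v (var_of k p) = (F k).2 p by rewrite /v /var_of pickleK.
have va a : a \in inds -> v (ivar a) = named I a.
  by move=> ia; rewrite vE; case: (HF (index a inds)) => _ -> _; apply: dE.
exists (abox_atoms ++ flatten [seq (F k).1 | k <- iota 0 m.+1]); last first.
  exists v; first by rewrite -map_comp; apply/eq_in_map => a; apply: va.
  apply/sat_all_cat; split; apply/sat_all_flatten => s /mapP[].
    move=> [A a|R a b] i -> //; apply/edge_atoms_sat => _.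
    have [ia ib] := inR _ _ _ i; rewrite !va //; apply: (mA (RoleAssertion R a b)).
    exact/in_listP.
  by move=> k _ ->; case: (HF k) => _ _; apply=> p.
apply/allpairsPdep; exists ts, [seq (F k).1 | k <- iota 0 m.+1]; split=> //.
  rewrite mem_filter; apply/andP; split; last first.
    apply/cartP; rewrite size_map size_iota size_nseq; split=> // i d0 lt.
    rewrite nth_nseq lt (set_nth_default [::]) ?size_map ?size_iota // tsE //.
    rewrite mem_filter filter_sublists andbT.
    by apply: typeof_okt => [|C1 D1|C1 D1 i1]; [exact: cl_of_closed|exact: cl_of_tbox|exact: mT].
  apply/allP => -[A a|R a b] i.
    rewrite asE ?(inA _ _ i) // mem_typeof ?(cl_of_abox i) //; apply/holdsP.
    by apply: (mA (ConceptAssertion A a)); apply/in_listP.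
  have [ia ib] := inR _ _ _ i; rewrite !asE //; apply: typeof_compat; first exact: cl_of_closed.
  by apply: (mA (RoleAssertion R a b)); apply/in_listP.
apply: cart_map => k; rewrite mem_iota add0n => /andP[_ lt].
by rewrite tsE //; case: (HF k).
Qed.

Lemma unfolding_embeds I : sat_ucq I unfolding_ucq inds -> embeds S K2 I n.
Proof.
case/ucq_satP=> phi /allpairsPdep[ts [cs [+ /cartP[szc ics] ->]]] [v].
rewrite mem_filter => /andP[/allP ok /cartP[szt its]] ev /sat_all_cat[ha /sat_all_flatten hc].
rewrite size_map size_iota in szc ics; rewrite size_nseq in szt its.
have ap k : k < m.+1 -> approx S K2 (@cint I) (@rint I) (@anywhere (elt I)) n
    (v (var_of k [::])) (nth [::] ts k).
  move=> lt; have := ics k [::] lt; rewrite (nth_map 0) ?size_iota // nth_iota // => h.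
  by apply: unfoldings_sound h _; apply: hc; apply: mem_nth; rewrite szc.
have tt k : k < m.+1 -> nth [::] ts k \in types_of K2.
  by move=> lt; have := its k [::] lt; rewrite nth_nseq lt.
have va a : a \in inds -> v (ivar a) = named I a.
  by move: ev; rewrite -map_comp => /eq_in_map; apply.
have lti a : a \in inds -> index a inds < m.+1.
  by move=> ia; rewrite ltnS ltnW // index_mem.
exists (assigned ts); split.
- by move=> a ia; split; [apply: tt; apply: lti|rewrite -va //; apply: ap; apply: lti].
- by move=> A a /ok.
- move=> R a b i; split; first exact: (ok _ i).
  have ia : a \in inds by apply/flattenP; exists [:: a; b]; rewrite ?mem_head //;
    apply/mapP; exists (RoleAssertion R a b).
  have ib : b \in inds by apply/flattenP; exists [:: a; b]; rewrite ?inE ?eqxx ?orbT //;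
    apply/mapP; exists (RoleAssertion R a b).
  move=> sR; move/sat_all_flatten: ha => /(_ (edge_atoms S R (ivar a) (ivar b))).
  move=> /(_ _)/edge_atoms_sat; rewrite !va //; apply=> //.
  by apply/mapP; exists (RoleAssertion R a b).
- by exists (nth [::] ts m), (v (var_of m [::])); split; [apply: tt|apply: ap].
Qed.

End RefutedQuery.

Lemma refuted_not_entails S K1 K2 : refuted S K1 K2 -> ~ ucq_entails S K1 K2.
Proof.
case=> I [n [mod ne]] ent; apply: ne.
have [//||//||_ h] := ent (unfolding_ucq S K2 n) (ind K2).
- exact: unfolding_over.
- by rewrite size_map.
- exact: unfolding_certain.
by apply: unfolding_embeds; apply: h.
Qed.


(** * From finite graphs to certificates *)

Lemma uniform_bound (T : eqType) (l : seq T) (P : nat -> T -> Prop) :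
  (forall n x, P n.+1 x -> P n x) -> (forall x, x \in l -> exists n, ~ P n x) ->
  exists N, forall x, x \in l -> ~ P N x.
Proof.
move=> dec; have le n m x : n <= m -> P m x -> P n x.
  elim: m => [|m IH]; first by rewrite leqn0 => /eqP->.
  by rewrite leq_eqVlt => /orP[/eqP->//|/IH h /dec].
elim: l => [|y l IH] H; first by exists 0.
have [N HN] := IH (fun x i => H x ltac:(by rewrite inE i orbT)).
have [n hn] := H y (mem_head _ _); exists (maxn N n) => x.
rewrite inE => /orP[/eqP->|/HN h] /le h'; first by apply: hn; apply: h'; apply: leq_maxr.
by apply: h; apply: h'; apply: leq_maxl.
Qed.

(** Compactness: for a decreasing property a finite list contains one element that serves all [n],
    by contraposition of [uniform_bound]. *)
Lemma pigeonhole (T : eqType) (l : seq T) (P : nat -> T -> Prop) :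
  (forall n x, P n.+1 x -> P n x) -> (forall n, exists2 x, x \in l & P n x) ->
  exists2 x, x \in l & forall n, P n x.
Proof.
move=> dec H; apply: NNPP => no.
have [|N hN] := @uniform_bound _ l P dec; last by have [x /hN] := H N.
move=> x ix; apply: not_all_ex_not => all; apply: no; by exists x.
Qed.

Lemma least (P : nat -> Prop) : (exists n, P n) -> exists n, P n /\ forall k, P k -> n <= k.
Proof.
move=> H; have ex : exists n, holds (P n) by case: H => n h; exists n; apply/holdsP.
exists (ex_minn ex); case: ex_minnP => n /holdsP h min; split=> // k h'.
by apply: min; apply/holdsP.
Qed.

Lemma count_lt (T : eqType) (p q : pred T) l : {in l, subpred p q} ->
  (exists2 x, x \in l & q x && ~~ p x) -> count p l < count q l.
Proof.
elim: l => [|y l IH] sub [x]; first by [].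
have sub' : {in l, subpred p q} by move=> z iz; apply: sub; rewrite inE iz orbT.
have le : count p l <= count q l.
  elim: (l) sub' => //= z l' IHl s; have := s z (mem_head _ _).
  have /IHl : {in l', subpred p q} by move=> u iu; apply: s; rewrite inE iu orbT.
  by case: (p z) => [le ->//|]; lia.
rewrite inE /= => /orP[/eqP-> /andP[-> /negPf->]|ix h]; first by lia.
have lt := IH sub' (ex_intro2 _ _ x ix h); have := sub y (mem_head _ _).
by case: (p y) => [->//|]; lia.
Qed.

Lemma card_seq_sub_le (T : choiceType) (s : seq T) : #|{: seq_sub s}| <= size s.
Proof.
rewrite cardE -(size_map (@ssval T s)); apply: uniq_leq_size.
  by rewrite map_inj_uniq ?enum_uniq //; apply: val_inj.
by move=> x /mapP[[z iz] _ ->].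
Qed.

Section Graph.
Variables (S : signature) (K1 K2 : kb) (Q : finType) (real : pred Q)
  (tq : Q -> type) (ti : name -> type)
  (EQ : name -> Q -> Q -> Prop) (EI : name -> name -> Q -> Prop) (q0 : Q).
Let cl1 := cl_of K1.
Let cl2 := cl_of K2.
Let types2 := types_of K2.
Let inds := ind K1.
Hypothesis tq_ok : forall q, real q -> okt cl1 (tbox K1) (tq q).
Hypothesis tq_sub : forall q, real q -> tq q \in sublists cl1.
Hypothesis ti_ok : forall a, okt cl1 (tbox K1) (ti a).
Hypothesis ti_sub : forall a, ti a \in sublists cl1.
Hypothesis EQ_real : forall R p q, EQ R p q -> real q.
Hypothesis EI_real : forall R a q, EI R a q -> real q.
Hypothesis EQ_wit : forall q C, real q -> C \in cl1 -> demand C (tq q) ->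
  exists2 q', EQ (role C) q q' & wit cl1 C (tq q) (tq q').
Hypothesis EI_wit : forall a C, C \in cl1 -> demand C (ti a) ->
  exists2 q', EI (role C) a q' & wit cl1 C (ti a) (tq q').
Hypothesis abox_role : forall R a b, RoleAssertion R a b \in abox K1 ->
  compat cl1 R (ti a) (ti b).
Hypothesis abox_atom : forall A a, ConceptAssertion A a \in abox K1 -> Atom A \in ti a.
Hypothesis q0_real : real q0.

Definition gnode := (name + Q)%type.
Definition gtype (x : gnode) := match x with inl a => ti a | inr q => tq q end.
Definition gat A (x : gnode) : Prop := Atom A \in gtype x.
Definition gedge R (x y : gnode) : Prop :=
  match x, y with
  | inl a, inl b => RoleAssertion R a b \in abox K1
  | inl a, inr q => EI R a q
  | inr p, inr q => EQ R p q
  | inr _, inl _ => False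
  end.
Definition gnodes : seq gnode := map inl inds ++ map inr (filter real (enum Q)).

Lemma inl_gnodes a : (inl a \in gnodes) = (a \in inds).
Proof.
rewrite mem_cat mem_map; last by move=> x y [].
by rewrite orbC; case: mapP => // -[].
Qed.

Lemma inr_gnodes q : (inr q \in gnodes) = real q.
Proof.
rewrite mem_cat [X in _ || X]mem_map; last by move=> x y [].
by rewrite mem_filter mem_enum andbT; case: mapP => // -[].
Qed.

Lemma edge_gnodes R x y : gedge R x y -> y \in gnodes.
Proof.
case: x y => [a|p] [b|q] //=; rewrite ?inl_gnodes ?inr_gnodes.
- move=> i; apply/flattenP; exists [:: a; b]; rewrite ?inE ?eqxx ?orbT //.
  by apply/mapP; exists (RoleAssertion R a b).
- exact: EI_real.
- exact: EQ_real.
Qed.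

(** Jumps are decoupled from the depth: their targets are a fixed set [H] of types, which is refined
    only in [stage]. *)
Definition capprox (H : type -> Prop) := approx S K2 gat gedge (fun _ => H).
Definition limit (H : type -> Prop) x t := forall n, capprox H n x t.

Lemma capprox_dec H n x t : capprox H n.+1 x t -> capprox H n x t.
Proof.
elim: n x t => [|n IH] x t [ok W]; first by split.
split=> // C iC dC; have [t' [it' w W']] := W C iC dC; exists t'; split=> //.
by move: W'; case: ifP => // _ [e r /IH h]; exists e.
Qed.

Lemma capprox_jump (H H' : type -> Prop) n x t : (forall t, t \in types2 -> H t -> H' t) ->
  capprox H n x t -> capprox H' n x t.
Proof.
move=> HH; elim: n x t => [|n IH] x t [ok W]; first by split.
split=> // C iC dC; have [t' [it' w W']] := W C iC dC; exists t'; split=> //.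
by move: W'; case: ifP => [_ [e r /IH h]|_ /HH]; [exists e|apply].
Qed.

Lemma limit_unfold H x t : limit H x t -> aok S gat x t /\
  forall C, C \in cl2 -> demand C t -> exists t', [/\ t' \in types2, wit cl2 C t t' &
    if role C \in sig_roles S then exists2 y, gedge (role C) x y & limit H y t'
    else H t'].
Proof.
move=> U; split; first exact: approx_aok (U 0).
move=> C iC dC; case sR: (role C \in sig_roles S); last first.
  by have [_ /(_ C iC dC)[t' [it' w]]] := U 1; rewrite sR => h; exists t'.
pose P n (p : type * gnode) := [/\ wit cl2 C t p.1, gedge (role C) x p.2 & capprox H n p.2 p.1].
have [|n|[t' y] /allpairsP[[t1 y1] /= [it iy [-> ->]]] h] :=
    @pigeonhole _ [seq (t', y) | t' <- types2, y <- gnodes] P.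
- by move=> n p [? ? /capprox_dec ?].
- have [_ /(_ C iC dC)[t' [it' w]]] := U n.+1; rewrite sR => -[y r W].
  exists (t', y); last by [].
  by apply/allpairsP; exists (t', y); split=> //=; apply: edge_gnodes r.
exists t1; have [w r _] := h 0; split=> //; exists y1 => // n.
by case: (h n).
Qed.

(** Decreasing sets of jump targets. A limit over all finite depths is taken before the set shrinks,
    so failure has an ordinal depth below [omega * (L + 1)]; the first stage at which it occurs
    gives the limit part. *)
Fixpoint stage i t : Prop :=
  if i is i.+1 then exists2 x, x \in gnodes & limit (stage i) x t else True.

Notation U i := (limit (stage i)).
Notation L := (size types2).

Lemma stage_dec i t : t \in types2 -> stage i.+1 t -> stage i t.
Proof.
elim: i t => [|i IH] t it; first by [].
case=> x ix u; exists x => // n; apply: capprox_jump (u n) => t' it'; exact: IH.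
Qed.

(** Each unstable round loses one of the [L] types. *)
Lemma stage_stable : exists2 i, i <= L & forall t, t \in types2 -> stage i t -> stage i.+1 t.
Proof.
apply: NNPP => no; pose c i := count (fun t => holds (stage i t)) types2.
have lt i : i <= L -> c i.+1 < c i.
  move=> iL; apply: count_lt => [t it /holdsP h|].
    by apply/holdsP; apply: stage_dec.
  apply: NNPP => nex; apply: no; exists i => // t it h; apply: NNPP => h'.
  by apply: nex; exists t => //; apply/andP; split; [apply/holdsP|apply/negP => /holdsP].
have : forall i, i <= L.+1 -> c i + i <= c 0.
  by elim=> [|i IH] iL; [lia|have := lt i iL; have := IH (ltnW iL); lia].
by move/(_ L.+1 (leqnn _)); have := count_size (fun t => holds (stage 0 t)) types2; rewrite -/(c 0); lia.
Qed.

Lemma uniform_depth : exists n, forall i x t, i <= L -> x \in gnodes -> t \in types2 ->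
  capprox (stage i) n x t -> U i x t.
Proof.
pose P n (p : nat * gnode * type) := capprox (stage p.1.1) n p.1.2 p.2 /\ ~ U p.1.1 p.1.2 p.2.
have [||N hN] := @uniform_bound _ [seq (ix, t) | ix <- [seq (i, x) | i <- iota 0 L.+1, x <- gnodes], t <- types2] P.
- by move=> n p [/capprox_dec].
- move=> [[i x] t] _; apply: NNPP => no; have h n : P n (i, x, t).
    by apply: NNPP => h; apply: no; exists n.
  by have [_] := h 0; apply => n; case: (h n).
exists N => i x t iL ix it W; apply: NNPP => nU; apply: (hN (i, x, t)); last by [].
apply/allpairsP; exists ((i, x), t); split=> //; apply/allpairsP; exists (i, x).
by rewrite mem_iota.
Qed.

Let TH : finType := ('I_L.+1 * 'I_L)%type.
Let Pf : finType := ('I_(size (sublists cl1)) * {set TH} * {set TH})%type.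

Definition setof (F : nat -> type -> Prop) : {set TH} :=
  [set th : TH | holds (F th.1 (nth [::] types2 th.2))].
Definition inset (A : {set TH}) (i : nat) (t : type) :=
  [exists th in A, (th.1 == i :> nat) && (th.2 == index t types2 :> nat)].

Lemma inset_setof F i t : i <= L -> t \in types2 -> inset (setof F) i t <-> F i t.
Proof.
move=> iL it; split.
  case/existsP=> -[j u]; rewrite inE /= => /and3P[/holdsP h /eqP ej /eqP eu].
  by move: h; rewrite ej eu nth_index.
move=> h; have lt : index t types2 < L by rewrite index_mem.
apply/existsP; exists (Ordinal (n := L.+1) iL, Ordinal lt).
rewrite inE /= nth_index // !eqxx !andbT; apply/holdsP; exact: h.
Qed.

(* A profile [(t, U, V)] is realised at [k] by a node of type [t] with limit
   set [U] whose depth-[k] approximation is contained in [V]. *)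
Definition real_by (P : Pf) k q :=
  [/\ real q, tq q = nth [::] (sublists cl1) P.1.1,
    P.1.2 = setof (fun i t => U i (inr q) t) &
    forall i t, i <= L -> t \in types2 -> capprox (stage i) k (inr q) t -> inset P.2 i t].

Lemma profileP q F : real q -> exists P : Pf,
  [/\ tq q = nth [::] (sublists cl1) P.1.1, P.1.2 = setof (fun i t => U i (inr q) t) &
    P.2 = setof F].
Proof.
move/tq_sub => i; have lt := i; rewrite -index_mem in lt.
exists (Ordinal lt, setof (fun i t => U i (inr q) t), setof F).
by rewrite /= nth_index.
Qed.

Variables (M Wd : nat).
Hypothesis HM : #|Pf| <= M.
Hypothesis HW : 2 * M + size inds * (L.+1 * L) + 1 < Wd.
Let N := L.+1 * Wd.

Hypothesis no_embedding : forall i, i <= L ->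
  (forall t, t \in types2 -> stage i t -> stage i.+1 t) ->
  (forall t, t \in types2 -> ~ stage i.+1 t) \/
  forall s : name -> type,
      (forall a, a \in ind K2 -> s a \in types2) ->
      (forall A a, ConceptAssertion A a \in abox K2 -> Atom A \in s a) ->
      (forall R a b, RoleAssertion R a b \in abox K2 ->
          compat cl2 R (s a) (s b)) ->
      (exists R a b, [/\ RoleAssertion R a b \in abox K2, R \in sig_roles S &
          RoleAssertion R a b \notin abox K1]) \/
      exists2 a, a \in ind K2 & ~ U i (inl a) (s a).
Hypothesis ind_sub : {subset ind K2 <= ind K1}.

(** Nodes of the certificate are the individuals and the realised profiles [(t, U, V)]. Within a
    stage, a pair outside [V] is refuted at a depth within the rank of the profile, and its
    refutation descends with the rank. A pair in [V] but outside [U] fails too late for that: it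
    waits while the ranks of the successors fall to 0, whereupon [V] is reset to [U] and the pair
    joins the first group. Counting waiting pairs [M] higher makes the value fall at every step. *)
Lemma graph_cert : inhabited (cert S K1 K2 N).
Proof.
have [n0 Hn0] := uniform_depth.
(* The least depth at which a profile is realised. Minimality makes ranks decrease along [succ]
   until they reach 0. *)
have [rank Hrank] : exists rank : Pf -> nat, forall P, (exists k q, real_by P k q) ->
    (exists q, real_by P (rank P) q) /\ forall k q, real_by P k q -> rank P <= k.
  apply: (choice_fun (P := fun P n => (exists k q, real_by P k q) ->
    (exists q, real_by P n q) /\ forall k q, real_by P k q -> n <= k)) => P.
  case: (classic (exists k q, real_by P k q)) => [[k [q h]]|no]; last by exists 0.
  have [n [hn min]] := least (ex_intro (fun k => exists q, real_by P k q) k (ex_intro _ q h)).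
  by exists n => _; split=> // k' q' h'; apply: min; exists q'.
have [rankI HrankI] : exists rk : name * nat * type -> nat, forall p, ~ U p.1.2 (inl p.1.1) p.2 ->
    ~ capprox (stage p.1.2) (rk p) (inl p.1.1) p.2 /\
    forall k, ~ capprox (stage p.1.2) k (inl p.1.1) p.2 -> rk p <= k.
  apply: (choice_fun (P := fun p n => ~ U p.1.2 (inl p.1.1) p.2 ->
    ~ capprox (stage p.1.2) n (inl p.1.1) p.2 /\
    forall k, ~ capprox (stage p.1.2) k (inl p.1.1) p.2 -> n <= k)) => p.
  case: (classic (U p.1.2 (inl p.1.1) p.2)) => [u|nu]; first by exists 0.
  by have [n [h min]] := least (not_all_ex_not _ _ nu); exists n.
pose PY := {P : Pf | exists k q, real_by P k q}.
pose Y := (seq_sub inds + PY)%type.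
have [wq Hwq] : exists wq : PY -> Q, forall P, real_by (sval P) (rank (sval P)) (wq P).
  by apply: (choice_fun (P := fun (P : PY) q => real_by (sval P) (rank (sval P)) q)) => P; case: (Hrank _ (proj2_sig P)).
pose node (y : Y) : gnode := match y with inl a => inl (ssval a) | inr P => inr (wq P) end.
have nodeG y : node y \in gnodes.
  by case: y => [[a ia]|P]; rewrite ?inl_gnodes ?inr_gnodes //; case: (Hwq P).
(* Depths have no useful bound, but only their order matters: the number of profiles of smaller rank
   stays below [M]. *)
pose rk (P : Pf) := #|[set P' | (rank P' < rank P)]|.
have rkM P : rk P < M.
  apply: leq_trans HM; rewrite /rk -cardsT; apply: proper_card; rewrite properT.
  by apply/eqP=> e; have := in_setT P; rewrite -e inE ltnn.
have rk_lt P P' : rank P' < rank P -> rk P' < rk P.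
  move=> lt; apply: proper_card; apply/properP; split.
    by apply/subsetP => X; rewrite !inE => h; apply: ltn_trans h lt.
  by exists P'; rewrite !inE ?ltnn.
pose BI := (seq_sub inds * TH)%type.
(* The same compression for the named part, over triples of an individual, a stage and a type. *)
pose rI a i t := #|[set x : BI | ~~ holds (U x.2.1 (inl (ssval x.1)) (nth [::] types2 x.2.2)) &&
  (rankI (ssval x.1, x.2.1 : nat, nth [::] types2 x.2.2) < rankI (a, i, t))]|.
have rIW a i t : rI a i t <= size inds * (L.+1 * L).
  apply: leq_trans (max_card _) _; rewrite !card_prod !card_ord leq_mul2r.
  by rewrite card_seq_sub_le orbT.
have rI_lt a i t b t' : a \in inds -> b \in inds -> i <= L -> t' \in types2 ->
    ~ U i (inl b) t' -> rankI (b, i, t') < rankI (a, i, t) -> rI b i t' < rI a i t.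
  move=> ia ib iL it' nu lt; apply: proper_card; apply/properP; split.
    by apply/subsetP => X; rewrite !inE => /andP[-> h] /=; apply: ltn_trans h lt.
  have l' : index t' types2 < L by rewrite index_mem.
  exists (SeqSub ib, (Ordinal (n := L.+1) iL, Ordinal l')); rewrite !inE /= nth_index //.
    by rewrite lt andbT; apply/negP => /holdsP.
  by rewrite ltnn andbF.
(* Value inside a block. An individual lies above [M], since its anonymous successors are entered
   with [V] equal to [U], and a refuted pair there has a value of at most [M]. *)
pose fv (y : Y) i t := match y with
  | inl a => (M + rI (ssval a) i t).+1
  | inr P => (if inset (sval P).2 i t then M + rk (sval P) else rk (sval P)).+1
  end.
have fvW y i t : fv y i t < Wd.
  case: y => [a|P]; apply: leq_ltn_trans HW; rewrite addn1 ltnS /=.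
    by apply: leq_add (rIW (ssval a) i t); lia.
  apply: leq_trans _ (leq_addr _ _); have h := ltnW (rkM (sval P)).
  rewrite mul2n -addnn; case: ifP => _; first by rewrite leq_add2l.
  exact: leq_trans h (leq_addr _ _).
pose first (y : Y) t := find (fun i => ~~ holds (U i (node y) t)) (iota 0 L.+1).
(* The block is given by the first failing stage; pairs that fail at no stage get [N]. *)
pose rho y t := if first y t < L.+1 then first y t * Wd + fv y (first y t) t else N.
have firstP y t : first y t < L.+1 -> ~ U (first y t) (node y) t.
  move=> lt; have : has (fun i => ~~ holds (U i (node y) t)) (iota 0 L.+1).
    by rewrite has_find size_iota.
  by move/(nth_find 0); rewrite nth_iota // add0n => /negP h /holdsP.
have first_le y t i : i <= L -> ~ U i (node y) t -> first y t <= i.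
  move=> iL nu; rewrite leqNgt; apply/negP => /(before_find 0) /negbFE.
  by rewrite nth_iota // => /holdsP.
have rho_lt y t i : i <= L -> ~ U i (node y) t -> rho y t < i.+1 * Wd.
  move=> iL nu; have le := first_le _ _ _ iL nu; rewrite /rho ltnS (leq_trans le iL).
  have := fvW y (first y t) t; have : first y t * Wd <= i * Wd by rewrite leq_mul2r le orbT.
  by rewrite mulSn; lia.
have rho_cmp y y' t t' : first y t < L.+1 -> ~ U (first y t) (node y') t' ->
    fv y' (first y t) t' < fv y (first y t) t -> rho y' t' < rho y t.
  move=> lt nu lt'; have le := first_le _ _ _ lt nu.
  have -> : rho y t = first y t * Wd + fv y (first y t) t by rewrite /rho lt.
  move: le; rewrite leq_eqVlt => /orP[/eqP e|l2].
    by rewrite /rho e lt ltn_add2l.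
  apply: leq_trans (leq_addr _ _); apply: (@leq_trans ((first y' t').+1 * Wd)).
    by apply: rho_lt; [apply: leq_trans (ltnW l2) lt|apply: firstP; apply: ltn_trans l2 lt].
  by rewrite leq_mul2r l2 orbT.
have rhoN y t : rho y t <= N.
  rewrite /rho; case: ifP => // lt; have := fvW y (first y t) t.
  have : (first y t).+1 * Wd <= N by rewrite leq_mul2r lt orbT.
  by rewrite mulSn; lia.
pose sfirst t := find (fun j => ~~ holds (stage j t)) (iota 0 L.+2).
(* A type excluded from stage [j.+1] fails at stage [j] at all nodes, so every rank of it lies below
   [j.+1 * Wd]. The predecessor turns this into a bound by [<=]. *)
pose g t := if sfirst t < L.+2 then (sfirst t * Wd).-1 else N.
have sfirst_le t i : i <= L.+1 -> ~ stage i t -> sfirst t <= i.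
  move=> iL nu; rewrite leqNgt; apply/negP => /(before_find 0) /negbFE.
  by rewrite nth_iota // => /holdsP.
have sfirstP t : sfirst t < L.+2 -> ~ stage (sfirst t) t.
  move=> lt; have : has (fun j => ~~ holds (stage j t)) (iota 0 L.+2).
    by rewrite has_find size_iota.
  by move/(nth_find 0); rewrite nth_iota // add0n => /negP h /holdsP.
have g_lt t i : i <= L.+1 -> ~ stage i t -> g t < i * Wd.
  move=> iL ns; have le := sfirst_le _ _ iL ns; rewrite /g ltnS (leq_trans le iL).
  have : sfirst t * Wd <= i * Wd by rewrite leq_mul2r le orbT.
  have : 0 < sfirst t.
    by have := sfirstP t; case: (sfirst t) => //= /(_ isT).
  by case: (sfirst t) => // j _; rewrite mulSn; lia.
have rho_g y t : rho y t <= g t.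
  rewrite /g; case: ifP => [lt|_]; last exact: rhoN.
  have := sfirstP _ lt; case: (sfirst t) lt => [|j] lt ns; first by case: ns.
  have := rho_lt y t j lt; rewrite mulSn => h.
  have : rho y t < Wd + j * Wd by apply: h => u; apply: ns; exists (node y).
  by lia.
pose tau y := gtype (node y).
(* A profile of rank [k.+1] hands on the depth-[k] approximation; at rank 0 the countdown restarts
   with [V] equal to [U]. *)
pose succ R (y y' : Y) : Prop := match y, y' with
  | inl a, inl b => RoleAssertion R (ssval a) (ssval b) \in abox K1
  | inl a, inr P => exists q, [/\ EI R (ssval a) q, real q, tq q = nth [::] (sublists cl1) (sval P).1.1,
      (sval P).1.2 = setof (fun i t => U i (inr q) t) & (sval P).2 = setof (fun i t => U i (inr q) t)]
  | inr P0, inr P => exists q, [/\ EQ R (wq P0) q, real q, tq q = nth [::] (sublists cl1) (sval P).1.1,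
      (sval P).1.2 = setof (fun i t => U i (inr q) t) &
      if rank (sval P0) is k.+1 then (sval P).2 = setof (fun i t => capprox (stage i) k (inr q) t)
      else (sval P).2 = setof (fun i t => U i (inr q) t)]
  | inr _, inl _ => False
  end.
have tauP P : tau (inr P) = tq (wq P) by [].
have UP (P : PY) i t : i <= L -> t \in types2 ->
    (forall q, (sval P).1.2 = setof (fun i t => U i (inr q) t) -> U i (inr q) t -> U i (inr (wq P)) t).
  move=> iL it q e u; have [_ _ e' _] := Hwq P.
  by apply/(inset_setof (fun i t => U i (inr (wq P)) t) iL it); rewrite -e' e; apply/inset_setof.
(* A reason for the refutation of [t] at [y] that all successors respect. *)
have why_ex (y : Y) t : t \in types2 -> first y t < L.+1 -> mism S (tau y) t \/
    exists C, [/\ C \in cl2, demand C t,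
      role C \notin sig_roles S -> forall t', t' \in types2 -> wit cl2 C t t' -> ~ stage (first y t) t' &
      role C \in sig_roles S -> forall t', t' \in types2 -> wit cl2 C t t' -> forall y', succ (role C) y y' ->
        ~ U (first y t) (node y') t' /\ fv y' (first y t) t' < fv y (first y t) t].
  move=> it lt; have nu := firstP _ _ lt; set i := first y t in lt nu *.
  have iL : i <= L by [].
  case: (classic (mism S (tau y) t)) => [|nm]; [by left|right].
  have ok : aok S gat (node y) t.
    move=> A iA sA; apply: NNPP => nA; apply: nm; exists A; split=> //.
    by apply/negP.
  (* [key k]: refutation of [t] at depth [k.+1] *)
  have key k : ~ capprox (stage i) k.+1 (node y) t -> exists C, [/\ C \in cl2, demand C t,
      role C \notin sig_roles S -> forall t', t' \in types2 -> wit cl2 C t t' -> ~ stage i t' &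
      role C \in sig_roles S -> forall t', t' \in types2 -> wit cl2 C t t' ->
        forall x, gedge (role C) (node y) x -> ~ capprox (stage i) k x t'].
    move=> nW; apply: NNPP => no; apply: nW; split=> // C iC dC; apply: NNPP => no'.
    apply: no; exists C; split=> // sR t' it' w.
      by move=> h; apply: no'; exists t'; rewrite (negPf sR).
    by move=> x r W; apply: no'; exists t'; rewrite sR; split=> //; exists x.
  (* One demand defeats the limit at all successors: otherwise every demand had a successor in the
     limit or an admissible jump, and the pair itself would belong to the limit. *)
  have keyU : exists C, [/\ C \in cl2, demand C t,
      role C \notin sig_roles S -> forall t', t' \in types2 -> wit cl2 C t t' -> ~ stage i t' &
      role C \in sig_roles S -> forall t', t' \in types2 -> wit cl2 C t t' ->
        forall x, gedge (role C) (node y) x -> ~ U i x t'].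
    have [k nW] := not_all_ex_not _ _ nu.
    have /key[C [iC dC h1 h2]] : ~ capprox (stage i) k.+1 (node y) t by move/capprox_dec.
    apply: NNPP => no; apply: nu => n.
    elim: n => [|n _]; first by split.
    split=> // D iD dD; apply: NNPP => no'; apply: no; exists D; split=> // sR t' it' w.
      by move=> h; apply: no'; exists t'; rewrite (negPf sR).
    by move=> x r u; apply: no'; exists t'; rewrite sR; split=> //; exists x => //; apply: u.
  case: y @i lt nu ok iL key keyU nm => [a|P] i lt nu ok iL key keyU nm.
  - have [r1 r2] := HrankI (ssval a, i, t) nu; rewrite /= in r1 r2.
    case Ek : (rankI (ssval a, i, t)) r1 => [|k] r1; first by case: r1.
    have [C [iC dC h1 h2]] := key k r1; exists C; split=> // sR t' it' w [b|P] /=.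
      move=> i'; have nW := h2 sR t' it' w (inl (ssval b)) i'.
      have nU : ~ U i (inl (ssval b)) t' by move=> u; apply: nW.
      split=> //; rewrite ltnS ltn_add2l; apply: rI_lt => //; try exact: ssvalP.
      have [_ min] := HrankI (ssval b, i, t') nU.
      by rewrite Ek ltnS; apply: min.
    case=> q [r rq eq1 eq2 eq3]; have nW := h2 sR t' it' w (inr q) r.
    have nU : ~ U i (inr q) t' by move=> u; apply: nW.
    split; first by move=> u; apply: nU; have [_ _ e' _] := Hwq P;
      apply/(inset_setof (fun i t => U i (inr q) t) iL it'); rewrite -eq2 e'; apply/inset_setof.
    rewrite ltnS; case: ifP => [|_]; last by apply: leq_trans (rkM _) (leq_addr _ _).
    by rewrite eq3 => /(inset_setof _ iL it').
  - have [rq eq1 eq2 hV] := Hwq P.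
    have nUc q' (P' : PY) t' : t' \in types2 -> (sval P').1.2 = setof (fun i t => U i (inr q') t) ->
        ~ U i (inr q') t' -> ~ U i (inr (wq P')) t'.
      move=> it' e n u; apply: n; have [_ _ e' _] := Hwq P'.
      by apply/(inset_setof (fun i t => U i (inr q') t) iL it'); rewrite -e e'; apply/inset_setof.
    have rle (P' : PY) q' k : real q' -> tq q' = nth [::] (sublists cl1) (sval P').1.1 ->
       (sval P').1.2 = setof (fun i t => U i (inr q') t) ->
       (sval P').2 = setof (fun i t => capprox (stage i) k (inr q') t) -> rank (sval P') <= k.
      move=> h1 h2 h3 h4; have [_ min] := Hrank _ (proj2_sig P').
      apply: (min k q'); split=> // i' t' iL' it' W; rewrite h4.
      by apply/(inset_setof (fun i t => capprox (stage i) k (inr q') t) iL' it').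
    (* A waiting pair: what the successors inherit is only its exclusion from [U]. *)
    case iV: (inset (sval P).2 i t).
      have [C [iC dC h1 h2]] := keyU; exists C; split=> // sR t' it' w [b|P'] //= [q [r rq' e1 e2 e3]].
      have nU := h2 sR t' it' w (inr q) r; split; first exact: nUc e2 nU.
      rewrite iV ltnS; case: (rank (sval P)) {hV} (rk_lt (sval P) (sval P')) e3 => [|k] lt' e3.
        case: ifP => [|_]; last by apply: leq_trans (rkM _) (leq_addr _ _).
        by rewrite e3 => /(inset_setof _ iL it').
      have l2 : rk (sval P') < rk (sval P) by apply: lt'; rewrite ltnS; apply: rle e1 e2 e3.
      by case: ifP => _; [rewrite ltn_add2l|apply: leq_trans l2 (leq_addl _ _)].
    case Ek : (rank (sval P)) hV => [|k] hV.
      (* At rank 0 every pair without a mismatch lies in [V], so a pair outside [V] has positive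
         rank. *)
      by have := hV i t iL it; rewrite iV => h; have := h (conj ok I).
    have nW : ~ capprox (stage i) k.+1 (node (inr P)) t.
      by move=> W; have := hV i t iL it W; rewrite iV.
    have [C [iC dC h1 h2]] := key k nW; exists C; split=> // sR t' it' w [b|P'] //= [q [r rq' e1 e2 e3]].
    rewrite Ek in e3; have nW' := h2 sR t' it' w (inr q) r.
    split; first by apply: nUc e2 _ => // u; apply: nW'.
    rewrite iV ltnS; case: ifP => [|_]; first by rewrite e3 => /(inset_setof _ iL it').
    by apply: rk_lt; rewrite Ek ltnS; apply: rle e1 e2 e3.
have [why Hwhy] : exists why : Y * type -> concept, forall p, p.2 \in types2 -> first p.1 p.2 < L.+1 ->
    ~ mism S (tau p.1) p.2 -> let C := why p in let i := first p.1 p.2 in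
    [/\ C \in cl2, demand C p.2,
      role C \notin sig_roles S -> forall t', t' \in types2 -> wit cl2 C p.2 t' -> ~ stage i t' &
      role C \in sig_roles S -> forall t', t' \in types2 -> wit cl2 C p.2 t' -> forall y', succ (role C) p.1 y' ->
        ~ U i (node y') t' /\ fv y' i t' < fv p.1 i p.2].
  apply: (choice_fun (P := fun p C => p.2 \in types2 -> first p.1 p.2 < L.+1 ->
    ~ mism S (tau p.1) p.2 -> let i := first p.1 p.2 in [/\ C \in cl2, demand C p.2,
      role C \notin sig_roles S -> forall t', t' \in types2 -> wit cl2 C p.2 t' -> ~ stage i t' &
      role C \in sig_roles S -> forall t', t' \in types2 -> wit cl2 C p.2 t' -> forall y', succ (role C) p.1 y' ->
        ~ U i (node y') t' /\ fv y' i t' < fv p.1 i p.2])) => -[y t] /=.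
  case: (classic (t \in types2 /\ first y t < L.+1 /\ ~ mism S (tau y) t)) => [[it [lt nm]]|no].
    by case: (why_ex y t it lt) => // -[C h]; exists C.
  by exists Top => it lt nm; case: no.
have rho_first y t : rho y t < N -> first y t < L.+1.
  by rewrite /rho; case: ifP => //; rewrite ltnn.
have mkP q F : real q -> (exists k, forall i t, i <= L -> t \in types2 ->
      capprox (stage i) k (inr q) t -> F i t) ->
    exists P : PY, [/\ tq q = nth [::] (sublists cl1) (sval P).1.1,
      (sval P).1.2 = setof (fun i t => U i (inr q) t) & (sval P).2 = setof F].
  move=> rq [k hk]; have [P [e1 e2 e3]] := profileP F rq.
  have h : exists k q, real_by P k q.
    exists k, q; split=> // i t iL it W; rewrite e3; apply/(inset_setof F iL it); exact: hk.
  by exists (exist _ P h).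
have mkU q : real q -> exists k, forall i t, i <= L -> t \in types2 ->
      capprox (stage i) k (inr q) t -> U i (inr q) t.
  by move=> rq; exists n0 => i t iL it; apply: Hn0 => //; rewrite inr_gnodes.
have [P0 _] := mkP q0 (fun i t => U i (inr q0) t) q0_real (mkU _ q0_real).
pose y0 a : Y := if insub a is Some b then inl b else inr P0.
have y0E a (ia : a \in inds) : y0 a = inl (SeqSub ia).
  by rewrite /y0 insubT.
have tau_q (P : PY) q : tq q = nth [::] (sublists cl1) (sval P).1.1 -> tau (inr P) = tq q.
  by move=> e; rewrite tauP e; case: (Hwq P).
have [ch Hch] : exists ch : Y * concept -> Y, forall p, p.2 \in cl1 -> demand p.2 (tau p.1) ->
    wit cl1 p.2 (tau p.1) (tau (ch p)) /\ succ (role p.2) p.1 (ch p).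
  apply: (choice_fun (P := fun p y => p.2 \in cl1 -> demand p.2 (tau p.1) ->
    wit cl1 p.2 (tau p.1) (tau y) /\ succ (role p.2) p.1 y)) => -[y C] /=.
  case: (classic (C \in cl1 /\ demand C (tau y))) => [[iC dC]|no]; last first.
    by exists (inr P0) => iC dC; case: no.
  case: y dC => [a|P] dC.
    have [q r w] := EI_wit iC dC; have rq := EI_real r.
    have [P [e1 e2 e3]] := mkP q _ rq (mkU _ rq).
    by exists (inr P) => _ _; rewrite (tau_q _ _ e1); split=> //; exists q.
  have [rP _ _ _] := Hwq P; have [q r w] := EQ_wit rP iC dC; have rq := EQ_real r.
  case Ek: (rank (sval P)) => [|k].
    have [P' [e1 e2 e3]] := mkP q _ rq (mkU _ rq).
    by exists (inr P') => _ _; rewrite (tau_q _ _ e1); split=> //; exists q; rewrite Ek.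
  have [P' [e1 e2 e3]] := mkP q (fun i t => capprox (stage i) k (inr q) t) rq (ex_intro _ k (fun i t _ _ W => W)).
  by exists (inr P') => _ _; rewrite (tau_q _ _ e1); split=> //; exists q; rewrite Ek.
have succ_ok R y y' : succ R y y' -> R \in sig_roles S -> forall t, t \in types2 ->
    rho y t < N -> ~ mism S (tau y) t -> role (why (y, t)) = R ->
    forall t', t' \in types2 -> wit cl2 (why (y, t)) t t' -> rho y' t' < rho y t.
  move=> sc sR t it lt nm eR t' it' w; have fL := rho_first _ _ lt.
  have /= [_ _ _ h] := Hwhy (y, t) it fL nm; rewrite eR in h.
  by have [nu lt'] := h sR t' it' w _ sc; apply: rho_cmp.
have ind1 R a b : RoleAssertion R a b \in abox K1 -> (a \in inds) /\ (b \in inds).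
  by move=> i; split; apply/flattenP; exists [:: a; b]; rewrite ?inE ?eqxx ?orbT //;
    apply/mapP; exists (RoleAssertion R a b).
apply: inhabits; apply: (@Cert S K1 K2 N Y tau rho (fun y t => why (y, t)) (fun y C => ch (y, C)) y0 g).
- case=> [a|P]; first by apply/andP; split; [apply: ti_ok|apply: ti_sub].
  by rewrite tauP; case: (Hwq P) => rP _ _ _; apply/andP; split; [apply: tq_ok|apply: tq_sub].
- move=> y C iC dC; have [w sc] := Hch (y, C) iC dC; split=> //.
  exact: succ_ok.
- move=> R a b i; have [ia ib] := ind1 _ _ _ i; rewrite !(y0E _ ia) !(y0E _ ib); split.
    exact: abox_role i.
  exact: succ_ok.
- move=> A a i; have ia : a \in inds.
    by apply/flattenP; exists [:: a]; rewrite ?mem_head //; apply/mapP; exists (ConceptAssertion A a).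
  by rewrite (y0E _ ia); apply: abox_atom i.
- move=> y t it lt; case: (classic (mism S (tau y) t)) => [|nm]; [by left|right].
  have fL := rho_first _ _ lt; have /= [iC dC h _] := Hwhy (y, t) it fL nm.
  have rE : rho y t = first y t * Wd + fv y (first y t) t by rewrite /rho fL.
  split=> //; last first.
    move=> sR t' it' w; apply: leq_trans (g_lt _ _ _ (h sR t' it' w)) _; first by apply: ltnW.
    by rewrite rE leq_addr.
  by rewrite rE addn_gt0; apply/orP; right; case: (y).
- by move=> y t _; apply: rho_g.
(* At a stable stage either no type survives, and then [g] is below [N] everywhere, or the failure
   is to be found at the individuals. *)
- have [i iL st] := stage_stable; case: (no_embedding iL st) => [h|h].
    left=> t it; apply: leq_trans (g_lt t i.+1 _ (h t it)) _ => //.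
    by rewrite leq_mul2r ltnS iL orbT.
  right=> s hs ha hr; case: (h s hs ha hr) => [|[a ia nu]]; [by left|right].
  exists a => //; rewrite (y0E _ (ind_sub ia)).
  by apply: leq_trans (rho_lt (inl (SeqSub (ind_sub ia))) _ _ iL nu) _; rewrite leq_mul2r ltnS iL orbT.
Qed.
End Graph.


(** * Finite quotients of a countermodel *)

Section Quotient.
Variables (S : signature) (K1 : kb) (I : interp).
Let cl1 := cl_of K1.
Let Rs := sig_roles S.

(** Successors are recorded for roles of the signature only: edges along other roles are never
    lifted to the model. *)
Fixpoint cls k : finType :=
  if k is k.+1 then ((size cl1).-tuple bool * {set 'I_(size Rs) * cls k})%type
  else (size cl1).-tuple bool.

Definition mask_of (d : elt I) : (size cl1).-tuple bool :=
  map_tuple (fun C => holds (ext C d)) (in_tuple cl1).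

(* The class of [d] under [k]-step bisimilarity. *)
Fixpoint cls_of k (d : elt I) : cls k :=
  if k is k'.+1 return cls k then
    (mask_of d, [set p : 'I_(size Rs) * cls k' |
       holds (exists2 e, rint (nth [::] Rs p.1) d e & cls_of k' e = p.2)])
  else mask_of d.

Lemma cls_mask k d d' : cls_of k d = cls_of k d' -> mask_of d = mask_of d'.
Proof. by case: k => [|k] // /(congr1 fst). Qed.

Lemma cls_typeof k d d' : cls_of k d = cls_of k d' -> typeof cl1 d = typeof cl1 d'.
Proof.
move/cls_mask/(congr1 val) => /= /eq_in_map e; exact: eq_in_filter.
Qed.

Lemma cls_lift k R d d' e : cls_of k.+1 d = cls_of k.+1 d' -> R \in Rs ->
  rint R d e -> exists2 e', rint R d' e' & cls_of k e' = cls_of k e.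
Proof.
case=> _ /setP es iR r; have lt : index R Rs < size Rs by rewrite index_mem.
have := es (Ordinal lt, cls_of k e); rewrite !inE /= nth_index // => h.
have : holds (exists2 e0, rint R d e0 & cls_of k e0 = cls_of k e).
  by apply/holdsP; exists e.
by rewrite h => /holdsP.
Qed.

Lemma cls_down k d d' : cls_of k.+1 d = cls_of k.+1 d' -> cls_of k d = cls_of k d'.
Proof.
elim: k d d' => [|k IH] d d' H; first exact: cls_mask H.
have em := cls_mask H; rewrite /= em; congr pair; apply/setP => -[R c]; rewrite !inE /=.
have iR : nth [::] Rs R \in Rs by apply: mem_nth.
apply/holdsP/holdsP => -[e r <-].
  by have [e' r' e1] := cls_lift H iR r; exists e' => //; apply: IH.
by have [e' r' e1] := cls_lift (esym H) iR r; exists e' => //; apply: IH.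
Qed.

Lemma cls_le j k d d' : j <= k -> cls_of k d = cls_of k d' -> cls_of j d = cls_of j d'.
Proof.
elim: k => [|k IH]; first by rewrite leqn0 => /eqP->.
by rewrite leq_eqVlt => /orP[/eqP->//|/IH h /cls_down].
Qed.

End Quotient.

Section Countermodel.
Variables (S : signature) (K1 K2 : kb) (I : interp) (m : nat).
Let cl1 := cl_of K1.
Let cl2 := cl_of K2.
Let Q := cls S K1 m.
Notation cm := (@cls_of S K1 I).
Hypothesis mod : model I K1.
Hypothesis ind_sub : {subset ind K2 <= ind K1}.

Definition qreal (p : Q) : bool := holds (exists d, cm m d = p).
Definition qrep (p : Q) : elt I := epsilon (inhabits (named I [::])) (fun d => cm m d = p).
Definition qtype (p : Q) : type := typeof cl1 (qrep p).
Definition qedge R (p p' : Q) := exists d e, [/\ cm m d = p, cm m e = p' & rint R d e].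
Definition qedgeI R a (p : Q) := exists2 e, cm m e = p & rint R (named I a) e.

Lemma qrepP p : qreal p -> cm m (qrep p) = p.
Proof. by move/holdsP; apply: epsilon_spec. Qed.

Lemma qrep_cls d : cm m (qrep (cm m d)) = cm m d.
Proof. by apply: qrepP; apply/holdsP; exists d. Qed.

Lemma qtype_cls d : qtype (cm m d) = typeof cl1 d.
Proof. exact: cls_typeof (qrep_cls d). Qed.

Lemma typeof_model K (J : interp) (d : elt J) : model J K -> okt (cl_of K) (tbox K) (typeof (cl_of K) d).
Proof.
case=> mT _; apply: typeof_okt => [|C D|C D i]; [exact: cl_of_closed|exact: cl_of_tbox|exact: mT].
Qed.

Notation gn := (gnode Q).
Notation ged := (gedge K1 qedge qedgeI).
Notation gns := (gnodes K1 qreal).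
Notation stg := (stage S K1 K2 qreal qtype (fun a => typeof cl1 (named I a)) qedge qedgeI).
Notation lim := (limit S K1 K2 qtype (fun a => typeof cl1 (named I a)) qedge qedgeI).

Section Embedding.
Variables (i : nat) (s : name -> type) (t0 : type) (x0 : gn).
Notation U := (lim (stg i)).
Hypothesis stable : forall t, t \in types_of K2 -> stg i t -> stg i.+1 t.
Hypothesis t0_in : t0 \in types_of K2.
Hypothesis x0_in : x0 \in gns.
Hypothesis U0 : U x0 t0.
Hypothesis s_in : forall a, a \in ind K2 -> s a \in types_of K2.
Hypothesis s_atom : forall A a, ConceptAssertion A a \in abox K2 -> Atom A \in s a.
Hypothesis s_role : forall R a b, RoleAssertion R a b \in abox K2 -> compat cl2 R (s a) (s b).
Hypothesis s_sig : forall R a b, RoleAssertion R a b \in abox K2 -> R \in sig_roles S ->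
  RoleAssertion R a b \in abox K1.
Hypothesis s_U : forall a, a \in ind K2 -> U (inl a) (s a).

Let Y := {p : type * gn | [/\ p.1 \in types_of K2, p.2 \in gns & U p.2 p.1]}.
Let tau (y : Y) := (sval y).1.
Let node (y : Y) := (sval y).2.

Lemma embedding_step : exists ch : Y * concept -> Y, forall y C, C \in cl2 -> demand C (tau y) ->
  wit cl2 C (tau y) (tau (ch (y, C))) /\
  (role C \in sig_roles S -> ged (role C) (node y) (node (ch (y, C)))).
Proof.
suff H (p : Y * concept) : exists y', p.2 \in cl2 -> demand p.2 (tau p.1) ->
    wit cl2 p.2 (tau p.1) (tau y') /\
    (role p.2 \in sig_roles S -> ged (role p.2) (node p.1) (node y')).
  by have [ch Hch] := choice_fun H; exists ch => y C iC dC; apply: (Hch (y, C)).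
case: p => y C /=; case: (classic (C \in cl2 /\ demand C (tau y))) => [[iC dC]|no]; last first.
  by exists y => iC dC; case: no.
have [it ix u] := proj2_sig y.
have er R p q : qedge R p q -> qreal q by case=> d [e [_ <- _]]; apply/holdsP; exists e.
have ei R a q : qedgeI R a q -> qreal q by case=> e <- _; apply/holdsP; exists e.
have [_ /(_ C iC dC)[t' [it' w]]] := limit_unfold er ei u.
case sR: (role C \in sig_roles S).
  case=> x r ux; have ix' := edge_gnodes er ei r.
  by exists (exist _ (t', x) (And3 it' ix' ux)).
(* Stability is used for jumps: a type in stage [i] is also in stage [i.+1], hence some node has it
   in its limit. *)
move=> h; have [x ix' ux] := stable it' h.
by exists (exist _ (t', x) (And3 it' ix' ux)).
Qed.

(** A stable stage that embeds the second knowledge base in the quotient yields a model of it, an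
    unravelling over pairs of a type and a node. The query holds there and has to be pulled back to
    [I] itself. To this end the unravelling is cut at every [m.+1]-st level, avoiding the few levels
    that carry variables; between cuts [m]-step bisimilarity suffices to follow the edges in [I]. *)
Lemma embedding_query q a : ucq_over S q -> {subset a <= ind K2} -> certain K2 q a ->
  (forall phi, phi \in disjuncts q -> 2 * size phi <= m) -> sat_ucq I q a.
Proof.
move=> over sub cert szm; have [ch Hch] := embedding_step.
pose yd : Y := exist _ (t0, x0) (And3 t0_in x0_in U0).
have ig b : b \in ind K2 -> (inl b : gn) \in gns by move/ind_sub; rewrite inl_gnodes.
have [y0 Hy0] : exists y0 : name -> Y, forall b, b \in ind K2 -> sval (y0 b) = (s b, inl b).
  apply: (choice_fun (P := fun b (y : Y) => b \in ind K2 -> sval y = (s b, inl b))) => b.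
  case: (boolP (b \in ind K2)) => [ib|_]; last by exists yd.
  by exists (exist _ (s b, inl b) (And3 (s_in ib) (ig b ib) (s_U ib))).
pose I2 := unravel K2 tau (fun y C => ch (y, C)) y0.
pose lab : elt I2 -> Y := ulab (fun y C => ch (y, C)) y0.
have indR R b c : RoleAssertion R b c \in abox K2 -> (b \in ind K2) /\ (c \in ind K2).
  by move=> h; split; apply/flattenP; exists [:: b; c]; rewrite ?inE ?eqxx ?orbT //;
    apply/mapP; exists (RoleAssertion R b c).
have tau0 b : b \in ind K2 -> tau (y0 b) = s b by move=> ib; rewrite /tau Hy0.
have mod2 : model I2 K2.
  apply: unravel_model.
  - by move=> y; have [] := proj2_sig y; rewrite mem_filter => /andP[].
  - by move=> y C iC dC; case: (Hch y C iC dC).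
  - by move=> R b c h; have [ib ic] := indR _ _ _ h; rewrite !tau0 //; apply: s_role.
  - move=> A b h; rewrite tau0; first exact: s_atom.
    by apply/flattenP; exists [:: b]; rewrite ?mem_head //; apply/mapP; exists (ConceptAssertion A b).
have /ucq_satP[phi iphi [v ev hv]] := cert _ mod2.
pose vars := flatten [seq (match x with ConceptAtom _ z => [:: z] | RoleAtom _ z z' => [:: z; z'] end) | x <- phi].
have szv : size vars <= m.
  apply: leq_trans (szm _ iphi); rewrite /vars; elim: (phi) => //= x l IH.
  by rewrite size_cat; case: x => /= *; lia.
pose depth (x : elt I2) := size (upath x).2.
(* There are [m.+1] residues and at most [m] variables, so some residue class of levels is free of
   variables. *)
have [r rm Hr] : exists2 r, r < m.+1 & forall z, z \in vars -> (depth (v z) + r) %% m.+1 != 0.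
  pose bad := [seq (m.+1 - depth (v z) %% m.+1) %% m.+1 | z <- vars].
  have [r /andP[ir nr]] : exists r, (r \in iota 0 m.+1) && (r \notin bad).
    apply: NNPP => no; have : size (iota 0 m.+1) <= size bad.
      apply: uniq_leq_size (iota_uniq _ _) _ => r ir; apply: NNPP => nr; apply: no.
      by exists r; rewrite ir; apply/negP.
    by rewrite size_iota size_map; lia.
  rewrite mem_iota add0n /= in ir; exists r => // z iz; apply/negP => /eqP e.
  case/negP: nr; apply/mapP; exists z => //.
  rewrite -modnDml in e; have l2 : depth (v z) %% m.+1 < m.+1 by rewrite ltn_mod.
  move: (depth (v z) %% m.+1) e l2 => c e l2.
  case: c e l2 => [|c] e l2; first by rewrite subn0 modnn; rewrite add0n modn_small in e.
  rewrite modn_small; last by lia.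
  have : m.+1 %| c.+1 + r by apply/eqP.
  by move/dvdnP=> [k]; case: k => [|[|k]]; nia.
(* Remaining precision: [m] on a cut level, one less for each level below it. *)
pose prec (n : nat) := m - (n + r) %% m.+1.
(* At a cut a successor of sufficient precision need not exist; the representative of the class then
   restarts the map, and the edge may be lost. *)
pose pick j R d (x : gn) : elt I := match x with
  | inl b => named I b
  | inr p => if excluded_middle_informative (exists e, rint R d e /\ cm j e = cm j (qrep p))
      is left _ then epsilon (inhabits d) (fun e => rint R d e /\ cm j e = cm j (qrep p)) else qrep p
  end.
pose psi0 b p := (fix psi0 (p : seq concept) : elt I := if p is C :: p' then
    pick (prec (size p)) (role C) (psi0 p') (node (lab (inr (b, C, p'))))
  else match node (y0 b) with inl c => named I c | inr q => qrep q end) p.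
pose psi (x : elt I2) := psi0 (upath x).1 (upath x).2.
have pickP j R d p : cm j (pick j R d (inr p)) = cm j (qrep p).
  rewrite /pick; case: excluded_middle_informative => // h.
  by have [] := epsilon_spec (inhabits d) (fun e => rint R d e /\ cm j e = cm j (qrep p)) h.
have inv x : match node (lab x) with inl b => psi x = named I b
    | inr p => cm (prec (depth x)) (psi x) = cm (prec (depth x)) (qrep p) end.
  case: x => [b|[[b C] p]]; rewrite /psi /=.
    by rewrite /lab /ulab /=; case: (node (y0 b)).
  case: (node _) => [c|p'] //; exact: pickP.
have edge x C : C \in cl2 -> demand C (tau (lab x)) -> role C \in sig_roles S ->
    (depth (uchild x C) + r) %% m.+1 != 0 -> rint (role C) (psi x) (psi (uchild x C)).
  move=> iC dC sR nz.
  have [_ /(_ sR)] := Hch (lab x) C iC dC.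
  have lc : lab (uchild x C) = ch (lab x, C) by apply: ulab_child.
  have psiE : psi (uchild x C) = pick (prec (depth (uchild x C))) (role C) (psi x) (node (lab (uchild x C))).
    by [].
  rewrite -lc psiE; have := inv x; case: (node (lab x)) => [b|p]; case: (node (lab (uchild x C))) => [c|p'] //=.
  - move=> -> i1; case: mod => _ /(_ (RoleAssertion (role C) b c)); apply; exact/in_listP.
  - move=> -> [e ee re]; case: excluded_middle_informative => [h|]; last first.
      case; exists e; split=> //; apply: (@cls_le _ _ _ _ m); first exact: leq_subr.
      by rewrite -ee qrep_cls.
    by have [] := epsilon_spec (inhabits (named I b)) _ h.
  - move=> ip [d [e [ed ee re]]]; case: excluded_middle_informative => [h|]; last first.
      set j := prec (depth (uchild x C)) in nz *.
      (* Off a cut the residue grows without wrapping around, so the parent has exactly one more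
         step of precision. *)
      have jx : prec (depth x) = j.+1.
        rewrite /j /prec; have -> : depth (uchild x C) = (depth x).+1 by [].
        have : (depth x + r) %% m.+1 < m.+1 by rewrite ltn_mod.
        move: nz; rewrite (_ : depth (uchild x C) + r = (depth x + r).+1) //.
        have : (depth x + r).+1 %% m.+1 < m.+1 by rewrite ltn_mod.
        by rewrite modnS; case: ifP => // _; lia.
      rewrite jx in ip; case.
      have e1 : cm j.+1 d = cm j.+1 (psi x).
        rewrite ip; apply: (@cls_le _ _ _ _ m); first by rewrite -jx leq_subr.
        by rewrite -ed qrep_cls.
      have [e' r' e2] := cls_lift e1 sR re; exists e'; split=> //; rewrite e2.
      by apply: (@cls_le _ _ _ _ m); [exact: leq_subr|rewrite -ee qrep_cls].
    by have [] := epsilon_spec (inhabits (psi x)) _ h.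
have psi_ind b : b \in ind K2 -> psi (inl b) = named I b.
  by move=> ib; rewrite /psi /= /node Hy0.
apply/ucq_satP; exists phi => //; exists (psi \o v).
  rewrite map_comp ev -map_comp; apply/eq_in_map => b /sub ib; exact: psi_ind.
move=> x ix; have ox : atom_over S x by apply: (over phi); apply/in_listP.
have vx z : z \in match x with ConceptAtom _ z => [:: z] | RoleAtom _ z z' => [:: z; z'] end -> z \in vars.
  move=> iz; apply/flattenP; eexists; last exact: iz.
  by apply/mapP; exists x.
case: x ix ox vx => [A z|R z z'] ix /= ox vx.
  have /= := hv _ ix; rewrite -/(lab (v z)) => iA.
  have [_ _ u] := proj2_sig (lab (v z)); have ok := approx_aok (u 0) iA ox.
  have := inv (v z); move: ok; rewrite /gat -/(node (lab (v z))); case: (node (lab (v z))) => [b|p] /=.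
    by rewrite mem_filter => /andP[/holdsP h _] ->.
  move=> h /cls_typeof e; by move: h; rewrite /qtype -e mem_filter => /andP[/holdsP].
have /= := hv _ ix; case=> [[b [c [-> -> h]]]|[C [ez' iC dC eR]]].
  have [ib ic] := indR _ _ _ h; rewrite !psi_ind //.
  by case: mod => _ /(_ (RoleAssertion R b c)); apply; apply/in_listP; apply: s_sig.
rewrite ez' -eR; apply: edge => //; first by rewrite eR.
by rewrite -ez'; apply: Hr; apply: vx; rewrite !inE eqxx orbT.
Qed.
End Embedding.
End Countermodel.

Lemma card_sets (T : finType) : #|{set T}| = 2 ^ #|T|.
Proof. by rewrite -[LHS]cardsT -powersetT card_powerset cardsT. Qed.

(** The query enters only through the depth of bisimilarity, and the number of classes does not
    enter the bound. [M] counts profiles: a type of the first knowledge base and two sets of pairs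
    of a stage and a type. *)
Lemma not_entails_cert S K1 K2 M Wd :
  let L := size (types_of K2) in
  size (sublists (cl_of K1)) * (2 ^ (L.+1 * L)) ^ 2 <= M ->
  2 * M + size (ind K1) * (L.+1 * L) + 1 < Wd ->
  {subset ind K2 <= ind K1} -> ~ ucq_entails S K1 K2 ->
  inhabited (cert S K1 K2 (L.+1 * Wd)).
Proof.
move=> L HM HW isub ne.
have [q [a [ov [sz [sub [c2 [I [mod nsat]]]]]]]] : exists q a, ucq_over S q /\ size a = size (answer_vars q) /\
    {subset a <= ind K2} /\ certain K2 q a /\ exists I, model I K1 /\ ~ sat_ucq I q a.
  apply: NNPP => no; apply: ne => q a ov sz sub c2; split; first by move=> x /sub/isub.
  move=> I mod; apply: NNPP => ns; apply: no; exists q, a; do !split=> //; by exists I.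
(* An atom has at most two variables, so [m] bounds the number of variables in a disjunct. *)
pose m := \max_(phi <- disjuncts q) (2 * size phi).
have mE phi : phi \in disjuncts q -> 2 * size phi <= m.
  by move=> i; rewrite /m; apply: (leq_bigmax_seq (F := fun phi => 2 * size phi)).
have er R p p' : @qedge S K1 I m R p p' -> qreal (S := S) (K1 := K1) I (m := m) p'.
  by case=> d [e [_ <- _]]; apply/holdsP; exists e.
have ei R b p : @qedgeI S K1 I m R b p -> qreal (S := S) (K1 := K1) I (m := m) p.
  by case=> e <- _; apply/holdsP; exists e.
apply: (@graph_cert S K1 K2 (cls S K1 m) (qreal I (m := m)) (qtype I (m := m))
  (fun b => typeof (cl_of K1) (named I b)) (qedge I (m := m)) (qedgeI I (m := m))
  (cls_of S K1 m (named I [::]))).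
- by move=> p _; apply: typeof_model.
- by move=> p _; apply: filter_sublists.
- by move=> b; apply: typeof_model.
- by move=> b; apply: filter_sublists.
- exact: er.
- exact: ei.
- move=> p C rp iC dC; have [e r w] := typeof_wit (@cl_of_closed K1) iC dC.
  exists (cls_of S K1 m e); last by rewrite qtype_cls.
  by exists (qrep I p), e; split=> //; apply: qrepP.
- move=> b C iC dC; have [e r w] := typeof_wit (@cl_of_closed K1) iC dC.
  by exists (cls_of S K1 m e); [exists e|rewrite qtype_cls].
- move=> R b c i; apply: typeof_compat; first exact: cl_of_closed.
  by case: mod => _ /(_ (RoleAssertion R b c)); apply; apply/in_listP.
- move=> A b i; rewrite mem_typeof ?(cl_of_abox i) //; apply/holdsP.
  by case: mod => _ /(_ (ConceptAssertion A b)); apply; apply/in_listP.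
- by apply/holdsP; exists (named I [::]).
- rewrite !card_prod !card_sets !card_prod !card_ord -mulnA mulnn; exact: HM.
- exact: HW.
- move=> i iL st; apply: NNPP => no.
  have [no1 no2] := not_or_and _ _ no.
  have [t0 it0] := not_all_ex_not _ _ no1.
  have [it {}it0] := imply_to_and _ _ it0.
  have [x0 ix0 u0] := NNPP _ it0.
  apply: no2 => s hs ha hr; apply: NNPP => no'; have [n1 n2] := not_or_and _ _ no'.
  apply: nsat; apply: (embedding_query mod isub st it ix0 u0 hs ha hr _ _ ov sub c2 mE).
    move=> R b c i1 sR; apply: NNPP => ni; apply: n1; exists R, b, c; split=> //; exact/negP.
  move=> b ib; apply: NNPP => nu; apply: n2; by exists b.
- exact: isub.
Qed.


(** * Search for certificates *)

Definition tab (V : Type) := seq (type * V).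
Definition label := (type * tab (nat * concept))%type.

Definition tables (A V : Type) (keys : seq A) (vals : seq V) : seq (seq (A * V)) :=
  cart [seq [seq (k, v) | v <- vals] | k <- keys].

Definition look (A : eqType) (V : Type) (d : V) (keys : seq A) (T : seq (A * V)) k : V :=
  (nth (k, d) T (index k keys)).2.

Lemma tables_look (A V : eqType) (d : V) (keys : seq A) vals T k :
  T \in tables keys vals -> k \in keys -> (k, look d keys T k) \in T /\ look d keys T k \in vals.
Proof.
move/cartP; rewrite size_map => -[sz H] ik; have lt : index k keys < size keys by rewrite index_mem.
have := H _ (k, d) lt; rewrite (nth_map k) // nth_index // => /mapP[v iv e].
rewrite /look e /=; split=> //; rewrite -e; apply: mem_nth; by rewrite sz.
Qed.

Lemma tables_fun (A V : eqType) (keys : seq A) (vals : seq V) f :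
  {in keys, forall k, f k \in vals} -> [seq (k, f k) | k <- keys] \in tables keys vals.
Proof.
by move=> H; apply: cart_map => k ik; apply/mapP; exists (f k) => //; apply: H.
Qed.

Definition mismb (sc : seq name) (t1 t : type) :=
  has (fun C => if C is Atom A then (A \in sc) && (C \notin t1) else false) t.

Lemma mismP S t1 t : reflect (mism S t1 t) (mismb (sig_concepts S) t1 t).
Proof.
apply: (iffP hasP) => [[C]|[A [iA sA nA]]]; last by exists (Atom A); rewrite // sA.
by case: C => // A iA /andP[sA nA]; exists A.
Qed.

Definition edge_okb (sc sr : seq name) (cl2 : seq concept) N R (l l' : label) :=
  (R \in sr) ==> all (fun p =>
    (p.2.1 < N) && ~~ mismb sc l.1 p.1 && (role p.2.2 == R) ==>
    all (fun p' => wit cl2 p.2.2 p.1 p'.1 ==> (p'.2.1 < p.2.1)) l'.2) l.2.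

Definition good_label (sc sr : seq name) cl2 N (g : tab nat) (l : label) :=
  all (fun p => ((p.2.1 < N) ==> mismb sc l.1 p.1 ||
    [&& p.2.2 \in cl2, demand p.2.2 p.1, 0 < p.2.1 &
      (role p.2.2 \notin sr) ==>
      all (fun p' => wit cl2 p.2.2 p.1 p'.1 ==> (p'.2 < p.2.1)) g]) &&
    all (fun p' => (p.1 == p'.1) ==> (p.2.1 <= p'.2)) g) l.2.

Definition supported (sc sr : seq name) cl1 cl2 N (X : seq label) (l : label) :=
  all (fun C => demand C l.1 ==>
    has (fun l' => wit cl1 C l.1 l'.1 && edge_okb sc sr cl2 N (role C) l l') X) cl1.

Definition elim_step (sc sr : seq name) cl1 cl2 N (X : seq label) :=
  filter (supported sc sr cl1 cl2 N X) X.

(** Folding over [X] supplies [size X] rounds. That is enough for a fixed point, since every round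
    before it discards a label. *)
Definition elim_all sc sr cl1 cl2 N (X : seq label) :=
  foldl (fun X' _ => elim_step sc sr cl1 cl2 N X') X X.

Definition good_assignment sc sr cl1 cl2 N (A1 : seq assertion) (X : seq label)
    (lam : seq (name * label)) :=
  all (fun p => p.2 \in X) lam &&
  all (fun x => match x with
    | ConceptAssertion A a => all (fun p => (p.1 == a) ==> (Atom A \in p.2.1)) lam
    | RoleAssertion R a b => all (fun p => all (fun p' => (p.1 == a) && (p'.1 == b) ==>
        compat cl1 R p.2.1 p'.2.1 && edge_okb sc sr cl2 N R p.2 p'.2) lam) lam
    end) A1.

Definition good_types cl2 (A2 : seq assertion) (s : seq (name * type)) :=
  all (fun x => match x with
    | ConceptAssertion A a => all (fun p => (p.1 == a) ==> (Atom A \in p.2)) s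
    | RoleAssertion R a b => all (fun p => all (fun p' => (p.1 == a) && (p'.1 == b) ==>
        compat cl2 R p.2 p'.2) s) s
    end) A2.

Definition missing_edge (sr : seq name) (A1 A2 : seq assertion) :=
  has (fun x => if x is RoleAssertion R _ _ then (R \in sr) && (x \notin A1) else false) A2.

Definition refutes N (lam : seq (name * label)) (s : seq (name * type)) :=
  has (fun p => all (fun p' => (p.1 == p'.1) ==>
    all (fun r => (r.1 == p.2) ==> (r.2.1 < N)) p'.2.2) lam) s.

Definition search sc sr cl1 cl2 N A1 A2 (Gs : seq (tab nat)) (Ls : seq label)
    (Lams : seq (seq (name * label))) (Sigs : seq (seq (name * type))) :=
  has (fun g => let X := elim_all sc sr cl1 cl2 N (filter (good_label sc sr cl2 N g) Ls) in
    ~~ nilp X && has (fun lam => good_assignment sc sr cl1 cl2 N A1 X lam &&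
      (all (fun p => p.2 < N) g ||
       all (fun s => good_types cl2 A2 s ==> missing_edge sr A1 A2 || refutes N lam s) Sigs))
    Lams) Gs.

Section FilterFix.
Variables (T : eqType) (p : seq T -> pred T).
Let st X := filter (p X) X.

Lemma iter_filter_fix n X : size X <= n -> st (iter n st X) = iter n st X.
Proof.
elim: n X => [|n IH] X; first by rewrite leqn0 => /nilP->.
move=> sz; rewrite iterSr; case: (boolP (all (p X) X)) => [/all_filterP e|na].
  have {}e : st X = X := e.
  by rewrite e; have -> : iter n st X = X by elim: n {IH sz} => //= n ->.
apply: IH; rewrite -ltnS; apply: leq_trans sz; rewrite size_filter.
by rewrite ltn_neqAle count_size andbT -all_count.
Qed.

(** Completeness of the elimination: labels that support one another survive every round. *)
Lemma iter_filter_max n X (Z : T -> Prop) : (forall x, Z x -> x \in X) ->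
  (forall Y x, (forall z, Z z -> z \in Y) -> Z x -> p Y x) ->
  forall x, Z x -> x \in iter n st X.
Proof.
move=> ZX cl; elim: n => [|n IH] x Zx; first exact: ZX.
by rewrite iterS mem_filter IH // andbT; apply: cl.
Qed.

Lemma iter_filter_sub n X : {subset iter n st X <= X}.
Proof. by elim: n => //= n IH x; rewrite mem_filter => /andP[_ /IH]. Qed.
End FilterFix.

Lemma foldl_const (A X : Type) (f : A -> A) a (s : seq X) :
  foldl (fun a _ => f a) a s = iter (size s) f a.
Proof. by elim: s a => //= x s IH a; rewrite IH -iterS -iterSr. Qed.

Section SearchCorrect.
Variables (S : signature) (K1 K2 : kb) (N : nat).
Let cl1 := cl_of K1.
Let cl2 := cl_of K2.
Let types2 := types_of K2.
Let sc := sig_concepts S.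
Let sr := sig_roles S.

Definition values : seq (nat * concept) := [seq (r, C) | r <- iota 0 N.+1, C <- Top :: cl2].

Definition all_labels : seq label :=
  [seq (t, T) | t <- [seq t <- sublists cl1 | okt cl1 (tbox K1) t],
    T <- tables types2 values].

Definition search_kb := search sc sr cl1 cl2 N (abox K1) (abox K2)
  (tables types2 (iota 0 N.+1)) all_labels (tables (ind K1) all_labels)
  (tables (ind K2) types2).

Lemma ind_role R a b K : RoleAssertion R a b \in abox K -> (a \in ind K) /\ (b \in ind K).
Proof.
by move=> h; split; apply/flattenP; exists [:: a; b]; rewrite ?inE ?eqxx ?orbT //;
  apply/mapP; exists (RoleAssertion R a b).
Qed.

Lemma ind_concept A a K : ConceptAssertion A a \in abox K -> a \in ind K.
Proof.
by move=> h; apply/flattenP; exists [:: a]; rewrite ?mem_head //;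
  apply/mapP; exists (ConceptAssertion A a).
Qed.

Hypothesis ind_sub : {subset ind K2 <= ind K1}.

Lemma search_cert : search_kb -> inhabited (cert S K1 K2 N).
Proof.
case/hasP=> g ig; set X := elim_all _ _ _ _ _ _ => /andP[nX /hasP[lam ilam /andP[/andP[/allP lX /allP lA] fin]]].
pose R0 t : nat := look 0 types2 g t.
have gP t : t \in types2 -> (t, R0 t) \in g by move=> it; case: (tables_look 0 ig it).
have XE : elim_step sc sr cl1 cl2 N X = X.
  rewrite /X /elim_all foldl_const; by apply: (@iter_filter_fix _ (supported sc sr cl1 cl2 N)).
have XL l : l \in X -> good_label sc sr cl2 N g l /\ l \in all_labels.
  rewrite /X /elim_all foldl_const => /(iter_filter_sub (p := fun X l => all (fun C => demand C l.1 ==>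
    has (fun l' => wit cl1 C l.1 l'.1 && edge_okb sc sr cl2 N (role C) l l') X) cl1)).
  by rewrite mem_filter => /andP.
pose Y := {l | l \in X}.
(* A label for names outside the ABox, on which [y0] needs a value too; it is the test [~~ nilp X]
   that provides it. *)
have [l0 il0] : exists l0, l0 \in X by case: (X) nX => // l ? _; exists l; rewrite mem_head.
pose lk (y : Y) t := look (0, Top) types2 (sval y).2 t.
have tabP (y : Y) : (sval y).2 \in tables types2 values /\
    [/\ (sval y).1 \in sublists cl1 & okt cl1 (tbox K1) (sval y).1].
  have [_ /allpairsP[[t T] /= [it iT ->]]] := XL _ (proj2_sig y).
  by move: it; rewrite mem_filter => /andP[].
have lkP (y : Y) t : t \in types2 -> (t, lk y t) \in (sval y).2.
  by move=> it; have [h _] := tabP y; case: (tables_look (0, Top) h it).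
pose y0 a : Y := if insub (look l0 (ind K1) lam a) is Some y then y else exist _ l0 il0.
have y0P a : a \in ind K1 -> (a, sval (y0 a)) \in lam.
  move=> ia; have [h h'] := tables_look l0 ilam ia; have hX := lX _ h.
  by rewrite /y0 insubT.
have [ch Hch] : exists ch : Y * concept -> Y, forall p, p.2 \in cl1 -> demand p.2 (sval p.1).1 ->
    wit cl1 p.2 (sval p.1).1 (sval (ch p)).1 /\ edge_okb sc sr cl2 N (role p.2) (sval p.1) (sval (ch p)).
  apply: (choice_fun (P := fun p y' => p.2 \in cl1 -> demand p.2 (sval p.1).1 ->
    wit cl1 p.2 (sval p.1).1 (sval y').1 /\ edge_okb sc sr cl2 N (role p.2) (sval p.1) (sval y'))).
  move=> [[l il] C] /=; case: (boolP ((C \in cl1) && demand C l.1)) => [/andP[iC dC]|no]; last first.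
    by exists (exist _ l il) => iC dC; rewrite iC dC in no.
  have := il; rewrite -{1}XE mem_filter => /andP[/allP/(_ C iC)]; rewrite dC => /hasP[l' il' /andP[w e]] _.
  by exists (exist _ l' il').
have eok R (y y' : Y) : edge_okb sc sr cl2 N R (sval y) (sval y') ->
    R \in sig_roles S -> forall t, t \in types2 -> (lk y t).1 < N -> ~ mism S (sval y).1 t ->
    role (lk y t).2 = R -> forall t', t' \in types2 -> wit cl2 (lk y t).2 t t' -> (lk y' t').1 < (lk y t).1.
  move=> /implyP h sR t it lt nm eR t' it' w.
  have /allP/(_ _ (lkP y t it)) /= := h sR; rewrite lt eR eqxx (introN (mismP _ _ _) nm) /=.
  by move/allP/(_ _ (lkP y' t' it')); rewrite /= w.
apply: inhabits; apply: (@Cert S K1 K2 N Y (fun y => (sval y).1) (fun y t => (lk y t).1) (fun y t => (lk y t).2)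
  (fun y C => ch (y, C)) y0 R0).
- by move=> y; have [_ [-> ->]] := tabP y.
- by move=> y C iC dC; have [w e] := Hch (y, C) iC dC; split=> //; apply: eok.
- move=> R a b i; have [ia ib] := ind_role i; have := lA _ i => /allP/(_ _ (y0P _ ia))/allP/(_ _ (y0P _ ib)).
  by rewrite /= !eqxx /= => /andP[c e]; split=> //; apply: eok.
- move=> A a i; have := lA _ i => /allP/(_ _ (y0P _ (ind_concept i))); by rewrite /= eqxx.
- move=> y t it lt; have [/allP/(_ _ (lkP y t it)) /andP[]] := XL _ (proj2_sig y); rewrite /= lt /=.
  case/orP=> [/mismP h _ _|/and4P[h1 h2 h3 /implyP h4] _ _]; [by left|right; split=> //].
  by move=> sR t' it' w; have /allP/(_ _ (gP t' it')) := h4 sR; rewrite /= w.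
- move=> y t it; have [/allP/(_ _ (lkP y t it)) /andP[_ /allP/(_ _ (gP t it)) h] _] := XL _ (proj2_sig y).
  by move: h; rewrite /= eqxx.
- case/orP: fin => [/allP h|/allP h]; first by left=> t it; apply: (h _ (gP t it)).
  right=> s hs ha hr; have is_ : [seq (a, s a) | a <- ind K2] \in tables (ind K2) types2 by apply: tables_fun.
  have gt : good_types cl2 (abox K2) [seq (a, s a) | a <- ind K2].
    apply/allP => -[A a|R a b] i.
      by apply/allP => _ /mapP[c _ ->] /=; apply/implyP => /eqP->; apply: ha i.
    by apply/allP => _ /mapP[c _ ->]; apply/allP => _ /mapP[d _ ->] /=; apply/implyP => /andP[/eqP-> /eqP->]; apply: hr i.
  have := h _ is_; rewrite gt /= => /orP[/hasP[[//|R a b] i /andP[sR n]]|]; first by left; exists R, a, b.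
  case/hasP=> _ /mapP[a ia ->] /allP/(_ _ (y0P _ (ind_sub ia))) /=; rewrite eqxx /=.
  move/allP/(_ _ (lkP _ _ (hs _ ia))); rewrite /= eqxx => lt.
  by right; exists a.
Qed.

Lemma cert_search : inhabited (cert S K1 K2 N) -> search_kb.
Proof.
case; case=> Y tau rho why ch y0 g edge_ok H1 H2 H3 H4 H5 H6 H7.
(* Truncation at [N] leaves finitely many values and preserves every comparison with a rank below
   [N]. *)
pose r y t := minn (rho y t) N.
pose c y t := if why y t \in cl2 then why y t else Top.
pose lab y : label := (tau y, [seq (t, (r y t, c y t)) | t <- types2]).
have rN y t : (r y t < N) = (rho y t < N) by rewrite /r gtn_min ltnn orbF.
have rE y t : rho y t < N -> r y t = rho y t by move=> lt; apply/minn_idPl/ltnW.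
have labL y : lab y \in all_labels.
  apply/allpairsP; exists (lab y); split=> //=.
    by rewrite mem_filter; case/andP: (H1 y) => -> ->.
  apply: tables_fun => t it; apply/allpairsP; exists (r y t, c y t); split=> //.
    by rewrite mem_iota add0n ltnS geq_minr.
  by rewrite /c; case: ifP => h; rewrite inE /= ?h ?orbT ?eqxx.
have eok R y y' : edge_ok R y y' -> edge_okb sc sr cl2 N R (lab y) (lab y').
  move=> h; apply/implyP => sR; apply/allP => _ /mapP[t it ->] /=.
  apply/implyP => /andP[/andP[lt /mismP nm] /eqP eR]; rewrite rN in lt.
  have [|[iw _ _ _]] := H5 y t it lt; first by move/nm.
  rewrite /c iw in eR *; apply/allP => _ /mapP[t' it' ->] /=; apply/implyP => w.
  rewrite (rE y t lt); apply: leq_ltn_trans (h sR t it lt nm eR t' it' w); exact: geq_minl.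
pose gt := [seq (t, minn (g t) N) | t <- types2].
apply/hasP; exists gt.
  by apply: tables_fun => t it; rewrite mem_iota /= add0n ltnS geq_minr.
have good y : good_label sc sr cl2 N gt (lab y).
  apply/allP => _ /mapP[t it ->] /=; apply/andP; split; last first.
    apply/allP => _ /mapP[t' it' ->] /=; apply/implyP => /eqP <-.
    by rewrite leq_min geq_minr andbT; apply: leq_trans (geq_minl _ _) (H6 y t it).
  rewrite rN; apply/implyP => lt; have [/mismP->//|[iw dw r0 jw]] := H5 y t it lt.
  apply/orP; right; rewrite /c iw dw rE // r0 /= -/cl2 iw /=.
  apply/implyP => sR; apply/allP => _ /mapP[t' it' ->] /=; apply/implyP => w.
  by apply: leq_ltn_trans (jw sR t' it' w); apply: geq_minl.
set X := elim_all _ _ _ _ _ _.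
have labX y : lab y \in X.
  rewrite /X /elim_all foldl_const.
  apply: (@iter_filter_max _ (supported sc sr cl1 cl2 N) _ _ (fun l => exists y, l = lab y)); last by exists y.
    by move=> _ [y' ->]; rewrite mem_filter good labL.
  move=> Z _ hZ [y' ->]; apply/allP => C iC; apply/implyP => dC; apply/hasP.
  have [w e] := H2 y' C iC dC; exists (lab (ch y' C)); first by apply: hZ; exists (ch y' C).
  by rewrite w eok.
apply/andP; split; first by case: (X) (labX (y0 [::])).
apply/hasP; exists [seq (a, lab (y0 a)) | a <- ind K1].
  by apply: tables_fun => a _; apply: labL.
apply/andP; split.
  apply/andP; split; first by apply/allP => _ /mapP[a _ ->]; apply: labX.
  apply/allP => -[A a|R a b] i.
    by apply/allP => _ /mapP[d _ ->] /=; apply/implyP => /eqP->; apply: H4 i.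
  apply/allP => _ /mapP[d _ ->]; apply/allP => _ /mapP[e _ ->] /=; apply/implyP => /andP[/eqP-> /eqP->].
  by have [-> h] := H3 _ _ _ i; rewrite eok.
case: H7 => [h|h]; apply/orP; [left|right].
  by apply/allP => _ /mapP[t it ->] /=; rewrite gtn_min h.
apply/allP => s is_; apply/implyP => /allP gs; pose f a := look [::] (ind K2) s a.
have fP a : a \in ind K2 -> (a, f a) \in s /\ f a \in types2 by move=> ia; apply: (tables_look [::] is_ ia).
case: (h f) => [a /fP[]//|A a i|R a b i|[R [a [b [i sR n]]]]|[a ia lt]].
- have [ia _] := fP _ (ind_concept i); have := gs _ i => /allP/(_ _ ia); by rewrite /= eqxx.
- have [ja jb] := ind_role i; have [ia _] := fP _ ja; have [ib _] := fP _ jb.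
  by have := gs _ i => /allP/(_ _ ia)/allP/(_ _ ib); rewrite /= !eqxx.
- by apply/orP; left; apply/hasP; exists (RoleAssertion R a b); rewrite // sR n.
- apply/orP; right; have [ja it] := fP _ ia.
  apply/hasP; exists (a, f a) => //; apply/allP => _ /mapP[d _ ->] /=; apply/implyP => /eqP<-.
  by apply/allP => _ /mapP[t _ ->] /=; apply/implyP => /eqP->; rewrite rN.
Qed.
End SearchCorrect.


(** * The search is elementary *)

Definition ctag C : nat :=
  match C with
  | Top => 0 | Bot => 1 | Atom _ => 2 | Not _ => 3 | And _ _ => 4 | Or _ _ => 5 | Ex _ _ => 6 | All _ _ => 7
  end.

Definition cname C : name :=
  match C with Atom A => A | Ex R _ | All R _ => R | _ => [::] end.

Definition carg1 C : concept :=
  match C with Not D | And D _ | Or D _ | Ex _ D | All _ D => D | _ => Top end.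

Definition carg2 C : concept := match C with And _ D | Or _ D => D | _ => Top end.

(* [Top] is encoded by the leaf, which is also what stands for a missing
   argument. *)
Fixpoint en_concept (C : concept) : tree :=
  let node (A : name) d e := N (en (ctag C)) (N (en A) (N d e)) in
  match C with
  | Top => L
  | Bot => node [::] L L
  | Atom A => node A L L
  | Not D => node [::] (en_concept D) L
  | And D E | Or D E => node [::] (en_concept D) (en_concept E)
  | Ex R D | All R D => node R (en_concept D) L
  end.

Lemma en_concept_inj : injective en_concept.
Proof.
elim=> [||A|C IHC|C IHC D IHD|C IHC D IHD|R C IHC|R C IHC];
  case=> [||A'|C'|C' D'|C' D'|R' C'|R' C'] //=.
- by case=> /(@en_inj (enc_seq enc_bool)) ->.
- by case=> /IHC->.
- by case=> /IHC-> /IHD->.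
- by case=> /IHC-> /IHD->.
- by case=> /(@en_inj (enc_seq enc_bool))-> /IHC->.
- by case=> /(@en_inj (enc_seq enc_bool))-> /IHC->.
Qed.
Canonical enc_concept := Enc en_concept_inj.

Definition is_role x := if x is RoleAssertion _ _ _ then true else false.
Definition aname x := match x with ConceptAssertion A _ => A | RoleAssertion R _ _ => R end.
Definition aind1 x := match x with ConceptAssertion _ a => a | RoleAssertion _ a _ => a end.
Definition aind2 x : name := match x with ConceptAssertion _ _ => [::] | RoleAssertion _ _ b => b end.

Definition en_assertion x := en (is_role x, (aname x, (aind1 x, aind2 x))).
Lemma en_assertion_inj : injective en_assertion.
Proof. by move=> [A a|R a b] [A' a'|R' a' b'] /en_inj //= []; move=> *; subst. Qed.
Canonical enc_assertion := Enc en_assertion_inj.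

(** Holds by conversion, as a tree is its own encoding. It allows a result to be assembled as a
    tree, whatever its type. *)
Lemma fp_detree (A B : enc) b (f : A -> B) : fpb b (fun x => en (f x) : tree) -> fpb b f.
Proof. by []. Qed.

Lemma fp_en (A B : enc) (f : A -> B) : fp f -> fp (fun x => en (f x) : tree).
Proof. by []. Qed.

Lemma fp_hd (A : enc) (f : A -> tree) : fp f -> fp (fun x => hd (f x)).
Proof.
move/fpb_comp; apply; exists Hd, 2 => t; split=> //=; rewrite -/(sz t); nia.
Qed.

Lemma fp_tl (A : enc) (f : A -> tree) : fp f -> fp (fun x => tl (f x)).
Proof.
move/fpb_comp; apply; exists Tl, 2 => t; split=> //=; rewrite -/(sz t); nia.
Qed.

Section ConceptFunctions.
Variable A : enc.
Implicit Types (f g : A -> concept) (h : A -> assertion).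

Lemma fp_ctag f : fp f -> fp (fun x => ctag (f x)).
Proof.
move=> hf; apply: fp_detree; apply: (fpb_ext (f := fun x => hd (en (f x)))).
  by move=> x; case: (f x).
by apply: fp_hd; apply: fp_en.
Qed.

Lemma fp_cname f : fp f -> fp (fun x => cname (f x)).
Proof.
move=> hf; apply: fp_detree; apply: (fpb_ext (f := fun x => hd (tl (en (f x))))).
  by move=> x; case: (f x).
by apply: fp_hd; apply: fp_tl; apply: fp_en.
Qed.

Lemma fp_carg1 f : fp f -> fp (fun x => carg1 (f x)).
Proof.
move=> hf; apply: fp_detree; apply: (fpb_ext (f := fun x => hd (tl (tl (en (f x)))))).
  by move=> x; case: (f x).
by apply: fp_hd; do 2!apply: fp_tl; apply: fp_en.
Qed.

Lemma fp_carg2 f : fp f -> fp (fun x => carg2 (f x)).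
Proof.
move=> hf; apply: fp_detree; apply: (fpb_ext (f := fun x => tl (tl (tl (en (f x)))))).
  by move=> x; case: (f x).
by do 3!apply: fp_tl; apply: fp_en.
Qed.

Lemma fp_assertion h : fp h -> fp (fun x => (is_role (h x), (aname (h x), (aind1 (h x), aind2 (h x))))).
Proof.
move=> hh; apply: (fpb_comp (g := fun x => (is_role x, (aname x, (aind1 x, aind2 x)))) hh).
exact: fp_recode.
Qed.

Lemma fp_is_role h : fp h -> fp (fun x => is_role (h x)).
Proof. by move/fp_assertion/fp_fst. Qed.

Lemma fp_aname h : fp h -> fp (fun x => aname (h x)).
Proof. by move/fp_assertion/fp_snd/fp_fst. Qed.

Lemma fp_aind1 h : fp h -> fp (fun x => aind1 (h x)).
Proof. by move/fp_assertion/fp_snd/fp_snd/fp_fst. Qed.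

Lemma fp_aind2 h : fp h -> fp (fun x => aind2 (h x)).
Proof. by move/fp_assertion/fp_snd/fp_snd/fp_snd. Qed.

Lemma fp_eqn (f g : A -> nat) : fp f -> fp g -> fp (fun x => f x == g x).
Proof. by apply: (fp_eq0 (r := fun x y : nat => x == y)) => x y; apply: eqP. Qed.

Lemma fp_eqs (f g : A -> seq bool) : fp f -> fp g -> fp (fun x => f x == g x).
Proof. by apply: (fp_eq0 (r := fun x y : seq bool => x == y)) => x y; apply: eqP. Qed.

Lemma fp_eqt (f g : A -> type) : fp f -> fp g -> fp (fun x => f x == g x).
Proof. by apply: (fp_eq0 (r := fun x y : type => x == y)) => x y; apply: eqP. Qed.

Lemma fp_mem (X : enc) (r : X -> X -> bool) (f : A -> X) (s : A -> seq X) :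
  (forall x y, reflect (x = y) (r x y)) -> fp f -> fp s -> fp (fun x => has (r (f x)) (s x)).
Proof.
move=> rP hf hs; apply: (fp_has (p := fun a y => r (f a) y)) => //.
apply: (fp_eq0 rP); last by proj.
by apply: (fpb_comp (f := fst)) hf; proj.
Qed.
End ConceptFunctions.

Lemma has_eq_op (T : eqType) (x : T) s : has (eq_op x) s = (x \in s).
Proof. by elim: s => //= y s ->. Qed.

Section Membership.
Variable A : enc.

Lemma fp_inC f (s : A -> type) : fp f -> fp s -> fp (fun x => f x \in s x).
Proof.
move=> hf hs; apply: (fpb_ext (f := fun x => has (eq_op (f x)) (s x))) => [x|]; first exact: has_eq_op.
apply: (@fp_mem A _ (fun x y : concept => x == y)) => // x y; exact: eqP.
Qed.

Lemma fp_inS f (s : A -> seq (seq bool)) : fp f -> fp s -> fp (fun x => f x \in s x).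
Proof.
move=> hf hs; apply: (fpb_ext (f := fun x => has (eq_op (f x)) (s x))) => [x|]; first exact: has_eq_op.
apply: (@fp_mem A _ (fun x y : seq bool => x == y)) => // x y; exact: eqP.
Qed.

Lemma fp_inA f (s : A -> seq assertion) : fp f -> fp s -> fp (fun x => f x \in s x).
Proof.
move=> hf hs; apply: (fpb_ext (f := fun x => has (eq_op (f x)) (s x))) => [x|]; first exact: has_eq_op.
apply: (@fp_mem A _ (fun x y : assertion => x == y)) => // x y; exact: eqP.
Qed.

Lemma fp_inL f (s : A -> seq label) : fp f -> fp s -> fp (fun x => f x \in s x).
Proof.
move=> hf hs; apply: (fpb_ext (f := fun x => has (eq_op (f x)) (s x))) => [x|]; first exact: has_eq_op.
apply: (@fp_mem A _ (fun x y : label => x == y)) => // x y; exact: eqP.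
Qed.
End Membership.

(** Syntax-directed: the outermost operation of the function selects the closure lemma, and a
    function with no listed head is tried as a constant, then as a conditional. *)
Ltac fp_step :=
  cbv beta;
  lazymatch goal with
  | H : fpb _ ?f |- fpb _ ?f => exact: H
  | |- fpb _ (fun q => q) => exact: fp_id
  | |- fpb _ fst => exact: fp_fst0
  | |- fpb _ snd => exact: fp_snd0
  | H : fpb _ ?f |- fpb _ (fun q => ?f (@?e q)) => apply: (fpb_comp (f := e) _ H)
  | |- fpb _ (fun q => @all _ (@?a q) (@?b q)) => apply: fp_all
  | |- fpb _ (fun q => @has _ (@?a q) (@?b q)) => apply: fp_has
  | |- fpb _ (fun q => @filter _ (@?a q) (@?b q)) => apply: fp_filter
  | |- fpb _ (fun q => @map _ _ (@?a q) (@?b q)) => apply: fp_map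
  | |- fpb _ (fun q => flatten (@?a q)) => apply: fp_flatten
  | |- fpb _ (fun q => nilp (@?a q)) => apply: fp_nilp
  | |- fpb _ (fun q => (@?a q) ++ (@?b q)) => apply: fp_cat
  | |- fpb _ (fun q => (@?a q) :: (@?b q)) => apply: fp_cons
  | |- fpb _ (fun q => (@?a q, @?b q)) => apply: fpb_pair
  | |- fpb _ (fun q => (@?a q) && (@?b q)) => apply: fp_andb
  | |- fpb _ (fun q => (@?a q) || (@?b q)) => apply: fp_orb
  | |- fpb _ (fun q => ~~ (@?a q)) => apply: fp_negb
  | |- fpb _ (fun q => (@?a q) ==> (@?b q)) => apply: fp_implb
  | |- fpb _ (fun q => (@?a q).1) => apply: fp_fst
  | |- fpb _ (fun q => (@?a q).2) => apply: fp_snd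
  | |- fpb _ (fun q => (@?a q) == (@?b q)) => first [apply: fp_eqn | apply: fp_eqs | apply: fp_eqt]
  | |- fpb _ (fun q => in_mem (@?a q) (@?b q)) => first [apply: fp_inC | apply: fp_inS | apply: fp_inA | apply: fp_inL]
  | |- fpb _ (fun q => ctag (@?a q)) => apply: fp_ctag
  | |- fpb _ (fun q => cname (@?a q)) => apply: fp_cname
  | |- fpb _ (fun q => carg1 (@?a q)) => apply: fp_carg1
  | |- fpb _ (fun q => carg2 (@?a q)) => apply: fp_carg2
  | |- fpb _ (fun q => is_role (@?a q)) => apply: fp_is_role
  | |- fpb _ (fun q => aname (@?a q)) => apply: fp_aname
  | |- fpb _ (fun q => aind1 (@?a q)) => apply: fp_aind1
  | |- fpb _ (fun q => aind2 (@?a q)) => apply: fp_aind2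
  | |- fpb _ (fun q => (@?a q) <= (@?b q)) => apply: fp_leq
  | |- fpb _ (fun q => (@?a q).+1) => apply: fp_succ
  | |- fpb _ (fun q => _) => first [exact: fp_const | apply: fp_if]
  | |- fpb _ ?f => apply: (fpb_ext (f := fun q => f q)) => //
  end.
Ltac fps := repeat fp_step.

Section SearchFunctions.
Variable A : enc.
Implicit Types (f g : A -> concept) (s t cl : A -> type) (R : A -> seq bool).

(** Matching on a concept becomes a cascade of tests on [ctag], and equality of booleans a
    conditional, since closure lemmas cover these forms. *)
Lemma fp_okc s f : fp s -> fp f -> fp (fun x => okc (s x) (f x)).
Proof.
move=> hs hf; pose e (t : type) C :=
  if ctag C == 0 then C \in t else
  if ctag C == 1 then C \notin t else
  if ctag C == 3 then if C \in t then carg1 C \notin t else ~~ (carg1 C \notin t) else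
  if ctag C == 4 then if C \in t then (carg1 C \in t) && (carg2 C \in t)
    else ~~ ((carg1 C \in t) && (carg2 C \in t)) else
  if ctag C == 5 then if C \in t then (carg1 C \in t) || (carg2 C \in t)
    else ~~ ((carg1 C \in t) || (carg2 C \in t)) else true.
apply: (fpb_ext (f := fun x => e (s x) (f x))); last by rewrite /e; fps.
by move=> x; rewrite /e; case: (f x) => //= *; case: (_ \in s x).
Qed.

End SearchFunctions.

Section SearchFunctions1.
Variable A : enc.
Implicit Types (f g : A -> concept) (s t cl : A -> type) (R : A -> seq bool).

Lemma fp_okt cl (T : A -> seq (concept * concept)) s : fp cl -> fp T -> fp s ->
  fp (fun x => okt (cl x) (T x) (s x)).
Proof. by move=> *; rewrite /okt; repeat first [lazymatch goal with |- fpb _ (fun q => okc (@?a q) (@?b q)) => apply: fp_okc end | fp_step]. Qed.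

Lemma fp_demand f s : fp f -> fp s -> fp (fun x => demand (f x) (s x)).
Proof.
move=> hf hs; apply: (fpb_ext (f := fun x => if ctag (f x) == 6 then f x \in s x else
  if ctag (f x) == 7 then f x \notin s x else false)); last by fps.
by move=> x; case: (f x).
Qed.

Lemma fp_role f : fp f -> fp (fun x => role (f x)).
Proof.
move=> hf; apply: (fpb_ext (f := fun x => if (ctag (f x) == 2) then [::] else cname (f x))); last by fps.
by move=> x; case: (f x).
Qed.

Lemma fp_compat cl R s t : fp cl -> fp R -> fp s -> fp t ->
  fp (fun x => compat (cl x) (R x) (s x) (t x)).
Proof.
move=> hcl hR hs ht; apply: (fpb_ext (f := fun x => all (fun C =>
   if ctag C == 7 then (cname C == R x) && (C \in s x) ==> (carg1 C \in t x) else
   if ctag C == 6 then (cname C == R x) && (C \notin s x) ==> (carg1 C \notin t x) else true) (cl x))).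
  by move=> x; apply: eq_all; case.
by fps.
Qed.

Lemma fp_wit cl f s t : fp cl -> fp f -> fp s -> fp t ->
  fp (fun x => wit (cl x) (f x) (s x) (t x)).
Proof.
move=> hcl hf hs ht; apply: fp_andb; first by apply: fp_compat => //; apply: fp_role.
apply: (fpb_ext (f := fun x => if ctag (f x) == 6 then carg1 (f x) \in t x else
  if ctag (f x) == 7 then carg1 (f x) \notin t x else false)); last by fps.
by move=> x; case: (f x).
Qed.

Lemma fp_mismb (sc : A -> seq name) s t : fp sc -> fp s -> fp t ->
  fp (fun x => mismb (sc x) (s x) (t x)).
Proof.
move=> hsc hs ht; apply: (fpb_ext (f := fun x => has (fun C =>
   if ctag C == 2 then (cname C \in sc x) && (C \notin s x) else false) (t x))).
  by move=> x; apply: eq_has; case.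
by fps.
Qed.
End SearchFunctions1.

Ltac fps2 := repeat (cbv beta; lazymatch goal with
  | |- fpb _ (fun q => mismb (@?a q) (@?b q) (@?c q)) => apply: fp_mismb
  | |- fpb _ (fun q => wit (@?a q) (@?b q) (@?c q) (@?d q)) => apply: fp_wit
  | |- fpb _ (fun q => compat (@?a q) (@?b q) (@?c q) (@?d q)) => apply: fp_compat
  | |- fpb _ (fun q => role (@?a q)) => apply: fp_role
  | |- fpb _ (fun q => demand (@?a q) (@?b q)) => apply: fp_demand
  | _ => fp_step
  end).

Section SearchFunctions2.
Variable A : enc.
Implicit Types (f g : A -> concept) (s t cl : A -> type) (R : A -> seq bool)
  (sc sr : A -> seq name) (N : A -> nat) (l : A -> label).

Lemma fp_edge_okb sc sr cl N R l l' : fp sc -> fp sr -> fp cl -> fp N -> fp R -> fp l -> fp l' ->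
  fp (fun x => edge_okb (sc x) (sr x) (cl x) (N x) (R x) (l x) (l' x)).
Proof. by move=> *; rewrite /edge_okb; fps2. Qed.

Lemma fp_good_label sc sr cl N (g : A -> tab nat) l : fp sc -> fp sr -> fp cl -> fp N -> fp g -> fp l ->
  fp (fun x => good_label (sc x) (sr x) (cl x) (N x) (g x) (l x)).
Proof. by move=> *; rewrite /good_label; fps2. Qed.

Lemma fp_elim_step sc sr cl1 cl2 N (X : A -> seq label) : fp sc -> fp sr -> fp cl1 -> fp cl2 -> fp N -> fp X ->
  fp (fun x => elim_step (sc x) (sr x) (cl1 x) (cl2 x) (N x) (X x)).
Proof.
by move=> *; rewrite /elim_step /supported; repeat first [apply: fp_edge_okb | progress fps2].
Qed.

End SearchFunctions2.

Section SearchFunctions3.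
Variable A : enc.
Implicit Types (f g : A -> concept) (s t cl : A -> type) (R : A -> seq bool)
  (sc sr : A -> seq name) (N : A -> nat) (l : A -> label).

Lemma fp_elim_all sc sr cl1 cl2 N (X : A -> seq label) : fp sc -> fp sr -> fp cl1 -> fp cl2 -> fp N -> fp X ->
  fp (fun x => elim_all (sc x) (sr x) (cl1 x) (cl2 x) (N x) (X x)).
Proof.
move=> hsc hsr h1 h2 hN hX; apply: (fpb_foldl (f := fun x X' _ => elim_step (sc x) (sr x) (cl1 x) (cl2 x) (N x) X')) => //.
  by apply: fp_elim_step; fps2.
exists (fun x => sz (X x)); first exact: (fpb_pbd hX).
move=> a i; have H u Y : sz (foldl (fun X' (_ : label) =>
    elim_step (sc a) (sr a) (cl1 a) (cl2 a) (N a) X') Y u) <= sz Y.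
  elim: u Y => //= _ u IH Y; apply: leq_trans (IH _) _; rewrite /elim_step.
  elim: {2 3}Y => //= y v IHv; case: ifP => _; rewrite !sz_cons; lia.
exact: H.
Qed.
End SearchFunctions3.

Lemma fp_node (A : enc) (k : nat) (n : A -> seq bool) (d e C : A -> concept) :
  (forall x, en (C x) = N (en k) (N (en (n x)) (N (en (d x)) (en (e x))))) ->
  fp n -> fp d -> fp e -> fp C.
Proof.
move=> eC hn hd he; apply: fp_detree; apply: (fpb_ext (f := fun x => en (k, (n x, (d x, e x))))).
  by move=> x; rewrite eC.
by apply: fp_en; do 3?apply: fpb_pair => //; apply: fp_const.
Qed.

Lemma fp_Atom (A : enc) (f : A -> seq bool) : fp f -> fp (fun x => Atom (f x)).
Proof.
move=> hf; apply: (@fp_node _ 2 f (fun=> Top) (fun=> Top)) => //; exact: fp_const.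
Qed.

Section SearchFunctions4.
Variable A : enc.
Implicit Types (f g : A -> concept) (s t cl : A -> type) (R : A -> seq bool)
  (sc sr : A -> seq name) (N : A -> nat) (l : A -> label).

Lemma fp_good_assignment sc sr cl1 cl2 N (A1 : A -> seq assertion) (X : A -> seq label) (lam : A -> seq (name * label)) :
  fp sc -> fp sr -> fp cl1 -> fp cl2 -> fp N -> fp A1 -> fp X -> fp lam ->
  fp (fun x => good_assignment (sc x) (sr x) (cl1 x) (cl2 x) (N x) (A1 x) (X x) (lam x)).
Proof.
move=> hsc hsr h1 h2 hN hA hX hl; apply: fp_andb; first by fps2.
apply: (fpb_ext (f := fun x => all (fun y => if is_role y then
    all (fun p => all (fun p' => (p.1 == aind1 y) && (p'.1 == aind2 y) ==>
        compat (cl1 x) (aname y) p.2.1 p'.2.1 &&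
        edge_okb (sc x) (sr x) (cl2 x) (N x) (aname y) p.2 p'.2) (lam x)) (lam x)
    else all (fun p => (p.1 == aind1 y) ==> (Atom (aname y) \in p.2.1)) (lam x)) (A1 x))).
  by move=> x; apply: eq_all; case.
repeat first [lazymatch goal with |- fpb _ (fun q => edge_okb _ _ _ _ _ _ _) => apply: fp_edge_okb
  | |- fpb _ (fun q => Atom _) => apply: fp_Atom end | progress fps2].
Qed.

Lemma fp_good_types cl2 (A2 : A -> seq assertion) (s : A -> seq (name * type)) : fp cl2 -> fp A2 -> fp s ->
  fp (fun x => good_types (cl2 x) (A2 x) (s x)).
Proof.
move=> h1 h2 hs.
apply: (fpb_ext (f := fun x => all (fun y => if is_role y then
    all (fun p => all (fun p' => (p.1 == aind1 y) && (p'.1 == aind2 y) ==>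
        compat (cl2 x) (aname y) p.2 p'.2) (s x)) (s x)
    else all (fun p => (p.1 == aind1 y) ==> (Atom (aname y) \in p.2)) (s x)) (A2 x))).
  by move=> x; apply: eq_all; case.
repeat first [lazymatch goal with |- fpb _ (fun q => Atom _) => apply: fp_Atom end | progress fps2].
Qed.

Lemma fp_missing_edge sr (A1 A2 : A -> seq assertion) : fp sr -> fp A1 -> fp A2 ->
  fp (fun x => missing_edge (sr x) (A1 x) (A2 x)).
Proof.
move=> h1 h2 hs; apply: (fpb_ext (f := fun x => has (fun y => if is_role y then
   (aname y \in sr x) && (y \notin A1 x) else false) (A2 x))); last by fps.
by move=> x; apply: eq_has; case.
Qed.

Lemma fp_refutes N (lam : A -> seq (name * label)) (s : A -> seq (name * type)) :
  fp N -> fp lam -> fp s -> fp (fun x => refutes (N x) (lam x) (s x)).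
Proof. by move=> *; rewrite /refutes; fps. Qed.
End SearchFunctions4.

Lemma fp_search (A : enc) (sc sr : A -> seq name) (cl1 cl2 : A -> type) (N : A -> nat)
    (A1 A2 : A -> seq assertion) Gs Ls Lams Sigs :
  fp sc -> fp sr -> fp cl1 -> fp cl2 -> fp N -> fp A1 -> fp A2 ->
  fp Gs -> fp Ls -> fp Lams -> fp Sigs ->
  fp (fun x => search (sc x) (sr x) (cl1 x) (cl2 x) (N x) (A1 x) (A2 x) (Gs x) (Ls x) (Lams x) (Sigs x)).
Proof.
move=> hsc hsr h1 h2 hN hA1 hA2 hG hL hLam hS; rewrite /search.
repeat (cbv beta; lazymatch goal with
  | |- fpb _ (fun q => let X := @?a q in (@?b q) && (@?c q)) => apply: fp_andb
  | |- fpb _ (fun q => good_assignment _ _ _ _ _ _ _ _) => apply: fp_good_assignment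
  | |- fpb _ (fun q => elim_all _ _ _ _ _ _) => apply: fp_elim_all
  | |- fpb _ (fun q => good_label _ _ _ _ _ _) => apply: fp_good_label
  | |- fpb _ (fun q => good_types _ _ _) => apply: fp_good_types
  | |- fpb _ (fun q => missing_edge _ _ _) => apply: fp_missing_edge
  | |- fpb _ (fun q => refutes _ _ _) => apply: fp_refutes
  | _ => fp_step end).
Qed.

(** * Single and double exponential time bounds *)

Section Bounds.
Variable W : enc.

Definition simple_exp (B : enc) (f : W -> B) := exists2 q, pbd (@sz W) q & fpb (fun w => 2 ^ q w) f.
Definition double_exp (B : enc) (f : W -> B) := exists2 q, pbd (@sz W) q & fpb (fun w => 2 ^ 2 ^ q w) f.

Lemma fpb_compb (A B C : enc) b c (f : A -> B) (g : B -> C) : fpb b f -> fpb c g ->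
  fpb (fun x => b x + c (f x)) (fun x => g (f x)).
Proof.
move=> ff [G [l HG]]; have hs := fpb_pbd ff; case: ff => F [k HF].
apply: (fpbI (F := Comp G F)) => [x|] /=; first by rewrite (HF x).1 (HG _).1.
apply: (pbd_le (v := fun x => (sz x + b x + 2) ^ k + (sz (f x) + c (f x) + 2) ^ l)); last first.
  by move=> x; have [e ?] := HF x; have [_ ?] := HG (f x); rewrite e; apply: leq_add.
have m u : pbd (fun x => sz x + b x) u -> pbd (fun x => sz x + (b x + c (f x))) u.
  by case=> n h; exists n => x; apply: leq_trans (h x) _; case: n {h} => // n; rewrite leq_exp2r //; lia.
have mc : pbd (fun x => sz x + (b x + c (f x))) (fun x => c (f x)).
  by exists 1 => x; lia.
have := m _ hs; have := m _ (@pbd_id _ (fun x => sz x + b x)); move=> *; pbd; by exists 1 => x; lia.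
Qed.

Lemma leq_self_exp n : n <= 2 ^ n. Proof. exact/ltnW/ltn_expl. Qed.

Lemma pexp (T : Type) (n q : T -> nat) k : pbd n q ->
  exists2 q', pbd n q' & forall x, (n x + 2 ^ q x + 2) ^ k <= 2 ^ q' x.
Proof.
move=> hq; exists (fun x => (n x + q x + 2) * k); first by pbd; exact: pbd_id.
move=> x; rewrite expnM; case: k => // k; rewrite leq_exp2r //.
have h1 := leq_self_exp (n x); rewrite !expnD.
have : 0 < 2 ^ q x by rewrite expn_gt0.
have : 0 < 2 ^ n x by rewrite expn_gt0.
nia.
Qed.

Lemma fpb_mono (A B : enc) b b' (f : A -> B) : (forall x, b x <= b' x) -> fpb b f -> fpb b' f.
Proof. by move=> le; apply: (@fpb_bound _ _ b' b 1) => x; rewrite expn1; have := le x; lia. Qed.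

Lemma simple_exp_fp (B : enc) (f : W -> B) : fp f -> simple_exp f.
Proof. by move=> h; exists (fun=> 0); [pbd|apply: fpb_le]. Qed.

Lemma double_exp_ex1 (B : enc) (f : W -> B) : simple_exp f -> double_exp f.
Proof.
case=> q hq hf; exists q => //; apply: fpb_mono hf => x; rewrite leq_exp2l //; exact: leq_self_exp.
Qed.

Lemma simple_exp_comp (B C : enc) (f : W -> B) (g : B -> C) : simple_exp f -> fp g -> simple_exp (fun x => g (f x)).
Proof. by case=> q hq hf hg; exists q => //; apply: fpb_comp. Qed.

Lemma double_exp_comp (B C : enc) (f : W -> B) (g : B -> C) : double_exp f -> fp g -> double_exp (fun x => g (f x)).
Proof. by case=> q hq hf hg; exists q => //; apply: fpb_comp. Qed.

Lemma simple_exp_pair (B C : enc) (f : W -> B) (g : W -> C) : simple_exp f -> simple_exp g -> simple_exp (fun x => (f x, g x)).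
Proof.
case=> q hq hf [r hr hg]; exists (fun x => q x + r x); first by pbd.
apply: fpb_pair; [apply: fpb_mono hf|apply: fpb_mono hg] => x; rewrite leq_exp2l //; lia.
Qed.

Lemma double_exp_pair (B C : enc) (f : W -> B) (g : W -> C) : double_exp f -> double_exp g -> double_exp (fun x => (f x, g x)).
Proof.
case=> q hq hf [r hr hg]; exists (fun x => q x + r x); first by pbd.
by apply: fpb_pair; [apply: fpb_mono hf|apply: fpb_mono hg] => x; rewrite !leq_exp2l //; lia.
Qed.

Lemma simple_exp_sz (B : enc) (f : W -> B) : simple_exp f -> exists2 q, pbd (@sz W) q & forall x, sz (f x) <= 2 ^ q x.
Proof.
case=> q hq /fpb_sz[k hk]; have [q' h h'] := @pexp _ (@sz W) q k hq; exists q' => // x.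
exact: leq_trans (hk x) (h' x).
Qed.

Lemma double_exp_sz (B : enc) (f : W -> B) : double_exp f -> exists2 q, pbd (@sz W) q & forall x, sz (f x) <= 2 ^ 2 ^ q x.
Proof.
case=> q hq /fpb_sz[k hk].
exists (fun x => sz x + q x + 2 + k); first by pbd; exact: pbd_id.
move=> x; apply: leq_trans (hk x) _.
have h1 := leq_self_exp (sz x); have hk' := leq_self_exp k.
apply: leq_trans (_ : (2 ^ (sz x + 2 ^ q x + 2)) ^ k <= _).
  case: k {hk hk'} => // k; rewrite leq_exp2r // !expnD.
  have : 0 < 2 ^ 2 ^ q x by rewrite expn_gt0.
  have : 0 < 2 ^ sz x by rewrite expn_gt0.
  nia.
rewrite -expnM leq_exp2l // expnD leq_mul // !expnD.
have : 0 < 2 ^ q x by rewrite expn_gt0.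
have : 0 < 2 ^ sz x by rewrite expn_gt0.
nia.
Qed.

Lemma simple_exp_step (B C : enc) c (f : W -> B) (g : B -> C) : fp f -> fpb c g ->
  (exists2 q, pbd (@sz W) q & forall x, c (f x) <= 2 ^ q x) -> simple_exp (fun x => g (f x)).
Proof.
move=> hf hg [q hq h]; exists q => //; apply: (fpb_mono _ (fpb_compb hf hg)); exact: h.
Qed.

Lemma double_exp_step (B C : enc) c (f : W -> B) (g : B -> C) : double_exp f -> fpb c g ->
  (exists2 q, pbd (@sz W) q & forall x, c (f x) <= 2 ^ 2 ^ q x) -> double_exp (fun x => g (f x)).
Proof.
case=> r hr hf hg [q hq h]; exists (fun x => q x + r x + 1); first by pbd.
apply: (fpb_mono _ (fpb_compb hf hg)) => x /=.
apply: leq_trans (leq_add (leqnn _) (h x)) _.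
have a : 2 ^ 2 ^ r x <= 2 ^ 2 ^ (q x + r x) by rewrite !leq_exp2l //; lia.
have b : 2 ^ 2 ^ q x <= 2 ^ 2 ^ (q x + r x) by rewrite !leq_exp2l //; lia.
apply: leq_trans (leq_add a b) _; rewrite addnn -mul2n -expnS leq_exp2l // addn1 expnS.
have : 0 < 2 ^ (q x + r x) by rewrite expn_gt0.
by lia.
Qed.
End Bounds.


(** * Parsing instances *)

Lemma fp_obind (A X Y : enc) (g : A -> X -> option Y) (f : A -> option X) :
  fp (fun p : A * X => g p.1 p.2) -> fp f -> fp (fun x => obind (g x) (f x)).
Proof.
move=> hg hf; pose e (o : option X) := if o is Some y then [:: y] else [::].
apply: (fpb_ext (f := fun x => head None (map (g x) (e (f x))))); first by move=> x; case: (f x).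
apply: fp_head; apply: fp_map => //; apply: (fpb_comp (g := e) hf).
by apply: fp_recode; case.
Qed.

(** [parser_ex] and [parser_eq] make success equivalent to starting with a code; [parser_sz] bounds
    parsed values by the words they are read from, as the folds that accumulate them require. *)
Record parser (T : enc) (e : T -> seq bool) (P : seq bool -> option (T * seq bool)) : Prop := Parser {
  parser_fp : fp P;
  parser_ex : forall x u, P (e x ++ u) = Some (x, u);
  parser_eq : forall w x u, P w = Some (x, u) -> w = e x ++ u;
  parser_sz : exists c, forall x, sz x <= c * size (e x) + c }.

Definition parsable (T : enc) e := exists P, @parser T e P.

Ltac fpo := repeat (cbv beta; lazymatch goal with
  | |- fpb _ (fun q => obind (@?a q) (@?b q)) => apply: fp_obind
  | |- fpb _ (fun q => head _ (@?a q)) => apply: fp_head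
  | |- fpb _ (fun q => behead (@?a q)) => apply: fp_behead
  | |- fpb _ (fun q => Some (@?a q)) => apply: fp_Some
  | |- fpb _ (fun q => rev (@?a q)) => apply: fp_rev
  | _ => fp_step end).

Lemma parsable_bool : @parsable enc_bool (fun b => [:: b]).
Proof.
exists (fun w => if nilp w then None else Some (head false w, behead w)); split.
- by fpo.
- by move=> [].
- by move=> [|b w] //= x u [-> ->].
- by exists 3 => b; have := sz_bool b; rewrite /=; lia.
Qed.

Lemma parsable_pair (T U : enc) (e : T -> seq bool) (d : U -> seq bool) : parsable e -> parsable d ->
  @parsable (enc_pair T U) (fun x => e x.1 ++ d x.2).
Proof.
move=> [P [hP exP eqP szP]] [Q [hQ exQ eqQ szQ]].
exists (fun w => obind (fun r => obind (fun r' => Some ((r.1, r'.1), r'.2)) (Q r.2)) (P w)); split.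
- by fpo.
- by move=> [x y] u; rewrite -catA exP /= exQ.
- move=> w [x y] u /=; case E: (P w) => [[x' v]|] //=; case E': (Q v) => [[y' v']|] //= [<- <- <-].
  by rewrite (eqP _ _ _ E) (eqQ _ _ _ E') catA.
- case: szP szQ => c hc [k hk]; exists (c + k + 1) => -[x y].
  by rewrite sz_pair size_cat /=; have := hc x; have := hk y; nia.
Qed.

Section SeqParser.
Variables (T : enc) (e : T -> seq bool) (P : seq bool -> option (T * seq bool)).
Hypothesis hP : parser e P.

Let step (s : option (bool * seq T * seq bool)) := obind (fun s =>
  if s.1.1 then Some s else if nilp s.2 then None else
  if head false s.2 then obind (fun r => Some ((false, r.1 :: s.1.2), r.2)) (P (behead s.2))
  else Some ((true, s.1.2), behead s.2)) s.

(** The word serves as its own clock: every round consumes at least one bit, so its length is enough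
    rounds. The flag records that the closing [false] has been met. *)
Let run w := foldl (fun s (_ : bool) => step s) (Some ((false, [::]), w)).

Let items (s : seq T) := flatten [seq true :: e x | x <- s].

Lemma enc_seq_items s : Defs.enc_seq e s = items s ++ [:: false].
Proof. by elim: s => //= x s ->; rewrite catA. Qed.

Lemma run_inv w l d acc r : run w l = Some ((d, acc), r) ->
  w = items (rev acc) ++ (if d then false :: r else r).
Proof.
elim/last_ind: l d acc r => [|l b IH] d acc r; first by case=> <- <- <-.
rewrite /run -cats1 foldl_cat -/(run w l) /=; case E: (run w l) => [[[d' a] r']|] //=.
have {E IH} -> := IH _ _ _ E; case: d' => [|]; first by case=> <- <- <-.
case: r' => [|[] r'] //=; last by case=> <- <- <-.
case E: (P r') => [[x u]|] //= [<- <- <-]; rewrite (parser_eq hP E) rev_cons /items -cats1.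
by rewrite map_cat flatten_cat /= cats0 -!catA.
Qed.

Lemma sz_items : exists c, forall s, sz s <= c * size (items s) + 1.
Proof.
have [c hc] := parser_sz hP; exists (c + 1); elim=> [|x s IH] /=; first by rewrite sz_nil; lia.
by rewrite sz_cons /items /= size_cat -/(items s); have := hc x; nia.
Qed.

Lemma fp_run : fp (fun w => run w w).
Proof.
have hf := parser_fp hP.
apply: (fpb_foldl (f := fun _ s _ => step s)); [by rewrite /step; fpo|by fpo|by fpo|].
have [c hc] := sz_items; exists (fun w => c * sz w + sz w + 10); first by pbd; exists 1 => x; lia.
move=> w i; rewrite -/(run w _); case E: (run w _) => [[[d acc] r]|]; last by rewrite /sz /=; lia.
have := run_inv E => eq; have := hc (rev acc).
have <- : sz acc = sz (rev acc).
  by elim: (acc) => // x s IH; rewrite rev_cons -cats1; have := sz_cat (rev s) [:: x]; rewrite !sz_cons sz_nil; lia.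
have l1 : size (items (rev acc)) <= sz w.
  have h1 : 2 * @size bool w < sz w := sz_size w.
    have h2 : @size bool w = _ := congr1 size eq; rewrite size_cat in h2; lia.
have l2 : sz r <= sz w.
  have := sz_cat (items (rev acc)) (if d then false :: r else r); rewrite -eq.
  by have := sz_gt0 (items (rev acc)); case: (d); rewrite ?sz_cons; lia.
have -> : sz (Some (d, acc, r)) = (sz d + sz acc + sz r).+4 by rewrite /sz /=; lia.
have := sz_bool d; nia.
Qed.

Lemma run_stable n acc r : iter n step (Some ((true, acc), r)) = Some ((true, acc), r).
Proof. by elim: n => //= n ->. Qed.

Lemma run_items s acc u n : size s < n ->
  iter n step (Some ((false, acc), items s ++ false :: u)) = Some ((true, catrev s acc), u).
Proof.
elim: s acc n => [|x s IH] acc [|n] //= lt; rewrite -iterS iterSr /=; first exact: run_stable.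
by rewrite -!catA (parser_ex hP) /= IH.
Qed.

Lemma parser_seq : parsable (T := enc_seq T) (Defs.enc_seq e).
Proof.
exists (fun w => obind (fun s => if s.1.1 then Some (rev s.1.2, s.2) else None) (run w w)); split.
- by have := fp_run => hr; fpo.
- move=> s u; rewrite /run (foldl_const step) enc_seq_items -catA run_items /=.
    by rewrite catrevE cats0 revK.
  have : size s <= size (items s) by elim: (s) => //= x t IH; rewrite /items /= size_cat -/(items t); lia.
  by rewrite size_cat /=; lia.
- move=> w s u; case E: (run w w) => [[[[] acc] r]|] //= [<- <-].
  by rewrite enc_seq_items -catA /=; apply: (run_inv E).
- have [c hc] := sz_items; exists (c + 1) => s; rewrite enc_seq_items size_cat.
  by have := hc s; rewrite /=; lia.
Qed.
End SeqParser.

Lemma parsable_seq (T : enc) (e : T -> seq bool) : parsable e -> @parsable (enc_seq T) (Defs.enc_seq e).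
Proof. by case=> P; apply: parser_seq. Qed.

Lemma parsable_name : @parsable (enc_seq enc_bool) enc_name.
Proof. exact: parsable_seq parsable_bool. Qed.



(** ** Concepts *)

(* The constructor is coded by the three bits of [enc_concept]. *)
Notation tok := (bool * (bool * bool) * name)%type.

Definition named_tok (k : bool * (bool * bool)) := k.2.1 && (k.1 || ~~ k.2.2).

Definition arity (k : bool * (bool * bool)) :=
  if k.1 && ~~ k.2.1 then 2 else if k.2.1 && (k.1 || k.2.2) then 1 else 0.

Definition enc_tok (t : tok) : seq bool :=
  [:: t.1.1; t.1.2.1; t.1.2.2] ++ (if named_tok t.1 then enc_name t.2 else [::]).

Definition concept_of (t : tok) (C D : concept) : concept :=
  if t.1.1 then
    if t.1.2.1 then if t.1.2.2 then All t.2 C else Ex t.2 C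
    else if t.1.2.2 then Or C D else And C D
  else if t.1.2.1 then if t.1.2.2 then Not C else Atom t.2
  else if t.1.2.2 then Bot else Top.

Fixpoint toks (C : concept) : seq tok :=
  match C with
  | Top => [:: ((false, (false, false)), [::])]
  | Bot => [:: ((false, (false, true)), [::])]
  | Atom A => [:: ((false, (true, false)), A)]
  | Not C => ((false, (true, true)), [::]) :: toks C
  | And C D => ((true, (false, false)), [::]) :: toks C ++ toks D
  | Or C D => ((true, (false, true)), [::]) :: toks C ++ toks D
  | Ex R C => ((true, (true, false)), R) :: toks C
  | All R C => ((true, (true, true)), R) :: toks C
  end.

Lemma fp_concept_of (A : enc) (t : A -> tok) (C D : A -> concept) : fp t -> fp C -> fp D ->
  fp (fun x => concept_of (t x) (C x) (D x)).
Proof.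
move=> ht hC hD; have h := fp_const A Top; have hn := fp_const A ([::] : seq bool).
have ht2 := fp_snd ht.
have n1 : fp (fun x => All (t x).2 (C x)) by apply: (@fp_node _ 7 (fun x => (t x).2) C (fun=> Top)).
have n2 : fp (fun x => Ex (t x).2 (C x)) by apply: (@fp_node _ 6 (fun x => (t x).2) C (fun=> Top)).
have n3 : fp (fun x => Or (C x) (D x)) by apply: (@fp_node _ 5 (fun=> [::]) C D).
have n4 : fp (fun x => And (C x) (D x)) by apply: (@fp_node _ 4 (fun=> [::]) C D).
have n5 : fp (fun x => Not (C x)) by apply: (@fp_node _ 3 (fun=> [::]) C (fun=> Top)).
have n6 := fp_Atom ht2.
have n7 := fp_const A Bot.
rewrite /concept_of; fps.
Qed.

(** Prefix notation is evaluated from the right end: the arguments are then on the stack before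
    their constructor arrives. *)
Definition ev (st : option (seq concept)) (t : tok) : option (seq concept) :=
  obind (fun st => if arity t.1 <= size st then
    Some (concept_of t (head Top st) (head Top (behead st)) :: drop (arity t.1) st) else None) st.

Lemma ev_toks C st : foldl ev (Some st) (rev (toks C)) = Some (C :: st).
Proof.
elim: C st => [||A|C IH|C IHC D IHD|C IHC D IHD|R C IH|R C IH] st //=;
  by rewrite ?rev_cons -?cats1 ?rev_cat ?foldl_cat ?IHD ?IHC ?IH /= ?drop0.
Qed.

Lemma ev_enc ts st : foldl ev (Some [::]) ts = Some st ->
  flatten (map enc_tok (rev ts)) = flatten (map Defs.enc_concept st).
Proof.
elim/last_ind: ts st => [|ts t IH] st; first by case=> <-.
rewrite -cats1 foldl_cat rev_cat /=; case: (foldl _ _ _) IH => [st'|] //= /(_ _ erefl) ->.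
case: t => [[b0 [b1 b2]] n]; rewrite /arity /enc_tok /concept_of /named_tok /=.
by case: b0 b1 b2 => -[] []; case: st' => [|C [|D st']] //= [<-] //=; rewrite ?drop0 -?catA ?cats0.
Qed.

Lemma sz_concept_of t C D : sz (concept_of t C D) <=
  sz t.2 + (0 < arity t.1) * sz C + (1 < arity t.1) * sz D + 25.
Proof. by rewrite /sz; case: t => [[[] [[] []]] n] /=; lia. Qed.

Lemma sz_ev ts st : foldl ev (Some [::]) ts = Some st -> sz st <= 30 * sz ts.
Proof.
elim/last_ind: ts st => [|ts t IH] st; first by case=> <-.
rewrite -cats1 foldl_cat /=; case: (foldl _ _ _) IH => [st'|] //= /(_ _ erefl).
have := sz_cat ts [:: t]; rewrite sz_cons sz_nil => e; case: ifP => // le le' [<-].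
have st2 : sz t.2 < sz t by case: (t) => a b; rewrite sz_pair ltnS leq_addl.
have h1 : (0 < arity t.1) * sz (head Top st') + (1 < arity t.1) * sz (head Top (behead st')) +
  sz (drop (arity t.1) st') <= sz st'.
  have : arity t.1 <= 2 by case: (t.1) => [[] [[] []]].
  case: (arity t.1) le => [|[|[|]]] //; case: st' {le'} => [|C [|D st']] //=; rewrite ?sz_cons ?sz_nil ?drop0 //; lia.
have h2 := sz_concept_of t (head Top st') (head Top (behead st')).
have key a b p q d n c st0 u v : a + b + d <= st0 -> c <= n + a + b + 25 -> n < q -> st0 <= 30 * u ->
  v.+1 = u + (q + 1).+1 -> p = (c + d).+1 -> p <= 30 * v by lia.
exact: (key _ _ _ _ _ _ _ _ _ _ h1 h2 st2 le' e (sz_cons _ _)).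
Qed.

Lemma parse_bits : exists Q, @parser (enc_pair enc_bool (enc_pair enc_bool enc_bool))
  (fun k => [:: k.1; k.2.1; k.2.2]) Q.
Proof. exact: (parsable_pair parsable_bool (parsable_pair parsable_bool parsable_bool)). Qed.

Section ConceptParser.
Variables (P : seq bool -> option (seq bool * seq bool))
  (Q : seq bool -> option (bool * (bool * bool) * seq bool)).
Hypothesis hP : @parser (enc_seq enc_bool) enc_name P.
Hypothesis hQ : @parser (enc_pair enc_bool (enc_pair enc_bool enc_bool))
  (fun k => [:: k.1; k.2.1; k.2.2]) Q.

Let ptok w := obind (fun r => if named_tok r.1 then obind (fun n => Some ((r.1, n.1), n.2)) (P r.2)
  else Some ((r.1, [::]), r.2)) (Q w).

Let wf (t : tok) := named_tok t.1 || nilp t.2.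

Lemma ptok_ex k n u : wf (k, n) -> ptok (enc_tok (k, n) ++ u) = Some ((k, n), u).
Proof.
move=> h; have e1 := parser_ex hQ k; rewrite /ptok /enc_tok -catA e1 /=.
case E: (named_tok k) h => /=; first by rewrite (parser_ex hP).
by rewrite /wf /= E => /nilP->.
Qed.

Lemma ptok_eq w t u : ptok w = Some (t, u) -> wf t /\ w = enc_tok t ++ u.
Proof.
rewrite /ptok; case E: (Q w) => [[k v]|] //=; have {E} -> := parser_eq hQ E.
case: ifP => nk; last by case=> <- <-; rewrite /enc_tok /wf /= nk.
by case E: (P v) => [[n v']|] //= [<- <-]; rewrite (parser_eq hP E) /enc_tok /wf /= nk.
Qed.

(** The number counts the concepts still to be read: a token settles one and adds its arity. Reading
    starts at 1 and stops at 0. *)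
Let step (s : option (nat * seq tok * seq bool)) := obind (fun s =>
  if s.1.1 == 0 then Some s
  else obind (fun t => Some ((arity t.1.1 + s.1.1.-1, t.1 :: s.1.2), t.2)) (ptok s.2)) s.

Let run w := foldl (fun s (_ : bool) => step s) (Some ((1, [::]), w)).

Let items (s : seq tok) := flatten (map enc_tok s).

Lemma run_tok_inv w l n acc r : run w l = Some ((n, acc), r) ->
  [/\ all wf acc, n <= 1 + 2 * size acc & w = items (rev acc) ++ r].
Proof.
elim/last_ind: l n acc r => [|l b IH] n acc r; first by case=> <- <- <-.
rewrite /run -cats1 foldl_cat -/(run w l) /=; case E: (run w l) => [[[n' a] r']|] //=.
have {E IH} [wa na ew] := IH _ _ _ E; case: ifP => _; first by case=> <- <- <-.
case E: (ptok r') => [[t u]|] //= [<- <- <-]; have [wt er] := ptok_eq E.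
split; first by rewrite /= wt.
  have : arity t.1 <= 2 by case: (t.1) => [[] [[] []]].
  by rewrite /=; lia.
by rewrite ew er rev_cons /items -cats1 map_cat flatten_cat /= cats0 -!catA.
Qed.

Lemma sz_tok : exists c, forall t, wf t -> sz t <= c * size (enc_tok t).
Proof.
have [c hc] := parser_sz hP; exists (c + 20) => -[[a [b d]] n] h.
rewrite !sz_pair /enc_tok size_cat /=; have := sz_bool a; have := sz_bool b; have := sz_bool d.
move: h; rewrite /wf /=; case: (named_tok _) => /= [_|/nilP->].
  by have := hc n; nia.
by rewrite sz_nil /=; nia.
Qed.

Lemma sz_toks : exists c, forall s, all wf s -> sz s <= c * size (items s) + 1.
Proof.
have [c hc] := sz_tok; exists (c + 1); rewrite /items; elim=> [|t s IH]; first by rewrite sz_nil; lia.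
have -> : flatten [seq enc_tok i | i <- t :: s] = enc_tok t ++ items s by [].
case/andP=> wt /IH.
rewrite sz_cons size_cat mulnDr mulnDl; have := hc t wt.
have : 0 < size (enc_tok t) by [].
by lia.
Qed.

Lemma sz_rev (T : enc) (s : seq T) : sz (rev s) = sz s.
Proof.
by elim: s => // x s IH; rewrite rev_cons -cats1; have := sz_cat (rev s) [:: x]; rewrite !sz_cons sz_nil; lia.
Qed.

Lemma fp_predn (A : enc) (f : A -> nat) : fp f -> fp (fun x => (f x).-1).
Proof.
move=> hf; apply: fp_detree; apply: (fpb_ext (f := fun x => tl (en (f x)))).
  by move=> x; case: (f x).
by apply: fp_tl; apply: fp_en.
Qed.

Ltac fpc := repeat (cbv beta; lazymatch goal with
  | |- fpb _ (fun q => obind (@?a q) (@?b q)) => apply: fp_obind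
  | |- fpb _ (fun q => head _ (@?a q)) => apply: fp_head
  | |- fpb _ (fun q => behead (@?a q)) => apply: fp_behead
  | |- fpb _ (fun q => Some (@?a q)) => apply: fp_Some
  | |- fpb _ (fun q => size (@?a q)) => apply: fp_size
  | |- fpb _ (fun q => drop (@?b q) (@?a q)) => apply: fp_drop
  | |- fpb _ (fun q => (@?b q) + (@?a q)) => apply: fp_addn
  | |- fpb _ (fun q => predn (@?a q)) => apply: fp_predn
  | |- fpb _ (fun q => concept_of _ _ _) => apply: fp_concept_of
  | _ => fp_step end).

Lemma fp_tok_run : fp (fun w => run w w).
Proof.
have hf := parser_fp hP; have hg := parser_fp hQ.
apply: (fpb_foldl (f := fun _ s _ => step s)); [by rewrite /step /ptok /arity /named_tok; fpc|by fpc|by fpc|].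
have [c hc] := sz_toks; exists (fun w => 5 * (c * sz w) + sz w + 30); first by pbd; exists 1 => x; lia.
move=> w i; rewrite -/(run w _); case E: (run w _) => [[[n acc] r]|]; last by rewrite /sz /=; lia.
have [wa na eq] := run_tok_inv E; have := hc (rev acc); rewrite all_rev => /(_ wa); rewrite sz_rev => l0.
have h1 : 2 * @size bool w < sz w := sz_size w.
have h2 : @size bool w = _ := congr1 size eq; rewrite size_cat in h2.
have l2 : sz r <= sz w.
  have := sz_cat (items (rev acc)) r; rewrite -eq.
  by have := sz_gt0 (items (rev acc)); lia.
have -> : sz (Some (n, acc, r)) = (sz n + sz acc + sz r).+4 by rewrite /sz /=; lia.
have := sz_size acc; rewrite sz_nat; have : size (items (rev acc)) <= sz w by lia.
move=> h3 h4.
have key n' a s' i' r' w1 w2 : n' <= 1 + 2 * s' -> 2 * s' < a -> a <= i' + 1 -> i' <= w1 -> r' <= w2 ->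
  ((2 * n').+1 + a + r').+3 < 5 * w1 + w2 + 30 by lia.
have h5 : c * size (items (rev acc)) <= c * sz w by rewrite leq_mul2l; apply/orP; right; lia.
exact: (key _ _ _ _ _ _ _ na h4 l0 h5 l2).
Qed.

Lemma iter_add k l s : iter (k + l) step s = iter l step (iter k step s).
Proof. by rewrite addnC iterD. Qed.

Lemma step_tok n acc k m u : wf (k, m) ->
  step (Some ((n.+1, acc), enc_tok (k, m) ++ u)) = Some ((arity k + n, (k, m) :: acc), u).
Proof. by move=> h; rewrite /step /= (ptok_ex _ h). Qed.

Lemma run_toks C n acc u :
  iter (size (toks C)) step (Some ((n.+1, acc), Defs.enc_concept C ++ u)) =
  Some ((n, catrev (toks C) acc), u).
Proof.
have D0 (s : seq bool) : s = [::] ++ s by [].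
elim: C n acc u => [||A|C IH|C IHC D IHD|C IHC D IHD|R C IH|R C IH] n acc u.
- exact: (@step_tok n acc (false, (false, false)) [::] u).
- exact: (@step_tok n acc (false, (false, true)) [::] u).
- exact: (@step_tok n acc (false, (true, false)) A u).
- by rewrite [size _]/= -add1n iter_add /= -IH; congr (iter _ step _);
    exact: (@step_tok n acc (false, (true, true)) [::] (Defs.enc_concept C ++ u)).
- rewrite [size _]/= size_cat -add1n !iter_add [iter 1 _ _]/= [toks _]/= [catrev _ _]/= catrev_catl -IHD -IHC.
  congr (iter _ step (iter _ step _)); rewrite [Defs.enc_concept _]/= -catA.
  exact: (@step_tok n acc (true, (false, false)) [::] (Defs.enc_concept C ++ Defs.enc_concept D ++ u)).
- rewrite [size _]/= size_cat -add1n !iter_add [iter 1 _ _]/= [toks _]/= [catrev _ _]/= catrev_catl -IHD -IHC.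
  congr (iter _ step (iter _ step _)); rewrite [Defs.enc_concept _]/= -catA.
  exact: (@step_tok n acc (true, (false, true)) [::] (Defs.enc_concept C ++ Defs.enc_concept D ++ u)).
- rewrite [size _]/= -add1n iter_add /= -IH; congr (iter _ step _); rewrite -catA.
  exact: (@step_tok n acc (true, (true, false)) R (Defs.enc_concept C ++ u)).
- rewrite [size _]/= -add1n iter_add /= -IH; congr (iter _ step _); rewrite -catA.
  exact: (@step_tok n acc (true, (true, true)) R (Defs.enc_concept C ++ u)).
Qed.

Lemma size_toks C : size (toks C) <= size (Defs.enc_concept C).
Proof. by elim: C => //= *; rewrite ?size_cat; lia. Qed.

Lemma parser_concept : @parsable enc_concept Defs.enc_concept.
Proof.
exists (fun w => obind (fun s => obind (fun st =>
   if (s.1.1 == 0) && (size st == 1) then Some (head Top st, s.2) else None)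
   (foldl ev (Some [::]) s.1.2)) (run w w)); split.
- have hr := fp_tok_run; fpc.
  apply: (fpb_foldl (f := fun _ s t => ev s t)); [by rewrite /ev /arity; fpc|by fpc|by fpc|].
  exists (fun q => 30 * sz q + 30); first by pbd; exists 1 => x; lia.
  move=> q i; case E: (foldl _ _ _) => [st|]; last by rewrite /sz /=; lia.
  have h1 := sz_ev E; have h2 := sz_take q.2.1.2 i.
  have h3 : sz q.2.1.2 <= sz q by case: (q) => a [[b d] e] /=; rewrite !sz_pair; lia.
  have key a b d e : a <= 30 * b -> b <= d -> d <= e -> (a + 1).+1 <= 30 * e + 30 by lia.
  exact: (key _ _ _ _ h1 h2 h3).
- move=> C u; rewrite /run (foldl_const step).
  have le : size (toks C) <= size (Defs.enc_concept C ++ u) by rewrite size_cat; have := size_toks C; lia.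
  rewrite -(subnKC le) iter_add run_toks.
  have -> : iter (size (Defs.enc_concept C ++ u) - size (toks C)) step (Some (0, catrev (toks C) [::], u))
    = Some (0, catrev (toks C) [::], u) by elim: (_ - _) => //= m ->.
  by rewrite /= -[catrev _ _]/(rev (toks C)) ev_toks.
- move=> w C u; case E: (run w w) => [[[n acc] r]|] //=.
  case E': (foldl ev _ acc) => [[|D [|]]|] //=; rewrite ?andbF //; case: ifP => // _ [<- <-].
  by have [_ _ ->] := run_tok_inv E; rewrite /items (ev_enc E') /= cats0.
- have [c hc] := parser_sz hP; exists (c + 30); rewrite /sz /=.
  elim=> [||A|C IH|C IHC D IHD|C IHC D IHD|R C IH|R C IH] /=; rewrite ?size_cat;
  try (have := hc A); try (have := hc R); rewrite /sz /=; nia.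
Qed.
End ConceptParser.

Lemma parsable_concept : @parsable enc_concept Defs.enc_concept.
Proof. by have [P hP] := parsable_name; have [Q hQ] := parse_bits; apply: parser_concept hP hQ. Qed.


Lemma parsable_assertion : @parsable enc_assertion Defs.enc_assertion.
Proof.
have [P hP] := parsable_name; have [Q hQ] := parsable_pair parsable_name parsable_name.
exists (fun w => if nilp w then None else
  if head false w then obind (fun r => obind (fun r' => Some (RoleAssertion r.1.1 r.1.2 r'.1, r'.2)) (P r.2)) (Q (behead w))
  else obind (fun r => Some (ConceptAssertion r.1.1 r.1.2, r.2)) (Q (behead w))); split.
- have hp := parser_fp hP; have hq := parser_fp hQ.
  have hR (A : enc) (f g h : A -> seq bool) : fp f -> fp g -> fp h -> fp (fun x => RoleAssertion (f x) (g x) (h x)).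
    move=> hf hg hh; apply: fp_detree; apply: (fp_en (f := fun x => (true, (f x, (g x, h x))))); fps.
  have hC (A : enc) (f g : A -> seq bool) : fp f -> fp g -> fp (fun x => ConceptAssertion (f x) (g x)).
    move=> hf hg; apply: fp_detree; apply: (fp_en (f := fun x => (false, (f x, (g x, [::] : seq bool))))); fps.
  repeat first [lazymatch goal with |- fpb _ (fun q => RoleAssertion _ _ _) => apply: hR
    | |- fpb _ (fun q => ConceptAssertion _ _) => apply: hC end | progress fpo].
- move=> [A a|R a b] u /=.
    by have := parser_ex hQ (A, a) u; rewrite /= => ->.
  by have := parser_ex hQ (R, a) (enc_name b ++ u); rewrite /= -!catA => -> /=; rewrite (parser_ex hP).
- move=> [|[] w] //= x u.
    case E: (Q w) => [[[R a] v]|] //=; case E': (P v) => [[b v']|] //= [<- <-].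
    by rewrite (parser_eq hQ E) (parser_eq hP E') /= -!catA.
  by case E: (Q w) => [[[A a] v]|] //= [<- <-]; rewrite (parser_eq hQ E).
- have [c hc] := parser_sz hP; exists (c * 2 + 10) => -[A a|R a b] /=; rewrite !size_cat /sz /=.
    by have := hc A; have := hc a; rewrite /sz /=; nia.
  by have := hc R; have := hc a; have := hc b; rewrite /sz /=; nia.
Qed.

(** ** Subconcepts *)

Definition args C : seq concept :=
  if (ctag C == 4) || (ctag C == 5) then [:: carg1 C; carg2 C] else
  if (ctag C == 3) || (ctag C == 6) || (ctag C == 7) then [:: carg1 C] else [::].

(** Depth-first traversal with an explicit stack, as folds over lists are the only recursion
    available. *)
Definition subs_step (s : seq concept * seq concept) :=
  if nilp s.1 then s else (args (head Top s.1) ++ behead s.1, head Top s.1 :: s.2).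

(* The length of [l] bounds the number of steps. *)
Definition fsubs (l : seq bool) C := rev (foldl (fun s _ => subs_step s) ([:: C], [::]) l).2.

Lemma iter_subs C st acc : iter (size (subs C)) subs_step (C :: st, acc) = (st, catrev (subs C) acc).
Proof.
elim: C st acc => [||A|C IH|C IHC D IHD|C IHC D IHD|R C IH|R C IH] st acc //.
- by rewrite [size _]/= iterSr /= IH.
- by rewrite [size _]/= iterSr size_cat addnC iterD /= IHC IHD catrev_catl.
- by rewrite [size _]/= iterSr size_cat addnC iterD /= IHC IHD catrev_catl.
- by rewrite [size _]/= iterSr /= IH.
- by rewrite [size _]/= iterSr /= IH.
Qed.

Lemma fsubsE (l : seq bool) C : size (subs C) <= size l -> fsubs l C = subs C.
Proof.
move=> le; rewrite /fsubs foldl_const -(subnKC le) addnC iterD iter_subs.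
have -> n s : iter n subs_step ([::], s) = ([::], s) by elim: n => //= n ->.
by rewrite /= -[catrev _ _]/(rev _) revK.
Qed.

Lemma size_subs C : size (subs C) <= size (Defs.enc_concept C).
Proof. by elim: C => //= *; rewrite ?size_cat; lia. Qed.

Lemma sz_carg C : sz (carg1 C) <= sz C /\ sz (carg2 C) <= sz C.
Proof. by rewrite /sz; case: C => //= *; split; lia. Qed.

Lemma iter_subs_bound n C : let s := iter n subs_step ([:: C], [::]) in
  [/\ size s.1 <= n.+1, size s.2 <= n, (forall D, List.In D s.1 -> sz D <= sz C)
    & forall D, List.In D s.2 -> sz D <= sz C].
Proof.
elim: n => [|n IH] /=; first by split=> // D [<-|].
case: (iter n _ _) IH => [[|D st] acc] /= [h1 h2 h3 h4].
  by rewrite /subs_step /=; split=> //; lia.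
have hD : sz D <= sz C by apply: h3; left.
have [a1 a2] := sz_carg D.
rewrite /subs_step /=; split.
- by rewrite size_cat; have : size (args D) <= 2; [by rewrite /args; case: ifP => _ //; case: ifP|lia].
- by [].
- move=> E /in_listP; rewrite mem_cat => /orP[|/in_listP i]; last by apply: h3; right.
  rewrite /args; case: ifP => _; first by rewrite !inE => /orP[]/eqP->; lia.
  by case: ifP => _ //; rewrite inE => /eqP->; lia.
- by move=> E [<- //|/h4].
Qed.

Lemma fp_fsubs (A : enc) (l : A -> seq bool) (C : A -> concept) : fp l -> fp C -> fp (fun x => fsubs (l x) (C x)).
Proof.
move=> hl hC; apply: fp_rev; apply: fp_snd.
apply: (fpb_foldl (f := fun _ s _ => subs_step s)); [by rewrite /subs_step /args; fpo|by fpo|by fpo|].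
exists (fun a => 10 + 4 * (sz (l a) + 1) * (sz (C a) + 1)).
  by have := fpb_pbd hl; have := fpb_pbd hC; move=> *; pbd.
move=> a i; rewrite foldl_const; set n := size _.
have hn : n <= sz (l a).
  have k1 a1 b1 c1 : 2 * a1 < b1 -> b1 <= c1 -> a1 <= c1 by lia.
  exact: (k1 _ _ _ (sz_size _) (sz_take _ _)).
have [h1 h2 h3 h4] := iter_subs_bound n (C a).
case: (iter _ _ _) h1 h2 h3 h4 => s t /= h1 h2 /(sz_seq_bound (A := enc_concept)) h3 /(sz_seq_bound (A := enc_concept)) h4.
have key x y m k N p : x <= (m * k.+1).+1 -> y <= (p * k.+1).+1 -> m <= n.+1 -> p <= n -> n <= N ->
   (x + y).+1 <= 10 + 4 * (N + 1) * (k + 1).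
  move=> e1 e2 e3 e4 e5; have : m * k.+1 <= N.+1 * k.+1 by rewrite leq_mul2r; apply/orP; right; lia.
  have : p * k.+1 <= N.+1 * k.+1 by rewrite leq_mul2r; apply/orP; right; lia.
  by rewrite -mulnA !addn1; lia.
exact: (key _ _ _ _ _ _ h3 h4 h1 h2 hn).
Qed.

(** ** Enumerations *)

Lemma fpb_foldr (A S X : enc) b (f : A -> X -> S -> S) (s0 : A -> S) (l : A -> seq X) :
  fp (fun p : A * S * X => f p.1.1 p.2 p.1.2) -> fpb b s0 -> fpb b l ->
  (exists2 u, pbd (fun x => sz x + b x) u &
     forall a i, sz (foldr (f a) (s0 a) (drop i (l a))) <= u a) ->
  fpb b (fun a => foldr (f a) (s0 a) (l a)).
Proof.
move=> hf hs hl [u hu h]; apply: (fpb_ext (f := fun a => foldl (fun s x => f a x s) (s0 a) (rev (l a)))).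
  by move=> a; rewrite foldl_rev.
apply: (fpb_foldl (f := fun a s x => f a x s)) => //.
  by apply: (fpb_comp (g := @rev X) hl); apply: fp_rev; apply: fp_id.
by exists u => // a i; rewrite take_rev foldl_rev; apply: h.
Qed.

Lemma sz_sublists (X : enc) (s : seq X) : sz (sublists s) <= 3 * (2 ^ sz s) ^ 3.
Proof.
elim: s => [|x s IH] //=; rewrite sz_cons.
set r := sublists s in IH *.
have e : sz (map (cons x) r) <= sz r * (sz x).+2.
  by elim: (r) => //= y t h; rewrite !sz_cons; have := sz_gt0 x; nia.
have := sz_cat r (map (cons x) r) => e2.
have h : sz x + 3 <= 2 ^ (sz x + 2).
  by elim: (sz x) => // n; rewrite addSn expnS; set y := 2 ^ _; lia.
rewrite -addSn addnC expnD expnMn mulnA.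
apply: leq_trans (_ : (3 * (2 ^ sz s) ^ 3) * (sz x + 3) <= _).
  have k1 a b c d : d.+1 = a + c -> c <= a * b.+2 -> d <= a * (b + 3) by move=> *; rewrite mulnDr; lia.
  by apply: leq_trans (k1 _ _ _ _ e2 e) _; rewrite leq_mul2r IH orbT.
rewrite leq_mul2l; apply/orP; right; apply: leq_trans h _.
by rewrite -expnM leq_exp2l //; lia.
Qed.

Lemma fpb_sublists (X : enc) : fpb (fun s : seq X => 2 ^ sz s) (@sublists X).
Proof.
apply: (fpb_ext (f := fun s => foldr (fun x r => r ++ map (cons x) r) [:: [::]] s)).
  by elim=> //= x s ->.
apply: (fpb_foldr (f := fun _ x r => r ++ map (cons x) r)); [by fps|apply: fpb_le; exact: fp_const|apply: fpb_le; exact: fp_id|].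
exists (fun s => 3 * (2 ^ sz s) ^ 3); first by pbd; exists 1 => x; lia.
move=> s i; have -> : foldr (fun x r => r ++ map (cons x) r) [:: [::]] (drop i s) = sublists (drop i s).
  by elim: (drop i s) => //= x t ->.
apply: leq_trans (sz_sublists _) _; rewrite leq_mul2l leq_exp2r // leq_exp2l //=.
have := sz_cat (take i s) (drop i s); rewrite cat_take_drop; have := sz_gt0 (take i s); lia.
Qed.

Lemma sz_cart (X : enc) (s : seq (seq X)) : sz (cart s) <= 3 * (5 * sz s) ^ size s.
Proof.
have e (l : seq X) (r : seq (seq X)) : sz [seq x :: u | x <- l, u <- r] <= 5 * sz l * sz r.
  have r0 := sz_gt0 r; elim: l => [|x l IH] /=.
    by rewrite sz_nil muln1; apply: leq_trans (leq_pmulr 5 r0).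
  have := sz_cat [seq x :: u | u <- r] [seq x0 :: u | x0 <- l, u <- r].
  have : sz [seq x :: u | u <- r] <= 3 * sz x * sz r.
    elim: r {IH r0} => [|y r h]; first by rewrite sz_nil; have := sz_gt0 x; lia.
    by rewrite /= !sz_cons; have := sz_gt0 x; have := sz_gt0 y; nia.
  rewrite [sz (x :: l)]sz_cons.
  have -> : 5 * (sz x + sz l).+1 * sz r = 5 * sz x * sz r + 5 * sz l * sz r + 5 * sz r.
    by rewrite -[(sz x + _).+1]addn1 !mulnDr !mulnDl muln1.
  by move: r0 IH; set y := sz r; set z := sz (_ ++ _); lia.
suff H n : sz s <= n -> sz (cart s) <= 3 * (5 * n) ^ size s by apply: H.
elim: s => [|l s IH] //=; rewrite sz_cons => le; apply: leq_trans (e _ _) _.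
have {IH} : sz (cart s) <= 3 * (5 * n) ^ size s by apply: IH; lia.
rewrite expnS => h; apply: leq_trans (_ : 5 * n * (3 * (5 * n) ^ size s) <= _); last by nia.
by apply: leq_mul => //; lia.
Qed.

Lemma fpb_cart (X : enc) : fpb (fun s : seq (seq X) => (5 * sz s) ^ size s) (@cart X).
Proof.
apply: (fpb_ext (f := fun s => foldr (fun l r => [seq x :: u | x <- l, u <- r]) [:: [::]] s)).
  by elim=> //= x s ->.
apply: (fpb_foldr (f := fun _ (l : seq X) r => [seq x :: u | x <- l, u <- r])).
- by apply: (fp_allpairs (f := fun _ x u => x :: u)); fps.
- by apply: fpb_le; exact: fp_const.
- by apply: fpb_le; exact: fp_id.
exists (fun s => 3 * (5 * sz s) ^ size s).
  by pbd; exists 1 => x; rewrite expn1 -addnA addnCA leq_addr.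
move=> s i; have -> : foldr (fun l r => [seq x :: u | x <- l, u <- r]) [:: [::]] (drop i s) = cart (drop i s).
  by elim: (drop i s) => //= x t ->.
apply: leq_trans (sz_cart _) _; rewrite leq_mul2l /=.
have h1 : sz (drop i s) <= sz s.
  by have := sz_cat (take i s) (drop i s); rewrite cat_take_drop; have := sz_gt0 (take i s); lia.
have := sz_gt0 (drop i s) => h2.
apply: leq_trans (_ : (5 * sz s) ^ size (drop i s) <= _).
  by case: (size _) => // n; rewrite leq_exp2r // leq_mul2l h1.
by apply: leq_pexp2l; [rewrite muln_gt0 sz_gt0|rewrite size_drop leq_subr].
Qed.

Lemma fpb_pow2 : fpb (fun n : nat => 2 ^ n) (fun n : nat => 2 ^ n).
Proof.
apply: (fpb_ext (f := fun n => foldl (fun s (_ : unit) => s + s) 1 (nseq n tt))).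
  move=> n; rewrite foldl_const size_nseq; elim: n => //= n ->; rewrite expnS; lia.
apply: (fpb_foldl (f := fun _ s _ => s + s)).
- by apply: fp_addn; fps.
- by apply: fpb_le; exact: fp_const.
- by apply: fpb_le; apply: fp_nseq; fps.
exists (fun n => 2 * 2 ^ n + 1); first by pbd; exists 1 => x; lia.
move=> n i; rewrite foldl_const; set m := size _.
have le : m <= n by rewrite /m size_take size_nseq; case: ifP; lia.
have -> : iter m (fun s => s + s) 1 = 2 ^ m by elim: (m) => //= k ->; rewrite expnS; lia.
have : 2 ^ m <= 2 ^ n by rewrite leq_exp2l.
by rewrite sz_nat; lia.
Qed.

Section Enumerations.
Variable W : enc.

Lemma simple_exp_sublists (X : enc) (f : W -> seq X) : fp f -> simple_exp (fun w => sublists (f w)).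
Proof.
move=> hf; apply: (simple_exp_step hf (fpb_sublists X)); exists (fun w => sz (f w)) => //.
by have [k hk] := fpb_pbd hf; exists k => x; have := hk x; rewrite addn0.
Qed.

Lemma double_exp_pow2 (f : W -> nat) : simple_exp f -> double_exp (fun w => 2 ^ f w).
Proof.
move=> hf; apply: (double_exp_step (double_exp_ex1 hf) fpb_pow2); have [q hq h] := simple_exp_sz hf; exists q => // x.
rewrite leq_exp2l //; apply: leq_trans (h x); rewrite sz_nat; lia.
Qed.

(** The number of tables is the number of values to the power of the number of keys. A single
    exponential exponent keeps a double exponential base double exponential, which is why labels may
    contain tables indexed by types. *)
Lemma double_exp_tables (X V : enc) (keys : W -> seq X) (vals : W -> seq V) : simple_exp keys -> double_exp vals ->
  double_exp (fun w => tables (keys w) (vals w)).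
Proof.
move=> hk hv; pose g (p : seq X * seq V) := [seq [seq (k, v) | v <- p.2] | k <- p.1].
have h : double_exp (fun w => g (keys w, vals w)).
  by apply: (double_exp_comp (f := fun w => (keys w, vals w))); [apply: double_exp_pair => //; apply: double_exp_ex1|rewrite /g; fps].
apply: (double_exp_step h (fpb_cart _)).
have [q hq e] := double_exp_sz h; have [r hr e'] := simple_exp_sz hk.
exists (fun w => q w + r w + 3); first by pbd.
move=> w; have -> : size (g (keys w, vals w)) = size (keys w) by rewrite size_map.
have s1 : size (keys w) <= 2 ^ r w by apply: leq_trans (e' w); have := sz_size (keys w); lia.
apply: leq_trans (_ : (5 * 2 ^ 2 ^ q w) ^ (2 ^ r w) <= _).
  apply: leq_trans (_ : (5 * 2 ^ 2 ^ q w) ^ size (keys w) <= _).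
    by case: (size _) => // n; rewrite leq_exp2r // leq_mul2l; apply/orP; right; apply: e.
  by apply: leq_pexp2l => //; rewrite muln_gt0 expn_gt0.
apply: leq_trans (_ : (2 ^ (3 + 2 ^ q w)) ^ 2 ^ r w <= _).
  by rewrite leq_exp2r ?expn_gt0 // expnD leq_mul2r orbT.
rewrite -expnM leq_exp2l // !expnD.
have : 0 < 2 ^ q w by rewrite expn_gt0.
have : 0 < 2 ^ r w by rewrite expn_gt0.
nia.
Qed.
End Enumerations.

(** ** The upper bound *)

Section UpperBound.
Variable W : enc.

(** [M] is the number of possible profiles, and the last factor is the least width [Wd] that
    [not_entails_cert] accepts; the 2 satisfies its strict inequality. *)
Definition card_bound (K1 K2 : kb) :=
  let L := size (types_of K2) in
  let M := size (sublists (cl_of K1)) * (2 ^ (L.+1 * L)) ^ 2 in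
  L.+1 * (2 * M + size (ind K1) * (L.+1 * L) + 2).

Lemma card_boundP S K1 K2 : {subset ind K2 <= ind K1} -> ~ ucq_entails S K1 K2 ->
  inhabited (cert S K1 K2 (card_bound K1 K2)).
Proof.
by move=> h ne; apply: not_entails_cert (leqnn _) _ h ne; rewrite addn1 addn2.
Qed.

Variables (sc sr : W -> seq name) (T1 T2 : W -> seq (concept * concept))
  (A1 A2 : W -> seq assertion).
Let K1 w := KB (T1 w) (A1 w).
Let K2 w := KB (T2 w) (A2 w).
Hypotheses (hsc : fp sc) (hsr : fp sr) (hT1 : fp T1) (hT2 : fp T2) (hA1 : fp A1) (hA2 : fp A2)
  (hcl1 : fp (fun w => cl_of (K1 w))) (hcl2 : fp (fun w => cl_of (K2 w))).

Lemma fp_ind (A : W -> seq assertion) T : fp A -> fp (fun w => ind (KB (T w) (A w))).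
Proof.
move=> hA; apply: (fpb_ext (f := fun w => flatten (map (fun x =>
   if is_role x then [:: aind1 x; aind2 x] else [:: aind1 x]) (A w)))); last by fps.
by move=> w; congr flatten; apply: eq_map; case.
Qed.

Lemma simple_exp_types (T : W -> seq (concept * concept)) A : fp T -> fp (fun w => cl_of (KB (T w) (A w))) ->
  simple_exp (fun w => [seq t <- sublists (cl_of (KB (T w) (A w))) | okt (cl_of (KB (T w) (A w))) (T w) t]).
Proof.
move=> hT hcl.
pose g (p : seq (concept * concept) * type * seq type) := [seq t <- p.2 | okt p.1.2 p.1.1 t].
apply: (simple_exp_comp (f := fun w => (T w, cl_of (KB (T w) (A w)), sublists (cl_of (KB (T w) (A w))))) (g := g)).
  by apply: simple_exp_pair; [apply: simple_exp_fp; fps|apply: simple_exp_sublists].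
by rewrite /g; repeat (cbv beta; lazymatch goal with |- fpb _ (fun q => okt _ _ _) => apply: fp_okt | _ => fp_step end).
Qed.

Lemma double_exp_card : double_exp (fun w => card_bound (K1 w) (K2 w)).
Proof.
pose L w := size (types_of (K2 w)).
have hL : simple_exp L by apply: (simple_exp_comp (simple_exp_types (A := A2) hT2 hcl2)); apply: fp_size; exact: fp_id.
have hE : double_exp (fun w => 2 ^ ((L w).+1 * L w)).
  apply: double_exp_pow2; apply: (simple_exp_comp (g := fun n => n.+1 * n) hL); apply: fp_muln; fps.
have hS : simple_exp (fun w => size (sublists (cl_of (K1 w)))).
  by apply: (simple_exp_comp (simple_exp_sublists hcl1)); apply: fp_size; exact: fp_id.
have hI : double_exp (fun w => size (ind (K1 w))).
  by apply: double_exp_ex1; apply: simple_exp_fp; apply: fp_size; apply: fp_ind.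
have := double_exp_pair (double_exp_pair (double_exp_ex1 hL) hE) (double_exp_pair (double_exp_ex1 hS) hI).
pose g (p : (nat * nat) * (nat * nat)) :=
  p.1.1.+1 * (2 * (p.2.1 * p.1.2 ^ 2) + p.2.2 * (p.1.1.+1 * p.1.1) + 2).
move/double_exp_comp => /(_ _ g); apply; rewrite /g.
repeat (cbv beta; lazymatch goal with |- fpb _ (fun q => _ * _) => apply: fp_muln
  | |- fpb _ (fun q => _ + _) => apply: fp_addn | |- fpb _ (fun q => _ ^ _) => apply: fp_expn | _ => fp_step end).
Qed.

Lemma double_exp_search : double_exp (fun w =>
  search_kb (Signature (sc w) (sr w)) (K1 w) (K2 w) (card_bound (K1 w) (K2 w))).
Proof.
have hN := double_exp_card; set N := fun w => card_bound (K1 w) (K2 w) in hN *.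
have ht := simple_exp_types (A := A2) hT2 hcl2; have ht1 := simple_exp_types (A := A1) hT1 hcl1.
have hG : double_exp (fun w => tables (types_of (K2 w)) (iota 0 (N w).+1)).
  by apply: double_exp_tables => //; apply: (double_exp_comp (g := fun n => iota 0 n.+1) hN); apply: fp_iota; fps.
have hV : double_exp (fun w => values (K2 w) (N w)).
  have := double_exp_pair hN (double_exp_ex1 (simple_exp_fp hcl2)).
  move/double_exp_comp => /(_ _ (fun p : nat * type => [seq (r, C) | r <- iota 0 p.1.+1, C <- Top :: p.2])); apply.
  apply: (fp_allpairs (f := fun _ r C => (r, C))); [by fps|by apply: fp_iota; fps|by fps].
have hLs : double_exp (fun w => all_labels (K1 w) (K2 w) (N w)).
  have := double_exp_pair (double_exp_ex1 ht1) (double_exp_tables ht hV).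
  move/double_exp_comp => /(_ _ (fun p => [seq (t, T) | t <- p.1, T <- p.2])); apply.
  by apply: (fp_allpairs (f := fun _ r C => (r, C))); fps.
have hi1 := simple_exp_fp (@fp_ind _ T1 hA1); have hi2 := simple_exp_fp (@fp_ind _ T2 hA2).
have hLam := double_exp_tables hi1 hLs; have hSig := double_exp_tables hi2 (double_exp_ex1 ht).
have e (B : enc) (f : W -> B) (h : fp f) := double_exp_ex1 (simple_exp_fp h).
have H1 := double_exp_pair (double_exp_pair (e _ _ hsc) (e _ _ hsr)) (double_exp_pair (e _ _ hcl1) (e _ _ hcl2)).
have := double_exp_pair (double_exp_pair H1 (double_exp_pair hN (double_exp_pair (e _ _ hA1) (e _ _ hA2)))) (double_exp_pair (double_exp_pair hG hLs) (double_exp_pair hLam hSig)).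
move/double_exp_comp => /(_ _ (fun p => search p.1.1.1.1 p.1.1.1.2 p.1.1.2.1 p.1.1.2.2 p.1.2.1 p.1.2.2.1 p.1.2.2.2
  p.2.1.1 p.2.1.2 p.2.2.1 p.2.2.2)); apply.
by apply: fp_search; fps.
Qed.
End UpperBound.

Notation inst := (seq (concept * concept) * seq assertion *
  (seq (concept * concept) * seq assertion * (seq name * seq name)))%type.

Definition enc_inst (x : inst) : seq bool :=
  (Defs.enc_seq enc_inclusion x.1.1 ++ Defs.enc_seq Defs.enc_assertion x.1.2) ++
  (Defs.enc_seq enc_inclusion x.2.1.1 ++ Defs.enc_seq Defs.enc_assertion x.2.1.2) ++
  (Defs.enc_seq enc_name x.2.2.1 ++ Defs.enc_seq enc_name x.2.2.2).

Lemma parsable_inst : @parsable (enc_pair (enc_pair (enc_seq (enc_pair enc_concept enc_concept)) (enc_seq enc_assertion))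
   (enc_pair (enc_pair (enc_seq (enc_pair enc_concept enc_concept)) (enc_seq enc_assertion))
     (enc_pair (enc_seq (enc_seq enc_bool)) (enc_seq (enc_seq enc_bool))))) enc_inst.
Proof.
have h1 := parsable_seq (parsable_pair parsable_concept parsable_concept).
have h2 := parsable_seq parsable_assertion; have h3 := parsable_seq parsable_name.
exact: (parsable_pair (parsable_pair h1 h2) (parsable_pair (parsable_pair h1 h2) (parsable_pair h3 h3))).
Qed.

Definition kb1 (x : inst) := KB x.1.1 x.1.2.
Definition kb2 (x : inst) := KB x.2.1.1 x.2.1.2.
Definition sgn (x : inst) := Signature x.2.2.1 x.2.2.2.

Definition inst0 : inst := (([::], [::]), (([::], [::]), ([::], [::]))).
Definition kbot := KB [:: (Top, Bot)] [::].
Definition sig0 := Signature [::] [::].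

(** The query with one answer variable and an empty body is certain for every individual of the
    second knowledge base. *)
Lemma ind_entails S K1 K2 : ucq_entails S K1 K2 -> {subset ind K2 <= ind K1}.
Proof.
move=> h a ia; have [] := h (UCQ [:: 0] [:: [::]]) [:: a] => //.
- by move=> phi [<-|//] x [].
- by move=> b; rewrite inE => /eqP->.
- by move=> I _; exists [::]; split; [left|exists (fun=> named I a)].
- by move=> /(_ a (mem_head _ _)).
Qed.

Lemma search_refutes S K1 K2 : {subset ind K2 <= ind K1} ->
  search_kb S K1 K2 (card_bound K1 K2) <-> ~ ucq_entails S K1 K2.
Proof.
move=> h; split.
  by move=> /(search_cert h)[c]; apply: refuted_not_entails; apply: cert_refuted c.
by move=> ne; apply: cert_search; apply: card_boundP.
Qed.

Lemma search_consistent K : search_kb sig0 K kbot (card_bound K kbot) <-> consistent K.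
Proof.
have h : {subset ind kbot <= ind K} by [].
rewrite search_refutes //; split=> [ne|[I mI] en].
  have [c] := card_boundP h ne; have [I [n [mI _]]] := cert_refuted c; by exists I.
(* [kbot] has no model, so even the empty union is certain, while it holds in no interpretation. *)
have bot : certain kbot (UCQ [::] [::]) [::].
  by move=> J [mJ _]; case: (mJ Top Bot (or_introl erefl) (named J [::]) Logic.I).
have [//|//|//|_ /(_ I mI)[phi []//]] := en (UCQ [::] [::]) [::] _ _ _ bot.
Qed.

Theorem entailment_two_exptime : in_two_exptime ucq_entailment_problem.
Proof.
have [P hP] := parsable_inst.
pose r w := obind (fun r => if nilp r.2 then Some r.1 else None) (P w).
(* A word that is no instance gets a dummy, which keeps all later functions total; the test
   [isSome (r w)] rejects it in the end. *)
pose x w := odflt inst0 (r w).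
have hr : fp r by have := parser_fp hP => hp; rewrite /r; fpo.
have hx : fp x by apply: fp_unsome.
have rP w y : r w = Some y <-> w = enc_inst y.
  rewrite /r; split.
    by case E: (P w) => [[z u]|] //=; case: nilP => // eu [<-]; rewrite (parser_eq hP E) eu cats0.
  by move->; have := parser_ex hP y [::]; rewrite cats0 => -> /=.
(* The input word is long enough to bound the traversal of subconcepts, as every concept of the
   instance is written out in it. *)
have fuel w K : K = kb1 (x w) \/ K = kb2 (x w) -> cl_of K =
    flatten [seq fsubs w p.1 ++ fsubs w p.2 | p <- tbox K] ++
    [seq (if is_role a then Top else Atom (aname a)) | a <- abox K].
  move=> hK; congr (flatten _ ++ _); last by apply: eq_map; case.
  have hs C D : (C, D) \in tbox K -> size (Defs.enc_concept C) + size (Defs.enc_concept D) <= size w.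
    have key (T : eqType) (e : T -> seq bool) (s : seq T) z : z \in s -> size (e z) <= size (Defs.enc_seq e s).
      elim: s => //= z' s IH; rewrite inE size_cat => /orP[/eqP<-|/IH]; lia.
    case E: (r w) => [y|]; last by move: hK; rewrite /x E => -[]->.
    have -> := (rP _ _).1 E; have cat1 (s t u v a b : seq bool) n : n <= size s -> n <= size ((s ++ t) ++ (u ++ v) ++ a ++ b).
      by rewrite !size_cat; lia.
    have cat2 (s t u v a b : seq bool) n : n <= size u -> n <= size ((s ++ t) ++ (u ++ v) ++ a ++ b).
      by rewrite !size_cat; lia.
    move: hK; rewrite /x E -size_cat => -[]-> i; [apply: cat1|apply: cat2]; exact: (key _ enc_inclusion _ _ i).
  by apply/eq_in_map => -[C D] /hs le /=; rewrite !fsubsE //; [have := size_subs D|have := size_subs C]; lia.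
have hcl1 : fp (fun w => cl_of (KB (x w).1.1 (x w).1.2)).
  apply: (fpb_ext (f := fun w => flatten [seq fsubs w p.1 ++ fsubs w p.2 | p <- (x w).1.1] ++
    [seq (if is_role a then Top else Atom (aname a)) | a <- (x w).1.2])).
    by move=> w; rewrite (fuel w) //; left.
  by repeat (cbv beta; lazymatch goal with |- fpb _ (fun q => fsubs _ _) => apply: fp_fsubs
    | |- fpb _ (fun q => Atom _) => apply: fp_Atom | _ => fp_step end).
have hcl2 : fp (fun w => cl_of (KB (x w).2.1.1 (x w).2.1.2)).
  apply: (fpb_ext (f := fun w => flatten [seq fsubs w p.1 ++ fsubs w p.2 | p <- (x w).2.1.1] ++
    [seq (if is_role a then Top else Atom (aname a)) | a <- (x w).2.1.2])).
    by move=> w; rewrite (fuel w) //; right.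
  by repeat (cbv beta; lazymatch goal with |- fpb _ (fun q => fsubs _ _) => apply: fp_fsubs
    | |- fpb _ (fun q => Atom _) => apply: fp_Atom | _ => fp_step end).
have hcl0 : fp (fun _ : seq bool => cl_of kbot) by exact: fp_const.
have f11 : fp (fun w => (x w).1.1) by fps.
have f12 : fp (fun w => (x w).1.2) by fps.
have f21 : fp (fun w => (x w).2.1.1) by fps.
have f22 : fp (fun w => (x w).2.1.2) by fps.
have fsc : fp (fun w => (x w).2.2.1) by fps.
have fsr : fp (fun w => (x w).2.2.2) by fps.
have n0 : fp (fun _ : seq bool => [::] : seq name) by exact: fp_const.
have a0 : fp (fun _ : seq bool => [::] : seq assertion) by exact: fp_const.
have t0 : fp (fun _ : seq bool => [:: (Top, Bot)]) by exact: fp_const.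
have s1 := double_exp_search n0 n0 f11 t0 f12 a0 hcl1 hcl0.
have s2 := double_exp_search n0 n0 f21 t0 f22 a0 hcl2 hcl0.
have s3 := double_exp_search fsc fsr f11 f21 f12 f22 hcl1 hcl2.
(* The search decides non-entailment only under inclusion of the individuals, so this is tested
   apart; by [ind_entails] its failure makes a no-instance. *)
have hi : fp (fun w => isSome (r w) && all (fun a => a \in ind (KB (x w).1.1 (x w).1.2)) (ind (KB (x w).2.1.1 (x w).2.1.2))).
  apply: fp_andb; first exact: fp_isSome.
  apply: fp_all; last exact: fp_ind.
  by apply: fp_inS; [fps|apply: fp_ind; fps].
have := double_exp_pair (double_exp_pair s1 s2) (double_exp_pair s3 (double_exp_ex1 (simple_exp_fp hi))).
move/double_exp_comp => /(_ _ (fun p : bool * bool * (bool * bool) => [:: p.2.2 && p.1.1 && p.1.2 && ~~ p.2.1])).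
case; first by fps.
move=> q [k hk] hf.
apply: (fpb_two_exptime (q := fun n => (4 * n + 3) ^ k) hf).
- apply/poly_pbd; pbd; exact: (@pbd_id _ id).
- move=> w; rewrite !leq_exp2l //; apply: leq_trans (hk w) _; case: (k) => // k'; rewrite leq_exp2r //.
  have key a b : a <= 4 * b + 1 -> a + 2 <= 4 * b + 3 by lia.
  exact: key (sz_bits w).
move=> w /=; rewrite -/(kb1 (x w)) -/(kb2 (x w)) -/(sgn (x w)); split.
  case/andP => /andP[/andP[/andP[iS /allP sub] /search_consistent c1] /search_consistent c2] /negP ns.
  exists (kb1 (x w)), (kb2 (x w)), (sgn (x w)); split=> //.
    by move: iS; rewrite /x; case E: (r w) => [y|] // _; rewrite ((rP _ _).1 E) /enc_inst /enc_instance /= -!catA.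
  by apply: NNPP => ne; apply: ns; apply/search_refutes.
case=> K1 [K2 [S [ew c1 c2 en]]].
have E : r w = Some ((tbox K1, abox K1), ((tbox K2, abox K2), (sig_concepts S, sig_roles S))).
  by apply/rP; rewrite ew /enc_inst /enc_instance /= -!catA.
have eK1 : kb1 (x w) = K1 by rewrite /x E /kb1 /=; case: (K1).
have eK2 : kb2 (x w) = K2 by rewrite /x E /kb2 /=; case: (K2).
have eS : sgn (x w) = S by rewrite /x E /sgn /=; case: (S).
rewrite eK1 eK2 eS E /=; have sub := ind_entails en.
rewrite (introT allP sub) /=; apply/andP; split; last by apply/negP => /(search_refutes S sub).
by apply/andP; split; apply/search_consistent.
Qed.


(** * Binary counters *)

Definition bit v k := odd (v %/ 2 ^ k).

Definition pall (f : pred nat) k := all f (iota 0 k).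

Lemma pallS f k : pall f k.+1 = pall f k && f k.
Proof. by rewrite /pall -addn1 iotaD all_cat /= andbT. Qed.

Lemma pall_shift f k : pall f k.+1 = f 0 && pall (fun i => f i.+1) k.
Proof. by rewrite /pall /= -[1]/(1 + 0) iotaDl all_map. Qed.

Lemma pallP (f : pred nat) k : reflect (forall i, i < k -> f i) (pall f k).
Proof.
apply: (iffP allP) => h i; first by move=> lt; apply: h; rewrite mem_iota.
by rewrite mem_iota => /h.
Qed.

Lemma bit0 v : bit v 0 = odd v. Proof. by rewrite /bit divn1. Qed.

Lemma bitS v k : bit v k.+1 = bit v./2 k.
Proof. by rewrite /bit expnS divnMA divn2. Qed.

Lemma half_lt v N : v < 2 ^ N.+1 -> v./2 < 2 ^ N.
Proof. by rewrite expnS -divn2 ltn_divLR // mulnC. Qed.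

Lemma bit_ext N u v : u < 2 ^ N -> v < 2 ^ N -> (forall j, j < N -> bit u j = bit v j) -> u = v.
Proof.
elim: N u v => [|N IH] u v; first by rewrite expn0; case: u v => [|u] [|v].
move=> lu lv h; have := h 0 isT; rewrite !bit0 => eo.
rewrite -[u]odd_double_half -[v]odd_double_half eo; congr (_ + _.*2).
by apply: IH; rewrite ?half_lt // => j lt; rewrite -!bitS; apply: h.
Qed.

Lemma bit_of (f : nat -> bool) N : exists2 v, v < 2 ^ N & forall j, j < N -> bit v j = f j.
Proof.
elim: N f => [|N IH] f; first by exists 0.
have [v lv h] := IH (fun j => f j.+1); exists (f 0 + v.*2).
  by rewrite expnS; case: (f 0); rewrite -mul2n; lia.
by case=> [|j] lt; [rewrite bit0 oddD odd_double addbF oddb|rewrite bitS half_bit_double h].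
Qed.

Lemma bit_succ v k : bit v.+1 k = bit v k (+) pall (bit v) k.
Proof.
elim: k v => [|k IH] v; first by rewrite !bit0 /= addbT.
rewrite !bitS pall_shift bit0 -[v.+1./2]/(uphalf v) uphalf_half.
have -> : pall (fun i => bit v i.+1) k = pall (bit v./2) k by apply: eq_all => i; apply: bitS.
by case: (odd v); rewrite ?add1n ?IH // add0n addbF.
Qed.

Lemma bit_mod v N j : j < N -> bit (v %% 2 ^ N) j = bit v j.
Proof.
elim: N v j => // N IH v [|j] lt; first by rewrite !bit0 expnS odd_mod // oddM.
by rewrite !bitS -[RHS]IH // -!divn2 expnS modn_divl mulnC.
Qed.

Lemma bit_zero j : bit 0 j = false. Proof. by rewrite /bit div0n. Qed.

Lemma bit_addX v N j : j < N -> bit (v + 2 ^ N) j = bit v j.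
Proof. by move=> lt; rewrite -(bit_mod _ lt) modnDr bit_mod. Qed.

(** Subtracting 1 modulo [2 ^ N] is written with [2 ^ N] added first, since [.-1] truncates at 0. *)
Lemma pall_pred v N j : j <= N -> pall (bit (v + 2 ^ N).-1) j = pall (fun i => ~~ bit v i) j.
Proof.
elim: j => // j IH lt; rewrite !pallS IH; last exact: ltnW.
have := bit_succ (v + 2 ^ N).-1 j; rewrite prednK ?addn_gt0 ?expn_gt0 ?orbT // bit_addX // IH; last exact: ltnW.
by case: (pall _ _) => // ->; case: (bit _ j).
Qed.

Lemma bit_pred v N j : j < N -> bit (v + 2 ^ N).-1 j = bit v j (+) pall (fun i => ~~ bit v i) j.
Proof.
move=> lt; have := bit_succ (v + 2 ^ N).-1 j; rewrite prednK ?addn_gt0 ?expn_gt0 ?orbT // bit_addX //.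
by rewrite pall_pred; [move->; rewrite -addbA addbb addbF|exact: ltnW].
Qed.

Lemma pall_ones v N : v < 2 ^ N -> pall (bit v) N = (v.+1 == 2 ^ N).
Proof.
move=> lt; have lt' : (2 ^ N).-1 < 2 ^ N by rewrite prednK ?expn_gt0.
apply/pallP/eqP => [h|e].
  rewrite (bit_ext lt lt') ?prednK ?expn_gt0 // => j jN; rewrite h //.
  have := bit_pred 0 jN; rewrite add0n bit_zero => ->; apply/esym/pallP => i _; by rewrite bit_zero.
move=> i iN; have -> : v = (0 + 2 ^ N).-1 by rewrite add0n -e.
by rewrite bit_pred // bit_zero; apply/pallP => k _; rewrite bit_zero.
Qed.

Lemma pall_zero v N : v < 2 ^ N -> pall (fun i => ~~ bit v i) N = (v == 0).
Proof.
move=> lt; apply/pallP/eqP => [h|-> i _]; last by rewrite bit_zero.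
apply: (bit_ext lt); rewrite ?expn_gt0 // => j jN; rewrite bit_zero; exact/negbTE/h.
Qed.

(* [d] is 0, 1 or 2 for adding 0, 1 or -1 modulo [2 ^ N]. *)
Definition nxt N d v := (v + (if d == 0 then 0 else if d == 1 then 1 else (2 ^ N).-1)) %% 2 ^ N.

(** The carry of the increment or the borrow of the decrement: all lower bits are 1, respectively 0.
    In both cases a bit flips exactly when it is set. *)
Definition carry d v j := (d != 0) && pall (fun i => if d == 1 then bit v i else ~~ bit v i) j.

Lemma nxt_bit N d v j : j < N -> bit (nxt N d v) j = bit v j (+) carry d v j.
Proof.
move=> lt; rewrite bit_mod // /carry; case: d => [|[|d]] /=; first by rewrite addn0 addbF.
  by rewrite addn1 bit_succ.
by rewrite -subn1 addnBA ?expn_gt0 // subn1 bit_pred.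
Qed.

Lemma carryS d v j : carry d v j.+1 = carry d v j && (if d == 1 then bit v j else ~~ bit v j).
Proof. by rewrite /carry pallS andbA. Qed.

Lemma nxt_lt N d v : nxt N d v < 2 ^ N. Proof. by rewrite ltn_mod expn_gt0. Qed.

Lemma nxt0 N v : v < 2 ^ N -> nxt N 0 v = v.
Proof. by move=> lt; rewrite /nxt addn0 modn_small. Qed.

Lemma nxt_pred N v : v.+1 < 2 ^ N -> nxt N 2 v.+1 = v.
Proof.
move=> lt; rewrite /nxt /= addSn -addnS prednK ?expn_gt0 // modnDr modn_small //; exact: ltnW.
Qed.


(** * Claims as knowledge bases *)

(** Every number is written in unary with an end mark, so distinct lists give distinct names of
    polynomial length. *)
Definition nm (l : seq nat) : name := flatten [seq rcons (nseq k true) false | k <- l].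

Lemma nm_inj : injective nm.
Proof.
have h k k' (u v : seq bool) : nseq k true ++ false :: u = nseq k' true ++ false :: v -> k = k' /\ u = v.
  by elim: k k' => [|k IH] [|k'] //= []; [move->|move=> /IH[-> ->]].
elim=> [|k l IH] [|k' l'] //=; rewrite /nm /= -!/(nm _) ?cat_rcons.
- by case: k'.
- by case: k.
- by move=> /h[-> /IH->].
Qed.

Definition at_ l := Atom (nm l).
Definition R0 : name := [::].
Definition a0 : name := [::].
Definition bigand := foldr And Top.
Definition bigor := foldr Or Bot.
Definition lit (b : bool) C := if b then C else Not C.
Definition bools2 := [:: (true, true); (true, false); (false, true); (false, false)].

(* Both knowledge bases: [cbit k] is bit [k] of the position in a block.
   First one: [blk] marks the cells of blocks; on track [r], [own r b] and
   [par r b] say that this bit of the own number, respectively of the number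
   copied from the parent block, is [b], [cy r] is the carry from the second to
   the first, and [zf r] says that the lower own bits are all 0; [inf] starts an
   infinite path.  Second one: an element of [walk] starts either a longer path
   or, at an element of [own e.1 e.2], a chain of [err e] that ends one block
   later in a wrongly copied bit. *)
Definition blk := at_ [:: 0].
Definition inf := at_ [:: 1].
Definition cbit k := at_ [:: 2; k].
Definition own r (b : bool) := at_ [:: 3; r; nat_of_bool b].
Definition par r (b : bool) := at_ [:: 4; r; nat_of_bool b].
Definition cy r := at_ [:: 5; r].
Definition zf r := at_ [:: 6; r].
Definition lab (g : nat * nat) := at_ [:: 7; g.1; g.2].
Definition top := at_ [:: 8].
Definition walk := at_ [:: 9].
Definition err (e : nat * bool) := at_ [:: 10; e.1; nat_of_bool e.2].
Definition errs : seq (nat * bool) := [:: (0, true); (0, false); (1, true); (1, false)].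

Section Reduction.
Variables (P : nat) (labs : seq (nat * nat)) (dir : nat * nat -> nat -> nat)
  (alt : nat * nat -> bool * bool -> seq (seq (nat * nat))) (tops : seq (nat * nat)).

Definition cin k := bigand [seq cbit j | j <- iota 0 k].
Definition endc := cin P.

(** Bit [k] flips at a successor iff all lower bits are set, so along every edge out of [G] the
    position grows by 1 modulo [2 ^ P]. One inclusion for each bit and pair of truth values keeps
    this polynomial. *)
Definition cnt G : seq (concept * concept) :=
  [seq (And G (And (lit b.1 (cin k)) (lit b.2 (cbit k))), All R0 (lit (b.1 (+) b.2) (cbit k)))
  | k <- iota 0 P, b <- bools2].

Definition zeros := bigand [seq Not (cbit k) | k <- iota 0 P].

Definition strt g := And blk (And (lab g) (And zeros
  (bigand [seq And (lit (dir g r != 0) (cy r)) (zf r) | r <- [:: 0; 1]]))).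

Definition zero r := And (zf r) (Not (own r true)).

Definition ax_next := [:: (And blk (Not endc), Ex R0 blk)].
Definition ax_lab := [seq (And blk (And (Not endc) (lab g)), All R0 (lab g)) | g <- labs].
Definition ax_own := [seq (And blk (Not (own r true)), own r false) | r <- [:: 0; 1]].
(** Nothing ties the copy to the parent's own bit, which lies [2 ^ P] elements away: the copy is a
    guess, checked only by the second knowledge base. *)
Definition ax_par := [seq (And blk (Not (par r true)), par r false) | r <- [:: 0; 1]].
(** Together with [ax_carry] this lets a block add [dir] to the copied number, one bit per cell from
    the low end. *)
Definition ax_sum := [seq (And blk (And (lit b.1 (par r true)) (lit b.2 (cy r))), lit (b.1 (+) b.2) (own r true))
  | r <- [:: 0; 1], b <- bools2].
Definition ax_carry := flatten [seq [seq
    (And blk (And (Not endc) (And (lab g) (And (lit b.1 (par r true)) (lit b.2 (cy r))))),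
     All R0 (lit (b.2 && (if dir g r == 1 then b.1 else ~~ b.1)) (cy r)))
  | r <- [:: 0; 1], b <- bools2] | g <- labs].
Definition ax_zero := [seq
    (And blk (And (Not endc) (And (lit b.1 (zf r)) (lit b.2 (own r true)))), All R0 (lit (b.1 && ~~ b.2) (zf r)))
  | r <- [:: 0; 1], b <- bools2].
(** The last cell of a block knows from [zf] and its own bits whether each number is 0, and chooses
    a justification accordingly. *)
Definition ax_alt := [seq
    (And blk (And endc (And (lab g) (And (lit b.1 (zero 0)) (lit b.2 (zero 1))))),
     bigor [seq bigand [seq Ex R0 (strt g') | g' <- A] | A <- alt g b])
  | g <- labs, b <- bools2].
Definition ax_top := [:: (top, Or (Ex R0 inf) (bigor [seq Ex R0 (strt g) | g <- tops])); (inf, Ex R0 inf)].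

Definition tbox1 := cnt blk ++ ax_next ++ ax_lab ++ ax_own ++ ax_par ++ ax_sum ++ ax_carry ++ ax_zero ++
  ax_alt ++ ax_top.

(** The chain carries the positions 0 to [2 ^ P - 1], and the wrong copy sits on the element after
    its end, at distance exactly [2 ^ P] from its start. *)
Definition ax_err e := cnt (err e) ++ [:: (And (err e) (Not endc), Ex R0 (err e));
   (And (err e) endc, Ex R0 (par e.1 (~~ e.2)))].
Definition ax_walk := [:: (walk, Or (Ex R0 walk) (bigor [seq And (own e.1 e.2) (And (err e) zeros) | e <- errs]))].
Definition tbox2 := ax_walk ++ flatten [seq ax_err e | e <- errs].

Definition kb_1 := KB tbox1 [:: ConceptAssertion (nm [:: 8]) a0].
Definition kb_2 := KB tbox2 [:: ConceptAssertion (nm [:: 9]) a0].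
(** A query sees paths labelled with own and copied bits. Positions, labels and carries stay hidden,
    and so does the way in which the second knowledge base measures distance. *)
Definition sig_0 := Signature (flatten [seq [:: nm [:: 3; e.1; nat_of_bool e.2]; nm [:: 4; e.1; nat_of_bool e.2]] | e <- errs]) [:: R0].

Lemma ext_and I C D (d : elt I) : ext (And C D) d -> ext C d /\ ext D d.
Proof. by []. Qed.

Lemma ext_bigand I s (d : elt I) : ext (bigand s) d <-> (forall C, C \in s -> ext C d).
Proof.
elim: s => [|C s IH] //=; split=> [[h /IH h'] D|h].
  by rewrite inE => /orP[/eqP->|/h'].
by split; [|apply/IH => D i]; apply: h; rewrite inE ?eqxx ?i ?orbT.
Qed.

Lemma ext_bigor I s (d : elt I) : ext (bigor s) d <-> (exists2 C, C \in s & ext C d).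
Proof.
elim: s => [|C s IH] /=; first by split=> // -[].
split=> [[h|/IH[D i h]]|[D]]; first by exists C; rewrite ?mem_head.
  by exists D; rewrite // inE i orbT.
by rewrite inE => /orP[/eqP->|i h]; [left|right; apply/IH; exists D].
Qed.

Lemma ext_lit I b C (d : elt I) : ext (lit b C) d <-> holds (ext C d) = b.
Proof.
case: b => /=; first by split=> /holdsP.
by split=> [h|h /holdsP]; [apply/holdsP|rewrite h].
Qed.

Definition holds_at I l (d : elt I) := holds (ext (at_ l) d).

Definition cval I (d : elt I) v := forall k, k < P -> holds_at [:: 2; k] d = bit v k.

Lemma ext_cin I (d : elt I) k v : cval d v -> k <= P -> holds (ext (cin k) d) = pall (bit v) k.
Proof.
move=> cv le; apply/holdsP/pallP => [/ext_bigand h j lt|h].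
  by rewrite -cv ?(leq_trans lt) //; apply/holdsP/h/mapP; exists j; rewrite ?mem_iota.
apply/ext_bigand => _ /mapP[j + ->]; rewrite mem_iota add0n => /andP[_ lt].
by apply/holdsP; rewrite -/(holds_at [:: 2; j] d) cv ?h ?(leq_trans lt).
Qed.

Lemma ext_endc I (d : elt I) v : cval d v -> v < 2 ^ P -> holds (ext endc d) = (v.+1 == 2 ^ P).
Proof. by move=> cv lt; rewrite (ext_cin cv) // pall_ones. Qed.

Lemma ext_zeros I (d : elt I) : ext zeros d <-> cval d 0.
Proof.
rewrite /zeros ext_bigand; split=> [h k lt|h _ /mapP[k + ->]].
  rewrite bit_zero; apply/holdsP; apply: (h (Not (cbit k))).
  by apply/mapP; exists k; rewrite ?mem_iota.
rewrite mem_iota add0n => /andP[_ /h]; rewrite bit_zero => /holdsP; exact.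
Qed.

Definition satisfies I (T : seq (concept * concept)) :=
  forall C D, (C, D) \in T -> forall d : elt I, ext C d -> ext D d.

Lemma satisfies_sub I T T' : {subset T' <= T} -> satisfies I T -> satisfies I T'.
Proof. by move=> h s C D /h; apply: s. Qed.

Lemma satisfies_cat I T T' : satisfies I T -> satisfies I T' -> satisfies I (T ++ T').
Proof. by move=> h h' C D; rewrite mem_cat => /orP[/h|/h']. Qed.

Lemma satisfies_catE I T T' : satisfies I (T ++ T') -> satisfies I T /\ satisfies I T'.
Proof. by move=> h; split=> C D i; apply: h; rewrite mem_cat i ?orbT. Qed.

Lemma satisfies_model I K : satisfies I (tbox K) <-> forall C D, List.In (C, D) (tbox K) -> forall d : elt I, ext C d -> ext D d.
Proof. by split=> h C D /in_listP; apply: h. Qed.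

Lemma bools2P b : b \in bools2. Proof. by case: b => [] [] []. Qed.

Lemma cnt_sat I G : satisfies I (cnt G) <->
  forall d e : elt I, ext G d -> rint R0 d e -> forall k, k < P ->
  holds_at [:: 2; k] e = holds (ext (cin k) d) (+) holds_at [:: 2; k] d.
Proof.
split=> [s d e Gd Rde k lt|s C D /allpairsP[[k b] [/=]]].
  pose b := (holds (ext (cin k) d), holds_at [:: 2; k] d).
  have i : (And G (And (lit b.1 (cin k)) (lit b.2 (cbit k))), All R0 (lit (b.1 (+) b.2) (cbit k))) \in cnt G.
    by apply/allpairsP; exists (k, b); split; rewrite ?mem_iota ?bools2P.
  apply/ext_lit; apply: (s _ _ i d _ e Rde).
  by split=> //; split; apply/ext_lit.
rewrite mem_iota add0n => /andP[_ lt] _ [-> ->] d [Gd [/ext_lit h1 /ext_lit h2]] e Rde.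
by apply/ext_lit; rewrite -h1 -h2; apply: (s d e).
Qed.

Lemma cnt_step I G (d e : elt I) v : satisfies I (cnt G) -> ext G d -> rint R0 d e -> cval d v -> cval e v.+1.
Proof.
move=> /cnt_sat h Gd Rde cv k lt; rewrite (h d e Gd Rde k lt) bit_succ cv // (ext_cin cv) 1?addbC //.
exact: ltnW.
Qed.

(** Only position [2 ^ P - 1] satisfies [endc], so a successor can be chosen again and again until
    the counter is full. *)
Lemma counting_chain I G (d : elt I) : satisfies I (cnt G) ->
  (forall d : elt I, ext G d -> ~ ext endc d -> exists2 e, rint R0 d e & ext G e) ->
  ext G d -> cval d 0 ->
  exists c : nat -> elt I, [/\ c 0 = d, forall j, j < 2 ^ P -> ext G (c j) /\ cval (c j) j
    & forall j, j.+1 < 2 ^ P -> rint R0 (c j) (c j.+1)].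
Proof.
move=> s nx Gd cd.
have [f hf] : exists f : elt I -> elt I, forall d, ext G d -> ~ ext endc d -> rint R0 d (f d) /\ ext G (f d).
  apply: (choice_fun (P := fun d e => ext G d -> ~ ext endc d -> rint R0 d e /\ ext G e)) => x.
  case: (classic (ext G x /\ ~ ext endc x)) => [[a b]|n]; last by exists x => a b; case: n.
  by have [e r g] := nx x a b; exists e.
pose c j := iter j f d.
have hc j : j < 2 ^ P -> ext G (c j) /\ cval (c j) j.
  elim: j => // j IH lt; have [Gj cj] := IH (ltnW lt).
  have ne : ~ ext endc (c j) by move/holdsP; rewrite (ext_endc cj (ltnW lt)) => /eqP; lia.
  by have [r g] := hf _ Gj ne; split; [|apply: (cnt_step s Gj r cj)].
exists c; split=> // j lt; have [Gj cj] := hc j (ltnW lt).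
have ne : ~ ext endc (c j) by move/holdsP; rewrite (ext_endc cj (ltnW lt)) => /eqP; lia.
by have [] := hf _ Gj ne.
Qed.

Fixpoint path_to I n (d e : elt I) : Prop :=
  if n is n.+1 then exists2 d', rint R0 d d' & path_to n d' e else d = e.

Lemma path_cat I m n (x y z : elt I) : path_to m x y -> path_to n y z -> path_to (m + n) x z.
Proof. by elim: m x => [|m IH] x /=; [move->|case=> x' r /IH h /h p; exists x']. Qed.

Lemma path_seq I (c : nat -> elt I) j n : (forall i, i < n -> rint R0 (c (j + i)) (c (j + i).+1)) ->
  path_to n (c j) (c (j + n)).
Proof.
elim: n j => [|n IH] j h; first by rewrite addn0.
exists (c j.+1); first by have := h 0; rewrite addn0; apply.
by rewrite -addSnnS; apply: IH => i lt; rewrite addSnnS; apply: h.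
Qed.

Let N := 2 ^ P.
Let B := 2 ^ N.

(* A claim is a label with the numbers of the two tracks of its block; it is
   justified by the claims of the labels in one of its alternatives, whose
   numbers differ from its own by [dir]. *)
Inductive val : nat * nat -> nat -> nat -> Prop :=
  Val g t x A : A \in alt g (t == 0, x == 0) ->
    (forall g', g' \in A -> val g' (nxt N (dir g' 0) t) (nxt N (dir g' 1) x)) -> val g t x.

Variable rk : nat * nat -> nat.
Hypothesis alt_labs : forall g b A g', g \in labs -> A \in alt g b -> g' \in A -> g' \in labs.
Hypothesis tops_labs : {subset tops <= labs}.
Hypothesis tops_dir : forall g r, g \in tops -> dir g r = 0.
Hypothesis alt_rk : forall g b A g', g \in labs -> A \in alt g b -> g' \in A ->
  (dir g' 0 = 0 /\ rk g' < rk g) \/ [/\ dir g' 0 = 2, ~~ b.1 & rk g' <= rk g].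

(** Either the row stays and [rk] falls, or the row number falls by 1; it cannot wrap around,
    because the zero flag excludes row 0. This is why claim trees are finite. *)
Lemma child_rk g t x A g' : g \in labs -> t < B -> A \in alt g (t == 0, x == 0) -> g' \in A ->
  rk g' + nxt N (dir g' 0) t < rk g + t.
Proof.
move=> ig lt iA ig'; case: (alt_rk ig iA ig') => [[-> lr]|[-> /= t0 lr]]; first by rewrite nxt0 //; lia.
by case: t t0 lt {iA} => // t _ lt; rewrite nxt_pred //; lia.
Qed.

Section ModelClaims.
Variable I : interp.
Hypothesis mI : model I kb_1.
Let a : elt I := named I a0.

Hypothesis no_err : forall e n y y', e \in errs -> path_to n a y -> path_to N y y' ->
  holds_at [:: 3; e.1; nat_of_bool e.2] y -> holds_at [:: 4; e.1; nat_of_bool (~~ e.2)] y' -> False.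

Let sat1 : satisfies I tbox1.
Proof. exact: (proj2 (@satisfies_model I kb_1) (proj1 mI)). Qed.

Let s_cnt : satisfies I (cnt blk) := proj1 (satisfies_catE sat1).
Let s_next : satisfies I ax_next := proj1 (satisfies_catE (proj2 (satisfies_catE sat1))).
Let s_lab : satisfies I ax_lab := proj1 (satisfies_catE (proj2 (satisfies_catE (proj2 (satisfies_catE sat1))))).
Let s_own : satisfies I ax_own := proj1 (satisfies_catE (proj2 (satisfies_catE (proj2 (satisfies_catE (proj2 (satisfies_catE sat1))))))).
Let s_par : satisfies I ax_par := proj1 (satisfies_catE (proj2 (satisfies_catE (proj2 (satisfies_catE (proj2 (satisfies_catE (proj2 (satisfies_catE sat1))))))))).
Let s_sum : satisfies I ax_sum := proj1 (satisfies_catE (proj2 (satisfies_catE (proj2 (satisfies_catE (proj2 (satisfies_catE (proj2 (satisfies_catE (proj2 (satisfies_catE sat1))))))))))).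
Let s_carry : satisfies I ax_carry := proj1 (satisfies_catE (proj2 (satisfies_catE (proj2 (satisfies_catE (proj2 (satisfies_catE (proj2 (satisfies_catE (proj2 (satisfies_catE (proj2 (satisfies_catE sat1))))))))))))).
Let s_zero : satisfies I ax_zero := proj1 (satisfies_catE (proj2 (satisfies_catE (proj2 (satisfies_catE (proj2 (satisfies_catE (proj2 (satisfies_catE (proj2 (satisfies_catE (proj2 (satisfies_catE (proj2 (satisfies_catE sat1))))))))))))))).
Let s_alt : satisfies I ax_alt := proj1 (satisfies_catE (proj2 (satisfies_catE (proj2 (satisfies_catE (proj2 (satisfies_catE (proj2 (satisfies_catE (proj2 (satisfies_catE (proj2 (satisfies_catE (proj2 (satisfies_catE (proj2 (satisfies_catE sat1))))))))))))))))).
Let s_top : satisfies I ax_top := (proj2 (satisfies_catE (proj2 (satisfies_catE (proj2 (satisfies_catE (proj2 (satisfies_catE (proj2 (satisfies_catE (proj2 (satisfies_catE (proj2 (satisfies_catE (proj2 (satisfies_catE (proj2 (satisfies_catE sat1)))))))))))))))))).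

(* A block: a chain carrying a label and, on each track, the own number and
   the number copied from the parent block. *)
Lemma block_chain d g : ext (strt g) d -> g \in labs ->
  exists (c : nat -> elt I), [/\ c 0 = d, forall j, j.+1 < N -> rint R0 (c j) (c j.+1),
    forall j, j < N -> ext blk (c j), ext endc (c N.-1) /\ ext (lab g) (c N.-1) &
    forall r, r < 2 -> exists v pv, [/\ v < B, pv < B,
      forall j, j < N -> holds_at [:: 3; r; 1] (c j) = bit v j /\ holds_at [:: 4; r; 1] (c j) = bit pv j,
      v = nxt N (dir g r) pv & holds (ext (zero r) (c N.-1)) = (v == 0)]].
Proof.
move=> /ext_and[bd /ext_and[gd /ext_and[/ext_zeros zd /ext_bigand id]]] ig.
have nx (x : elt I) : ext blk x -> ~ ext endc x -> exists2 e, rint R0 x e & ext blk e.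
  move=> b e; have := s_next (mem_head _ _) (conj b e); by case=> y []; exists y.
have [c [c0 hc hR]] := counting_chain s_cnt nx bd zd.
have ne j : j.+1 < N -> ~ ext endc (c j).
  by move=> lt; have [_ cj] := hc j (ltnW lt); move/holdsP; rewrite (ext_endc cj (ltnW lt)) => /eqP; rewrite -/N; lia.
have N0 : N.-1 < N by rewrite prednK // expn_gt0.
have hg j : j < N -> ext (lab g) (c j).
  elim: j => [|j IH] lt; first by rewrite c0.
  have [bj _] := hc j (ltnW lt).
  have i : (And blk (And (Not endc) (lab g)), All R0 (lab g)) \in ax_lab by apply/mapP; exists g.
  by apply: (s_lab i (d := c j)); [split=> //; split; [exact: ne|exact: IH (ltnW lt)]|exact: hR].
exists c; split=> //; first by move=> j /hc[].
  split; last exact: hg.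
  by have [_ cj] := hc _ N0; apply/holdsP; rewrite (ext_endc cj N0) prednK // expn_gt0.
move=> r r2; have ir : r \in [:: 0; 1] by case: r r2 => [|[|]].
have [v lv hv] := bit_of (fun j => holds_at [:: 3; r; 1] (c j)) N.
have [pv lpv hpv] := bit_of (fun j => holds_at [:: 4; r; 1] (c j)) N.
have /id [icy iz] : And (lit (dir g r != 0) (cy r)) (zf r) \in [seq And (lit (dir g r != 0) (cy r)) (zf r) | r <- [:: 0; 1]].
  by apply/mapP; exists r.
(* [strt] sets the first carry to [dir g r != 0], the value of [carry] when there are no lower bits;
   [ax_carry] propagates it. *)
have hcy j : j < N -> holds_at [:: 5; r] (c j) = carry (dir g r) pv j.
  elim: j => [|j IH] lt; first by rewrite c0 /carry andbT; apply/ext_lit.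
  have [bj _] := hc j (ltnW lt); pose b := (holds_at [:: 4; r; 1] (c j), holds_at [:: 5; r] (c j)).
  have i : (And blk (And (Not endc) (And (lab g) (And (lit b.1 (par r true)) (lit b.2 (cy r))))),
     All R0 (lit (b.2 && (if dir g r == 1 then b.1 else ~~ b.1)) (cy r))) \in ax_carry.
    by apply/flatten_mapP; exists g => //; apply/allpairsP; exists (r, b); split; rewrite ?bools2P.
  rewrite carryS -(IH (ltnW lt)) hpv; last exact: ltnW.
  apply/ext_lit; apply: (s_carry i (d := c j)); last exact: hR.
  by split=> //; split; [exact: ne|split; [exact: hg (ltnW lt)|split; apply/ext_lit]].
have hz j : j < N -> holds_at [:: 6; r] (c j) = pall (fun i => ~~ bit v i) j.
  elim: j => [|j IH] lt; first by rewrite c0; apply/holdsP.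
  have [bj _] := hc j (ltnW lt); pose b := (holds_at [:: 6; r] (c j), holds_at [:: 3; r; 1] (c j)).
  have i : (And blk (And (Not endc) (And (lit b.1 (zf r)) (lit b.2 (own r true)))), All R0 (lit (b.1 && ~~ b.2) (zf r))) \in ax_zero.
    by apply/allpairsP; exists (r, b); split; rewrite ?bools2P.
  rewrite pallS -(IH (ltnW lt)) hv; last exact: ltnW.
  apply/ext_lit; apply: (s_zero i (d := c j)); last exact: hR.
  by split=> //; split; [exact: ne|split; apply/ext_lit].
exists v, pv; split=> // [j lt||].
- by rewrite hv // hpv.
- apply: (bit_ext lv (nxt_lt _ _ _)) => j lt; rewrite nxt_bit // -hcy // hpv // hv //.
  have [bj _] := hc j lt; pose b := (holds_at [:: 4; r; 1] (c j), holds_at [:: 5; r] (c j)).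
  have i : (And blk (And (lit b.1 (par r true)) (lit b.2 (cy r))), lit (b.1 (+) b.2) (own r true)) \in ax_sum.
    by apply/allpairsP; exists (r, b); split; rewrite ?bools2P.
  by apply/ext_lit; apply: (s_sum i); split=> //; split; apply/ext_lit.
have NE : N = N.-1.+1 by rewrite prednK // expn_gt0.
rewrite -(pall_zero lv) [in RHS]NE pallS -hz // hv //.
apply/holdsP/andP => -[h1 h2]; split; first exact/holdsP.
- by apply/negP => /holdsP.
- exact/holdsP.
- by move/holdsP; apply/negP.
Qed.

(** The index [k] bounds the measure of [child_rk]. The copied numbers of a child equal the own
    numbers of this block, for a bit that differs at cell [j] would be an error at distance [N]; the
    child's own numbers then follow by addition. Copied numbers are part of the conclusion so that
    the parent block can make this comparison. *)
Lemma block_val : forall k g d n, g \in labs -> ext (strt g) d -> path_to n a d ->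
  exists c v pv, [/\ c 0 = d, forall j, j < N -> path_to j d (c j) /\ ext blk (c j),
    forall r j, r < 2 -> j < N -> holds_at [:: 3; r; 1] (c j) = bit (v r) j /\ holds_at [:: 4; r; 1] (c j) = bit (pv r) j,
    forall r, r < 2 -> v r < B /\ v r = nxt N (dir g r) (pv r) /\ pv r < B &
    rk g + v 0 < k -> val g (v 0) (v 1)].
Proof.
elim=> [|k IH] g d n ig sd pd.
all: have [c [c0 hR hb [he hl] hr]] := block_chain sd ig.
all: have [v0 [pv0 [lv0 lp0 hh0 e0 hz0]]] := hr 0 isT.
all: have [v1 [pv1 [lv1 lp1 hh1 e1 hz1]]] := hr 1 isT.
all: have hpath j : j < N -> path_to j d (c j) by
  move=> lt; rewrite -c0; have := @path_seq I c 0 j; rewrite add0n; apply=> i li; apply: hR; lia.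
all: exists c, (fun r => if r == 0 then v0 else v1), (fun r => if r == 0 then pv0 else pv1); split=> //.
1,4: by move=> j lt; split; [exact: hpath|exact: hb].
1,3: by move=> [|[|]] // j _ lt; [exact: hh0|exact: hh1].
1,2: by move=> [|[|]].
move=> /= lk.
have N0 : N.-1 < N by rewrite prednK // expn_gt0.
have i : (And blk (And endc (And (lab g) (And (lit (v0 == 0) (zero 0)) (lit (v1 == 0) (zero 1))))),
     bigor [seq bigand [seq Ex R0 (strt g') | g' <- A] | A <- alt g (v0 == 0, v1 == 0)]) \in ax_alt.
  by apply/allpairsP; exists (g, (v0 == 0, v1 == 0)); split; rewrite ?bools2P.
have /ext_bigor[_ /mapP[A iA ->] /ext_bigand hA] : ext (bigor [seq bigand [seq Ex R0 (strt g') | g' <- A] | A <- alt g (v0 == 0, v1 == 0)]) (c N.-1).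
  by apply: (s_alt i); split; [exact: hb|split=> //; split=> //; split; apply/ext_lit].
apply: (Val iA) => g' ig'.
have [|e [Re se]] := hA (Ex R0 (strt g')); first by apply/mapP; exists g'.
have ig'' := alt_labs ig iA ig'.
have pe : path_to (n + N) a e.
  have NE : N = N.-1 + 1 by rewrite addn1 prednK // expn_gt0.
  apply: path_cat pd _; rewrite NE; apply: path_cat (hpath _ N0) _.
  by exists e.
have [c' [v' [pv' [c'0 hp' hb' hv' hval]]]] := IH g' e _ ig'' se pe.
have eq r : r < 2 -> pv' r = (if r == 0 then v0 else v1).
  move=> r2; have [_ [_ lp]] := hv' r r2.
  have lv : (if r == 0 then v0 else v1) < B by case: ifP.
  apply: (bit_ext lp lv) => j lt; have [_ <-] := hb' r j r2 lt.
  have -> : bit (if r == 0 then v0 else v1) j = holds_at [:: 3; r; 1] (c j).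
    by case: r r2 {lp lv} => [|[|]] // _; [have [->] := hh0 _ lt|have [->] := hh1 _ lt].
  have pj : path_to (n + j) a (c j) by apply: path_cat pd _; apply: hpath.
  have pN : path_to N (c j) (c' j).
    (* From cell [j] to the end of the block, one edge to the child, and [j] cells into it. *)
    have -> : N = (N.-1 - j) + 1 + j by lia.
    apply: (path_cat _ (proj1 (hp' _ lt))); apply: (@path_cat _ _ 1 _ (c N.-1)); last by exists e.
    have -> : N.-1 = j + (N.-1 - j) by lia.
    by rewrite addnC addnK addnC; apply: path_seq => i' li; apply: hR; lia.
  have ir : r \in [:: 0; 1] by case: r r2 {lp lv} => [|[|]].
  have E b : (r, b) \in errs by case: r b r2 {lp lv ir pN} => [|[|]] [].
  case h3: (holds_at [:: 3; r; 1] (c j)).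
    apply/negbNE/negP => nh; apply: (no_err (E true) pj pN h3); apply/holdsP.
    have /s_par : (And blk (Not (par r true)), par r false) \in ax_par by apply/mapP; exists r.
    by move=> h; apply: (h (c' j)); split; [exact: proj2 (hp' _ lt)|move/holdsP; apply/negP].
  apply/negbTE/negP => nh; apply: (no_err (E false) pj pN _ nh); apply/holdsP.
  have /s_own : (And blk (Not (own r true)), own r false) \in ax_own by apply/mapP; exists r.
  by move=> h; apply: (h (c j)); split; [exact: hb|move/holdsP; rewrite -/(holds_at [:: 3; r; 1] _) h3].
have [_ [e0' _]] := hv' 0 isT; have [_ [e1' _]] := hv' 1 isT.
have p0 : pv' 0 = v0 := eq 0 isT; have p1 : pv' 1 = v1 := eq 1 isT.
rewrite -p0 -p1 -e0' -e1'; apply: hval.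
rewrite e0' p0; have := child_rk ig lv0 iA ig'; lia.
Qed.

Hypothesis no_inf : ~ exists c : nat -> elt I, c 0 = a /\ forall j, rint R0 (c j) (c j.+1).

Lemma model_claim : exists g t x, [/\ g \in tops, t < B, x < B & val g t x].
Proof.
have ha : ext top a by case: mI => _ /(_ _ (or_introl erefl)).
have [[e [Re ie]]|hor] := s_top (mem_head _ _) ha; last first.
  have /ext_bigor[_ /mapP[g ig ->] [e [Re se]]] : ext (bigor [seq Ex R0 (strt g) | g <- tops]) a := hor.
  have [|c [v [pv [_ _ _ hv hval]]]] := @block_val (rk g + B) g e 1 (tops_labs ig) se; first by exists e.
  have [l0 [_ _]] := hv 0 isT; have [l1 _] := hv 1 isT.
  by exists g, (v 0), (v 1); split=> //; apply: hval; lia.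
have nx : forall x : elt I, ext inf x -> exists y, rint R0 x y /\ ext inf y.
  by move=> x; apply: (@s_top inf (Ex R0 inf)); rewrite !inE eqxx orbT.
have [f hf] : exists f : elt I -> elt I, forall x, ext inf x -> rint R0 x (f x) /\ ext inf (f x).
  apply: (choice_fun (P := fun x y => ext inf x -> rint R0 x y /\ ext inf y)) => x.
  by case: (classic (ext inf x)) => [/nx[y h]|n]; [exists y|exists x].
have hi j : ext inf (iter j f e) by elim: j => //= j /hf[].
case: no_inf; exists (fun j => if j is j.+1 then iter j f e else a); split=> // -[|j] //=.
by have [] := hf _ (hi j).
Qed.
End ModelClaims.
End Reduction.


Definition coded (D : Type) (cs : seq nat -> name + D -> Prop) (ed : name + D -> name + D -> Prop) : interp :=
  @Interp D (fun A d => exists2 l, A = nm l & cs l d) (fun R d e => R = R0 /\ ed d e).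

Lemma ext_coded D cs ed l (d : name + D) : @ext (coded cs ed) (at_ l) d <-> cs l d.
Proof. by split=> [[l' /nm_inj <-]|h] //; exists l. Qed.

Lemma holds_at_coded D cs ed l (d : name + D) (b : bool) : (cs l d <-> b) -> @holds_at (coded cs ed) l d = b.
Proof.
by move=> h; apply/idP/idP => [/holdsP/ext_coded/h|/h h']; last by apply/holdsP/ext_coded.
Qed.

Lemma path_fun I n (x y : elt I) : path_to n x y ->
  exists c : nat -> elt I, [/\ c 0 = x, c n = y & forall i, i < n -> rint R0 (c i) (c i.+1)].
Proof.
elim: n x => [|n IH] x /=; first by move->; exists (fun=> y).
case=> x' r /IH[c [c0 cn h]]; exists (fun i => if i is i.+1 then c i else x); split=> //.
by case=> [|i] lt; [rewrite c0|apply: h].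
Qed.

Lemma ext_orr I C D (d : elt I) : ext D d -> ext (Or C D) d.
Proof. by right. Qed.

(** ** Paths *)

(** Position 0 is the individual [a0] itself; [inr 0] and the other individuals lie off the path. *)
Definition pos (d : name + nat) : option nat :=
  match d with
  | inl b => if b == a0 then Some 0 else None
  | inr n => if n is n'.+1 then Some n else None
  end.

Definition at_pos n : name + nat := if n is 0 then inl a0 else inr n.

Lemma posK n : pos (at_pos n) = Some n. Proof. by case: n => [|n] /=; rewrite ?eqxx. Qed.

Lemma pos_inj d n : pos d = Some n -> d = at_pos n.
Proof. by case: d => [b|[|m]] //=; [case: eqP => // -> [<-]|case=> <-]. Qed.

Definition path_interp (cs : seq nat -> nat -> Prop) (ed : nat -> Prop) : interp :=
  coded (fun l d => exists2 i, pos d = Some i & cs l i)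
    (fun d e => exists i, [/\ pos d = Some i, pos e = Some i.+1 & ed i]).

Lemma sigP l : nm l \in sig_concepts sig_0 -> exists r b, l = [:: 3; r; b] \/ l = [:: 4; r; b].
Proof.
case/flatten_mapP=> e _; rewrite !inE => /orP[]/eqP/nm_inj->; exists e.1, (nat_of_bool e.2); [left|right] => //.
Qed.

Section PathInterp.
Variables (cs : seq nat -> nat -> Prop) (ed : nat -> Prop).
Let J := path_interp cs ed.

Lemma ext_path l d : @ext J (at_ l) d <-> exists2 i, d = at_pos i & cs l i.
Proof.
rewrite ext_coded; split=> [[i /pos_inj -> h]|[i -> h]]; exists i => //; exact: posK.
Qed.

Lemma ext_path_pos l i : @ext J (at_ l) (at_pos i) <-> cs l i.
Proof.
rewrite ext_path; split=> [[j e h]|h]; last by exists i.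
by have := congr1 pos e; rewrite !posK => -[->].
Qed.

Lemma rint_path d e : @rint J R0 d e <-> exists i, [/\ d = at_pos i, e = at_pos i.+1 & ed i].
Proof.
split=> [[_ [i [/pos_inj -> /pos_inj -> h]]]|[i [-> -> h]]]; first by exists i.
by split=> //; exists i; rewrite !posK.
Qed.

(** Positions are sent along [c] and individuals to themselves. This preserves roles and the concept
    names of the signature, so it transports matches of the query together with their answers. *)
Lemma path_hom I (c : nat -> elt I) q a : c 0 = named I a0 ->
  (forall i, ed i -> rint R0 (c i) (c i.+1)) ->
  (forall i l, nm l \in sig_concepts sig_0 -> cs l i -> cint (nm l) (c i)) ->
  ucq_over sig_0 q -> sat_ucq J q a -> sat_ucq I q a.
Proof.
move=> c0 hr hc over [phi [iphi [v [ev hv]]]].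
pose h (d : elt J) : elt I := match d with inl b => inl b | inr n => c n end.
have hp i : h (at_pos i) = c i by case: i => [|i] //=; rewrite c0.
exists phi; split=> //; exists (fun z => h (v z)); split.
  by rewrite (map_comp h v) ev -map_comp.
move=> [A z|R z z'] ix; have := over _ iphi _ ix; have := hv _ ix => /=.
  case=> l -> [i /pos_inj -> hl] ov; rewrite hp; exact: hc.
case=> -> [i [/pos_inj -> /pos_inj -> hi]] _; rewrite !hp; exact: hr.
Qed.
End PathInterp.

Section Models.
Variables (P : nat) (labs : seq (nat * nat)) (dir : nat * nat -> nat -> nat)
  (alt : nat * nat -> bool * bool -> seq (seq (nat * nat))) (tops : seq (nat * nat)).
Let N := 2 ^ P.
Let B := 2 ^ N.
Let val := val P dir alt.
Let kb_1 := kb_1 P labs dir alt tops.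
Let kb_2 := kb_2 P.
Let endc := endc P.
Let strt := strt P dir.

Lemma N_gt0 : 0 < N. Proof. by rewrite expn_gt0. Qed.

Lemma sat_tbox2 I : satisfies I (ax_walk P) -> (forall e, e \in errs -> satisfies I (ax_err P e)) ->
  satisfies I (tbox2 P).
Proof.
move=> h h'; apply: satisfies_cat => // C D /flatten_mapP[e ie i]; exact: (h' e ie).
Qed.

(** Walking for ever is a model of the second knowledge base that shows no concept of the signature,
    so it maps to every infinite path from [a0]. *)
Lemma infinite_sat I q a : (exists c : nat -> elt I, c 0 = named I a0 /\ forall j, rint R0 (c j) (c j.+1)) ->
  ucq_over sig_0 q -> certain kb_2 q a -> sat_ucq I q a.
Proof.
case=> c [c0 hc] over cq; pose cs (l : seq nat) (i : nat) := l = [:: 9].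
apply: (@path_hom cs (fun=> True) I c) => //; first by move=> i l h e; rewrite e in h; case/negP: h.
apply: cq; split; last by move=> _ [<-|//]; apply/(@ext_path_pos cs (fun=> True) _ 0).
apply/(@satisfies_model _ kb_2); apply: sat_tbox2 => [C D|e ie].
  rewrite inE => /eqP[-> ->] d /ext_path[i -> _]; left; exists (at_pos i.+1); split; first by apply/rint_path; exists i.
  exact/ext_path_pos.
have ne d : ~ @ext (path_interp cs (fun=> True)) (err e) d by move/ext_path=> [i _].
apply: satisfies_cat; first by apply/cnt_sat => d x /ne.
by move=> C D; rewrite !inE => /orP[]/eqP[-> ->] d [/ne].
Qed.

(** The model walks [n] steps and then runs one error chain. The only concepts of the signature in
    it are the two conflicting bits at positions [n] and [n + N], and these are present in [I]. *)
Lemma error_sat I e n y y' q a : e \in errs -> path_to n (named I a0) y -> path_to N y y' ->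
  holds_at [:: 3; e.1; nat_of_bool e.2] y -> holds_at [:: 4; e.1; nat_of_bool (~~ e.2)] y' ->
  ucq_over sig_0 q -> certain kb_2 q a -> sat_ucq I q a.
Proof.
move=> ie /path_fun[c1 [c10 c1n h1]] /path_fun[c2 [c20 c2n h2]] hy hy' over cq.
pose c i := if i <= n then c1 i else c2 (i - n).
pose cs (l : seq nat) (i : nat) := match l with
  | [:: 9] => i <= n
  | [:: 10; r; b] => [/\ r = e.1, b = e.2 & n <= i < n + N]
  | [:: 2; k] => n <= i /\ bit (i - n) k
  | [:: 3; r; b] => [/\ r = e.1, b = e.2 & i = n]
  | [:: 4; r; b] => [/\ r = e.1, b = ~~ e.2 & i = n + N]
  | _ => False end.
have N0 := N_gt0.
apply: (@path_hom cs (fun i => i < n + N) I c) => //.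
- move=> i lt; rewrite /c; case: (leqP i n) => le; last first.
    have -> : (i.+1 <= n) = false by lia.
    by rewrite subSn; [apply: h2; lia|exact: ltnW].
  case: (ltnP i n) => lt'; first by apply: h1.
  have -> : i = n by lia.
  by rewrite subSn // subnn c1n -c20; apply: h2.
- move=> i l /sigP[r [b [->|->]]] /= [-> -> ->]; rewrite /c.
    by rewrite leqnn c1n; apply/holdsP.
  have -> : (n + N <= n) = false by lia.
  by rewrite addKn c2n; apply/holdsP.
apply: cq; set J := path_interp _ _.
split; last by move=> _ [<-|//]; apply/(@ext_path_pos cs (fun i => i < n + N) _ 0).
have cv i : n <= i -> @cval P J (at_pos i) (i - n).
  move=> le k _; apply/holdsP/idP => [/ext_path_pos[]//|h]; by apply/ext_path_pos.
apply/(@satisfies_model _ kb_2); apply: sat_tbox2 => [C D|e' ie'].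
  rewrite inE => /eqP[-> ->] d /ext_path[i -> le]; rewrite /cs in le.
  case: (ltnP i n) => lt.
    left; exists (at_pos i.+1); split; first by apply/rint_path; exists i; split=> //; lia.
    by apply/(@ext_path_pos cs (fun i => i < n + N) [:: 9] i.+1).
  have -> : i = n by lia.
  apply: ext_orr; rewrite -[X in ext X _]/(bigor [seq And (own e.1 e.2) (And (err e) (zeros P)) | e <- errs]).
  apply/ext_bigor; exists (And (own e.1 e.2) (And (err e) (zeros P))); first by apply/mapP; exists e.
  split; first by apply/(@ext_path_pos cs (fun i => i < n + N) [:: 3; _; _] n).
  split; first by apply/(@ext_path_pos cs (fun i => i < n + N) [:: 10; _; _] n); split=> //; lia.
  by apply/ext_zeros; rewrite -(subnn n); apply: cv.
have errE d : @ext J (err e') d -> e' = e /\ exists i, d = at_pos i /\ n <= i < n + N.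
  case/ext_path => i -> [e1 e2 le]; split; last by exists i.
  by case: (e) (e') e1 e2 => [r b] [r' b'] /= -> ; case: b b' => [] [].
apply: satisfies_cat.
  apply/cnt_sat => d x /errE[_ [i [-> /andP[le lt]]]] /rint_path[j [ej -> _]] k lk.
  have -> : j = i by have := congr1 pos ej; rewrite !posK => -[].
  rewrite (ext_cin (cv _ le)); last exact: ltnW.
  by rewrite !cv ?(leqW le) // subSn // bit_succ addbC.
move=> C D; rewrite !inE => /orP[]/eqP[-> ->] d [/errE[-> [i [-> /andP[le lt]]]] he];
  have lt' : i - n < 2 ^ P by rewrite -/N; lia.
  exists (at_pos i.+1).
  have lt2 : (i - n).+1 != N by apply/eqP => en; apply: he; apply/holdsP; rewrite (ext_endc (cv _ le) lt'); apply/eqP.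
  split; first by apply/rint_path; exists i.
  by apply/ext_path_pos; split=> //; move/eqP: lt2; lia.
move/holdsP: he; rewrite (ext_endc (cv _ le) lt') -/N => /eqP en.
exists (at_pos i.+1); split; first by apply/rint_path; exists i.
by apply/ext_path_pos; split=> //; lia.
Qed.

Hypothesis tops_dir : forall g r, g \in tops -> dir g r = 0.
Hypothesis tops_labs : {subset tops <= labs}.
Variable rk : nat * nat -> nat.
Hypothesis alt_labs : forall g b A g', g \in labs -> A \in alt g b -> g' \in A -> g' \in labs.
Hypothesis alt_rk : forall g b A g', g \in labs -> A \in alt g b -> g' \in A ->
  (dir g' 0 = 0 /\ rk g' < rk g) \/ [/\ dir g' 0 = 2, ~~ b.1 & rk g' <= rk g].

Definition top_val := exists g t x, [/\ g \in tops, t < B, x < B & val g t x].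

Lemma entails_of_not_val : ~ top_val -> ucq_entails sig_0 kb_1 kb_2.
Proof.
move=> nv q a over sza sub cq; split; first exact: sub.
move=> I mI; case: (classic (exists c : nat -> elt I, c 0 = named I a0 /\ forall j, rint R0 (c j) (c j.+1))).
  by move=> h; apply: infinite_sat h over cq.
move=> ni; apply: NNPP => ns; apply: nv.
apply: (model_claim alt_labs tops_labs alt_rk mI _ ni) => e n y y' ie p1 p2 h1 h2; apply: ns.
exact: error_sat ie p1 p2 h1 h2 over cq.
Qed.

Definition guarded (T : seq (concept * concept)) := forall C D, (C, D) \in T -> exists C', C = And blk C'.

Lemma sat_tbox1 I : satisfies I (cnt P blk) -> satisfies I (ax_next P) -> satisfies I (ax_lab P labs) ->
  satisfies I ax_own -> satisfies I ax_par -> satisfies I ax_sum -> satisfies I (ax_carry P labs dir) ->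
  satisfies I (ax_zero P) -> satisfies I (ax_alt P labs dir alt) -> satisfies I (ax_top P dir tops) ->
  satisfies I (tbox1 P labs dir alt tops).
Proof. by move=> *; do 9!apply: satisfies_cat => //. Qed.

(** Inclusions guarded by [blk] hold vacuously where nothing is a block, and [inf] everywhere takes
    care of the others. *)
Lemma consistent_1 : consistent kb_1.
Proof.
pose cs (l : seq nat) (d : name + unit) := l = [:: 1] \/ l = [:: 8].
pose J := coded cs (fun _ _ => True).
exists J; split; last by move=> _ [<-|//]; apply/(@ext_coded _ cs (fun _ _ => True) [:: 8]); right.
have nb d : ~ @ext J blk d by move/ext_coded=> [].
have G T : guarded T -> satisfies J T by move=> g C D /g[C' ->] d [/nb].
apply/(@satisfies_model _ kb_1); apply: sat_tbox1; last first.
  move=> C D; rewrite !inE => /orP[]/eqP[-> ->] d _; [left|];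
    by exists (named J a0); split=> //; apply/ext_coded; left.
- by apply: G => C D /allpairsP[[k b] [_ _ [-> _]]]; eexists.
- by apply: G => C D /allpairsP[[k b] [_ _ [-> _]]]; eexists.
- by apply: G => C D /flatten_mapP[g _ /allpairsP[[k b] [_ _ [-> _]]]]; eexists.
- by apply: G => C D /allpairsP[[k b] [_ _ [-> _]]]; eexists.
- by apply: G => C D /mapP[r _ [-> _]]; eexists.
- by apply: G => C D /mapP[r _ [-> _]]; eexists.
- by apply: G => C D /mapP[r _ [-> _]]; eexists.
- by apply: G => C D; rewrite inE => /eqP[-> _]; eexists.
- by apply: G => C D /allpairsP[[k b] [_ _ [-> _]]]; eexists.
Qed.

Lemma consistent_2 : consistent kb_2.
Proof.
pose cs (l : seq nat) (d : name + unit) := l = [:: 9].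
pose J := coded cs (fun _ _ => True).
exists J; split; last by move=> _ [<-|//]; apply/(@ext_coded _ cs (fun _ _ => True) [:: 9]).
apply/(@satisfies_model _ kb_2); apply: sat_tbox2 => [C D|e ie].
  rewrite inE => /eqP[-> ->] d _; left; exists (named J a0); split=> //; exact/ext_coded.
have ne d : ~ @ext J (err e) d by move/ext_coded.
apply: satisfies_cat; first by apply/cnt_sat => d x /ne.
by move=> C D; rewrite !inE => /orP[]/eqP[-> ->] d [/ne].
Qed.
End Models.


(** * A countermodel from a valid top claim, and its separating query *)

Section CounterModel.
Variables (P : nat) (labs : seq (nat * nat)) (dir : nat * nat -> nat -> nat)
  (alt : nat * nat -> bool * bool -> seq (seq (nat * nat))) (tops : seq (nat * nat)).
Let N := 2 ^ P.
Let B := 2 ^ N.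
Let val := val P dir alt.
Let kb_1 := kb_1 P labs dir alt tops.
Let kb_2 := kb_2 P.
Hypothesis tops_dir : forall g r, g \in tops -> dir g r = 0.
Hypothesis tops_labs : {subset tops <= labs}.
Variable rk : nat * nat -> nat.
Hypothesis alt_labs : forall g b A g', g \in labs -> A \in alt g b -> g' \in A -> g' \in labs.
Hypothesis alt_rk : forall g b A g', g \in labs -> A \in alt g b -> g' \in A ->
  (dir g' 0 = 0 /\ rk g' < rk g) \/ [/\ dir g' 0 = 2, ~~ b.1 & rk g' <= rk g].

Variables (g0 : nat * nat) (t0 x0 : nat).
Hypotheses (ig0 : g0 \in tops) (lt0 : t0 < B) (lx0 : x0 < B) (v0 : val g0 t0 x0).

(* Cell [idx] of a block that carries the label [lbl] and, on track [r], the
   number [pnum r] copied from the parent block. *)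
Record cellb := Cellb { lbl : nat * nat; pt : nat; px : nat; idx : nat }.

Definition pnum p r := if r == 0 then pt p else px p.
Definition num p r := nxt N (dir (lbl p) r) (pnum p r).

(** Only valid claims become blocks, so that each last cell has a valid alternative into which it
    can branch. *)
Definition okb p := [/\ lbl p \in labs, pt p < B, px p < B, idx p < N & val (lbl p) (num p 0) (num p 1)].

Definition same p p' := [/\ lbl p' = lbl p, pt p' = pt p & px p' = px p].

Definition child p p' := [/\ idx p' = 0, pt p' = num p 0, px p' = num p 1 &
  exists2 A, A \in alt (lbl p) (num p 0 == 0, num p 1 == 0) & lbl p' \in A].

Definition root := Cellb g0 t0 x0 0.

Definition edb (d e : name + cellb) : Prop :=
  match d, e with
  | inl b, inr p => b = a0 /\ p = root
  | inr p, inr p' => [/\ okb p, okb p' & ((idx p).+1 < N /\ same p p' /\ idx p' = (idx p).+1)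
       \/ ((idx p).+1 = N /\ child p p')]
  | _, _ => False
  end.

Definition csb (l : seq nat) (d : name + cellb) : Prop :=
  match d with
  | inl b => l = [:: 8] /\ b = a0
  | inr p => okb p /\ match l with
    | [:: 0] => True
    | [:: 2; k] => bit (idx p) k
    | [:: 3; r; b] => bit (num p r) (idx p) = (b != 0)
    | [:: 4; r; b] => bit (pnum p r) (idx p) = (b != 0)
    | [:: 5; r] => carry (dir (lbl p) r) (pnum p r) (idx p)
    | [:: 6; r] => pall (fun i => ~~ bit (num p r) i) (idx p)
    | [:: 7; m; s] => lbl p = (m, s)
    | _ => False
    end
  end.

Let I : interp := coded csb edb.

Lemma okb_idx p p' : same p p' -> idx p' < N -> okb p -> okb p'.
Proof.
case: p p' => g t x j [g' t' x' j'] [/= -> -> ->] lt [a b c d e]; split=> //.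
Qed.

Lemma root_ok : okb root.
Proof.
split=> //; [exact: tops_labs|by rewrite expn_gt0|].
by rewrite /num /= !tops_dir // !nxt0.
Qed.

Lemma ext_blk d : @ext I blk d -> exists2 p, d = inr p & okb p.
Proof. by move/ext_coded; case: d => [b []//|p [h _]]; exists p. Qed.

Lemma blk_ext p : okb p -> @ext I blk (inr p).
Proof. by move=> h; apply/ext_coded. Qed.

Section Cell.
Variable p : cellb.
Hypothesis okp : okb p.
Let d : elt I := inr p.

Lemma cell_cval : cval P d (idx p).
Proof. by move=> k _; apply: holds_at_coded; split=> [[]|]. Qed.

Lemma cell_own r : holds_at [:: 3; r; 1] d = bit (num p r) (idx p).
Proof. by apply: holds_at_coded; split=> [[_ ->]|h]. Qed.

Lemma cell_par r : holds_at [:: 4; r; 1] d = bit (pnum p r) (idx p).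
Proof. by apply: holds_at_coded; split=> [[_ ->]|h]. Qed.

Lemma cell_cy r : holds_at [:: 5; r] d = carry (dir (lbl p) r) (pnum p r) (idx p).
Proof. by apply: holds_at_coded; split=> [[]|]. Qed.

Lemma cell_zf r : holds_at [:: 6; r] d = pall (fun i => ~~ bit (num p r) i) (idx p).
Proof. by apply: holds_at_coded; split=> [[]|]. Qed.

Lemma cell_lab g : ext (lab g) d <-> lbl p = g.
Proof. by rewrite ext_coded; case: g => m s; split=> [[]|]. Qed.

Lemma cell_endc : holds (ext (endc P) d) = ((idx p).+1 == N).
Proof. by apply: (ext_endc cell_cval); case: okp. Qed.

Lemma cell_zero r : (idx p).+1 = N -> holds (ext (zero r) d) = (num p r == 0).
Proof.
move=> e; have l : num p r < B by exact: nxt_lt.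
rewrite -(pall_zero l) -e pallS -cell_zf -cell_own.
apply/holdsP/andP => [/ext_and[h1 h2]|[/holdsP h1 /negP h2]].
  by split; [apply/holdsP|apply/negP => /holdsP].
by split=> // /holdsP.
Qed.

Lemma cell_strt : idx p = 0 -> ext (strt P dir (lbl p)) d.
Proof.
move=> e; split; first exact: blk_ext.
split; first by apply/cell_lab.
split; first by apply/ext_zeros; rewrite -e; apply: cell_cval.
apply/ext_bigand => _ /mapP[r _ ->]; split.
  by apply/ext_lit; have := cell_cy r; rewrite e /carry andbT.
by apply/holdsP; have := cell_zf r; rewrite e.
Qed.
End Cell.

Lemma next_cell p d' : okb p -> ~ (idx p).+1 = N -> @rint I R0 (inr p) d' ->
  exists p', [/\ d' = inr p', okb p', same p p' & idx p' = (idx p).+1].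
Proof.
move=> okp ne [_]; case: d' => // p' [_ ok' [[_ [s e]]|[e _]]] //.
by exists p'.
Qed.

Lemma not_endc p : okb p -> ~ @ext I (endc P) (inr p) -> ~ (idx p).+1 = N.
Proof. by move=> okp ne e; apply: ne; apply/holdsP; rewrite cell_endc // e. Qed.

Lemma lit_eq b C (d : elt I) b' : ext (lit b C) d -> holds (ext C d) = b' -> b = b'.
Proof. by move/ext_lit => <-. Qed.

Lemma sat_counter : satisfies I (tbox1 P labs dir alt tops).
Proof.
apply: sat_tbox1.
- apply/cnt_sat => d e /ext_blk[p -> okp] [_]; case: e => // p' [_ okp' h] k lk.
  rewrite (cell_cval okp') // (cell_cval okp) // (ext_cin (cell_cval okp)); last exact: ltnW.
  case: h => [[_ [_ ->]]|[e [-> _ _ _]]]; first by rewrite bit_succ addbC.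
  (* At the end of a block the position passes from [N - 1] to 0, which agrees with counting modulo
     [2 ^ P]. *)
  by rewrite addbC -bit_succ e /N -[2 ^ P]add0n bit_addX.
- move=> C D; rewrite inE => /eqP[-> ->] d /ext_and[/ext_blk[p -> okp] /(not_endc okp) ne].
  have lt : (idx p).+1 < N by case: okp => _ _ _; lia.
  have ok' : okb (Cellb (lbl p) (pt p) (px p) (idx p).+1) by apply: okb_idx okp.
  exists (inr (Cellb (lbl p) (pt p) (px p) (idx p).+1)); split; last exact: blk_ext.
  by split=> //; split=> //; left.
- move=> C D /mapP[g ig [-> ->]] d /ext_and[/ext_blk[p -> okp] /ext_and[/(not_endc okp) ne /(cell_lab okp) eg]] d'.
  case/(next_cell okp ne) => p' [-> ok' [e _ _] _]; apply/(cell_lab ok'); by rewrite e.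
- move=> C D /mapP[r _ [-> ->]] d /ext_and[/ext_blk[p -> okp] h]; apply/ext_coded; split=> //.
  apply: (@negbTE (bit _ _)); apply/negP => h'.
  by have [] : ~ @ext I (own r true) (inr p) := h; apply/ext_coded; split; last exact: h'.
- move=> C D /mapP[r _ [-> ->]] d /ext_and[/ext_blk[p -> okp] h]; apply/ext_coded; split=> //.
  apply: (@negbTE (bit _ _)); apply/negP => h'.
  by have [] : ~ @ext I (par r true) (inr p) := h; apply/ext_coded; split; last exact: h'.
- move=> C D /allpairsP[[r b] [_ _ [-> ->]]] d /ext_and[/ext_blk[p -> okp] /ext_and[h1 h2]].
  apply/ext_lit; rewrite (lit_eq h1 (cell_par okp r)) (lit_eq h2 (cell_cy okp r)).
  by rewrite -[holds _]/(holds_at [:: 3; r; 1] _) cell_own // /num nxt_bit //; case: okp.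
- move=> C D /flatten_mapP[g ig /allpairsP[[r b] [_ _ [-> ->]]]] d /ext_and[/ext_blk[p -> okp]
    /ext_and[/(not_endc okp) ne /ext_and[/(cell_lab okp) eg /ext_and[h1 h2]]]] d'.
  case/(next_cell okp ne) => p' [-> ok' [e1 e2 e3] e4]; apply/ext_lit.
  rewrite (lit_eq h1 (cell_par okp r)) (lit_eq h2 (cell_cy okp r)).
  by rewrite -[holds _]/(holds_at [:: 5; r] _) cell_cy // /pnum e1 e2 e3 e4 carryS eg.
- move=> C D /allpairsP[[r b] [_ _ [-> ->]]] d /ext_and[/ext_blk[p -> okp]
    /ext_and[/(not_endc okp) ne /ext_and[h1 h2]]] d'.
  case/(next_cell okp ne) => p' [-> ok' [e1 e2 e3] e4]; apply/ext_lit.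
  rewrite (lit_eq h1 (cell_zf okp r)) (lit_eq h2 (cell_own okp r)).
  by rewrite -[holds _]/(holds_at [:: 6; r] _) cell_zf // /num /pnum e1 e2 e3 e4 pallS.
- move=> C D /allpairsP[[g b] [ig _ [-> ->]]] d /ext_and[/ext_blk[p -> okp]
    /ext_and[/holdsP he /ext_and[/(cell_lab okp) eg /ext_and[h1 h2]]]].
  move: he; rewrite (cell_endc okp) => /eqP he.
  have eb : b = (num p 0 == 0, num p 1 == 0).
    rewrite -(lit_eq h1 (cell_zero okp _ he)) -(lit_eq h2 (cell_zero okp _ he)); by case: (b).
  have [A iA hA] : exists2 A, A \in alt (lbl p) (num p 0 == 0, num p 1 == 0) &
      forall g', g' \in A -> val g' (nxt N (dir g' 0) (num p 0)) (nxt N (dir g' 1) (num p 1)).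
    by case: okp => _ _ _ _; case=> g' t x A h h'; exists A.
  apply/ext_bigor; exists (bigand [seq Ex R0 (strt P dir g') | g' <- A]).
    by apply/mapP; exists A => //; move: iA; rewrite eb eg.
  apply/ext_bigand => _ /mapP[g' ig' ->].
  have ok' : okb (Cellb g' (num p 0) (num p 1) 0).
    split; rewrite /= ?nxt_lt ?expn_gt0 //; last exact: hA.
    by apply: alt_labs ig'; [|exact: iA]; case: okp.
  exists (inr (Cellb g' (num p 0) (num p 1) 0)); split; last exact: (@cell_strt (Cellb g' (num p 0) (num p 1) 0)).
  by split=> //; split=> //; right; split=> //; split=> //; exists A.
- move=> C D; rewrite !inE => /orP[]/eqP[-> ->] d; last by move/ext_coded; case: d => [b []//|p []].
  move/ext_coded; case: d => [b [_ ->]|p []//]; apply: ext_orr; apply/ext_bigor.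
  exists (Ex R0 (strt P dir g0)); first by apply/mapP; exists g0.
  by exists (inr root); split=> //; apply: (@cell_strt root) => //; exact: root_ok.
Qed.

Lemma counter_model : model I kb_1.
Proof.
split; first by apply/(@satisfies_model _ kb_1); apply: sat_counter.
by move=> _ [<-|//]; exists [:: 8].
Qed.

(** A bound for the length of paths: by [child_rk] the first summand loses at least [N] from one
    block to the next, and the second counts the cells left in the block. *)
Definition fuel p := (rk (lbl p) + num p 0) * N + (N - idx p).

Lemma edge_fuel p p' : edb (inr p) (inr p') -> fuel p' < fuel p.
Proof.
have N0 : 0 < N by rewrite expn_gt0.
rewrite /fuel; case=> okp okp' [[lt [[e1 e2 e3] e4]]|[e [i0 e1 e2 [A iA iA']]]].
  by rewrite /num /pnum /= e1 e2 e4 ltn_add2l; lia.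
have [il _ _ _ _] := okp; have := child_rk alt_rk il (nxt_lt _ _ _) iA iA'.
have e' : num p' 0 = nxt N (dir (lbl p') 0) (num p 0) by rewrite {1}/num /pnum /= e1.
rewrite e' i0 subn0 => lt.
have : (rk (lbl p') + nxt N (dir (lbl p') 0) (num p 0)).+1 * N <= (rk (lbl p) + num p 0) * N by rewrite leq_mul2r lt orbT.
have : idx p < N by case: okp.
by rewrite mulSn; set a := _ * N; set b := _ * N; lia.
Qed.

Lemma path_fuel n p d : path_to (I := I) n (inr p) d -> n <= fuel p.
Proof.
elim: n p => [|n IH] p //= [[b|p'] [_ r]]; first by case: r.
by move/IH; have := edge_fuel r; lia.
Qed.

Lemma path_bound n d : path_to (I := I) n (named I a0) d -> n <= (fuel root).+1.
Proof.
case: n => [|n] //= [[b|p'] [_ r]]; first by case: r.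
by case: r => _ -> /path_fuel; lia.
Qed.

Lemma path_cells n p d : okb p -> path_to (I := I) n (inr p) d ->
  exists p', [/\ d = inr p', okb p', idx p + n < N -> same p p' /\ idx p' = idx p + n
    & N <= idx p + n < N + N -> idx p' = idx p + n - N /\ forall r, r < 2 -> pnum p' r = num p r].
Proof.
elim: n p => [|n IH] p okp.
  by move=> <-; exists p; rewrite addn0; split=> // h; case: okp => _ _ _; lia.
case=> [[b|p1] [_ r]]; first by case: r.
case: r => _ ok1 h /(IH _ ok1)[p' [-> ok' h1 h2]]; exists p'; split=> //.
  move=> lt; case: h => [[_ [[s1 s2 s3] e]]|[e _]]; last by lia.
  by have [|[r1 r2 r3] ->] := h1; [lia|split; [split; congruence|lia]].
move=> lt; case: h => [[l1 [[s1 s2 s3] e]]|[e [i0 e1 e2 _]]].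
  have [|-> hp] := h2; first by lia.
  split; first by lia.
  by move=> r r2; rewrite hp // /num /pnum s1 s2 s3.
have [|[r1 r2 r3] ->] := h1; first by lia.
split; first by lia.
by move=> [|[|]] // _; rewrite /pnum /= ?r2 ?r3 ?e1 ?e2.
Qed.

Lemma no_errors e y y' : e \in errs -> path_to (I := I) N y y' ->
  holds_at [:: 3; e.1; nat_of_bool e.2] y -> holds_at [:: 4; e.1; nat_of_bool (~~ e.2)] y' -> False.
Proof.
move=> ie py /holdsP/ext_coded; case: y py => [b _ []//|p py [okp hp]] /holdsP/ext_coded.
have [p' [-> ok' _ h2]] := path_cells okp py; case=> _ hp'.
have e2 : e.1 < 2 by move: ie; rewrite !inE => /or4P[]/eqP->.
have [|ei en] := h2; first by case: okp => _ _ _; lia.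
move: hp'; rewrite en // ei addnK hp; by case: (e.2).
Qed.

Definition path_query n : seq Defs.atom := [seq RoleAtom R0 i i.+1 | i <- iota 0 n].
Definition err_query n (e : nat * bool) : seq Defs.atom := path_query (n + N) ++
  [:: ConceptAtom (nm [:: 3; e.1; nat_of_bool e.2]) n;
      ConceptAtom (nm [:: 4; e.1; nat_of_bool (~~ e.2)]) (n + N)].

(** Longer than any path from [a0], by [path_bound]. *)
Let D := (fuel root).+2.

Definition query := UCQ [:: 0] (path_query D :: [seq err_query n e | n <- iota 0 D, e <- errs]).

Lemma path_querySat J n (v : var -> elt J) :
  (forall x, List.In x (path_query n) -> sat_atom v x) <-> (forall i, i < n -> rint R0 (v i) (v i.+1)).
Proof.
split=> [h i lt|h x /in_listP/mapP[i + ->]]; last by rewrite mem_iota => /h.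
by apply: (h (RoleAtom R0 i i.+1)); apply/in_listP/mapP; exists i; rewrite ?mem_iota.
Qed.

(** By induction on [k], a model of the second knowledge base still walks after [k] steps or has
    begun an error chain before. Stopping at [D] turns this unbounded alternative into a finite
    union. *)
Lemma query_certain : certain kb_2 query [:: a0].
Proof.
move=> J [mT mA]; have sT : satisfies J (tbox2 P) by apply/(@satisfies_model _ kb_2).
have sw : satisfies J (ax_walk P) := proj1 (satisfies_catE sT).
have se e : e \in errs -> satisfies J (ax_err P e).
  by move=> ie; apply: satisfies_sub (proj2 (satisfies_catE sT)) => x ix; apply/flatten_mapP; exists e.
have K k : (exists2 y, path_to k (named J a0) y & ext walk y) \/
    exists n e y y', [/\ n < k /\ e \in errs, path_to n (named J a0) y, path_to N y y',
      holds_at [:: 3; e.1; nat_of_bool e.2] y & holds_at [:: 4; e.1; nat_of_bool (~~ e.2)] y'].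
  elim: k => [|k [[y py wy]|[n [e [y [y' [[lt ie] h1 h2 h3 h4]]]]]]].
  - by left; exists (named J a0) => //; apply: (mA _ (or_introl erefl)).
  - have [[z [r wz]]|hor] := sw _ _ (mem_head _ _) _ wy.
      by left; exists z => //; rewrite -addn1; apply: path_cat py _; exists z.
    have /ext_bigor[_ /mapP[e ie ->] /ext_and[oy /ext_and[ey /ext_zeros zy]]] :
      ext (bigor [seq And (own e.1 e.2) (And (err e) (zeros P)) | e <- errs]) y := hor.
    have s1 := proj1 (satisfies_catE (se e ie)); have s2 := proj2 (satisfies_catE (se e ie)).
    have nx (d : elt J) : ext (err e) d -> ~ ext (endc P) d -> exists2 f, rint R0 d f & ext (err e) f.
      by move=> h1 h2; have [f [h3 h4]] := s2 _ _ (mem_head _ _) d (conj h1 h2); exists f.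
    have [c [c0 hc hR]] := counting_chain s1 nx ey zy.
    have N0 : N.-1 < 2 ^ P by rewrite prednK // expn_gt0.
    have [hl cl] := hc _ N0.
    have he : ext (endc P) (c N.-1) by apply/holdsP; rewrite (ext_endc cl N0) prednK // expn_gt0.
    have i2 : (And (err e) (endc P), Ex R0 (par e.1 (~~ e.2))) \in
       [:: (And (err e) (Not (endc P)), Ex R0 (err e)); (And (err e) (endc P), Ex R0 (par e.1 (~~ e.2)))].
      by rewrite !inE eqxx orbT.
    have [y' [r hy']] := s2 _ _ i2 _ (conj hl he).
    right; exists k, e, y, y'; split=> //; [|exact/holdsP|exact/holdsP].
    have -> : N = N.-1 + 1 by rewrite addn1 prednK // expn_gt0.
    apply: (@path_cat _ _ 1 _ (c N.-1)); last by exists y'.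
    rewrite -c0; have := @path_seq J c 0 N.-1; rewrite add0n; apply=> i lt; apply: hR; rewrite -/N; lia.
  - by right; exists n, e, y, y'; split=> //; split=> //; exact: ltnW.
case: (K D) => [[y /path_fun[c [c0 _ hc]] _]|[n [e [y [y' [[lt ie] p1 p2 h3 h4]]]]]].
  exists (path_query D); split; first by left.
  by exists c; split; [rewrite /= c0|apply/path_querySat].
have := path_fun p1 => -[c1 [c10 c1n hc1]]; have := path_fun p2 => -[c2 [c20 c2n hc2]].
exists (err_query n e); split.
  by right; apply/in_listP/allpairsP; exists (n, e); rewrite mem_iota.
exists (fun i => if i <= n then c1 i else c2 (i - n)); split; first by rewrite /= c10.
have N0 : 0 < N by rewrite expn_gt0.
move=> x /in_listP; rewrite mem_cat => /orP[ix|].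
  move: x ix; suff h : forall x, List.In x (path_query (n + N)) -> sat_atom (fun i => if i <= n then c1 i else c2 (i - n)) x.
    by move=> x /in_listP; apply: h.
  apply/path_querySat => i li; case: (leqP i n) => le; last first.
    have -> : (i.+1 <= n) = false by lia.
    by rewrite subSn; [apply: hc2; lia|exact: ltnW].
  case: (ltnP i n) => lt'; first by apply: hc1.
  have -> : i = n by lia.
  by rewrite subSn // subnn c1n -c20; apply: hc2.
rewrite !inE => /orP[]/eqP-> /=; first by rewrite leqnn c1n; apply/holdsP.
have -> : (n + N <= n) = false by lia.
by rewrite addKn c2n; apply/holdsP.
Qed.

Lemma not_entails : ~ ucq_entails sig_0 kb_1 kb_2.
Proof.
move=> h; have [||||_ /(_ I counter_model)[phi [+ [v [[ev] hv]]]]] := h query [:: a0].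
- move=> phi /in_listP; rewrite inE => /orP[/eqP->|/allpairsP[[n e] [_ ie ->]]] x /in_listP.
    by case/mapP=> i _ ->.
  rewrite mem_cat => /orP[/mapP[i _ ->] //|]; move: ie; rewrite !inE.
  by case/or4P=> /eqP-> /orP[]/eqP->.
- by [].
- by [].
- exact: query_certain.
have path n : (forall x, List.In x (path_query n) -> sat_atom v x) -> path_to n (named I a0) (v n).
  move/path_querySat => hr; rewrite -ev; have := @path_seq I v 0 n; rewrite add0n; apply=> i; apply: hr.
move/in_listP; rewrite inE => /orP[/eqP e|/allpairsP[[n e] [_ ie /= e1]]].
  by have := @path D; rewrite -e => /(_ hv)/path_bound; rewrite /D; lia.
have hp : path_to (n + N) (named I a0) (v (n + N)).
  by apply: path => x ix; apply: hv; rewrite e1; apply/in_listP; rewrite mem_cat; apply/orP; left; apply/in_listP.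
have hs x : x \in [:: ConceptAtom (nm [:: 3; e.1; nat_of_bool e.2]) n;
    ConceptAtom (nm [:: 4; e.1; nat_of_bool (~~ e.2)]) (n + N)] -> sat_atom v x.
  by move=> ix; apply: hv; rewrite e1; apply/in_listP; rewrite mem_cat ix orbT.
have p2 : path_to N (v n) (v (n + N)).
  have h1 : forall x, List.In x (path_query (n + N)) -> sat_atom v x.
    by move=> x ix; apply: hv; rewrite e1; apply/in_listP; rewrite mem_cat; apply/orP; left; apply/in_listP.
  by apply: path_seq => i lt; apply: ((path_querySat _ _).1 h1); rewrite ltn_add2l.
apply: (no_errors ie p2); apply/holdsP; [exact: (hs (ConceptAtom _ n) (mem_head _ _))|].
by apply: (hs (ConceptAtom _ (n + N))); rewrite !inE eqxx orbT.
Qed.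
End CounterModel.


(** * Computations as claims *)

Section Cyclic.
Variable N : nat.
Hypothesis N2 : 1 < N.
Let B := 2 ^ N.

Lemma B_gt3 : 3 < B. Proof. by apply: (@leq_trans (2 ^ 2)) => //; rewrite leq_exp2l. Qed.

Lemma nxt1E x : x < B -> nxt N 1 x = if x.+1 == B then 0 else x.+1.
Proof.
move=> lt; rewrite /nxt /= addn1; case: eqP => [->|ne]; first by rewrite modnn.
by rewrite modn_small //; lia.
Qed.

Lemma nxt2E x : x < B -> nxt N 2 x = if x == 0 then B.-1 else x.-1.
Proof.
case: x => [|x] lt /=; last by rewrite nxt_pred.
by rewrite /nxt /= add0n modn_small // prednK // expn_gt0.
Qed.

Lemma nxt12 x : x < B -> nxt N 1 (nxt N 2 x) = x.
Proof.
move=> lt; have h := nxt_lt N 2 x; rewrite (nxt1E h) nxt2E //; have := B_gt3; move: lt.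
by case: x {h} => [|x] /=; case: eqP; lia.
Qed.

Lemma nxt21 x : x < B -> nxt N 2 (nxt N 1 x) = x.
Proof.
move=> lt; have h := nxt_lt N 1 x; rewrite (nxt2E h) nxt1E //; have := B_gt3.
by case: (x.+1 =P B) => /=; lia.
Qed.

(** On a cycle of more than three cells a cell and its two neighbours are distinct, so the head is
    seen at most once among them. *)
Lemma nxt_neq x : x < B -> [/\ (nxt N 1 x == x) = false, (nxt N 2 x == x) = false & (nxt N 1 x == nxt N 2 x) = false].
Proof.
move=> lt; rewrite nxt1E // nxt2E //; have := B_gt3.
by case: (x.+1 =P B) => e; case: x e lt => [|x] /=; split; lia.
Qed.
End Cyclic.

Section Rows.
Variables (M : tm) (w : seq bool) (N : nat).
Hypothesis N2 : 1 < N.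
Let B := 2 ^ N.

Definition sym := (option (bool + aux M) * option (state M))%type.

(* A configuration on a cyclic tape of [2 ^ N] cells: the state, the position
   of the head and the tape. *)
Definition cconf := (state M * nat * (nat -> cell M))%type.

Definition mdir m := match m with MoveLeft => 2 | Stay => 0 | MoveRight => 1 end.

Definition cstep (s : cconf) : cconf :=
  if trans s.1.1 (s.2 s.1.2) is Some (q, y, m) then
    (q, nxt N (mdir m) s.1.2, fun i => if i == s.1.2 then y else s.2 i)
  else s.

Definition crun t : cconf := iter t cstep (start M, 0, nth None (input_cells M w)).

Definition csym (s : cconf) x : sym := (s.2 x, if x == s.1.2 then Some s.1.1 else None).

Definition row t x := csym (crun t) x.

Definition arrive (a : sym) d : option (state M) :=
  if a.2 is Some q then if trans q a.1 is Some (q', _, m) then if mdir m == d then Some q' else None else None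
  else None.

(** The local rule on three adjacent cells: the head arrives from the left when it moves right
    (direction 1) and from the right when it moves left (direction 2). *)
Definition rule (a b c : sym) : sym :=
  if b.2 is Some q then
    if trans q b.1 is Some (q', y, m) then (y, if mdir m == 0 then Some q' else None) else b
  else (b.1, if arrive a 1 is Some q' then Some q' else arrive c 2).

Lemma csym_step s x : s.1.2 < B -> x < B ->
  csym (cstep s) x = rule (csym s (nxt N 2 x)) (csym s x) (csym s (nxt N 1 x)).
Proof.
case: s => [[q h] tp] /= lh lx; have [n1 n2 n3] := nxt_neq N2 lx.
rewrite /csym /rule /cstep /arrive /=; case: (x =P h) => [<-|ne].
  case: (trans q (tp x)) => [[[q' y] m]|] /=; last by rewrite eqxx.
  rewrite eqxx; congr (_, _); have [h1 h2 _] := nxt_neq N2 lx.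
  by case: m => /=; rewrite ?nxt0 ?eqxx // 1?eq_sym ?h1 ?h2.
have e2 : (nxt N 2 x == h) = (x == nxt N 1 h).
  by apply/eqP/eqP => [<-|->]; [rewrite nxt12|rewrite nxt21].
have e1 : (nxt N 1 x == h) = (x == nxt N 2 h).
  by apply/eqP/eqP => [<-|->]; [rewrite nxt21|rewrite nxt12].
case E: (trans q (tp h)) => [[[q' y] m]|] /=; last first.
  rewrite (introF eqP ne); case: (nxt N 2 x =P h) => [->|_] /=; rewrite ?E //;
    by case: (nxt N 1 x =P h) => [->|_] /=; rewrite ?E.
rewrite (introF eqP ne); congr (_, _).
case: (nxt N 2 x =P h) => [a|/eqP/negbTE a] /=.
  rewrite a E; have b : (nxt N 1 x == h) = false by rewrite -a n3.
  rewrite b; have := e2; rewrite a eqxx => /esym/eqP ->.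
  have [h1 h2 h3] := nxt_neq N2 lh.
  by case: m {E} => /=; rewrite ?eqxx ?h3 ?nxt0 ?h1.
case: (nxt N 1 x =P h) => [b|/eqP/negbTE b] /=.
  rewrite b E; have := e1; rewrite b eqxx => /esym/eqP ->.
  have [h1 h2 h3] := nxt_neq N2 lh.
  by case: m {E} => /=; rewrite ?eqxx ?nxt0 ?h2 // eq_sym h3.
rewrite e2 in a; rewrite e1 in b.
by case: m {E} => /=; rewrite ?a ?b // nxt0 // (introF eqP ne).
Qed.

Lemma crun_head t : (crun t).1.2 < B.
Proof.
elim: t => [|t IH]; first by rewrite expn_gt0.
rewrite /crun iterS -/(crun t) /cstep; case: (trans _ _) => [[[q y] m]|] //=; exact: nxt_lt.
Qed.

Lemma rowS t x : x < B -> row t.+1 x = rule (row t (nxt N 2 x)) (row t x) (row t (nxt N 1 x)).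
Proof. by move=> lx; rewrite /row /crun iterS; apply: csym_step lx; exact: crun_head. Qed.

(** The cyclic tape agrees with the infinite one in a window of about [K] cells on both sides of the
    head. A step may narrow the window by one cell, so a run shorter than the cycle notices no
    difference. *)
Definition sim K (c : config M) (s : cconf) :=
  [/\ cstate c = s.1.1, s.1.2 < B,
      forall i, i <= K -> s.2 ((s.1.2 + i) %% B) = nth None (tape_right c) i
    & forall i, i <= K -> s.2 ((s.1.2 + (B - i.+1)) %% B) = nth None (tape_left c) i].

Lemma mod_neq h j : h < B -> j < B -> ((h + j) %% B == h) = (j == 0).
Proof.
move=> lh lj; case: (ltnP (h + j) B) => le; first by rewrite modn_small //; lia.
have -> : (h + j) %% B = h + j - B by rewrite -{1}(subnK le) modnDr modn_small //; lia.
lia.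
Qed.

Lemma sim_step K c s c' : K.+2 < B -> sim K.+1 c s -> step c = Some c' -> sim K c' (cstep s).
Proof.
case: s => [[q h] tp] lK [/= eq lh hr hl]; rewrite /step /cstep eq /=.
have th : tp h = head None (tape_right c).
  by have := hr 0 isT; rewrite addn0 modn_small // nth0.
rewrite th; case: (trans _ _) => [[[q' y] m]|] // [<-].
pose tp' i := if i == h then y else tp i.
have r0 : tp' h = y by rewrite /tp' eqxx.
have rS i : i < K.+1 -> tp' ((h + i.+1) %% B) = nth None (tape_right c) i.+1.
  by move=> lt; rewrite /tp' mod_neq //; [rewrite hr|lia].
have lS i : i < K.+2 -> tp' ((h + (B - i.+1)) %% B) = nth None (tape_left c) i.
  move=> lt; rewrite /tp' mod_neq //; last by lia.
  have -> : (B - i.+1 == 0) = false by lia.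
  by rewrite hl.
have B0 : 0 < B by rewrite expn_gt0.
have n2 i : (nxt N 2 h + i) %% B = (h + B.-1 + i) %% B by apply: modnDml.
have n1 i : (nxt N 1 h + i) %% B = (h + 1 + i) %% B by apply: modnDml.
case: m; split=> //; rewrite ?nxt_lt //.
- move=> i le; rewrite -[LHS]/(tp' ((nxt N 2 h + i) %% B)) n2.
  case: i le => [|i] le; first by rewrite addn0 -subn1 lS // nth0.
  have -> : h + B.-1 + i.+1 = h + i + B by lia.
  rewrite modnDr; case: i le => [|i] le; first by rewrite addn0 modn_small.
  by rewrite rS /= ?nth_behead //; lia.
- move=> i le; rewrite -[LHS]/(tp' ((nxt N 2 h + (B - i.+1)) %% B)) n2 /= nth_behead.
  have -> : h + B.-1 + (B - i.+1) = h + (B - i.+2) + B by lia.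
  by rewrite modnDr lS //; lia.
- move=> i le; rewrite -[LHS]/(tp' ((nxt N 0 h + i) %% B)) nxt0 //; case: i le => [|i] le; first by rewrite addn0 modn_small.
  by rewrite rS /= ?nth_behead //; lia.
- by move=> i le; rewrite -[LHS]/(tp' ((nxt N 0 h + (B - i.+1)) %% B)) nxt0 // lS //; lia.
- move=> i le; rewrite -[LHS]/(tp' ((nxt N 1 h + i) %% B)) n1 addn1 addSnnS rS /= ?nth_behead //; lia.
- move=> i le; rewrite -[LHS]/(tp' ((nxt N 1 h + (B - i.+1)) %% B)) n1; case: i le => [|i] le.
    have -> : h + 1 + (B - 1) = h + B by lia.
    by rewrite modnDr modn_small.
  have -> : h + 1 + (B - i.+2) = h + (B - i.+1) by lia.
  by rewrite lS //; lia.
Qed.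

(** Cells to the left of the head are found at the far end of the cycle; the margin keeps them clear
    of the input. *)
Lemma sim_init K : K + size w + 2 <= B -> sim K (init M w) (crun 0).
Proof.
move=> le; split=> //=; first by rewrite expn_gt0.
  by move=> i li; rewrite add0n modn_small //; lia.
have B0 : 0 < B by rewrite expn_gt0.
move=> i li; rewrite add0n modn_small; last by lia.
by rewrite nth_nil nth_default // size_map; lia.
Qed.

Lemma sim_run n K c : n + K + size w + 2 <= B ->
  iter n (obind (@step M)) (Some (init M w)) = Some c -> sim K c (crun n).
Proof.
elim: n K c => [|n IH] K c le; first by case=> <-; apply: sim_init.
rewrite iterS; case E: (iter n _ _) => [c'|] //= h.
by apply: sim_step h; [lia|apply: IH E; lia].
Qed.

Definition halted (s : cconf) := trans s.1.1 (s.2 s.1.2) = None.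

Lemma halted_stays s n : halted s -> iter n cstep s = s.
Proof. by move=> h; elim: n => //= n ->; rewrite /cstep h. Qed.

(** A halted configuration repeats in all later rows, so a halting state seen in any row belongs to
    the final configuration. *)
Lemma rows_reject T (c : config M) : halts_within w T c -> T + size w + 2 <= B ->
  (exists t x q y, [/\ t < B, x < B, row t x = (y, Some q), trans q y = None & ~~ accepting q])
  <-> ~~ accepting (cstate c).
Proof.
case=> n [le hn hs] lB; have [es lh hr _] : sim 0 c (crun n) by apply: sim_run hn; lia.
have hn' : halted (crun n).
  move: hs; rewrite /step /halted es; have := hr 0 isT; rewrite addn0 modn_small // nth0 => ->.
  by case: (trans _ _) => [[[]]|].
split=> [[t [x [q [y [lt lx]]]]]|na].
  rewrite /row /csym; case: eqP => // -> [<- <-] ht na; rewrite es.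
  suff -> : crun n = crun t by [].
  case: (leqP t n) => lt'; first by rewrite /crun -(subnK lt') iterD halted_stays.
  by rewrite /crun -[t](subnK (ltnW lt')) iterD [RHS]halted_stays.
exists n, (crun n).1.2, (crun n).1.1, ((crun n).2 (crun n).1.2); split=> //; first by lia.
  by rewrite /row /csym eqxx.
by rewrite -es.
Qed.
End Rows.


Section Labels.
Variable M : tm.

Notation sym := (sym M).

Definition cod (s : sym) : nat := enum_rank s.

Lemma cod_inj : injective cod.
Proof. by move=> s s' /ord_inj/enum_rank_inj. Qed.

Definition init_sym (w : seq bool) k : sym :=
  (nth None (input_cells M w) k, if k == 0 then Some (start M) else None).

Definition triples (s : nat) : seq (seq (nat * nat)) :=
  image (fun a => [:: (1, cod a.1.1); (2, cod a.1.2); (3, cod a.2)])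
    [pred a : sym * sym * sym | cod (rule a.1.1 a.1.2 a.2) == s].

(* The modes 0, 1, 2 and 3 belong to claims on rows; those of mode 1, 2 and 3
   justify a claim on the next row.  Mode [4 + i] walks down from a cell
   of the initial row to the cell at position 0, [i] being the number of steps
   made so far. *)
Definition dirs (g : nat * nat) r : nat :=
  if r == 0 then (if (0 < g.1) && (g.1 < 4) then 2 else 0)
  else if g.1 == 3 then 1 else if (g.1 == 1) || (4 < g.1) then 2 else 0.

(** Claims can test [x] only for 0, so a cell of the initial row is identified by walking to
    position 0 and counting the steps in the mode. A walk of [size w] steps that has not reached 0
    began on a blank cell away from the head. *)
Definition alts (w : seq bool) (g : nat * nat) (z : bool * bool) : seq (seq (nat * nat)) :=
  if g.1 < 4 then if z.1 then [:: [:: (4, g.2)]] else triples g.2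
  else if z.2 then (if g.2 == cod (init_sym w (g.1 - 4)) then [:: [::]] else [::])
  else if g.1 < 4 + size w then [:: [:: (g.1.+1, g.2)]]
  else if g.2 == cod (None, None) then [:: [::]] else [::].

Definition rejecting (s : sym) := if s.2 is Some q then ~~ isSome (trans q s.1) && ~~ accepting q else false.

Definition tops : seq (nat * nat) := image (fun s => (0, cod s)) [pred s | rejecting s].

Definition labels (w : seq bool) : seq (nat * nat) := [seq (m, s) | m <- iota 0 (5 + size w), s <- codom cod].

(** Constant on the modes of row claims, where the row number falls instead; entering the initial
    walk and each step of it lowers the value. *)
Definition rank (w : seq bool) (g : nat * nat) := if g.1 < 4 then size w + 2 else size w + 5 - g.1.

Section Word.
Variables (w : seq bool) (P : nat).
Hypothesis P0 : 0 < P.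
Let N := 2 ^ P.
Let B := 2 ^ N.
Let N2 : 1 < N. Proof. by rewrite /N -[1]/(2 ^ 0) ltn_exp2l. Qed.

Lemma labelsP m s : ((m, s) \in labels w) = (m < 5 + size w) && (s \in codom cod).
Proof.
apply/allpairsP/andP => [[[m' s'] [hm hs [-> ->]]]|[lt is_]]; last by exists (m, s); rewrite mem_iota.
by split=> //; move: hm; rewrite mem_iota add0n => /andP[].
Qed.

Lemma triplesP s A : A \in triples s -> exists a b c,
  A = [:: (1, cod a); (2, cod b); (3, cod c)] /\ cod (rule a b c) = s.
Proof. by case/imageP=> -[[a b] c] /eqP e ->; exists a, b, c. Qed.

Lemma tops_labels : {subset tops <= labels w}.
Proof. by move=> _ /imageP[s _ ->]; rewrite labelsP codom_f. Qed.

Lemma tops_dirs g r : g \in tops -> dirs g r = 0.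
Proof. by move=> /imageP[s _ ->]; rewrite /dirs /=; case: ifP. Qed.

Lemma alts_child g b A g' : g \in labels w -> A \in alts w g b -> g' \in A ->
  g' \in labels w /\
  ((dirs g' 0 = 0 /\ rank w g' < rank w g) \/ [/\ dirs g' 0 = 2, ~~ b.1 & rank w g' <= rank w g]).
Proof.
case: g => m s; rewrite labelsP => /andP[lm is_]; rewrite /alts /=; case: ifP => m4.
  case: ifP => b1.
    rewrite inE => /eqP->; rewrite inE => /eqP->; rewrite labelsP is_ andbT; split; first by lia.
    by left; rewrite /rank /= m4; split=> //; lia.
  case/triplesP=> a [c [d [-> _]]]; rewrite !inE => /or3P[]/eqP->;
    rewrite labelsP codom_f andbT; (split; first by lia); right; rewrite /rank /= m4; split=> //.
case: ifP => _; first by case: ifP => // _; rewrite inE => /eqP->.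
case: ifP => lt; last by case: ifP => // _; rewrite inE => /eqP->.
rewrite inE => /eqP->; rewrite inE => /eqP->; rewrite labelsP is_ andbT; split; first by lia.
left; rewrite /dirs /rank /= m4; have -> : (m.+1 < 4) = false by lia.
by split=> //; lia.
Qed.

(** Mode [4 + i] at position [x] speaks of cell [x + i] of the initial row, from which the walk
    began; in this form the statement is inductive along the walk. *)
Lemma val_sound g t x : val P dirs (alts w) g t x -> t < B -> x < B -> g.1 <= size w + 4 ->
  g.2 = cod (if g.1 < 4 then row M w N t x else init_sym w (x + (g.1 - 4))).
Proof.
elim=> {}g {}t {}x A iA _ IH lt lx lm; move: iA; rewrite /alts; case: ifP => m4.
  case: ifP => [/eqP t0|/negbT t0].
    rewrite inE => /eqP eA; have := IH (4, g.2); rewrite eA mem_head /dirs /=.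
    rewrite !nxt0 // => /(_ isT lt lx) ->; last by lia.
    by rewrite t0 subnn addn0.
  case/triplesP=> a [b [c [eA <-]]]; case: t t0 lt IH => // t _ lt IH.
  have d1 : nxt N 2 t.+1 = t by rewrite nxt_pred.
  have lt' : t < B by exact: ltnW.
  have := IH (1, cod a); have := IH (2, cod b); have := IH (3, cod c).
  rewrite eA !inE !eqxx !orbT /dirs /= -!/N !d1 !(nxt0 lx).
  move=> /(_ isT lt' (nxt_lt _ _ _)) h3 /(_ isT lt' lx) h2 /(_ isT lt' (nxt_lt _ _ _)) h1.
  have {}h1 := cod_inj (h1 _); have {}h2 := cod_inj (h2 _); have {}h3 := cod_inj (h3 _).
  by rewrite rowS // h1 ?h2 ?h3 //; lia.
case: ifP => [/eqP x0|/negbT x0].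
  by case: ifP => // /eqP -> _; rewrite x0 add0n.
case: ifP => lw.
  rewrite inE => /eqP eA; have := IH (g.1.+1, g.2); rewrite eA mem_head /dirs /=.
  have -> : (g.1.+1 < 4) = false by lia.
  have -> : (g.1.+1 == 3) = false by lia.
  have -> : (g.1.+1 == 1) || (4 < g.1.+1) = true by lia.
  case: x x0 lx {IH} => // x _ lx; rewrite nxt0 // nxt_pred // => /(_ isT lt (ltnW lx)) ->; last by lia.
  by rewrite subSn; [rewrite addnS|lia].
case: ifP => // /eqP -> _; congr cod; rewrite /init_sym nth_default.
  by have -> : (x + (g.1 - 4) == 0) = false by move: x0 => /=; lia.
by rewrite size_map; lia.
Qed.

Lemma alts_init i s z : alts w (4 + i, s) z =
  if z.2 then (if s == cod (init_sym w i) then [:: [::]] else [::])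
  else if i < size w then [:: [:: (4 + i.+1, s)]]
  else if s == cod (None, None) then [:: [::]] else [::].
Proof.
rewrite /alts; have -> : ((4 + i, s).1 < 4) = false by rewrite /=; lia.
have -> : (4 + i, s).1 - 4 = i by rewrite /=; lia.
by have -> : ((4 + i, s).1 < 4 + size w) = (i < size w) by rewrite /=; lia.
Qed.

Lemma dirs_init i s : dirs (4 + i.+1, s) 0 = 0 /\ dirs (4 + i.+1, s) 1 = 2.
Proof. by []. Qed.

(** [k] is the number of steps that the walk may still make. *)
Lemma val_init k x t : k <= size w -> t < B -> x < B ->
  val P dirs (alts w) (4 + (size w - k), cod (init_sym w (x + (size w - k)))) t x.
Proof.
elim: k x => [|k IH] x lk lt lx; case: (posnP x) => [->|x0].
1,3: by apply: (@Val _ _ _ _ _ _ [::]) => //; rewrite alts_init eqxx add0n eqxx mem_head.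
  apply: (@Val _ _ _ _ _ _ [::]) => //; rewrite alts_init subn0 ltnn.
  have -> : (x == 0) = false by lia.
  rewrite /init_sym nth_default; last by rewrite size_map; lia.
  have -> : (x + size w == 0) = false by lia.
  by rewrite eqxx mem_head.
have ek : (size w - k.+1).+1 = size w - k by lia.
apply: (@Val _ _ _ _ _ _ [:: (4 + (size w - k), cod (init_sym w (x + (size w - k.+1))))]).
  rewrite alts_init; have -> : (x == 0) = false by lia.
  have -> : size w - k.+1 < size w by lia.
  by rewrite ek mem_head.
move=> g'; rewrite inE => /eqP->; case: x x0 lx => // x _ lx.
have [d0 d1] := dirs_init (size w - k.+1) (cod (init_sym w (x.+1 + (size w - k.+1)))).
rewrite -ek d0 d1 nxt0 // nxt_pred //.
have -> : x.+1 + (size w - k.+1) = x + (size w - k) by lia.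
by rewrite ek; apply: IH => //; lia.
Qed.

Lemma val_row t x m : m < 4 -> t < B -> x < B -> val P dirs (alts w) (m, cod (row M w N t x)) t x.
Proof.
elim: t x m => [|t IH] x m lm lt lx.
  apply: (@Val _ _ _ _ _ _ [:: (4, cod (init_sym w x))]); first by rewrite /alts /= lm mem_head.
  move=> g'; rewrite inE => /eqP->; have d r s : dirs (4, s) r = 0 by case: r.
  rewrite !d !nxt0 //.
  by have := val_init (leqnn _) lt lx; rewrite subnn !addn0.
apply: (@Val _ _ _ _ _ _ [:: (1, cod (row M w N t (nxt N 2 x))); (2, cod (row M w N t x)); (3, cod (row M w N t (nxt N 1 x)))]).
  rewrite /alts /= lm; apply/imageP.
  exists (row M w N t (nxt N 2 x), row M w N t x, row M w N t (nxt N 1 x)) => //.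
  by rewrite inE /= -rowS // eqxx.
have d1 : nxt N 2 t.+1 = t by rewrite nxt_pred.
have lt' : t < B by exact: ltnW.
move=> g'; rewrite !inE => /or3P[]/eqP->; rewrite -[dirs _ 0]/2 -!/N d1.
- by rewrite -[dirs _ 1]/2; apply: IH => //; exact: nxt_lt.
- by rewrite -[dirs _ 1]/0 nxt0 //; apply: IH.
- by rewrite -[dirs _ 1]/1; apply: IH => //; exact: nxt_lt.
Qed.

Lemma top_valP : top_val P dirs (alts w) tops <->
  exists t x q y, [/\ t < B, x < B, row M w N t x = (y, Some q), trans q y = None & ~~ accepting q].
Proof.
split=> [[g [t [x [/imageP[s rs ->] lt lx /val_sound v]]]]|[t [x [q [y [lt lx e h na]]]]]].
  have {}v := cod_inj (v lt lx _); exists t, x.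
  move: rs; rewrite inE /rejecting v; last by rewrite /=; lia.
  by case: (row M w N t x) => y [q|] // /andP[]; case E: (trans q y) => // _ na; exists q, y.
exists (0, cod (row M w N t x)), t, x; split=> //; last exact: val_row.
by apply/imageP; exists (row M w N t x) => //; rewrite inE /rejecting e /= h.
Qed.

Theorem reduction_correct : [/\ consistent (kb_1 P (labels w) dirs (alts w) tops), consistent (kb_2 P)
  & ucq_entails sig_0 (kb_1 P (labels w) dirs (alts w) tops) (kb_2 P) <->
    ~ exists t x q y, [/\ t < B, x < B, row M w N t x = (y, Some q), trans q y = None & ~~ accepting q]].
Proof.
have h1 g b A g' ig iA ig' := proj1 (@alts_child g b A g' ig iA ig').
have h2 g b A g' ig iA ig' := proj2 (@alts_child g b A g' ig iA ig').
split; [exact: consistent_1|exact: consistent_2|rewrite -top_valP; split].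
  move=> en [g [t [x [ig lt lx v]]]].
  by apply: (not_entails tops_dirs tops_labels h1 h2 ig lt lx v en).
by move=> nv; apply: (entails_of_not_val tops_labels h1 h2).
Qed.
End Word.
End Labels.


(** * The reduction is polynomial *)

Section Encode.
Variable A : enc.
Implicit Types C D : A -> concept.

Lemma fp_name (f : A -> seq bool) : fp f -> fp (fun x => enc_name (f x)).
Proof.
move=> hf; apply: (fpb_ext (f := fun x => flatten [seq [:: true; b] | b <- f x] ++ [:: false])); last by fps.
by move=> x; elim: (f x) => //= b s <-.
Qed.

Lemma fp_nm (f : A -> seq nat) : fp f -> fp (fun x => nm (f x)).
Proof.
move=> hf; apply: (fpb_ext (f := fun x => flatten [seq nseq k true ++ [:: false] | k <- f x])).
  by move=> x; congr flatten; apply: eq_map => k; rewrite cats1.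
by apply: fp_flatten; apply: fp_map => //; apply: fp_cat; [apply: fp_nseq; fps|exact: fp_const].
Qed.

Lemma fp_at (f : A -> seq nat) : fp f -> fp (fun x => Defs.enc_concept (at_ (f x))).
Proof. by move=> hf; apply: (@fp_cat _ _ (fun=> [:: false; true; false])); [exact: fp_const|apply: fp_name; apply: fp_nm]. Qed.

Lemma fp_Not C : fp (fun x => Defs.enc_concept (C x)) -> fp (fun x => Defs.enc_concept (Not (C x))).
Proof. by move=> h; apply: (@fp_cat _ _ (fun=> [:: false; true; true])) => //; exact: fp_const. Qed.

Lemma fp_And C D : fp (fun x => Defs.enc_concept (C x)) -> fp (fun x => Defs.enc_concept (D x)) ->
  fp (fun x => Defs.enc_concept (And (C x) (D x))).
Proof. by move=> h h'; apply: (@fp_cat _ _ (fun=> [:: true; false; false])); [exact: fp_const|apply: fp_cat]. Qed.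

Lemma fp_Or C D : fp (fun x => Defs.enc_concept (C x)) -> fp (fun x => Defs.enc_concept (D x)) ->
  fp (fun x => Defs.enc_concept (Or (C x) (D x))).
Proof. by move=> h h'; apply: (@fp_cat _ _ (fun=> [:: true; false; true])); [exact: fp_const|apply: fp_cat]. Qed.

Lemma fp_Ex r C : fp (fun x => Defs.enc_concept (C x)) -> fp (fun x => Defs.enc_concept (Ex r (C x))).
Proof.
move=> h; apply: (@fp_cat _ _ (fun=> [:: true; true; false])); first exact: fp_const.
by apply: fp_cat => //; exact: fp_const.
Qed.

Lemma fp_All r C : fp (fun x => Defs.enc_concept (C x)) -> fp (fun x => Defs.enc_concept (All r (C x))).
Proof.
move=> h; apply: (@fp_cat _ _ (fun=> [:: true; true; true])); first exact: fp_const.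
by apply: fp_cat => //; exact: fp_const.
Qed.

Lemma fp_lit b C : fp b -> fp (fun x => Defs.enc_concept (C x)) -> fp (fun x => Defs.enc_concept (lit (b x) (C x))).
Proof.
move=> hb h; apply: (fpb_ext (f := fun x => if b x then Defs.enc_concept (C x) else Defs.enc_concept (Not (C x)))).
  by move=> x; case: (b x).
by apply: fp_if => //; apply: fp_Not.
Qed.

Lemma fp_bigand (X : enc) (f : A -> X -> concept) (l : A -> seq X) :
  fp (fun p : A * X => Defs.enc_concept (f p.1 p.2)) -> fp l ->
  fp (fun x => Defs.enc_concept (bigand (map (f x) (l x)))).
Proof.
move=> hf hl; apply: (fpb_ext (f := fun x => flatten [seq [:: true; false; false] ++ Defs.enc_concept (f x y) | y <- l x]
   ++ [:: false; false; false])).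
  by move=> x; elim: (l x) => //= y s IH; rewrite -IH -!catA.
apply: fp_cat; last exact: fp_const.
by apply: fp_flatten; apply: fp_map => //; apply: fp_cat => //; exact: fp_const.
Qed.

Lemma fp_bigor (X : enc) (f : A -> X -> concept) (l : A -> seq X) :
  fp (fun p : A * X => Defs.enc_concept (f p.1 p.2)) -> fp l ->
  fp (fun x => Defs.enc_concept (bigor (map (f x) (l x)))).
Proof.
move=> hf hl; apply: (fpb_ext (f := fun x => flatten [seq [:: true; false; true] ++ Defs.enc_concept (f x y) | y <- l x]
   ++ [:: false; false; true])).
  by move=> x; elim: (l x) => //= y s IH; rewrite -IH -!catA.
apply: fp_cat; last exact: fp_const.
by apply: fp_flatten; apply: fp_map => //; apply: fp_cat => //; exact: fp_const.
Qed.

(** The code without its closing bit, so that concatenating TBoxes concatenates codes. *)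
Definition items (T : seq (concept * concept)) := flatten [seq true :: enc_inclusion p | p <- T].

Lemma enc_items T : Defs.enc_seq enc_inclusion T = items T ++ [:: false].
Proof. by elim: T => //= p s ->; rewrite -catA. Qed.

Lemma fp_items_cat (S T : A -> seq (concept * concept)) : fp (fun x => items (S x)) -> fp (fun x => items (T x)) ->
  fp (fun x => items (S x ++ T x)).
Proof.
move=> h h'; apply: (fpb_ext (f := fun x => items (S x) ++ items (T x))); last exact: fp_cat.
by move=> x; rewrite /items map_cat flatten_cat.
Qed.

Lemma fp_items_cons C D (T : A -> seq (concept * concept)) : fp (fun x => Defs.enc_concept (C x)) ->
  fp (fun x => Defs.enc_concept (D x)) -> fp (fun x => items (T x)) -> fp (fun x => items ((C x, D x) :: T x)).
Proof.
move=> h h' h''.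
apply: (fpb_ext (f := fun x => (true :: (Defs.enc_concept (C x) ++ Defs.enc_concept (D x))) ++ items (T x))) => //.
by fps.
Qed.

Lemma fp_items_map (X : enc) (f g : A -> X -> concept) (l : A -> seq X) :
  fp (fun p : A * X => Defs.enc_concept (f p.1 p.2)) -> fp (fun p : A * X => Defs.enc_concept (g p.1 p.2)) ->
  fp l -> fp (fun x => items [seq (f x y, g x y) | y <- l x]).
Proof.
move=> hf hg hl.
apply: (fpb_ext (f := fun x => flatten [seq true :: Defs.enc_concept (f x y) ++ Defs.enc_concept (g x y) | y <- l x])).
  by move=> x; rewrite /items -map_comp.
by apply: fp_flatten; apply: fp_map => //; fps.
Qed.

Lemma fp_items_flatten (X : enc) (f : A -> X -> seq (concept * concept)) (l : A -> seq X) :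
  fp (fun p : A * X => items (f p.1 p.2)) -> fp l -> fp (fun x => items (flatten (map (f x) (l x)))).
Proof.
move=> hf hl; apply: (fpb_ext (f := fun x => flatten [seq items (f x y) | y <- l x])).
  by move=> x; elim: (l x) => //= y s IH; rewrite IH /items map_cat flatten_cat.
by apply: fp_flatten; apply: fp_map.
Qed.

Lemma fp_addb (f g : A -> bool) : fp f -> fp g -> fp (fun x => f x (+) g x).
Proof.
by move=> hf hg; apply: (fpb_ext (f := fun x => if f x then ~~ g x else g x)); [move=> x; case: (f x)|fps].
Qed.

Lemma fp_subn (f : A -> nat) k : fp f -> fp (fun x => f x - k).
Proof.
move=> hf; elim: k => [|k IH]; first by apply: (fpb_ext (f := f)) => // x; rewrite subn0.
by apply: (fpb_ext (f := fun x => (f x - k).-1)); [move=> x; rewrite subnS|apply: fp_predn].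
Qed.

Lemma fp_bool (f : A -> bool) : fp f -> fp (fun x => nat_of_bool (f x)).
Proof. by move=> hf; apply: (fpb_ext (f := fun x => if f x then 1 else 0)); [move=> x; case: (f x)|fps]. Qed.

Lemma fp_dirs (g : A -> nat * nat) (r : A -> nat) : fp g -> fp r -> fp (fun x => dirs (g x) (r x)).
Proof. by move=> hg hr; rewrite /dirs; fps. Qed.
End Encode.

Ltac fp_enc := repeat (cbv beta; lazymatch goal with
  | |- fpb _ (fun q => Defs.enc_concept (And (@?a q) (@?b q))) => apply: fp_And
  | |- fpb _ (fun q => Defs.enc_concept (Or (@?a q) (@?b q))) => apply: fp_Or
  | |- fpb _ (fun q => Defs.enc_concept (Not (@?a q))) => apply: fp_Not
  | |- fpb _ (fun q => Defs.enc_concept (Ex _ (@?a q))) => apply: fp_Ex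
  | |- fpb _ (fun q => Defs.enc_concept (All _ (@?a q))) => apply: fp_All
  | |- fpb _ (fun q => Defs.enc_concept (lit (@?a q) (@?b q))) => apply: fp_lit
  | |- fpb _ (fun q => Defs.enc_concept (at_ (@?a q))) => apply: fp_at
  | |- fpb _ (fun q => Defs.enc_concept (bigand (@map _ _ (@?a q) (@?b q)))) => apply: fp_bigand
  | |- fpb _ (fun q => Defs.enc_concept (bigor (@map _ _ (@?a q) (@?b q)))) => apply: fp_bigor
  | |- fpb _ (fun q => items ((@?a q) ++ (@?b q))) => apply: fp_items_cat
  | |- fpb _ (fun q => items (((@?a q), (@?b q)) :: (@?c q))) => apply: fp_items_cons
  | |- fpb _ (fun q => items (flatten (@map _ _ (@?a q) (@?b q)))) => apply: fp_items_flatten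
  | |- fpb _ (fun q => items (@map _ _ (@?a q) (@?b q))) => apply: fp_items_map
  | |- fpb _ (fun q => (@?a q) (+) (@?b q)) => apply: fp_addb
  | |- fpb _ (fun q => nat_of_bool (@?a q)) => apply: fp_bool
  | |- fpb _ (fun q => dirs (@?a q) (@?b q)) => apply: fp_dirs
  | |- fpb _ (fun q => iota (@?a q) (@?b q)) => apply: fp_iota
  | |- fpb _ (fun q => (@?b q) + (@?a q)) => apply: fp_addn
  | |- fpb _ (fun q => size (@?a q)) => apply: fp_size
  | _ => fp_step end).

Section KB.
Variables (A : enc) (P : A -> nat) (labs : A -> seq (nat * nat))
  (alt : A -> nat * nat -> bool * bool -> seq (seq (nat * nat))) (tops : seq (nat * nat)).
Hypotheses (hP : fp P) (hlabs : fp labs) (halt : fp (fun p : A * (nat * nat) * (bool * bool) => alt p.1.1 p.1.2 p.2)).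

Lemma fp_tbox2 : fp (fun x => items (tbox2 (P x))).
Proof.
rewrite /tbox2 /ax_walk /ax_err /cnt /endc /cin /zeros /blk /inf /cbit /own /par /cy /zf /lab /top /walk /err.
by fp_enc.
Qed.

Lemma fp_strt (B : enc) (Q : B -> nat) (g : B -> nat * nat) : fp Q -> fp g -> fp (fun x => Defs.enc_concept (strt (Q x) dirs (g x))).
Proof.
move=> hQ hg; rewrite /strt /zeros /blk /cbit /cy /zf /lab.
by fp_enc.
Qed.

Lemma fp_tbox1 : fp (fun x => items (tbox1 (P x) (labs x) dirs (alt x) tops)).
Proof.
rewrite /tbox1 /ax_next /ax_lab /ax_own /ax_par /ax_sum /ax_carry /ax_zero /ax_alt /ax_top /cnt /endc /cin /zero.
rewrite /blk /inf /cbit /own /par /cy /zf /lab /top.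
repeat (fp_enc; try lazymatch goal with
  | |- fpb _ (fun q => Defs.enc_concept (strt (@?a q) dirs (@?b q))) => apply: fp_strt
  | |- fpb _ (fun q => alt (@?a q) (@?b q) (@?c q)) => apply: (fpb_comp (f := fun q => (a q, b q, c q)) _ halt)
  end).
Qed.
End KB.

Section Machine.
Variable M : tm.

Lemma cod_init (w : seq bool) k : cod (init_sym M w k) =
  if k == 0 then (if k < size w then if nth false w k then cod (Some (inl true), Some (start M)) : nat
    else cod (Some (inl false), Some (start M)) else cod (None, Some (start M)))
  else (if k < size w then if nth false w k then cod (Some (inl true), None : option (state M))
    else cod (Some (inl false), None : option (state M)) else cod (None, None : option (state M))).
Proof.
rewrite /init_sym; case: (ltnP k (size w)) => le.
  by rewrite (nth_map false) //; case: (nth false w k); case: eqP.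
by rewrite nth_default ?size_map //; case: eqP.
Qed.

(** The machine is fixed, so its triples form a constant table, and looking up a symbol replaces any
    computation with [M]. Numbers beyond the table code no symbol and have no triples. *)
Lemma triples_table s : triples M s = nth [::] [seq triples M s | s <- iota 0 #|{: sym M}|] s.
Proof.
case: (ltnP s #|{: sym M}|) => le; first by rewrite (nth_map 0) ?size_iota // nth_iota.
rewrite nth_default ?size_map ?size_iota //; case E: (triples M s) => [//|A u].
have /triplesP[a [b [c [_ e]]]] : A \in triples M s by rewrite E mem_head.
by move: le; rewrite -e leqNgt ltn_ord.
Qed.

Lemma fp_alts : fp (fun p : seq bool * (nat * nat) * (bool * bool) => alts M p.1.1 p.1.2 p.2).
Proof.
have ht : fp (fun p : seq bool * (nat * nat) * (bool * bool) => triples M p.1.2.2).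
  apply: (fpb_ext (f := fun p => nth [::] [seq triples M s | s <- iota 0 #|{: sym M}|] p.1.2.2)).
    by move=> p; rewrite -triples_table.
  by apply: fp_nth; [fps|exact: fp_const].
have hk : fp (fun p : seq bool * (nat * nat) * (bool * bool) => p.1.2.1 - 4) by apply: fp_subn; fps.
have hi : fp (fun p : seq bool * (nat * nat) * (bool * bool) => cod (init_sym M p.1.1 (p.1.2.1 - 4)) : nat).
  apply: (fpb_ext (f := fun p => _)) => [p|]; first exact/esym/cod_init.
  have hn : fp (fun p : seq bool * (nat * nat) * (bool * bool) => nth false p.1.1 (p.1.2.1 - 4)).
    by apply: fp_nth => //; fps.
  by repeat (first [exact: hn | exact: hk | lazymatch goal with |- fpb _ (fun q => size _) => apply: fp_size end | fp_step]).
rewrite /alts.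
by repeat (first [exact: ht | exact: hi | lazymatch goal with |- fpb _ (fun q => size _) => apply: fp_size
  | |- fpb _ (fun q => _ + _) => apply: fp_addn end | fp_step]).
Qed.

Lemma fp_labels : fp (fun w : seq bool => labels M w).
Proof.
apply: (fp_allpairs (f := fun _ m s => (m, s))); [fps|by fp_enc|exact: fp_const].
Qed.

Lemma fp_instance (P : seq bool -> nat) : fp P -> fp (fun w =>
  enc_instance (kb_1 (P w) (labels M w) dirs (alts M w) (tops M), kb_2 (P w), sig_0)).
Proof.
move=> hP; pose abx l := Defs.enc_seq Defs.enc_assertion [:: ConceptAssertion (nm l) a0].
apply: (fpb_ext (f := fun w =>
    ((items (tbox1 (P w) (labels M w) dirs (alts M w) (tops M)) ++ [:: false]) ++ abx [:: 8]) ++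
    ((items (tbox2 (P w)) ++ [:: false]) ++ abx [:: 9]) ++ enc_signature sig_0)).
  by move=> w; rewrite -!enc_items.
have h1 : fp (fun w => items (tbox1 (P w) (labels M w) dirs (alts M w) (tops M))).
  by apply: fp_tbox1 => //; [exact: fp_labels|exact: fp_alts].
have h2 := fp_tbox2 hP.
by apply: fp_cat; [apply: fp_cat; [apply: fp_cat => //|]|apply: fp_cat; [apply: fp_cat; [apply: fp_cat => //|]|]]; exact: fp_const.
Qed.
End Machine.

(** Room for the running time [2 ^ 2 ^ p] and for the margin [n + 2] that [rows_reject] asks for. *)
Lemma exponent_room p n : 2 ^ 2 ^ p + n + 2 <= 2 ^ 2 ^ (p + n + 3).
Proof.
have a1 : 0 < 2 ^ p by rewrite expn_gt0.
have h m : m < 2 ^ m by exact: ltn_expl.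
have e1 : 2 ^ p + (n + 3) <= 2 ^ (p + n + 3).
  by rewrite -addnA expnD; have := h (n + 3); set b := 2 ^ (n + 3); nia.
apply: leq_trans (_ : 2 ^ (2 ^ p + (n + 3)) <= _); last by rewrite leq_exp2l.
rewrite expnD; have := h (n + 3); have := h (2 ^ p); set a := 2 ^ 2 ^ p; set b := 2 ^ (n + 3); nia.
Qed.

Theorem entailment_hard L : in_two_exptime L -> poly_reducible L ucq_entailment_problem.
Proof.
case=> M [p [[c [k hp]] dec]].
(* This dominates [p (size w) + size w + 3] and is computable in polynomial time, which [p] itself
   need not be. *)
pose P (w : seq bool) := c * size w ^ k + c + size w + 3.
pose f w := enc_instance (kb_1 (P w) (labels M w) dirs (alts M w) (tops M), kb_2 (P w), sig_0).
exists f; split.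
  apply: fp_computes; apply: fp_instance; rewrite /P.
  repeat (first [lazymatch goal with |- fpb _ (fun q => size _) => apply: fp_size
  | |- fpb _ (fun q => _ + _) => apply: fp_addn | |- fpb _ (fun q => _ * _) => apply: fp_muln
  | |- fpb _ (fun q => _ ^ _) => apply: fp_expn end | fp_step]).
move=> w; have [cf [hw acc]] := dec w.
have P0 : 0 < P w by rewrite /P addnS.
have N2 : 1 < 2 ^ P w by rewrite -[1]/(2 ^ 0) ltn_exp2l.
have room : 2 ^ 2 ^ p (size w) + size w + 2 <= 2 ^ 2 ^ P w.
  apply: leq_trans (exponent_room _ _) _; rewrite !leq_exp2l //.
  by have := hp (size w); rewrite /P; lia.
have [c1 c2 en] := reduction_correct M w P0.
have rej := rows_reject N2 hw room.
rewrite -acc; split=> [a|[K1 [K2 [S [e _ _ ent]]]]].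
  exists (kb_1 (P w) (labels M w) dirs (alts M w) (tops M)), (kb_2 (P w)), sig_0; split=> //.
  by apply/en => /rej; rewrite a.
(* By injectivity of the encoding, [f w] encodes no other instance. *)
have [e1 e2 e3] : [/\ kb_1 (P w) (labels M w) dirs (alts M w) (tops M) = K1, kb_2 (P w) = K2 & sig_0 = S].
  by have := enc_instance_inj e; case.
by apply: negbNE; apply/negP => /rej; apply/en; rewrite e1 e2 e3.
Qed.

Theorem theorem7 : two_exptime_complete ucq_entailment_problem.
Proof. by split; [exact: entailment_two_exptime|exact: entailment_hard]. Qed.
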